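(* Let $d\ge1$, $\mathbf k\in\mathbb N^d$, and let $M$ be a wide-sense stationary $L^2$ random measure on $\mathbb R^d$ with spectral density $s$, such that $0$ is not a pole of order $\mathbf k$ of $s^{-1}$. (1) Let $R>0$. Suppose that either $s$ is isotropic ($s(u)$ depends only on $\|u\|$) and $A=B(0,R)$, or $s$ is separable ($s(u)=s_1(u_1)\cdots s_d(u_d)$ for some even functions $s_i:\mathbb R\to\mathbb R_+$) and $A=[-R,R]^d$; suppose moreover that $M$ is not linearly maximally rigid on $A$ and that it is not true that $\int_{B(0,\varepsilon)}u^{2\mathbf k}s(u)^{-1}du=\infty$ for all $\varepsilon>0$. Then for every $\eta>0$, $M$ is not linearly $Q$-rigid on $A^{+\eta}=\bigcup_{t\in A}B(t,\eta)$ for any $\mathbf k$-polynomial $Q$. (2) Suppose that $s$ is simple. Then for every $\eta>0$, $M$ is not linearly $Q$-rigid on $B(0,\eta)$ for any $\mathbf k$-polynomial $Q$.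
   Context: $\mathbb N=\{0,1,2,\dots\}$; for $\mathbf k\in\mathbb N^d$, $t^{\mathbf k}=\prod_{i}t_i^{k_i}$; $\mathbf k'\preceq\mathbf k$ means $k'_i\le k_i$ for all $i$. $\mathcal C_c^b(\mathbb R^d)$ is the space of bounded measurable compactly supported functions on $\mathbb R^d$, $\mathcal C_c^b(A^c)$ the subspace of those vanishing on $A$, and $\hat f(u)=\int e^{-i\langle u,x\rangle}f(x)\,dx$. Wide-sense stationary (WSS) $L^2$ random (signed) measure $M$: a linear family of real $L^2$ random variables $I_M(f)$, $f\in\mathcal C_c^b(\mathbb R^d)$ real (extended linearly to complex $f$), such that $\mathrm{Var}(I_M(f))$ is invariant under translations of $f$ and $\mathrm{Var}(I_M(f))=(2\pi)^{-d}\int|\hat f|^2\,d\mathsf S$ for a non-negative symmetric measure $\mathsf S$ on $\mathbb R^d$, the spectral measure. The spectral density $s$ is the density of the absolutely continuous part of $\mathsf S$. Convention: $1/0=\infty$. A $\mathbf k$-polynomial is a polynomial $Q(t)=\sum_{\mathbf m}a_{\mathbf m}t^{\mathbf m}$ such that for some $\mathbf k_0\succeq\mathbf k$, $a_{\mathbf k_0}\ne0$ and all $\mathbf m$ with $a_{\mathbf m}\neq0$ satisfy $\mathbf m\preceq\mathbf k_0$. $0$ is a pole of order $\mathbf k$ of $s^{-1}$ if for every polynomial $Q(u)=\sum_{\mathbf m}a_{\mathbf m}u^{\mathbf m}$ such that $\int_{B(0,\varepsilon)}|Q|^2s^{-1}<\infty$ for some $\varepsilon>0$, one has $a_{\mathbf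 k}=0$. A point $u_0\in\mathbb R^d$ is a pole of $s^{-1}$ if $\int_{B(u_0,\varepsilon)}s^{-1}=\infty$ for all $\varepsilon>0$; it has finite order if $\int_{B(u_0,\varepsilon)}\|u-u_0\|^{2q}s(u)^{-1}du<\infty$ for some $\varepsilon>0$, $q\in\mathbb N$. $s$ is simple if $s^{-1}$ has finitely many poles, all with finite order, and there are $p\in\mathbb N$, $c>0$, $\varepsilon>0$ such that $s(u)\ge c(1+\|u\|)^{-p}$ for all $u$ at distance at least $\varepsilon$ from these poles. For $\gamma$ bounded measurable with bounded support, $M$ is linearly $\gamma$-rigid on a bounded set $A$ if $\inf_{h\in\mathcal C_c^b(A^c)}\mathrm{Var}(I_M(\gamma)-I_M(h))=0$. For a polynomial $Q$, $M$ is linearly $Q$-rigid on $A$ if this holds for $\gamma=Q1_A$; it is linearly maximally rigid on $A$ if this holds for every bounded measurable $\gamma$ supported in $A$. *)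

(* Defs.v *)
From HB Require Import structures.
From mathcomp Require Import all_boot all_order all_algebra.
From mathcomp Require Import complex.
(* The notations of mpoly clash with those of MathComp-Analysis: only its
   names and coercions are imported. *)
From mathcomp Require mpoly.
Import -(notations) mpoly.
From mathcomp Require Import all_classical all_reals all_analysis.

Set Implicit Arguments.
Unset Strict Implicit.
Unset Printing Implicit Defensive.

Import Order.TTheory GRing.Theory Num.Theory.
Import numFieldNormedType.Exports.

Local Open Scope classical_set_scope.
Local Open Scope ring_scope.

(* R^d as d-tuples, with the product of the Borel sigma-algebras. *)
Notation Rn R d := (d.-tuple (measurableTypeR R)).

(* {mpoly R[i][d]} and 'X_{1..d}, whose notations are not imported. *)
Notation cpoly R d := (mpoly.mpoly d R[i]).
Notation multi_index d := (mpoly.multinom d).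

(* Reproved because the canonical sigma-finite structure found on (_ \x _) is
   the one of products of probability measures. *)
Lemma sigma_finite_product (d1 d2 : measure_display) (T1 : measurableType d1)
    (T2 : measurableType d2) (R : realType)
    (m1 : {sigma_finite_measure set T1 -> \bar R})
    (m2 : {sigma_finite_measure set T2 -> \bar R}) :
  sigma_finite setT (m1 \x m2)%E.
Proof.
have /sigma_finiteP[F [TF ndF Foo]] := sigma_finiteT m1.
have /sigma_finiteP[G [TG ndG Goo]] := sigma_finiteT m2.
exists (fun n => F n `*` G n).
  rewrite -setXTT TF TG predeqE => -[x y]; split.
    move=> [/= [n _ Fnx] [k _ Gky]]; exists (maxn n k) => //; split.
    - by move: x Fnx; exact/subsetPset/ndF/leq_maxl.
    - by move: y Gky; exact/subsetPset/ndG/leq_maxr.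
  by move=> [n _ []/= ? ?]; split; exists n.
move=> k; have [? ?] := Foo k; have [? ?] := Goo k.
split; first exact: measurableX.
by rewrite product_measure1E// lte_mul_pinfty// ge0_fin_numE.
Qed.

Section product_cons.
Context (disp : measure_display) (T : measurableType disp) (R : realType).
Context (n : nat).
Variable m1 : {sigma_finite_measure set T -> \bar R}.
Variable m2 : {sigma_finite_measure set (n.-tuple T) -> \bar R}.

Definition tcons (p : T * n.-tuple T) : n.+1.-tuple T :=
  [the n.+1.-tuple T of p.1 :: p.2].

Lemma measurable_tcons : measurable_fun setT tcons.
Proof. exact: measurable_cons. Qed.

Definition product_cons : set (n.+1.-tuple T) -> \bar R :=
  pushforward (m1 \x m2)%E tcons.

HB.instance Definition _ := Measure.copy product_cons
  (measure_function_pushforward__canonical__measure_function_Measure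
     (m1 \x m2)%E measurable_tcons).

Let product_cons_sigma_finite : sigma_finite setT product_cons.
Proof.
have [F FT mF] := sigma_finite_product m1 m2.
pose split_ (t : n.+1.-tuple T) : T * n.-tuple T :=
  (tnth t ord0, [tuple of behead t]).
have msplit : measurable_fun setT split_.
  by apply: measurable_fun_pair;
    [exact: measurable_tnth|exact: measurable_behead].
have splitK : cancel tcons split_.
  by case=> x t; congr pair; apply/val_inj.
exists (fun k => split_ @^-1` F k).
  by rewrite -preimage_bigcup -FT preimage_setT.
move=> k; have [mFk Fk] := mF k; split.
  by rewrite -[X in measurable X]setTI; exact: msplit.
rewrite /product_cons /pushforward -comp_preimage.
by rewrite (_ : split_ \o tcons = id)//; apply/funext => p; exact: splitK.
Qed.

HB.instance Definition _ := @Measure_isSigmaFinite.Build _ _ _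
  product_cons product_cons_sigma_finite.

End product_cons.

Section lebesgue_Rn.
Variable R : realType.

Definition tnil : Rn R 0 := [tuple].

(* Lebesgue measure on R^n, by iterated products. *)
Fixpoint lebesgue_Rn (n : nat) : {sigma_finite_measure set (Rn R n) -> \bar R} :=
  if n is m.+1 then product_cons lebesgue_measure (lebesgue_Rn m) else dirac tnil.

Lemma lebesgue_Rn_box (n : nat) (A : 'I_n -> set (measurableTypeR R)) :
  (forall i, measurable (A i)) ->
  (lebesgue_Rn n [set x | forall i, A i (tnth x i)] =
   \big[*%E/1%E]_(i < n) lebesgue_measure (A i))%E.
Proof.
elim: n A => [|n IH] A mA.
  by rewrite big_ord0 /= diracE mem_set//= => -[].
rewrite big_ord_recl -IH//=.
rewrite /product_cons /pushforward.
rewrite [X in (_ \x _)%E X](_ : _ = A ord0 `*`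
  [set x : Rn R n | forall i, A (lift ord0 i) (tnth x i)]); last first.
  apply/seteqP; split=> -[x t] /=.
    by move=> h; split=> [|i]; [exact: (h ord0)|have := h (lift ord0 i); rewrite tnthS].
  move=> [h0 h] i; case: (unliftP ord0 i) => [j ->|->//].
  by rewrite tnthS; exact: h.
rewrite product_measure1E//.
rewrite [X in measurable X](_ : _ = \bigcap_(i in [set: 'I_n])
  ((fun x : Rn R n => tnth x i) @^-1` A (lift ord0 i))); last first.
  by apply/seteqP; split=> x /= h i; [move=> _; exact: h|exact: (h i)].
apply: fin_bigcap_measurable; first exact: finite_finset.
move=> i _; rewrite -[X in measurable X]setTI.
exact: (@measurable_tnth _ (measurableTypeR R) n i).
Qed.

End lebesgue_Rn.

Local Open Scope complex_scope.

Notation cRe := (@complex.Re _).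
Notation cIm := (@complex.Im _).
Notation cnorm := (@Normc.normc _).

Section euclidean.
Context (R : realType) (d : nat).
Implicit Types (x u v : Rn R d) (A : set (Rn R d)).

Definition vzero : Rn R d := [tuple 0 | i < d].

Definition vsub u v : Rn R d := [tuple tnth u i - tnth v i | i < d].

Definition vopp u : Rn R d := [tuple - tnth u i | i < d].

Definition dotp u x : R := \sum_(i < d) tnth u i * tnth x i.

Definition enorm u : R := Num.sqrt (\sum_(i < d) tnth u i ^+ 2).

Definition eball u (r : R) : set (Rn R d) := [set x | enorm (vsub x u) < r].

Definition cube (r : R) : set (Rn R d) := [set x | forall i, - r <= tnth x i <= r].

(* The eta-enlargement of A, written A^{+eta}. *)
Definition enlarge A (eta : R) : set (Rn R d) :=
  \bigcup_(t in A) eball t eta.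

Definition monomial (k : multi_index d) u : R := \prod_(i < d) tnth u i ^+ k i.

Definition peval (Q : cpoly R d) u : R[i] :=
  mpoly.meval (fun i => (tnth u i)%:C) Q.

Definition bounded_measurable (f : Rn R d -> R[i]) : Prop :=
  [/\ measurable_fun setT (cRe \o f),
      measurable_fun setT (cIm \o f) &
      exists c : R, forall x, cnorm (f x) <= c].

(* The space C_c^b(R^d).  In R^d, compact support amounts to vanishing outside
   some ball. *)
Definition Ccb (f : Rn R d -> R[i]) : Prop :=
  bounded_measurable f /\ exists r : R, forall x, r < enorm x -> f x = 0.

Definition toC (f : Rn R d -> R) : Rn R d -> R[i] := fun x => (f x)%:C.

Definition expi (theta : R) : R[i] := cos theta +i* sin theta.

Definition fourier (f : Rn R d -> R[i]) u : R[i] :=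
  let g x := expi (- dotp u x) * f x in
  (\int[lebesgue_Rn R d]_x cRe (g x))%R +i*
  (\int[lebesgue_Rn R d]_x cIm (g x))%R.

End euclidean.

Arguments vzero {R d}.

Section complex_variance.
Context (disp : measure_display) (T : measurableType disp) (R : realType).
Variable P : probability T R.

Definition cexpectation (X : T -> R[i]) : R[i] :=
  fine ('E_P[cRe \o X])%E +i* fine ('E_P[cIm \o X])%E.

(* E|X - E X|^2, which is 'V_P[X] for real-valued X. *)
Definition cvariance (X : T -> R[i]) : \bar R :=
  ('E_P[fun w => (cnorm (X w - cexpectation X) ^+ 2)%R])%E.

End complex_variance.

(* Only the values of wss_int on real functions of C_c^b are constrained.
   Identities between elements of L^2 hold almost surely. *)
Record wss_measure (disp : measure_display) (T : measurableType disp)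
    (R : realType) (P : probability T R) (d : nat) := WssMeasure {
  wss_int : (Rn R d -> R) -> T -> R;
  wss_spectral : {measure set (Rn R d) -> \bar R};
  wss_L2 : forall f, Ccb (toC f) -> wss_int f \in Lfun P 2%:E;
  wss_linear : forall (a : R) f g, Ccb (toC f) -> Ccb (toC g) ->
    {ae P, forall w,
      wss_int (fun x => a * f x + g x) w = a * wss_int f w + wss_int g w};
  wss_stationary : forall f v, Ccb (toC f) ->
    ('V_P[wss_int (fun x => f (vsub x v))] = 'V_P[wss_int f])%E;
  wss_spectral_sym : forall A, measurable A ->
    wss_spectral (@vopp R d @^-1` A) = wss_spectral A;
  wss_varianceE : forall f, Ccb (toC f) ->
    ('V_P[wss_int f] = (((2 * pi) ^+ d)^-1)%:E *
      \int[wss_spectral]_u (cnorm (fourier (toC f) u) ^+ 2)%:E)%E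
}.

Section wss.
Context (disp : measure_display) (T : measurableType disp) (R : realType).
Context (P : probability T R) (d : nat).
Variable M : wss_measure P d.
Implicit Types (A : set (Rn R d)) (Q : cpoly R d).

(* The complex-linear extension of the integral. *)
Definition wss_cint (f : Rn R d -> R[i]) : T -> R[i] :=
  fun w => wss_int M (cRe \o f) w +i* wss_int M (cIm \o f) w.

Definition mutually_singular (m1 m2 : set (Rn R d) -> \bar R) : Prop :=
  exists N, [/\ measurable N, m1 N = 0%E & m2 (~` N) = 0%E].

(* Via the Lebesgue decomposition of the spectral measure. *)
Definition is_spectral_density (s : Rn R d -> R) : Prop :=
  [/\ measurable_fun setT s, forall u, 0 <= s u &
      exists2 nu : {measure set (Rn R d) -> \bar R},
        mutually_singular (lebesgue_Rn R d) nu &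
        forall A, measurable A ->
          (wss_spectral M A = \int[lebesgue_Rn R d]_(u in A) (s u)%:E + nu A)%E].

Definition linearly_rigid A (gamma : Rn R d -> R[i]) : Prop :=
  ereal_inf [set cvariance P (fun w => wss_cint gamma w - wss_cint h w) |
             h in [set h | Ccb h /\ forall x, A x -> h x = 0]] = 0%E.

Definition linearly_poly_rigid A Q : Prop :=
  linearly_rigid A (fun x => peval Q x * (\1_A x)%:C).

Definition linearly_maximally_rigid A : Prop :=
  forall gamma, bounded_measurable gamma -> (forall x, ~ A x -> gamma x = 0) ->
    linearly_rigid A gamma.

End wss.

Section density.
Context (R : realType) (d : nat).
Variable s : Rn R d -> R.

(* 1/s, where the inverse on extended reals satisfies 1/0 = +oo. *)
Definition sinv (u : Rn R d) : \bar R := ((s u)%:E^-1)%E.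

Definition pole_of_order (k : multi_index d) : Prop :=
  forall Q : cpoly R d,
    (exists2 eps : R, 0 < eps &
      (\int[lebesgue_Rn R d]_(u in eball vzero eps)
         ((cnorm (peval Q u) ^+ 2)%:E * sinv u) < +oo)%E) ->
    mpoly.mcoeff k Q = 0.

Definition is_pole (u0 : Rn R d) : Prop :=
  forall eps : R, 0 < eps ->
    (\int[lebesgue_Rn R d]_(u in eball u0 eps) sinv u = +oo)%E.

Definition finite_order (u0 : Rn R d) : Prop :=
  exists (eps : R) (q : nat), 0 < eps /\
    (\int[lebesgue_Rn R d]_(u in eball u0 eps)
       ((enorm (vsub u u0) ^+ (2 * q))%:E * sinv u) < +oo)%E.

Definition simple_density : Prop :=
  [/\ finite_set is_pole,
      forall u0, is_pole u0 -> finite_order u0 &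
      exists (p : nat) (c eps : R), [/\ 0 < c, 0 < eps &
        forall u, (forall u0, is_pole u0 -> eps <= enorm (vsub u u0)) ->
          c * (1 + enorm u) ^- p <= s u]].

Definition isotropic : Prop := forall u v, enorm u = enorm v -> s u = s v.

Definition separable : Prop :=
  exists s_ : 'I_d -> R -> R,
    [/\ forall i x, 0 <= s_ i x, forall i x, s_ i (- x) = s_ i x &
        forall u, s u = \prod_(i < d) s_ i (tnth u i)].

End density.

(* mpoly.lem is the componentwise order on multi-indices. *)
Definition is_kpoly (R : realType) (d : nat) (k : multi_index d)
    (Q : cpoly R d) : Prop :=
  exists k0, [/\ mpoly.lem k k0, mpoly.mcoeff k0 Q != 0 &
    forall m, mpoly.mcoeff m Q != 0 -> mpoly.lem m k0].

(* Main.v *)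
Require Import Defs.
From HB Require Import structures.
From mathcomp Require Import all_boot all_order all_algebra.
From mathcomp Require Import complex.
From mathcomp Require mpoly.
Import -(notations) mpoly.
From mathcomp Require Import all_classical all_reals all_analysis.
From mathcomp Require Import measurable_realfun.
From mathcomp Require Import ring lra zify.
Import Order.TTheory GRing.Theory Num.Theory.
Import numFieldNormedType.Exports.
Local Open Scope classical_set_scope.
Local Open Scope ring_scope.
Local Open Scope complex_scope.

Set Implicit Arguments.
Unset Strict Implicit.
Unset Printing Implicit Defensive.

(** Let [L] be Lebesgue measure and [S = s L + nu] the spectral measure.

    Non-rigidity is proved by duality.  If [g] is integrable, and square-integrable
    against [1 / s], the pairing of [g] with the transform of a test function [f] is
    controlled by the variance of the integral of [f]; it is also the integral of
    [f] against the transform [G] of [g].  Hence, if [G] vanishes outside [A] and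
    the integral of [Q G] is not zero, [Q] cannot be approximated by functions that
    vanish on [A] ([not_rigid_of_dual]).

    Such a [g] is sought in the form of a product of a polynomial [W], of factors
    [sinc (del u_i) ^ n] with [n del] small, and of a function [chi] that is the
    transform of a complex measure carried by a set slightly smaller than [A].  The
    transform of [v ^ j sinc (del v) ^ n] has a small support, its moments of order
    less than [j] vanish and that of order [j] does not ([good_ker_exists]).
    Therefore, when [k0] is the top exponent of [Q] and the only exponent of [W]
    below [k0], the integral of [Q G] is a non-zero multiple of [chi 0]
    ([brep_not_rigid]).  What remains is to find [W] and [chi] such that [chi 0] is
    not zero and [g] is square-integrable against [1 / s].

    When [s] is simple, [chi] is constant and [W] cancels the poles
    ([simple_not_rigid]).  At infinity it is enough to take [n] large.

    When [s] is isotropic or separable, [W] is the monomial of exponent [k0], and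
    [chi] has to cope with all the singularities but the one at the origin, of which
    nothing is known except that [M] is not maximally rigid on the given set [A].
    The projection theorem then provides a non-zero [F] in [L^2(S)] that is
    orthogonal to the transforms of the functions vanishing on [A]
    ([rigidity_defect]).  With [b] the transform of a small box, the transform of
    [b F^* S] is bounded and vanishes away from [A].  Transforming back gives a
    function [chi0], with spectrum near [A], and [chi0 L] is proportional to
    [b F^* S] since two complex measures with the same integrals of tents are equal
    ([unique_of_tents]).  Off a null set that carries [nu] this makes [chi0]
    proportional to [b F^* s], so that [|chi0|^2 / s] is at most a multiple of
    [|F|^2 s], which is integrable ([dual_kernel]).

    The value of [chi0] at the origin may be zero.  This is corrected by a division,
    which affects the integrability only near the origin, where the hypothesis on
    [k] replaces it.  In one variable, the transform of a measure carried by
    [[-r, r]] is the product of a power of the variable and of a function of the same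
    kind that is not zero at the origin ([rep1_factor]).  In the separable case this is
    applied to the restrictions of [chi0] to lines parallel to the axes, and the
    quotients are multiplied together ([separable_kernel]).  In the isotropic case
    the mean over directions of [chi0 u] times the exponential of [a.u] is a radial
    function with almost the same spectrum, it satisfies the same integrability
    condition because [s] is constant on spheres ([average_L2]), and it is not zero
    for some small [a] ([average_neq0]); a radial function can be divided by powers of
    the squared norm ([radial_factor], [isotropic_kernel]). *)

(** * Complex-valued functions and their integrals *)

Section complex_basics.
Context {R : realType}.
Implicit Types (z w : R[i]) (a b t : R).

Lemma cReD z w : cRe (z + w) = cRe z + cRe w.
Proof. by case: z; case: w. Qed.

Lemma cImD z w : cIm (z + w) = cIm z + cIm w.
Proof. by case: z; case: w. Qed.

Lemma cReM z w : cRe (z * w) = cRe z * cRe w - cIm z * cIm w.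
Proof. by case: z; case: w. Qed.

Lemma cImM z w : cIm (z * w) = cRe z * cIm w + cIm z * cRe w.
Proof. by case: z; case: w. Qed.

Lemma complex_ext z w : cRe z = cRe w -> cIm z = cIm w -> z = w.
Proof. by case: z => a b; case: w => a' b' /= -> ->. Qed.

Lemma cnormD z w : cnorm (z + w) <= cnorm z + cnorm w.
Proof. exact: (@le_normcD R z w). Qed.

Lemma cnormM z w : cnorm (z * w) = cnorm z * cnorm w.
Proof. exact: Normc.normcM. Qed.

Lemma cnormN z : cnorm (- z) = cnorm z.
Proof. exact: (@normcN R z). Qed.

Lemma cnorm_ge0 z : 0 <= cnorm z.
Proof. by case: z => a b; rewrite /Normc.normc sqrtr_ge0. Qed.

Lemma cnorm2E z : cnorm z ^+ 2 = cRe z ^+ 2 + cIm z ^+ 2.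
Proof. by case: z => a b /=; rewrite sqr_sqrtr // addr_ge0 // sqr_ge0. Qed.

Lemma cnorm_toC a : cnorm a%:C = `|a|.
Proof. by rewrite /= expr0n /= addr0 sqrtr_sqr. Qed.

Lemma cnorm_toCi a : cnorm (a *i) = `|a|.
Proof. by rewrite /= expr0n /= add0r sqrtr_sqr. Qed.

Lemma ler_Re_cnorm z : `|cRe z| <= cnorm z.
Proof.
by rewrite -ler_sqr ?nnegrE ?cnorm_ge0// cnorm2E real_normK ?num_real// lerDl sqr_ge0.
Qed.

Lemma ler_Im_cnorm z : `|cIm z| <= cnorm z.
Proof.
by rewrite -ler_sqr ?nnegrE ?cnorm_ge0// cnorm2E real_normK ?num_real// lerDr sqr_ge0.
Qed.

Lemma cnorm_le z : cnorm z <= `|cRe z| + `|cIm z|.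
Proof.
rewrite -ler_sqr ?nnegrE ?cnorm_ge0 ?addr_ge0// cnorm2E sqrrD.
rewrite !real_normK ?num_real// -addrA lerD2l lerDr mulrn_wge0// mulr_ge0.
Qed.

Lemma cnorm_eq0 z : cnorm z = 0 -> z = 0.
Proof. exact: Normc.eq0_normc. Qed.

Lemma cnorm0 : cnorm (0 : R[i]) = 0.
Proof. exact: Normc.normc0. Qed.

Lemma cnorm_gt0 z : z != 0 -> 0 < cnorm z.
Proof.
by rewrite lt_def cnorm_ge0 andbT; apply: contra => /eqP /cnorm_eq0 ->.
Qed.

Lemma cnormX z n : cnorm (z ^+ n) = cnorm z ^+ n.
Proof.
by elim: n => [|n IH]; [exact: Normc.normc1|rewrite !exprS cnormM IH].
Qed.

Lemma cnorm_prod (I : Type) (r : seq I) (F : I -> R[i]) :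
  cnorm (\prod_(i <- r) F i) = \prod_(i <- r) cnorm (F i).
Proof.
elim: r => [|i r IH]; first by rewrite !big_nil; exact: Normc.normc1.
by rewrite !big_cons cnormM IH.
Qed.

Lemma cnorm_sum (I : Type) (r : seq I) (F : I -> R[i]) :
  cnorm (\sum_(i <- r) F i) <= \sum_(i <- r) cnorm (F i).
Proof.
elim: r => [|i r IH]; first by rewrite !big_nil cnorm0.
by rewrite !big_cons (le_trans (cnormD _ _))// lerD2l.
Qed.

Lemma toCD a b : (a + b)%:C = a%:C + b%:C :> R[i].
Proof. by apply: complex_ext; rewrite /= ?addr0. Qed.

Lemma toCM a b : (a * b)%:C = a%:C * b%:C :> R[i].
Proof. by apply: complex_ext; rewrite /= ?mul0r ?mulr0 ?subr0 ?addr0. Qed.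

Lemma toCX a n : (a ^+ n)%:C = a%:C ^+ n :> R[i].
Proof. by elim: n => [//|n IH]; rewrite !exprS toCM IH. Qed.

Lemma toC_prod (I : Type) (r : seq I) (F : I -> R) :
  (\prod_(i <- r) F i)%:C = \prod_(i <- r) (F i)%:C :> R[i].
Proof. by elim: r => [|i r IH]; rewrite ?big_nil// !big_cons toCM IH. Qed.

Lemma toC_sum (I : Type) (r : seq I) (F : I -> R) :
  (\sum_(i <- r) F i)%:C = \sum_(i <- r) (F i)%:C :> R[i].
Proof. by elim: r => [|i r IH]; rewrite ?big_nil// !big_cons toCD IH. Qed.

Lemma expiD a b : expi (a + b) = expi a * expi b.
Proof. by rewrite /expi cosD sinD; apply: complex_ext => /=; ring. Qed.

Lemma expi0 : expi 0 = 1 :> R[i].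
Proof. by rewrite /expi cos0 sin0. Qed.

Lemma cnorm_expi a : cnorm (expi a) = 1.
Proof. by rewrite /= cos2Dsin2 sqrtr1. Qed.

Lemma expi_sum (I : Type) (r : seq I) (F : I -> R) :
  expi (\sum_(i <- r) F i) = \prod_(i <- r) expi (F i).
Proof.
by elim: r => [|i r IH]; rewrite ?big_nil ?expi0// !big_cons expiD IH.
Qed.

End complex_basics.

Section cmeas.
Context {R : realType} {d : measure_display} {T : measurableType d}.
Implicit Types f g : T -> R[i].

Definition cmeas f :=
  measurable_fun setT (cRe \o f) /\ measurable_fun setT (cIm \o f).

Lemma cmeas_cst (c : R[i]) : cmeas (fun=> c).
Proof. by split; exact: measurable_cst. Qed.

Lemma cmeasD f g : cmeas f -> cmeas g -> cmeas (fun x => f x + g x).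
Proof.
move=> [f1 f2] [g1 g2]; split.
  rewrite (_ : _ \o _ = (cRe \o f) \+ (cRe \o g)); first exact: measurable_funD.
  by apply/funext => x /=; rewrite cReD.
rewrite (_ : _ \o _ = (cIm \o f) \+ (cIm \o g)); first exact: measurable_funD.
by apply/funext => x /=; rewrite cImD.
Qed.

Lemma cmeasM f g : cmeas f -> cmeas g -> cmeas (fun x => f x * g x).
Proof.
move=> [f1 f2] [g1 g2]; split.
  rewrite (_ : _ \o _ = ((cRe \o f) \* (cRe \o g)) \- ((cIm \o f) \* (cIm \o g))).
    by apply: measurable_funB; exact: measurable_funM.
  by apply/funext => x /=; rewrite cReM.
rewrite (_ : _ \o _ = ((cRe \o f) \* (cIm \o g)) \+ ((cIm \o f) \* (cRe \o g))).
  by apply: measurable_funD; exact: measurable_funM.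
by apply/funext => x /=; rewrite cImM.
Qed.

Lemma cmeas_toC (f : T -> R) : measurable_fun setT f -> cmeas (fun x => (f x)%:C).
Proof. by move=> mf; split => //; exact: measurable_cst. Qed.

Lemma cmeasN f : cmeas f -> cmeas (fun x => - f x).
Proof.
move=> mf; rewrite (_ : (fun x => - f x) = (fun x => (- 1) * f x)).
  by apply: cmeasM => //; exact: cmeas_cst.
by apply/funext => x; rewrite mulN1r.
Qed.

Lemma cmeasB f g : cmeas f -> cmeas g -> cmeas (fun x => f x - g x).
Proof. by move=> mf mg; apply: cmeasD => //; exact: cmeasN. Qed.

Lemma cmeas_conj f : cmeas f -> cmeas (fun x => (f x)^*%C).
Proof.
move=> [f1 f2]; split.
  by rewrite (_ : _ \o _ = cRe \o f)//; apply/funext => x /=; case: (f x).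
rewrite (_ : _ \o _ = \- (cIm \o f)); first exact: measurable_funN.
by apply/funext => x /=; case: (f x).
Qed.

Lemma cmeas_expi (f : T -> R) : measurable_fun setT f ->
  cmeas (fun x => expi (f x)).
Proof.
move=> mf; split.
  rewrite (_ : _ \o _ = cos \o f)//; apply: measurableT_comp => //.
  by apply: continuous_measurable_fun; exact: continuous_cos.
rewrite (_ : _ \o _ = sin \o f)//; apply: measurableT_comp => //.
by apply: continuous_measurable_fun; exact: continuous_sin.
Qed.

Lemma cmeas_sum (I : Type) (r : seq I) (F : I -> T -> R[i]) :
  (forall i, cmeas (F i)) -> cmeas (fun x => \sum_(i <- r) F i x).
Proof.
move=> mF; elim: r => [|i r IH].
  rewrite (_ : (fun _ => _) = fun=> 0); first exact: cmeas_cst.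
  by apply/funext => x; rewrite big_nil.
rewrite (_ : (fun _ => _) = fun x => F i x + \sum_(j <- r) F j x).
  exact: cmeasD.
by apply/funext => x; rewrite big_cons.
Qed.

Lemma cmeas_prod (I : Type) (r : seq I) (F : I -> T -> R[i]) :
  (forall i, cmeas (F i)) -> cmeas (fun x => \prod_(i <- r) F i x).
Proof.
move=> mF; elim: r => [|i r IH].
  rewrite (_ : (fun _ => _) = fun=> 1); first exact: cmeas_cst.
  by apply/funext => x; rewrite big_nil.
rewrite (_ : (fun _ => _) = fun x => F i x * \prod_(j <- r) F j x).
  exact: cmeasM.
by apply/funext => x; rewrite big_cons.
Qed.

Lemma cmeasX f n : cmeas f -> cmeas (fun x => f x ^+ n).
Proof.
move=> mf; elim: n => [|n IH]; first exact: cmeas_cst.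
rewrite (_ : (fun _ => _) = fun x => f x * f x ^+ n); first exact: cmeasM.
by apply/funext => x; rewrite exprS.
Qed.

Lemma measurable_cnorm f : cmeas f -> measurable_fun setT (fun x => cnorm (f x)).
Proof.
move=> [f1 f2].
rewrite (_ : (fun _ => _) =
  (fun x => Num.sqrt ((cRe \o f) x ^+ 2 + (cIm \o f) x ^+ 2))); last first.
  by apply/funext => x /=; case: (f x).
apply: (@measurableT_comp _ _ _ _ _ _ (@Num.sqrt R)).
  by apply: continuous_measurable_fun; exact: sqrt_continuous.
by apply: measurable_funD; exact: measurable_funX.
Qed.

End cmeas.

Lemma cmeas_comp {R : realType} {d d' : measure_display} {T : measurableType d}
    {U : measurableType d'} (f : T -> R[i]) (g : U -> T) :
  cmeas f -> measurable_fun setT g -> cmeas (f \o g).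
Proof. by move=> [f1 f2] mg; split; [exact: (measurableT_comp f1 mg)|exact: (measurableT_comp f2 mg)]. Qed.

Section Cint.
Context {R : realType} {d : measure_display} {T : measurableType d}.
Variable m : {measure set T -> \bar R}.
Implicit Types f g : T -> R[i].

Definition Cint f : R[i] :=
  (\int[m]_x cRe (f x))%R +i* (\int[m]_x cIm (f x))%R.

Definition Cintegrable f :=
  cmeas f /\ m.-integrable setT (fun x => (cnorm (f x))%:E).

Lemma eq_Cint f g : f =1 g -> Cint f = Cint g.
Proof. by move=> fg; congr Cint; apply/funext. Qed.

Lemma Cintegrable_cmeas f : Cintegrable f -> cmeas f.
Proof. by case. Qed.

Lemma CintegrableP f : Cintegrable f <->
  m.-integrable setT (EFin \o (cRe \o f)) /\ m.-integrable setT (EFin \o (cIm \o f)).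
Proof.
split=> [[[m1 m2] fi]|[f1 f2]].
  split; apply: (le_integrable _ _ _ fi) => //; try exact/measurable_EFinP.
    by move=> x _ /=; rewrite lee_fin (ger0_norm (cnorm_ge0 _)) ler_Re_cnorm.
  by move=> x _ /=; rewrite lee_fin (ger0_norm (cnorm_ge0 _)) ler_Im_cnorm.
have mf : cmeas f.
  by split; [move/measurable_int : f1 => /measurable_EFinP|
             move/measurable_int : f2 => /measurable_EFinP].
split=> //; have := integrableD measurableT (integrable_abse f1) (integrable_abse f2).
apply: le_integrable => //; first exact/measurable_EFinP/measurable_cnorm.
move=> x _ /=; rewrite lee_fin (ger0_norm (cnorm_ge0 _)).
by rewrite (le_trans (cnorm_le _))// ler_norm.
Qed.

Lemma Cintegrable_le f (g : T -> R) : cmeas f -> m.-integrable setT (EFin \o g) ->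
  (forall x, cnorm (f x) <= g x) -> Cintegrable f.
Proof.
move=> mf ig fg; split=> //; apply: (le_integrable _ _ _ ig) => //.
  exact/measurable_EFinP/measurable_cnorm.
move=> x _ /=; rewrite lee_fin (ger0_norm (cnorm_ge0 _)).
by rewrite (le_trans (fg x))// ler_norm.
Qed.

Lemma CintegrableD f g : Cintegrable f -> Cintegrable g ->
  Cintegrable (fun x => f x + g x).
Proof.
move=> [mf fi] [mg gi].
apply: (@Cintegrable_le _ (fun x => cnorm (f x) + cnorm (g x))).
- exact: cmeasD.
- exact: (integrableD measurableT fi gi).
- by move=> x; exact: cnormD.
Qed.

Lemma CintegrableZ c f : Cintegrable f -> Cintegrable (fun x => c * f x).
Proof.
move=> [mf fi]; apply: (@Cintegrable_le _ (fun x => cnorm c * cnorm (f x))).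
- by apply: cmeasM => //; exact: cmeas_cst.
- exact: (integrableZl measurableT (cnorm c) fi).
- by move=> x; rewrite cnormM.
Qed.

Lemma CintegrableM_bounded (h : T -> R[i]) f (c : R) : cmeas h -> Cintegrable f ->
  (forall x, cnorm (h x) <= c) -> Cintegrable (fun x => h x * f x).
Proof.
move=> mh [mf fi] hc; apply: (@Cintegrable_le _ (fun x => c * cnorm (f x))).
- exact: cmeasM.
- exact: (integrableZl measurableT c fi).
- by move=> x; rewrite cnormM ler_wpM2r ?cnorm_ge0.
Qed.

Lemma Cintegrable_expiM (h : T -> R) f : measurable_fun setT h -> Cintegrable f ->
  Cintegrable (fun x => expi (h x) * f x).
Proof.
move=> mh fi; apply: (@CintegrableM_bounded _ _ 1) => //; first exact: cmeas_expi.
by move=> x; rewrite cnorm_expi.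
Qed.

Lemma CintD f g : Cintegrable f -> Cintegrable g ->
  Cint (fun x => f x + g x) = Cint f + Cint g.
Proof.
move=> /CintegrableP[f1 f2] /CintegrableP[g1 g2]; apply: complex_ext => /=.
  by rewrite -RintegralD//; apply: eq_Rintegral => x _; rewrite cReD.
by rewrite -RintegralD//; apply: eq_Rintegral => x _; rewrite cImD.
Qed.

Lemma CintZ c f : Cintegrable f -> Cint (fun x => c * f x) = c * Cint f.
Proof.
move=> /CintegrableP[f1 f2]; apply: complex_ext; rewrite ?cReM ?cImM /=.
  rewrite -!RintegralZl// -RintegralB//; last 2 first.
    exact: (integrableZl measurableT (cRe c) f1).
    exact: (integrableZl measurableT (cIm c) f2).
  by apply: eq_Rintegral => x _; rewrite cReM.
rewrite -!RintegralZl// -RintegralD//; last 2 first.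
  exact: (integrableZl measurableT (cRe c) f2).
  exact: (integrableZl measurableT (cIm c) f1).
by apply: eq_Rintegral => x _; rewrite cImM.
Qed.

Lemma CintZr c f : Cintegrable f -> Cint (fun x => f x * c) = Cint f * c.
Proof.
by move=> fi; rewrite mulrC -CintZ//; apply: eq_Cint => x; rewrite mulrC.
Qed.

Lemma CintB f g : Cintegrable f -> Cintegrable g ->
  Cint (fun x => f x - g x) = Cint f - Cint g.
Proof.
move=> fi gi; rewrite -[in RHS]mulN1r -CintZ// -CintD//; last exact: CintegrableZ.
by apply: eq_Cint => x; rewrite mulN1r.
Qed.

Lemma CintegrableB f g : Cintegrable f -> Cintegrable g ->
  Cintegrable (fun x => f x - g x).
Proof.
move=> fi gi; rewrite (_ : (fun _ => _) = (fun x => f x + (- 1) * g x)).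
  by apply: CintegrableD => //; exact: CintegrableZ.
by apply/funext => x; rewrite mulN1r.
Qed.

Lemma Cint0 : Cint (fun=> 0) = 0.
Proof. by apply: complex_ext; rewrite /= /Rintegral integral0. Qed.

Lemma Cintegrable0 : Cintegrable (fun=> 0).
Proof.
apply: (@Cintegrable_le _ (fun=> 0)); first exact: cmeas_cst.
  exact: integrable0.
by move=> x; rewrite cnorm0.
Qed.

Lemma Cintegrable_sum (I : Type) (r : seq I) (F : I -> T -> R[i]) :
  (forall i, Cintegrable (F i)) -> Cintegrable (fun x => \sum_(i <- r) F i x).
Proof.
move=> iF; elim: r => [|i r IH].
  under eq_fun do rewrite big_nil; exact: Cintegrable0.
under eq_fun do rewrite big_cons; exact: CintegrableD.
Qed.

Lemma Cint_sum (I : Type) (r : seq I) (F : I -> T -> R[i]) :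
  (forall i, Cintegrable (F i)) ->
  Cint (fun x => \sum_(i <- r) F i x) = \sum_(i <- r) Cint (F i).
Proof.
move=> iF; elim: r => [|i r IH].
  by rewrite big_nil -[RHS]Cint0; apply: eq_Cint => x; rewrite big_nil.
rewrite big_cons -IH -CintD//; last exact: Cintegrable_sum.
by apply: eq_Cint => x; rewrite big_cons.
Qed.

(** Multiplying by the conjugate of the integral reduces to a real
    integral. *)
Lemma cnorm_Cint f : Cintegrable f -> cnorm (Cint f) <= \int[m]_x cnorm (f x).
Proof.
move=> fi; have [z0|z0] := eqVneq (Cint f) 0.
  by rewrite z0 cnorm0; apply: Rintegral_ge0 => x _; exact: cnorm_ge0.
set z := Cint f in z0 *.
rewrite -(ler_pM2l (cnorm_gt0 z0)) -expr2.
have -> : cnorm z ^+ 2 = cRe (Cint (fun x => z^*%C * f x)).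
  by rewrite CintZ// -/z cnorm2E cReM; case: z {z0} => a b /=; ring.
have ci : Cintegrable (fun x => z^*%C * f x) by exact: CintegrableZ.
rewrite -RintegralZl//; last by case: fi.
apply: le_Rintegral => //.
- by case/CintegrableP : ci.
- by case: fi => _ fi; exact: (integrableZl measurableT (cnorm z) fi).
- move=> x _; rewrite (le_trans (ler_norm _))// (le_trans (ler_Re_cnorm _))//.
  rewrite cnormM ler_wpM2r ?cnorm_ge0//.
  by case: (z) => a b /=; rewrite sqrrN.
Qed.

(** Dominated convergence, in the form of a null sequence of distances. *)
Lemma Cint_dominated (f_ : nat -> T -> R[i]) f (g : T -> R) :
  (forall n, cmeas (f_ n)) -> cmeas f -> m.-integrable setT (EFin \o g) ->
  (forall x, (fun n => cnorm (f_ n x - f x)) @ \oo --> (0 : R)) ->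
  (forall n x, cnorm (f_ n x) <= g x) -> (forall x, cnorm (f x) <= g x) ->
  (fun n => cnorm (Cint (f_ n) - Cint f)) @ \oo --> (0 : R).
Proof.
move=> mf_ mf ig cvf f_g fg.
have fi_ n : Cintegrable (f_ n) by exact: Cintegrable_le (mf_ n) ig (f_g n).
have fi : Cintegrable f by exact: Cintegrable_le mf ig fg.
have di n : Cintegrable (fun x => f_ n x - f x) by exact: CintegrableB.
pose h n x := (cnorm (f_ n x - f x))%:E.
have [] := @dominated_convergence _ T R m setT measurableT h (cst 0%E)
  (fun x => ((EFin \o g) x + (EFin \o g) x)%E).
- by move=> n; case: (di n) => _ i; exact: measurable_int i.
- exact: measurable_cst.
- by apply: aeW => x _; apply/cvg_EFin; [exact: nearW|exact: cvf].
- exact: integrableD.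
- apply: aeW => x n _ /=; rewrite lee_fin (ger0_norm (cnorm_ge0 _)).
  by rewrite (le_trans (cnormD _ _))// cnormN lerD.
move=> _ _; rewrite integral0 => cvh.
have {}cvh : (fun n => (\int[m]_x cnorm (f_ n x - f x))%R) @ \oo --> (0 : R).
  by apply: (@fine_cvg _ _ _ _ _ 0%R); exact: cvh.
apply: (squeeze_cvgr _ (cvg_cst 0) cvh).
apply: nearW => n; rewrite cnorm_ge0 andTb.
by rewrite -(CintB (fi_ n) fi); exact: cnorm_Cint.
Qed.

End Cint.

Section fubini.
Context {R : realType} {d1 d2 : measure_display}.
Context {T1 : measurableType d1} {T2 : measurableType d2}.
Variable m1 : {sigma_finite_measure set T1 -> \bar R}.
Variable m2 : {sigma_finite_measure set T2 -> \bar R}.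

Lemma Rfubini_dominated (f : T1 * T2 -> R) (A : T1 -> R) (B : T2 -> R) :
  measurable_fun setT f ->
  m1.-integrable setT (EFin \o A) -> m2.-integrable setT (EFin \o B) ->
  (forall x y, `|f (x, y)| <= A x * B y) ->
  [/\ (m1 \x m2)%E.-integrable setT (EFin \o f),
      m1.-integrable setT (fun x => (\int[m2]_y f (x, y))%:E),
      m2.-integrable setT (fun y => (\int[m1]_x f (x, y))%:E),
      (\int[m1]_x \int[m2]_y f (x, y))%R = (\int[(m1 \x m2)%E]_z f z)%R &
      (\int[m2]_y \int[m1]_x f (x, y))%R = (\int[(m1 \x m2)%E]_z f z)%R].
Proof.
move=> mf iA iB fAB.
have fAB' x y : `|f (x, y)| <= `|A x| * `|B y|.
  by rewrite (le_trans (fAB x y))// (le_trans (ler_norm _))// normrM.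
have mEf : measurable_fun setT (EFin \o f) by exact/measurable_EFinP.
have i2 x : m2.-integrable setT (fun y => (f (x, y))%:E).
  apply: (le_integrable measurableT _ _
    (integrableZl measurableT `|A x| (integrable_norm iB))).
    by apply/measurable_EFinP; exact: measurableT_comp.
  by move=> y _ /=; rewrite lee_fin normrM !normr_id.
have i1 y : m1.-integrable setT (fun x => (f (x, y))%:E).
  apply: (le_integrable measurableT _ _
    (integrableZl measurableT `|B y| (integrable_norm iA))).
    by apply/measurable_EFinP; exact: measurableT_comp.
  by move=> x _ /=; rewrite lee_fin normrM !normr_id mulrC.
have i12 : (m1 \x m2)%E.-integrable setT (EFin \o f).
  apply/integrable12ltyP => //=.
  have mA : measurable_fun setT (EFin \o A) by exact: measurable_int iA.
  have mB : measurable_fun setT (EFin \o B) by exact: measurable_int iB.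
  have mnA : measurable_fun setT (fun x => `|A x|%:E).
    by apply/measurable_EFinP; apply: measurableT_comp => //; exact/measurable_EFinP.
  have mnB : measurable_fun setT (fun x => `|B x|%:E).
    by apply/measurable_EFinP; apply: measurableT_comp => //; exact/measurable_EFinP.
  have fB : (\int[m2]_y `|B y|%:E < +oo)%E by case/integrableP : iB.
  apply: (@le_lt_trans _ _ (\int[m1]_x (`|A x|%:E * \int[m2]_y `|B y|%:E))%E).
    apply: ge0_le_integral => //=.
    - by move=> x _; exact: integral_ge0.
    - apply: (measurable_fun_fubini_tonelli_F (fun z => `|f z|%:E)) => //.
      by apply/measurable_EFinP; exact: measurableT_comp.
    - apply: emeasurable_funM => //; exact: measurable_cst.
    - move=> x _; rewrite -ge0_integralZl//.
      apply: ge0_le_integral => //=.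
      + apply/measurable_EFinP; apply: measurableT_comp => //.
        exact: measurableT_comp.
      + by apply: emeasurable_funM => //; exact: measurable_cst.
      + by move=> y _; rewrite -EFinM lee_fin.
  rewrite ge0_integralZr//; last exact: integral_ge0.
  have fA : (\int[m1]_x `|A x|%:E < +oo)%E by case/integrableP : iA.
  apply: lte_mul_pinfty => //; first exact: integral_ge0.
  by rewrite ge0_fin_numE//; exact: integral_ge0.
have F1 : (fun x => (\int[m2]_y f (x, y))%:E) = fubini_F m2 (EFin \o f).
  by apply/funext => x; rewrite /fubini_F /Rintegral fineK//; exact: integrable_fin_num.
have F2 : (fun y => (\int[m1]_x f (x, y))%:E) = fubini_G m1 (EFin \o f).
  by apply/funext => x; rewrite /fubini_G /Rintegral fineK//; exact: integrable_fin_num.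
split=> //.
- by rewrite F1; exact: integrable_fubini_F.
- apply: (le_integrable measurableT _ _
    (integrableZl measurableT (\int[m1]_x `|A x|)%R (integrable_norm iB))).
    by rewrite F2; exact: (measurable_fubini_G i12).
  move=> y _ /=; rewrite lee_fin normrM normr_id ger0_norm; last first.
    exact: Rintegral_ge0.
  rewrite (le_trans (le_normr_Rintegral _ (i1 y)))//.
  rewrite -RintegralZr//; last exact: integrable_norm.
  apply: le_Rintegral => //; first exact: integrable_norm (i1 y).
  exact: (integrableZr measurableT `|B y| (integrable_norm iA)).
- by rewrite {1}/Rintegral F1 integral12_prod_meas1.
- by rewrite {1}/Rintegral F2 integral21_prod_meas1.
Qed.

(** The domination by a product makes every slice integrable, so that no
    exceptional null sets appear. *)
Lemma Cfubini (f : T1 * T2 -> R[i]) (A : T1 -> R) (B : T2 -> R) :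
  cmeas f -> m1.-integrable setT (EFin \o A) -> m2.-integrable setT (EFin \o B) ->
  (forall x y, cnorm (f (x, y)) <= A x * B y) ->
  [/\ Cintegrable (m1 \x m2)%E f,
      Cintegrable m1 (fun x => Cint m2 (fun y => f (x, y))),
      Cintegrable m2 (fun y => Cint m1 (fun x => f (x, y))),
      Cint m1 (fun x => Cint m2 (fun y => f (x, y))) = Cint (m1 \x m2)%E f &
      Cint m2 (fun y => Cint m1 (fun x => f (x, y))) = Cint (m1 \x m2)%E f].
Proof.
move=> [mf1 mf2] iA iB fAB.
have [|i1 i2 i3 e1 e2] := @Rfubini_dominated (cRe \o f) A B mf1 iA iB.
  by move=> x y; exact: le_trans (ler_Re_cnorm _) (fAB x y).
have [|j1 j2 j3 h1 h2] := @Rfubini_dominated (cIm \o f) A B mf2 iA iB.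
  by move=> x y; exact: le_trans (ler_Im_cnorm _) (fAB x y).
split; [exact/CintegrableP|exact/CintegrableP|exact/CintegrableP| |].
- exact: complex_ext.
- exact: complex_ext.
Qed.

End fubini.

Section image_measure.
Context {R : realType} {d1 d2 : measure_display}.
Context {T1 : measurableType d1} {T2 : measurableType d2}.
Variables (m : {measure set T1 -> \bar R}) (m' : {measure set T2 -> \bar R}).
Variables (phi : T1 -> T2) (mphi : measurable_fun setT phi).
Hypothesis m'E : forall A, measurable A -> m' A = m (phi @^-1` A).

Let pf : {measure set T2 -> \bar R} :=
  measure_function_pushforward__canonical__measure_function_Measure m mphi.

Lemma ge0_integral_image (f : T2 -> \bar R) : measurable_fun setT f ->
  (forall y, 0 <= f y)%E -> (\int[m']_y f y = \int[m]_x f (phi x))%E.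
Proof.
move=> mf f0; rewrite (@eq_measure_integral _ _ _ _ pf)//; last first.
  by move=> A mA _; rewrite m'E.
by rewrite ge0_integral_pushforward// preimage_setT.
Qed.

Lemma integrable_image (f : T2 -> \bar R) : measurable_fun setT f ->
  m.-integrable setT (f \o phi) -> m'.-integrable setT f.
Proof.
move=> mf /integrableP[_ fi]; apply/integrableP; split => //.
by rewrite ge0_integral_image//; exact: measurableT_comp.
Qed.

Lemma Cint_image (f : T2 -> R[i]) : cmeas f -> Cintegrable m (f \o phi) ->
  Cintegrable m' f /\ Cint m' f = Cint m (f \o phi).
Proof.
move=> [f1 f2] /CintegrableP[i1 i2].
have mf1 : measurable_fun setT (EFin \o (cRe \o f)) by exact/measurable_EFinP.
have mf2 : measurable_fun setT (EFin \o (cIm \o f)) by exact/measurable_EFinP.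
split; first by apply/CintegrableP; split; apply: integrable_image.
have eqm (g : T2 -> \bar R) : (\int[m']_y g y = \int[pf]_y g y)%E.
  by apply: eq_measure_integral => A mA _; rewrite m'E.
by apply: complex_ext; rewrite /= /Rintegral eqm integral_pushforward// preimage_setT.
Qed.

End image_measure.

Section ftc.
Context {R : realType}.
Local Notation mu := (@lebesgue_measure R).

Lemma FTC_is_derive (F f : R -> R) (a b : R) : a <= b ->
  (forall x : R, is_derive x 1 F (f x)) -> continuous f ->
  (\int[mu]_(x in `[a, b]) f x)%R = F b - F a.
Proof.
move=> ab Ff cf; move: ab; rewrite le_eqVlt => /predU1P[<-|ab].
  by rewrite set_itv1 Rintegral_set1 subrr.
have cF : continuous F.
  move=> x; apply: differentiable_continuous; apply/derivable1_diffP.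
  by have /@ex_derive := Ff x.
rewrite /Rintegral (@continuous_FTC2 _ _ F)//.
- by apply: continuous_in_subspaceT => x _; exact: cf.
- split.
  + by move=> x _; have /@ex_derive := Ff x.
  + by apply: cvg_at_right_filter; exact: cF.
  + by apply: cvg_at_left_filter; exact: cF.
- by move=> x _; rewrite derive1E; have /@derive_val := Ff x.
Qed.

(** Indicators with complex values, so that an integral over an interval
    is a [Cint] over the line. *)
Definition itvC (a b : R) (t : R) : R[i] := (\1_`[a, b] t : R)%:C.

Lemma Cintegrable_itvC a b (f : R -> R[i]) (c : R) : cmeas f ->
  (forall t, a <= t <= b -> cnorm (f t) <= c) ->
  Cintegrable mu (fun t => itvC a b t * f t).
Proof.
move=> mf fc; apply: (@Cintegrable_le R _ (measurableTypeR R) mu _ (fun t => c * \1_`[a, b] t)).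
- apply: cmeasM => //; apply: cmeas_toC; exact: measurable_indic.
- have := integrable_indic_itv a b true false.
  move=> /(integrableZl measurableT c); apply: eq_integrable => //.
- move=> t; rewrite cnormM cnorm_toC indicE; case: (boolP (t \in _)) => /=.
    by rewrite inE/= in_itv/= => /fc; rewrite normr1 mul1r mulr1.
  by rewrite normr0 mul0r mulr0.
Qed.

Lemma Cint_itvC a b (f : R -> R[i]) :
  Cint mu (fun t => itvC a b t * f t) =
  (\int[mu]_(x in `[a, b]) cRe (f x))%R +i* (\int[mu]_(x in `[a, b]) cIm (f x))%R.
Proof.
apply: complex_ext => /=; rewrite [RHS]Rintegral_mkcond; apply: eq_Rintegral => x _;
  rewrite patchE ?(cReM, cImM) /itvC indicE; case: (x \in _) => /=;
  by rewrite !(mul0r, mulr0, mul1r, subr0, addr0).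
Qed.

Lemma Cint_expi_itv a b (z : R) : a <= b ->
  z *i * Cint mu (fun t => itvC a b t * expi (t * z)) = expi (b * z) - expi (a * z).
Proof.
move=> ab; have [->|z0] := eqVneq z 0.
  by rewrite !mulr0 subrr (_ : 0 *i = 0)// mul0r.
have cmz : continuous (fun x : R => x * z) by exact: mulrr_continuous.
have d1 (x : R) : is_derive x 1 (fun x => sin (x * z) / z) (cos (x * z)).
  by apply: is_derive_eq; rewrite /GRing.scale/=; field.
have d2 (x : R) : is_derive x 1 (fun x => - cos (x * z) / z) (sin (x * z)).
  by apply: is_derive_eq; rewrite /GRing.scale/=; field.
have h1 : (\int[mu]_(x in `[a, b]) cos (x * z))%R = (sin (b * z) - sin (a * z)) / z.
  rewrite (FTC_is_derive ab d1) ?mulrBl//.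
  by move=> x; apply: continuous_comp; [exact: cmz|exact: continuous_cos].
have h2 : (\int[mu]_(x in `[a, b]) sin (x * z))%R = (cos (a * z) - cos (b * z)) / z.
  rewrite (FTC_is_derive ab d2); first by rewrite -mulrBl; congr (_ / _); ring.
  by move=> x; apply: continuous_comp; [exact: cmz|exact: continuous_sin].
rewrite Cint_itvC /= h1 h2.
by apply: complex_ext; rewrite /=; field.
Qed.

End ftc.

Arguments Cint {R d T} m f : simpl never.
Arguments Normc.normc {R} x : simpl never.

(** * Lebesgue measure on R^d *)

Section lebesgue_affine.
Context {R : realType}.
Local Notation mu := (@lebesgue_measure R).

Lemma measurable_affine (a b : R) :
  measurable_fun setT (fun x : measurableTypeR R => a * x + b : measurableTypeR R).
Proof. by apply: measurable_funD => //; exact: measurable_funM. Qed.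

Lemma lebesgue_measure_affine (a b : R) (A : set (measurableTypeR R)) : a != 0 ->
  measurable A ->
  mu A = (`|a|%:E * mu ((fun x => a * x + b)%R @^-1` A))%E.
Proof.
move=> a0 mA.
have na0 : 0 <= `|a| by [].
pose m' : {measure set (measurableTypeR R) -> \bar R} := mscale (NngNum na0)
  (measure_function_pushforward__canonical__measure_function_Measure mu
    (measurable_affine a b)).
rewrite (@lebesgue_measure_unique R m')// => X /ocitvP[->|[[u v]/= uv ->]].
  by rewrite !measure0.
rewrite /m' /mscale/= /pushforward lebesgue_measure_itv/= lte_fin uv.
have [an|ap] := ltP a 0.
  rewrite (_ : _ @^-1` _ = `[(v - b) / a, (u - b) / a[%classic); last first.
    apply/seteqP; split=> x /=; rewrite !in_itv/=.
      by move=> /andP[h1 h2]; rewrite ler_ndivrMr// ltr_ndivlMr//; apply/andP; split; lra.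
    by rewrite ler_ndivrMr// ltr_ndivlMr// => /andP[h1 h2]; apply/andP; split; lra.
  rewrite lebesgue_measure_itv/= lte_fin ltr_ndivlMr// divfK// ltrBlDr subrK uv.
  by rewrite -!EFinB -EFinM ltr0_norm//; congr EFin; field.
have {}ap : 0 < a by rewrite lt_def a0.
rewrite (_ : _ @^-1` _ = `](u - b) / a, (v - b) / a]%classic); last first.
  apply/seteqP; split=> x /=; rewrite !in_itv/=.
    by move=> /andP[h1 h2]; rewrite ltr_pdivrMr// ler_pdivlMr//; apply/andP; split; lra.
  by rewrite ltr_pdivrMr// ler_pdivlMr// => /andP[h1 h2]; apply/andP; split; lra.
rewrite lebesgue_measure_itv/= lte_fin ltr_pdivrMr// divfK// ltrBlDr subrK uv.
by rewrite -!EFinB -EFinM gtr0_norm//; congr EFin; field.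
Qed.

Lemma ge0_integral_affine (a b : R) (f : measurableTypeR R -> \bar R) : a != 0 ->
  measurable_fun setT f -> (forall x, 0 <= f x)%E ->
  (\int[mu]_x f x = `|a|%:E * \int[mu]_x f (a * x + b)%R)%E.
Proof.
move=> a0 mf f0; have na0 : 0 <= `|a| by [].
rewrite (@ge0_integral_image _ _ _ _ _ (mscale (NngNum na0) mu) mu _
  (measurable_affine a b))//; last first.
  by move=> A mA; exact: lebesgue_measure_affine.
rewrite ge0_integral_mscale//=; apply: measurableT_comp => //.
exact: measurable_affine.
Qed.

Lemma integrable_affine (a b : R) (f : measurableTypeR R -> \bar R) : a != 0 ->
  mu.-integrable setT f -> mu.-integrable setT (fun x => f (a * x + b)%R).
Proof.
move=> a0 /integrableP[mf fi].
have mf' : measurable_fun setT (fun x => f (a * x + b)%R).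
  by apply: measurableT_comp => //; exact: measurable_affine.
apply/integrableP; split => //.
move: fi; rewrite (@ge0_integral_affine a b (fun x => `|f x|%E))//; last first.
  exact: measurableT_comp.
apply: contraTT; rewrite -!leNgt !leye_eq => /eqP ->.
by rewrite mulry gtr0_sg ?normr_gt0// mul1e.
Qed.

Lemma integral_affine (a b : R) (f : measurableTypeR R -> \bar R) : a != 0 ->
  mu.-integrable setT f ->
  (\int[mu]_x f x = `|a|%:E * \int[mu]_x f (a * x + b)%R)%E.
Proof.
move=> a0 fi; have mf := measurable_int mu fi.
rewrite [LHS]integralE [in RHS]integralE.
rewrite (@ge0_integral_affine a b (f^\+)%E)//; last exact: measurable_funepos.
rewrite (@ge0_integral_affine a b (f^\-)%E)//; last exact: measurable_funeneg.
have h1 := integrable_pos_fin_num measurableT (integrable_affine b a0 fi).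
have mulB (p q : \bar R) : p \is a fin_num ->
    (`|a|%:E * (p - q) = `|a|%:E * p - `|a|%:E * q)%E.
  by move=> hp; rewrite muleBr// fin_num_adde_defr.
rewrite [RHS]mulB//; congr (_ * _ - _ * _)%E; apply: eq_integral => x _.
  by rewrite !funeposE.
by rewrite !funenegE.
Qed.

Lemma Cint_affine (a b : R) (f : R -> R[i]) : a != 0 -> Cintegrable mu f ->
  Cintegrable mu (fun x => f (a * x + b)) /\
  Cint mu f = `|a|%:C * Cint mu (fun x => f (a * x + b)).
Proof.
move=> a0 /CintegrableP[f1 f2].
have g1 := integrable_affine b a0 f1; have g2 := integrable_affine b a0 f2.
split; first exact/CintegrableP.
apply: complex_ext; rewrite ?(cReM, cImM) /= mul0r ?subr0 ?addr0.
  rewrite /Rintegral (integral_affine b a0 f1) fineM//.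
  exact: integrable_fin_num g1.
rewrite /Rintegral (integral_affine b a0 f2) fineM//.
exact: integrable_fin_num g2.
Qed.

End lebesgue_affine.

Section lebesgue_Rn_fubini.
Context {R : realType}.
Local Notation mu := (@lebesgue_measure R).

Lemma ge0_integral_Rn0 (f : Rn R 0 -> \bar R) : measurable_fun setT f ->
  (\int[lebesgue_Rn R 0]_x f x = f (@tnil R))%E.
Proof. by move=> mf; rewrite /= integral_dirac// diracT mul1e. Qed.

Lemma ge0_integral_Rn_cons n (f : Rn R n.+1 -> \bar R) :
  measurable_fun setT f -> (forall x, 0 <= f x)%E ->
  (\int[lebesgue_Rn R n.+1]_x f x =
   \int[mu]_x \int[lebesgue_Rn R n]_t f (tcons (x, t)))%E.
Proof.
move=> mf f0.
rewrite (@ge0_integral_image _ _ _ _ _ (mu \x lebesgue_Rn R n)%E _ _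
  (@measurable_tcons _ _ n))//.
rewrite (fubini_tonelli1 (f \o @tcons _ _ n))//.
  by apply: measurableT_comp => //; exact: measurable_tcons.
by move=> x; exact: f0.
Qed.

Lemma measurable_tcons_pair {disp} {T : measurableType disp} n
    (f : T -> measurableTypeR R) (g : T -> Rn R n) :
  measurable_fun setT f -> measurable_fun setT g ->
  measurable_fun setT (fun t => tcons (f t, g t)).
Proof.
move=> mf mg; apply: (measurableT_comp (@measurable_tcons _ _ n)).
exact: measurable_fun_pair.
Qed.

Lemma Cint_Rn_cons n (f : Rn R n.+1 -> R[i]) (A : R -> R) (B : Rn R n -> R) :
  cmeas f -> mu.-integrable setT (EFin \o A) ->
  (lebesgue_Rn R n).-integrable setT (EFin \o B) ->
  (forall x t, cnorm (f (tcons (x, t))) <= A x * B t) ->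
  Cintegrable (lebesgue_Rn R n.+1) f /\
  Cint (lebesgue_Rn R n.+1) f =
  Cint mu (fun x => Cint (lebesgue_Rn R n) (fun t => f (tcons (x, t)))).
Proof.
move=> mf iA iB fAB.
have mft : cmeas (f \o @tcons _ (measurableTypeR R) n).
  exact: (cmeas_comp mf (@measurable_tcons _ _ n)).
have [i1 _ _ e _] := Cfubini mft iA iB fAB.
have [i2 ->] := @Cint_image _ _ _ _ _ (mu \x lebesgue_Rn R n)%E
  (lebesgue_Rn R n.+1) _ (@measurable_tcons _ _ n) (fun _ _ => erefl) _ mf i1.
by split.
Qed.

Lemma tnth_tcons0 n (p : measurableTypeR R * Rn R n) : tnth (tcons p) ord0 = p.1.
Proof. by []. Qed.

Lemma tnth_tconsS n (p : measurableTypeR R * Rn R n) i :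
  tnth (tcons p) (lift ord0 i) = tnth p.2 i.
Proof. exact: tnthS. Qed.

Lemma measurable_tnthR n (i : 'I_n) : measurable_fun setT (fun x : Rn R n => tnth x i).
Proof. exact: measurable_tnth. Qed.

Lemma ge0_integral_prod n (f : 'I_n -> R -> \bar R) :
  (forall i, measurable_fun setT (f i : measurableTypeR R -> \bar R)) ->
  (forall i x, 0 <= f i x)%E ->
  (\int[lebesgue_Rn R n]_x \big[*%E/1%E]_(i < n) f i (tnth x i) =
   \big[*%E/1%E]_(i < n) \int[mu]_x f i x)%E.
Proof.
elim: n f => [|n IH] f mf f0.
  rewrite ge0_integral_Rn0; last first.
    by under eq_fun do rewrite big_ord0; exact: measurable_cst.
  by rewrite !big_ord0.
have p0 m (g : 'I_m -> \bar R) : (forall i, 0 <= g i)%E -> (0 <= \big[*%E/1%E]_(i < m) g i)%E.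
  by move=> g0; elim/big_ind : _ => //; exact: mule_ge0.
have mprod m (g : 'I_m -> R -> \bar R) :
    (forall i, measurable_fun setT (g i : measurableTypeR R -> \bar R)) ->
    measurable_fun setT (fun x : Rn R m => \big[*%E/1%E]_(i < m) g i (tnth x i)).
  move=> mg; elim: (index_enum _) => [|i r IHr].
    by under eq_fun do rewrite big_nil; exact: measurable_cst.
  under eq_fun do rewrite big_cons.
  apply: emeasurable_funM => //.
  by apply: measurableT_comp (mg i) _; exact: measurable_tnthR.
rewrite ge0_integral_Rn_cons//; [|exact: mprod|by move=> x; exact: p0].
rewrite big_ord_recl -IH// -ge0_integralZr//; last first.
  by apply: integral_ge0 => x _; exact: p0.
apply: eq_integral => x _.
rewrite -ge0_integralZl//; last 2 first.
  by apply: (mprod n (fun i => f (lift ord0 i))) => i; exact: mf.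
  by move=> y _; exact: p0.
apply: eq_integral => t _; rewrite big_ord_recl tnth_tcons0; congr (_ * _)%E.
by apply: eq_bigr => i _; rewrite tnth_tconsS.
Qed.

Lemma Cint_prod n (f : 'I_n -> R -> R[i]) : (forall i, Cintegrable mu (f i)) ->
  Cintegrable (lebesgue_Rn R n) (fun x => \prod_(i < n) f i (tnth x i)) /\
  Cint (lebesgue_Rn R n) (fun x => \prod_(i < n) f i (tnth x i)) =
  \prod_(i < n) Cint mu (f i).
Proof.
elim: n f => [|n IH] f fi.
  rewrite big_ord0; under eq_fun do rewrite big_ord0.
  split.
    split; first exact: cmeas_cst.
    apply/integrableP; split; first exact: measurable_cst.
    by rewrite ge0_integral_Rn0 ?ltry//; exact: measurable_cst.
  by apply: complex_ext; rewrite /= /Rintegral integral_dirac// diracT mul1e.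
have mf : cmeas (fun x : Rn R n.+1 => \prod_(i < n.+1) f i (tnth x i)).
  apply: cmeas_prod => i; apply: (cmeas_comp (Cintegrable_cmeas (fi i))).
  exact: measurable_tnthR.
have [ig eg] := IH (fun i => f (lift ord0 i)) (fun i => fi _).
have fE x (t : Rn R n) : \prod_(i < n.+1) f i (tnth (tcons (x, t)) i) =
    f ord0 x * \prod_(i < n) f (lift ord0 i) (tnth t i).
  rewrite big_ord_recl tnth_tcons0; congr (_ * _).
  by apply: eq_bigr => i _; rewrite tnth_tconsS.
have [|i1 ->] := Cint_Rn_cons mf (proj2 (fi ord0)) (proj2 ig).
  by move=> x t; rewrite fE cnormM.
split => //; rewrite big_ord_recl -eg -CintZr//; apply: eq_Cint => x.
by rewrite -CintZ//; apply: eq_Cint => t; rewrite fE.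
Qed.

End lebesgue_Rn_fubini.

(** * Euclidean geometry of tuples *)

Section tuple_geometry.
Context {R : realType} {d : nat}.
Implicit Types (u v w x y : Rn R d) (a b : R).

Definition vadd u v : Rn R d := [tuple tnth u i + tnth v i | i < d].
Definition vscale a u : Rn R d := [tuple a * tnth u i | i < d].

Lemma tnth_vadd u v i : tnth (vadd u v) i = tnth u i + tnth v i.
Proof. by rewrite tnth_mktuple. Qed.
Lemma tnth_vscale a u i : tnth (vscale a u) i = a * tnth u i.
Proof. by rewrite tnth_mktuple. Qed.
Lemma tnth_vsub u v i : tnth (vsub u v) i = tnth u i - tnth v i.
Proof. by rewrite tnth_mktuple. Qed.
Lemma tnth_vopp u i : tnth (vopp u) i = - tnth u i.
Proof. by rewrite tnth_mktuple. Qed.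
Lemma tnth_vzero i : tnth (vzero : Rn R d) i = 0.
Proof. by rewrite tnth_mktuple. Qed.

Definition tnthE := (tnth_vadd, tnth_vscale, tnth_vsub, tnth_vopp, tnth_vzero).

Lemma vaddC u v : vadd u v = vadd v u.
Proof. by apply: eq_from_tnth => i; rewrite !tnthE addrC. Qed.

Lemma dotpDl u v w : dotp (vadd u v) w = dotp u w + dotp v w.
Proof. by rewrite /dotp -big_split; apply: eq_bigr => i _; rewrite tnthE mulrDl. Qed.

Lemma dotpC u v : dotp u v = dotp v u.
Proof. by apply: eq_bigr => i _; rewrite mulrC. Qed.

Lemma dotpDr u v w : dotp u (vadd v w) = dotp u v + dotp u w.
Proof. by rewrite dotpC dotpDl !(dotpC u). Qed.

Lemma dotpZl a u v : dotp (vscale a u) v = a * dotp u v.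
Proof. by rewrite /dotp mulr_sumr; apply: eq_bigr => i _; rewrite tnthE mulrA. Qed.

Lemma dotpZr a u v : dotp u (vscale a v) = a * dotp u v.
Proof. by rewrite dotpC dotpZl dotpC. Qed.

Lemma dotpN u v : dotp (vopp u) v = - dotp u v.
Proof. by rewrite /dotp -sumrN; apply: eq_bigr => i _; rewrite tnthE mulNr. Qed.

Lemma dotpBl u v w : dotp (vsub u v) w = dotp u w - dotp v w.
Proof. by rewrite /dotp -sumrB; apply: eq_bigr => i _; rewrite tnthE mulrBl. Qed.

Lemma dotpBr u v w : dotp u (vsub v w) = dotp u v - dotp u w.
Proof. by rewrite dotpC dotpBl !(dotpC u). Qed.

Lemma dotp0r u : dotp u vzero = 0.
Proof. by rewrite /dotp big1// => i _; rewrite tnthE mulr0. Qed.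

Lemma sqr_enorm u : enorm u ^+ 2 = dotp u u.
Proof.
rewrite sqr_sqrtr; first by apply: eq_bigr => i _; rewrite expr2.
by apply: sumr_ge0 => i _; exact: sqr_ge0.
Qed.

Lemma enorm_ge0 u : 0 <= enorm u.
Proof. exact: sqrtr_ge0. Qed.

Lemma enormE u : enorm u = Num.sqrt (dotp u u).
Proof. by rewrite /enorm; congr Num.sqrt; apply: eq_bigr => i _; rewrite expr2. Qed.

Lemma dotp_ge0 u : 0 <= dotp u u.
Proof. by rewrite -sqr_enorm sqr_ge0. Qed.

Lemma enormZ a u : enorm (vscale a u) = `|a| * enorm u.
Proof. by rewrite !enormE dotpZl dotpZr mulrA -expr2 sqrtrM ?sqr_ge0// sqrtr_sqr. Qed.

Lemma enormN u : enorm (vopp u) = enorm u.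
Proof. by rewrite !enormE dotpN dotpC dotpN opprK. Qed.

Lemma enorm0 : enorm (vzero : Rn R d) = 0.
Proof. by rewrite enormE dotp0r sqrtr0. Qed.

Lemma enorm_eq0 u : enorm u = 0 -> u = vzero.
Proof.
move=> u0; have : dotp u u = 0 by rewrite -sqr_enorm u0 expr0n.
move=> /eqP; rewrite /dotp psumr_eq0; last by move=> i _; rewrite -expr2 sqr_ge0.
move=> /allP h; apply: eq_from_tnth => i; rewrite tnthE.
by have := h i (mem_index_enum _); rewrite implyTb mulf_eq0 orbb => /eqP.
Qed.

(** Cauchy-Schwarz, from the nonnegativity of the squared norm of
    [|v|^2 u - (u.v) v]. *)
Lemma ler_dotp u v : dotp u v <= enorm u * enorm v.
Proof.
have [v0|v0] := eqVneq (enorm v) 0.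
  by rewrite (enorm_eq0 v0) enorm0 dotp0r mulr0.
have {}v0 : 0 < dotp v v by rewrite -sqr_enorm exprn_gt0// lt_def v0 enorm_ge0.
suff h : dotp u v ^+ 2 <= (enorm u * enorm v) ^+ 2.
  rewrite (le_trans (ler_norm _))// -ler_sqr ?nnegrE ?mulr_ge0 ?enorm_ge0//.
  by rewrite real_normK ?num_real.
rewrite exprMn !sqr_enorm.
have := dotp_ge0 (vsub (vscale (dotp v v) u) (vscale (dotp u v) v)).
rewrite !(dotpBl, dotpBr, dotpZl, dotpZr) (dotpC v u).
set a := dotp u u; set b := dotp v v; set c := dotp u v => h.
have : 0 <= b * (a * b - c ^+ 2) by apply: le_trans h _; rewrite le_eqVlt; apply/orP; left; apply/eqP; ring.
by rewrite pmulr_rge0// subr_ge0.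
Qed.

Lemma enormD u v : enorm (vadd u v) <= enorm u + enorm v.
Proof.
rewrite -ler_sqr ?nnegrE ?addr_ge0 ?enorm_ge0// sqr_enorm sqrrD !sqr_enorm.
rewrite !(dotpDl, dotpDr) (dotpC v u).
by have := ler_dotp u v; rewrite -mulr_natr; lra.
Qed.

Lemma ler_norm_tnth u i : `|tnth u i| <= enorm u.
Proof.
rewrite -ler_sqr ?nnegrE ?enorm_ge0// sqr_enorm real_normK ?num_real//.
by rewrite /dotp (bigD1 i)//= -expr2 lerDl; apply: sumr_ge0 => j _; rewrite -expr2 sqr_ge0.
Qed.

Lemma enorm_le_sum u : enorm u <= \sum_(i < d) `|tnth u i|.
Proof.
rewrite -ler_sqr ?nnegrE ?enorm_ge0 ?sumr_ge0// sqr_enorm /dotp expr2 mulr_suml.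
apply: ler_sum => i _; rewrite mulr_sumr (bigD1 i)//= -normrM.
rewrite (le_trans (ler_norm _))// lerDl; apply: sumr_ge0 => j _.
by rewrite mulr_ge0.
Qed.

Lemma enorm_cube u c : cube c u -> enorm u <= d%:R * c.
Proof.
move=> uc; apply: le_trans (enorm_le_sum u) _.
rewrite -[X in X%:R]card_ord -sum1_card natr_sum mulr_suml.
by apply: ler_sum => i _; rewrite mul1r ler_norml.
Qed.

Lemma cube_enorm u c : enorm u <= c -> cube c u.
Proof.
by move=> uc i; rewrite -ler_norml (le_trans (ler_norm_tnth u i)).
Qed.

End tuple_geometry.

Section tuple_measurability.
Context {R : realType} {d : nat}.

Lemma measurable_tuple_fun {disp} {T : measurableType disp} (f : T -> Rn R d) :
  (forall i, measurable_fun setT (fun t => tnth (f t) i)) -> measurable_fun setT f.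
Proof. by move=> mf; apply/measurable_fun_tnthP. Qed.

Lemma measurable_tnth_comp {disp} {T : measurableType disp} (f : T -> Rn R d) i :
  measurable_fun setT f -> measurable_fun setT (fun t => tnth (f t) i).
Proof. by move=> mf; move/measurable_fun_tnthP : mf => /(_ i). Qed.

Lemma measurable_dotp {disp} {T : measurableType disp} (f g : T -> Rn R d) :
  measurable_fun setT f -> measurable_fun setT g ->
  measurable_fun setT (fun t => dotp (f t) (g t)).
Proof.
move=> mf mg; apply: measurable_sum => i.
by apply: measurable_funM; exact: measurable_tnth_comp.
Qed.

Lemma measurable_enorm {disp} {T : measurableType disp} (f : T -> Rn R d) :
  measurable_fun setT f -> measurable_fun setT (fun t => enorm (f t)).
Proof.
move=> mf; under eq_fun do rewrite enormE.
apply: (@measurableT_comp _ _ _ _ _ _ (@Num.sqrt R)).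
  by apply: continuous_measurable_fun; exact: sqrt_continuous.
exact: measurable_dotp.
Qed.

Lemma measurable_vadd {disp} {T : measurableType disp} (f g : T -> Rn R d) :
  measurable_fun setT f -> measurable_fun setT g ->
  measurable_fun setT (fun t => vadd (f t) (g t)).
Proof.
move=> mf mg; apply: measurable_tuple_fun => i.
under eq_fun do rewrite tnthE.
by apply: measurable_funD; exact: measurable_tnth_comp.
Qed.

Lemma measurable_vsub {disp} {T : measurableType disp} (f g : T -> Rn R d) :
  measurable_fun setT f -> measurable_fun setT g ->
  measurable_fun setT (fun t => vsub (f t) (g t)).
Proof.
move=> mf mg; apply: measurable_tuple_fun => i.
under eq_fun do rewrite tnthE.
by apply: measurable_funB; exact: measurable_tnth_comp.
Qed.

Lemma measurable_vscale {disp} {T : measurableType disp} (a : T -> R) (f : T -> Rn R d) :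
  measurable_fun setT a -> measurable_fun setT f ->
  measurable_fun setT (fun t => vscale (a t) (f t)).
Proof.
move=> ma mf; apply: measurable_tuple_fun => i.
under eq_fun do rewrite tnthE.
by apply: measurable_funM => //; exact: measurable_tnth_comp.
Qed.

Lemma measurable_lt_set {disp} {T : measurableType disp} (f g : T -> R) :
  measurable_fun setT f -> measurable_fun setT g -> measurable [set t | f t < g t].
Proof.
move=> mf mg; have := measurable_fun_ltr mf mg => /(_ measurableT [set true]).
by rewrite setTI; apply.
Qed.

Lemma measurable_le_set {disp} {T : measurableType disp} (f g : T -> R) :
  measurable_fun setT f -> measurable_fun setT g -> measurable [set t | f t <= g t].
Proof.
move=> mf mg; have := measurable_fun_ler mf mg => /(_ measurableT [set true]).
by rewrite setTI; apply.
Qed.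

Lemma measurable_eball (x : Rn R d) r : measurable (eball x r).
Proof.
apply: measurable_lt_set => //; apply: measurable_enorm.
by apply: measurable_vsub => //; exact: measurable_cst.
Qed.

Lemma measurable_cube r : measurable (cube r : set (Rn R d)).
Proof.
rewrite (_ : cube r = \bigcap_(i in [set: 'I_d])
  ([set x | - r <= tnth x i] `&` [set x | tnth x i <= r])); last first.
  apply/seteqP; split=> x /= h.
    by move=> i _; have /andP[] := h i.
  by move=> i; have [/= -> ->] := h i I.
apply: fin_bigcap_measurable; first exact: finite_finset.
move=> i _; apply: measurableI; apply: measurable_le_set => //;
  exact: measurable_tnthR.
Qed.

Lemma lebesgue_cube r : 0 <= r -> lebesgue_Rn R d (cube r) = ((2 * r) ^+ d)%:E.
Proof.
move=> r0; rewrite (_ : cube r = [set x | forall i, `[- r, r]%classic (tnth x i)]).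
  rewrite (@lebesgue_Rn_box R d (fun _ => `[- r, r]%classic))//.
  under eq_bigr do rewrite lebesgue_measure_itv/= lte_fin.
  have -> : (if (- r < r)%R then r%:E + (- - r)%:E else 0)%E = (2 * r)%:E.
    case: ifPn => [_|]; first by rewrite -EFinD; congr EFin; lra.
    by rewrite -leNgt => h; congr EFin; lra.
  by rewrite big_const card_ord; elim: d => [//|n IH]; rewrite iterS IH -EFinM exprS.
by apply/seteqP; split=> x /= h i; have := h i; rewrite in_itv.
Qed.

End tuple_measurability.

(** * Linear changes of variables *)

Lemma measurable_indic_comp {R : realType} {disp disp'} {U : measurableType disp}
    {V : measurableType disp'} (h : U -> V) (A : set V) :
  measurable A -> measurable_fun setT h ->
  measurable_fun setT (fun t => (\1_A (h t))%:E : \bar R).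
Proof.
move=> mA mh; apply/measurable_EFinP.
rewrite (_ : (fun t => \1_A (h t)) = \1_(h @^-1` A))//.
by apply: measurable_indic; rewrite -[X in measurable X]setTI; exact: mh.
Qed.

Section invariance.
Context {R : realType} {d : nat}.
Local Notation L := (lebesgue_Rn R d).

Lemma ge0_integral_shift (f : Rn R d -> \bar R) v :
  measurable_fun setT f -> (forall x, 0 <= f x)%E ->
  (\int[L]_x f (vadd x v) = \int[L]_x f x)%E.
Proof.
elim: d f v => [|n IH] f v mf f0.
  rewrite !ge0_integral_Rn0//; last first.
    apply: measurableT_comp => //; apply: measurable_vadd => //; exact: measurable_cst.
  by congr f; apply: eq_from_tnth => -[].
have mfv : measurable_fun setT (fun x : Rn R n.+1 => f (vadd x v)).
  apply: measurableT_comp => //; apply: measurable_vadd => //; exact: measurable_cst.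
rewrite !ge0_integral_Rn_cons//.
pose v' : Rn R n := [tuple of behead v].
have vE (x : R) t : vadd (tcons (x, t)) v = tcons (x + tnth v ord0, vadd t v').
  apply: eq_from_tnth => i; rewrite tnthE.
  case: (unliftP ord0 i) => [j ->|->//]; rewrite !tnth_tconsS tnthE.
  by rewrite [in LHS](tuple_eta v) tnthS.
transitivity (\int[@lebesgue_measure R]_x
   \int[lebesgue_Rn R n]_t f (tcons ((x + tnth v ord0)%R, t)))%E.
  apply: eq_integral => x _; under eq_integral do rewrite vE.
  apply: (IH (fun t => f (tcons (x + tnth v ord0, t)))) => //.
  by apply: measurableT_comp => //; apply: measurable_tcons_pair => //; exact: measurable_cst.
pose g (x : measurableTypeR R) := (\int[lebesgue_Rn R n]_t f (tcons (x, t)))%E.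
have mg : measurable_fun setT g.
  apply: (measurable_fun_fubini_tonelli_F (f \o @tcons _ _ n)) => [|x]; last exact: f0.
  by apply: measurableT_comp => //; exact: measurable_tcons.
rewrite (@ge0_integral_affine R 1 (tnth v ord0) g) ?oner_neq0//; last first.
  by move=> x; exact: integral_ge0.
by rewrite normr1 mul1e; apply: eq_integral => x _; rewrite mul1r.
Qed.

Variables (T S : Rn R d -> Rn R d).
Hypothesis mT : measurable_fun setT T.
Hypothesis TS : forall x y, T (vadd x (S y)) = vadd (T x) y.

(** A map that intertwines the translations sends Lebesgue measure to a
    multiple of itself, as one sees by integrating [1_E(T x) 1_F(T x + y)]
    in both orders, after translating [x] by [S (- y)] in one of them.
    This gives the effect of dilations, reflections and permutations of
    coordinates without determinants. *)
Lemma lebesgue_image_proportional (E F : set (Rn R d)) : measurable E -> measurable F ->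
  (L (T @^-1` E) * L F = L (T @^-1` F) * L (@vopp R d @^-1` E))%E.
Proof.
move=> mE mF.
have mTE : measurable (T @^-1` E) by rewrite -[X in measurable X]setTI; exact: mT.
have mTF : measurable (T @^-1` F) by rewrite -[X in measurable X]setTI; exact: mT.
have mopp : measurable_fun setT (@vopp R d).
  apply: measurable_tuple_fun => i; under eq_fun do rewrite tnthE.
  by apply: measurableT_comp => //; exact: measurable_tnthR.
have mE' : measurable (@vopp R d @^-1` E) by rewrite -[X in measurable X]setTI; exact: mopp.
have mi := @measurable_indic_comp R.
pose f (z : Rn R d * Rn R d) : \bar R :=
  ((\1_E (T z.1))%:E * (\1_F (vadd (T z.1) z.2))%:E)%E.
have mf : measurable_fun setT f.
  apply: emeasurable_funM; apply: mi => //.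
    exact: measurableT_comp.
  by apply: measurable_vadd => //; exact: measurableT_comp.
have f0 z : (0 <= f z)%E by rewrite mule_ge0// lee_fin.
have := @fubini_tonelli _ _ _ _ _ L L f mf f0; rewrite /f/=.
have shiftF x : (\int[L]_y (\1_F (vadd x y))%:E = L F)%E.
  under eq_integral do rewrite vaddC.
  rewrite (ge0_integral_shift (f := fun y => (\1_F y)%:E))//.
  - by rewrite integral_indic// setIT.
  - exact: mi.
have mvT y : measurable_fun setT (fun x => vadd (T x) y).
  by apply: measurable_vadd => //; exact: measurable_cst.
have mvT' x : measurable_fun setT (fun y => vadd (T x) y).
  by apply: measurable_vadd => //; exact: measurable_cst.
have e1 x : (\int[L]_y ((\1_E (T x))%:E * (\1_F (vadd (T x) y))%:E) =
    (\1_E (T x))%:E * L F)%E.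
  by rewrite ge0_integralZl// ?shiftF// ?lee_fin//; exact: mi.
under eq_integral do rewrite e1.
rewrite ge0_integralZr//=; last exact: mi.
rewrite -{1}[T @^-1` E](setIT) -(integral_indic _ measurableT mTE) => h.
transitivity (\int[L]_x (\1_(T @^-1` E) x)%:E * L F)%E => //.
rewrite [LHS]h.
have e2 y : (\int[L]_x ((\1_E (T x))%:E * (\1_F (vadd (T x) y))%:E) =
    \int[L]_x ((\1_E (vadd (T x) (vopp y)))%:E * (\1_F (T x))%:E))%E.
  rewrite -(ge0_integral_shift (f := fun x => ((\1_E (T x))%:E *
      (\1_F (vadd (T x) y))%:E)%E) (S (vopp y))).
  - apply: eq_integral => x _; rewrite TS (_ : vadd (vadd (T x) (vopp y)) y = T x)//.
    by apply: eq_from_tnth => i; rewrite !tnthE subrK.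
  - by apply: emeasurable_funM; exact: mi.
  - by move=> x; rewrite mule_ge0// lee_fin.
under eq_integral do rewrite e2.
pose g (z : Rn R d * Rn R d) : \bar R :=
  ((\1_E (vadd (T z.1) (vopp z.2)))%:E * (\1_F (T z.1))%:E)%E.
have mg : measurable_fun setT g.
  apply: emeasurable_funM; apply: mi => //.
    apply: measurable_vadd; first exact: measurableT_comp.
    exact: measurableT_comp.
  exact: measurableT_comp.
have g0 z : (0 <= g z)%E by rewrite mule_ge0// lee_fin.
have := @fubini_tonelli _ _ _ _ _ L L g mg g0; rewrite /g/= => <-.
have e3 x : (\int[L]_y (\1_E (vadd (T x) (vopp y)))%:E = L (@vopp R d @^-1` E))%E.
  rewrite -(ge0_integral_shift (f := fun y => (\1_E (vadd (T x) (vopp y)))%:E) (T x)).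
  - under eq_integral => y _.
      rewrite (_ : vadd _ _ = vopp y); last first.
        by apply: eq_from_tnth => i; rewrite !tnthE; ring.
      over.
    by rewrite (integral_indic _ _ mE')// setIT.
  - by apply: mi => //; apply: (measurableT_comp (mvT' x)).
  - by move=> y; rewrite lee_fin.
have e4 x : (\int[L]_y ((\1_E (vadd (T x) (vopp y)))%:E * (\1_F (T x))%:E) =
    L (@vopp R d @^-1` E) * (\1_F (T x))%:E)%E.
  rewrite ge0_integralZr// ?e3// ?lee_fin//.
  by apply: mi => //; apply: (measurableT_comp (mvT' x)).
under eq_integral do rewrite e4.
rewrite ge0_integralZl//=; last exact: mi.
by rewrite [RHS]muleC -[T @^-1` F]setIT -(integral_indic _ measurableT mTF).
Qed.

End invariance.

Lemma mule_cancel {R : realType} (c x y : \bar R) : (0 < c < +oo)%E ->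
  (c * x = c * y)%E -> x = y.
Proof.
case: c => [c| |]; rewrite ?ltxx ?andbF// lte_fin => /andP[c0 _] h.
have e z : z = (c^-1%:E * (c%:E * z))%E by rewrite muleA -EFinM mulVf ?mul1e ?gt_eqF.
by rewrite (e x) (e y) h.
Qed.

Section invariance_applications.
Context {R : realType} {d : nat}.
Local Notation L := (lebesgue_Rn R d).

Lemma lebesgue_unit_cube_gt0 : (0 < L (cube 1) < +oo)%E.
Proof. by rewrite lebesgue_cube ?ler01// lte_fin exprn_gt0 ?ltry// mulr_gt0. Qed.

(** The case where [T] is the identity, compared with a symmetric set. *)
Lemma lebesgue_vopp (E : set (Rn R d)) : measurable E -> L (@vopp R d @^-1` E) = L E.
Proof.
move=> mE; have := @lebesgue_image_proportional R d id id (@measurable_id _ _ setT)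
  (fun _ _ => erefl) E (cube 1) mE (measurable_cube _).
rewrite !preimage_id muleC => h; apply: esym.
exact: mule_cancel lebesgue_unit_cube_gt0 h.
Qed.

Variables (T S : Rn R d -> Rn R d) (c : R) (F : set (Rn R d)).
Hypothesis mT : measurable_fun setT T.
Hypothesis TS : forall x y, T (vadd x (S y)) = vadd (T x) y.
Hypothesis mF : measurable F.
Hypothesis F0 : (0 < L F < +oo)%E.
Hypothesis cF : L (T @^-1` F) = (c%:E * L F)%E.

(** The factor is read off one test set [F]. *)
Lemma lebesgue_image (E : set (Rn R d)) : measurable E ->
  L (T @^-1` E) = (c%:E * L E)%E.
Proof.
move=> mE; have := lebesgue_image_proportional mT TS mE mF.
rewrite cF lebesgue_vopp// [LHS]muleC muleAC [RHS]muleC.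
exact: mule_cancel F0.
Qed.

Lemma ge0_integral_linear (f : Rn R d -> \bar R) : 0 <= c ->
  measurable_fun setT f -> (forall x, 0 <= f x)%E ->
  (\int[L]_x f (T x) = c%:E * \int[L]_x f x)%E.
Proof.
move=> c0 mf f0; rewrite -(@ge0_integral_image _ _ _ _ _ L (mscale (NngNum c0) L) _ mT)//.
  by rewrite ge0_integral_mscale.
by move=> A mA; rewrite /mscale/= lebesgue_image.
Qed.

End invariance_applications.

Section orthogonal_invariance.
Context {R : realType} {d : nat}.
Local Notation L := (lebesgue_Rn R d).

Lemma lebesgue_unit_ball_gt0 : (0 < L (eball vzero 1) < +oo)%E.
Proof.
have [->|d0] := eqVneq d 0%N.
  rewrite (_ : eball _ _ = setT); last first.
    apply/seteqP; split=> // x _; rewrite /eball/= /enorm big_ord0 sqrtr0.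
    exact: ltr01.
  by rewrite /= diracT lte_fin ltr01 ltry.
have c0 : 0 < ((2 * d%:R)^-1 : R) by rewrite invr_gt0 mulr_gt0// ltr0n lt0n.
apply/andP; split.
  apply: (@lt_le_trans _ _ (L (cube (2 * d%:R)^-1))).
    by rewrite lebesgue_cube ?(ltW c0)// lte_fin exprn_gt0// mulr_gt0.
  apply: le_measure; rewrite ?inE; [exact: measurable_cube|exact: measurable_eball|].
  move=> x /enorm_cube xd; rewrite /eball/=.
  rewrite (_ : vsub x vzero = x); last by apply: eq_from_tnth => i; rewrite !tnthE subr0.
  apply: le_lt_trans xd _; rewrite invfM mulrCA divff ?mulr1 ?pnatr_eq0//.
  by rewrite invf_lt1 ?ltr1n.
apply: (@le_lt_trans _ _ (L (cube 1))); last by have /andP[] := @lebesgue_unit_cube_gt0 R d.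
apply: le_measure; rewrite ?inE; [exact: measurable_eball|exact: measurable_cube|].
move=> x; rewrite /eball/= (_ : vsub x vzero = x) => [/ltW/cube_enorm//|].
by apply: eq_from_tnth => i; rewrite !tnthE subr0.
Qed.

Lemma eball0E (r : R) (x : Rn R d) : eball vzero r x = (enorm x < r) :> Prop.
Proof.
by rewrite /eball/= (_ : vsub x vzero = x)//; apply: eq_from_tnth => i; rewrite !tnthE subr0.
Qed.

Lemma ge0_integral_dilation (c : R) (f : Rn R d -> \bar R) : 0 < c ->
  measurable_fun setT f -> (forall x, 0 <= f x)%E ->
  (\int[L]_x f (vscale c^-1 x) = (c ^+ d)%:E * \int[L]_x f x)%E.
Proof.
move=> c0 mf f0.
apply: (@ge0_integral_linear R d (vscale c^-1) (vscale c) (c ^+ d) (cube 1)) => //.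
- apply: measurable_vscale => //; exact: measurable_cst.
- move=> x y; apply: eq_from_tnth => i; rewrite !tnthE mulrDr mulrA mulVf ?mul1r//.
  by rewrite gt_eqF.
- exact: measurable_cube.
- exact: lebesgue_unit_cube_gt0.
- rewrite (_ : _ @^-1` _ = cube c).
    by rewrite !lebesgue_cube ?ler01 ?(ltW c0)// -EFinM mulr1 -exprMn mulrC.
  apply/seteqP; split=> x /= h i; have := h i; rewrite tnthE.
    by rewrite mulrC ler_pdivrMr// ler_pdivlMr// mul1r mulN1r.
  by rewrite mulrC ler_pdivrMr// ler_pdivlMr// mul1r mulN1r.
- by rewrite exprn_ge0// ltW.
Qed.

(** The reflection in the hyperplane orthogonal to [a]. *)
Definition householder (a x : Rn R d) : Rn R d :=
  vsub x (vscale (2 * dotp a x / dotp a a) a).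

Lemma measurable_householder a : measurable_fun setT (householder a).
Proof.
apply: measurable_vsub => //; apply: measurable_vscale; last exact: measurable_cst.
apply: measurable_funM; last exact: measurable_cst.
apply: measurable_funM; first exact: measurable_cst.
by apply: measurable_dotp => //; exact: measurable_cst.
Qed.

Lemma dotp_householder a x y : dotp (householder a x) y = dotp x (householder a y).
Proof. by rewrite !(dotpBl, dotpBr, dotpZl, dotpZr) (dotpC x a); ring. Qed.

Lemma householderK a : dotp a a != 0 -> involutive (householder a).
Proof.
move=> a0 x; rewrite /householder; apply: eq_from_tnth => i; rewrite !tnthE.
by rewrite dotpBr dotpZr; field.
Qed.

Lemma enorm_householder a x : dotp a a != 0 -> enorm (householder a x) = enorm x.
Proof. by move=> a0; rewrite !enormE dotp_householder householderK. Qed.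

Lemma ge0_integral_householder a (f : Rn R d -> \bar R) : dotp a a != 0 ->
  measurable_fun setT f -> (forall x, 0 <= f x)%E ->
  (\int[L]_x f (householder a x) = \int[L]_x f x)%E.
Proof.
move=> a0 mf f0; rewrite -[RHS]mul1e.
apply: (@ge0_integral_linear R d (householder a) (householder a) 1 (eball vzero 1)) => //.
- exact: measurable_householder.
- move=> x y; rewrite -[y in RHS](householderK a0).
  by apply: eq_from_tnth => i; rewrite /householder !(tnthE, dotpDr) ; ring.
- exact: measurable_eball.
- exact: lebesgue_unit_ball_gt0.
- rewrite mul1e; congr (L _); apply/seteqP; split=> x /=;
    by rewrite !eball0E enorm_householder.
Qed.

(** Reflection in the perpendicular bisector of [v] and [w], which
    contains the origin. *)
Lemma householder_exchange (v w : Rn R d) : enorm v = enorm w -> v != w ->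
  dotp (vsub v w) (vsub v w) != 0 /\ householder (vsub v w) v = w.
Proof.
move=> vw nvw.
have a0 : dotp (vsub v w) (vsub v w) != 0.
  apply: contra nvw => /eqP h.
  have := enorm_eq0 (u := vsub v w); rewrite enormE h sqrtr0 => /(_ erefl) /eqP.
  move=> /eqP e; apply/eqP; apply: eq_from_tnth => i.
  by have /eqP := congr1 (fun z => tnth z i) e; rewrite !tnthE subr_eq0 => /eqP.
split=> //.
have e : 2 * dotp (vsub v w) v = dotp (vsub v w) (vsub v w).
  have := sqr_enorm v; rewrite vw sqr_enorm => vw2.
  by rewrite !(dotpBl, dotpBr) vw2 (dotpC w v); ring.
rewrite /householder e divff//; apply: eq_from_tnth => i; rewrite !tnthE mul1r.
by rewrite opprB addrC subrK.
Qed.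

Definition permute (s : 'I_d -> 'I_d) (x : Rn R d) : Rn R d :=
  [tuple tnth x (s i) | i < d].

Lemma measurable_permute s : measurable_fun setT (permute s).
Proof.
apply: measurable_tuple_fun => i; under eq_fun do rewrite tnth_mktuple.
exact: measurable_tnthR.
Qed.

Lemma ge0_integral_permute s (f : Rn R d -> \bar R) : involutive s ->
  measurable_fun setT f -> (forall x, 0 <= f x)%E ->
  (\int[L]_x f (permute s x) = \int[L]_x f x)%E.
Proof.
move=> sK mf f0; rewrite -[RHS]mul1e.
apply: (@ge0_integral_linear R d (permute s) (permute s) 1 (cube 1)) => //.
- exact: measurable_permute.
- by move=> x y; apply: eq_from_tnth => i; rewrite !(tnth_mktuple, tnthE) sK.
- exact: measurable_cube.
- exact: lebesgue_unit_cube_gt0.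
- rewrite mul1e; congr (L _); apply/seteqP; split=> x /= h i.
    by have := h (s i); rewrite tnth_mktuple sK.
  by rewrite tnth_mktuple.
Qed.

End orthogonal_invariance.

(** * Compactly supported kernels whose transforms are powers of sinc *)

Section sinc.
Context {R : realType}.
Local Notation mu := (@lebesgue_measure R).

Lemma measurable_invr : measurable_fun setT (@GRing.inv R : measurableTypeR R -> R).
Proof.
rewrite -(setvU [set 0]); apply/measurable_funU => //; first exact: measurableC.
split.
  apply: subspace_continuous_measurable_fun; first exact: measurableC.
  apply: continuous_in_subspaceT => x; rewrite inE/= => /eqP x0.
  exact: inv_continuous.
exact: measurable_fun_set1.
Qed.

Lemma Rintegral_itv_cst (a b c : R) : a <= b ->
  (\int[mu]_(x in `[a, b]) c)%R = c * (b - a).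
Proof.
move=> ab.
have dF (x : R) : is_derive x 1 (fun x => c * x) c.
  by apply: is_derive_eq; rewrite /GRing.scale/=; ring.
by rewrite (FTC_is_derive ab dF) ?mulrBr// => x; exact: cvg_cst.
Qed.

Lemma cnorm_expi_sub1 (z : R) : cnorm (expi z - 1) <= `|z|.
Proof.
have := @Cint_expi_itv R 0 1 z ler01; rewrite mul1r mul0r expi0 => <-.
rewrite cnormM cnorm_toCi.
rewrite ler_piMr//.
have mexp : cmeas (fun t : measurableTypeR R => expi (t * z)).
  by apply: cmeas_expi; exact: measurable_funM.
have ci : Cintegrable mu (fun t => itvC 0 1 t * expi (t * z)).
  by apply: (@Cintegrable_itvC _ _ _ _ 1) => // t _; rewrite cnorm_expi.
apply: le_trans (cnorm_Cint ci) _.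
apply: (@le_trans _ _ (\int[mu]_(x in `[0, 1]) 1)%R).
  rewrite [leRHS]Rintegral_mkcond; apply: le_Rintegral => //.
  - by case: ci.
  - rewrite (_ : _ \o _ = (EFin \o (\1_`[0, 1] : R -> R))); last first.
      by apply/funext => x; rewrite /= patchE indicE; case: (x \in _).
    exact: integrable_indic_itv.
  - move=> x _; rewrite cnormM cnorm_expi mulr1 cnorm_toC patchE indicE.
    by case: (x \in _); rewrite ?normr1 ?normr0.
by rewrite Rintegral_itv_cst ?ler01// subr0 mulr1.
Qed.

Lemma ler_sin (z : R) : `|sin z| <= `|z|.
Proof.
apply: le_trans (cnorm_expi_sub1 z); apply: le_trans (ler_Im_cnorm _).
by rewrite /= subr0.
Qed.

Lemma one_sub_cos_le (z : R) : 1 - cos z <= z ^+ 2 / 2.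
Proof.
have : cnorm (expi z - 1) ^+ 2 <= `|z| ^+ 2.
  by rewrite ler_sqr ?nnegrE ?cnorm_ge0// cnorm_expi_sub1.
rewrite cnorm2E real_normK ?num_real//= subr0 => h.
have := cos2Dsin2 z; nra.
Qed.

Definition sinc (x : R) : R := if x == 0 then 1 else sin x / x.

Lemma sinc0 : sinc 0 = 1.
Proof. by rewrite /sinc eqxx. Qed.

Lemma mul_sinc (x : R) : x * sinc x = sin x.
Proof.
rewrite /sinc; case: eqP => [->|/eqP x0]; first by rewrite mul0r sin0.
by rewrite mulrC divfK.
Qed.

Lemma ler_sinc1 (x : R) : `|sinc x| <= 1.
Proof.
rewrite /sinc; case: eqP => [_|/eqP x0]; first by rewrite normr1.
by rewrite normrM normfV ler_pdivrMr ?normr_gt0// mul1r ler_sin.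
Qed.

Lemma measurable_sinc : measurable_fun setT (sinc : measurableTypeR R -> R).
Proof.
apply: measurable_fun_ifT => //.
- apply: (measurable_fun_bool true).
  rewrite (_ : _ @^-1` _ = [set 0]).
    by rewrite setTI; exact: measurable_set1.
  by apply/seteqP; split=> x /= /eqP.
- apply: measurable_funM; first by apply: continuous_measurable_fun; exact: continuous_sin.
  exact: measurable_invr.
Qed.

(** [sinc] is the transform of the uniform law on [-1, 1]. *)
Lemma Cint_expi_sinc (z : R) :
  Cint mu (fun t => itvC (-1) 1 t * expi (t * z)) = (2 * sinc z)%:C.
Proof.
have [->|z0] := eqVneq z 0.
  under eq_Cint do rewrite mulr0 expi0.
  rewrite Cint_itvC sinc0 mulr1 /= !Rintegral_itv_cst; [|lra|lra].
  by apply: complex_ext => /=; ring.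
have le11 : -1 <= 1 :> R by lra.
have := Cint_expi_itv z le11; rewrite mul1r mulN1r => h.
have zi0 : z *i != 0 :> R[i] by rewrite eq_complex /= negb_and z0 orbT.
apply: (mulfI zi0); rewrite h /expi cosN sinN.
apply: complex_ext => /=; first by ring.
by have := mul_sinc z => <-; ring.
Qed.

Lemma ler_sinc (del v : R) : 0 < del ->
  `|sinc (del * v)| <= (1 + del^-1) / (1 + `|v|).
Proof.
move=> d0; rewrite ler_pdivlMr; last by rewrite ltr_pwDl.
rewrite mulrDr mulr1 lerD ?ler_sinc1//.
rewrite -(ler_pM2l d0) mulfV ?gt_eqF// mulrCA -[X in X * `|v|]gtr0_norm//.
by rewrite -normrM -normrM mulrC mul_sinc ler_norml sin_geN1 sin_le1.
Qed.

Lemma integrable_oneDsqrV : mu.-integrable setT (fun x => ((1 + x ^+ 2)^-1)%:E).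
Proof.
have m1 : measurable_fun setT (fun x : measurableTypeR R => ((1 + x ^+ 2)^-1)).
  by apply: continuous_measurable_fun; exact: continuous_oneDsqrV.
apply/integrableP; split; first exact/measurable_EFinP.
have p0 (x : R) : 0 <= (1 + x ^+ 2)^-1 by rewrite invr_ge0 addr_ge0 ?sqr_ge0.
under eq_integral do rewrite gee0_abs ?lee_fin//.
rewrite (@ge0_symfun_integralT R (fun x => (1 + x ^+ 2)^-1))//.
- rewrite (_ : [set x | 0 <= x] = `[0, +oo[%classic); last first.
    by apply/seteqP; split=> x /=; rewrite in_itv/= andbT.
  by have := @integral0y_oneDsqr R; rewrite /oneDsqr => ->; rewrite -EFinM ltry.
- exact: continuous_oneDsqrV.
- by move=> x; rewrite /= sqrrN.
Qed.

Lemma integrable_onesqV : mu.-integrable setT (fun x => ((1 + `|x|) ^- 2)%:E).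
Proof.
apply: le_integrable integrable_oneDsqrV => //.
  apply/measurable_EFinP; apply: (measurableT_comp measurable_invr).
  apply: measurable_funX; apply: measurable_funD => //.
move=> x _; have p1 : 0 <= (1 + `|x|) ^- 2 by rewrite invr_ge0 exprn_ge0// addr_ge0.
have p2 : 0 <= (1 + x ^+ 2)^-1 by rewrite invr_ge0 addr_ge0// sqr_ge0.
rewrite lee_fin (ger0_norm p1) (ger0_norm p2) lef_pV2 ?posrE ?exprn_gt0 ?ltr_pwDl ?sqr_ge0//.
rewrite sqrrD expr1n real_normK ?num_real// lerD2r lerDl mul1r mulrn_wge0//.
Qed.

Lemma dominated_invsq (f : R -> R[i]) c : cmeas (f : measurableTypeR R -> R[i]) ->
  (forall x, cnorm (f x) <= c * (1 + `|x|) ^- 2) -> Cintegrable mu f.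
Proof.
move=> mf fc; apply: (@Cintegrable_le R _ (measurableTypeR R) mu _
  (fun x => c * (1 + `|x|) ^- 2)) => //.
exact: (integrableZl measurableT c integrable_onesqV).
Qed.

Definition dcos (a v : R) : R := (1 - cos (a * v)) / v ^+ 2.

Lemma dcos_ge0 a v : 0 <= dcos a v.
Proof. by rewrite /dcos divr_ge0 ?sqr_ge0// subr_ge0 cos_le1. Qed.

Lemma dcos_le a v : dcos a v <= (8 + 2 * a ^+ 2) * (1 + `|v|) ^- 2.
Proof.
have [->|v0] := eqVneq v 0.
  rewrite /dcos expr0n/= invr0 mulr0 normr0 addr0 expr1n invr1 mulr1.
  by rewrite addr_ge0// mulr_ge0// sqr_ge0.
have v2 : 0 < v ^+ 2 by rewrite lt_def sqrf_eq0 v0 sqr_ge0.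
rewrite /dcos ler_pdivrMr// mulrAC ler_pdivlMr ?exprn_gt0 ?ltr_pwDl//.
have e1 := one_sub_cos_le (a * v); have e2 := cos_geN1 (a * v).
have e4 := cos_le1 (a * v).
set c := cos _ in e1 e2 e4 *.
have -> : v ^+ 2 = `|v| ^+ 2 by rewrite real_normK ?num_real.
rewrite exprMn -(real_normK (num_real v)) in e1.
have w0 : 0 <= `|v| by [].
have a0 := sqr_ge0 a.
set w := `|v| in w0 e1 *; set b := a ^+ 2 in a0 e1 *.
have [w1|w1] := leP w 1; nra.
Qed.

Lemma measurable_dcos a : measurable_fun setT (dcos a : measurableTypeR R -> R).
Proof.
apply: measurable_funM.
  apply: measurable_funB => //; apply: measurableT_comp.
    by apply: continuous_measurable_fun; exact: continuous_cos.
  exact: measurable_funM.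
by apply: (measurableT_comp measurable_invr); exact: measurable_funX.
Qed.

Lemma integrable_dcos a : mu.-integrable setT (EFin \o dcos a).
Proof.
apply: (le_integrable measurableT _ _
   (integrableZl measurableT (8 + 2 * a ^+ 2) integrable_onesqV)).
  by apply/measurable_EFinP; exact: measurable_dcos.
move=> v _ /=; rewrite lee_fin ger0_norm ?dcos_ge0// (le_trans (dcos_le a v))//.
exact: ler_norm.
Qed.

Definition idcos : R := (\int[mu]_v dcos 1 v)%R.

Lemma Rintegral_affine (a b : R) (f : R -> R) : a != 0 ->
  mu.-integrable setT (EFin \o f) ->
  (\int[mu]_x f x)%R = `|a| * (\int[mu]_x f (a * x + b))%R.
Proof.
move=> a0 fi; rewrite /Rintegral (integral_affine b a0 fi) fineM//.
exact: integrable_fin_num (integrable_affine b a0 fi).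
Qed.

(** Rescaling makes the integral proportional to [|a|]. *)
Lemma integral_dcos a : (\int[mu]_v dcos a v)%R = `|a| * idcos.
Proof.
have [->|a0] := eqVneq a 0.
  rewrite normr0 mul0r /Rintegral; under eq_integral do
    rewrite /dcos mul0r cos0 subrr mul0r.
  by rewrite integral0.
rewrite /idcos (Rintegral_affine 0 a0 (integrable_dcos 1)) mulrA -expr2.
rewrite -[RHS]RintegralZl//; last first.
  exact: (integrable_affine 0 a0 (integrable_dcos 1)).
apply: eq_Rintegral => v _; rewrite /dcos addr0 mul1r real_normK ?num_real//.
have [->|v0] := eqVneq v 0; first by rewrite !mulr0 cos0 subrr !mul0r mulr0.
by rewrite exprMn; field; rewrite a0 v0.
Qed.

(** The integrand is at least [1 / 16] between [pi / 2] and [pi]. *)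
Lemma idcos_gt0 : 0 < idcos.
Proof.
have i1 := integrable_dcos 1.
have p1 : 1 <= pi / 2 :> R by exact: pihalf_ge1.
have p2 : pi / 2 < 2 :> R by exact: pihalf_lt2.
apply: (@lt_le_trans _ _ ((\int[mu]_(v in `[pi / 2, pi]) (1 / 16)))%R).
  rewrite Rintegral_itv_cst; last by lra.
  by rewrite mulr_gt0//; lra.
rewrite /idcos Rintegral_mkcond; apply: le_Rintegral => //.
  rewrite (_ : _ \o _ = (fun v => (1 / 16)%:E * (\1_`[pi / 2, pi] v : R)%:E)%E).
    exact: (integrableZl measurableT _ (integrable_indic_itv _ _ _ _)).
  apply/funext => x; rewrite /= patchE indicE.
  by case: (x \in _); rewrite ?mule1 ?mule0.
move=> v _; rewrite patchE; case: ifPn => [|_]; last exact: dcos_ge0.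
rewrite inE/= in_itv/= => /andP[v1 v2].
have c0 : cos v <= 0.
  have -> : v = (v - pi / 2) + pi / 2 by rewrite subrK.
  rewrite cosD cos_pihalf sin_pihalf mulr0 mulr1 sub0r oppr_le0.
  by apply: sin_ge0_pi; apply/andP; split; lra.
rewrite /dcos mul1r ler_pdivlMr; last by rewrite exprn_gt0//; lra.
have : v ^+ 2 <= 16 by nra.
by rewrite mul1r; lra.
Qed.

(** A tent of height [4] on [[-2, 2]], as a second difference of the
    absolute value: the form in which it comes out of integrals of [dcos]. *)
Definition tri2 (y : R) : R := `|y + 2| + `|y - 2| - 2 * `|y|.

Lemma tri2_out y : 2 <= `|y| -> tri2 y = 0.
Proof.
rewrite /tri2 => y2; case: (leP 0 y) y2 => y0 y2.
  by rewrite (ger0_norm y0) in y2 *; rewrite !ger0_norm; lra.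
by rewrite (ltr0_norm y0) in y2 *; rewrite !ler0_norm; lra.
Qed.

Lemma tri2_in y : `|y| <= 2 -> tri2 y = 4 - 2 * `|y|.
Proof.
rewrite ler_norml => /andP[y1 y2]; rewrite /tri2 ger0_norm; last by lra.
by rewrite (_ : `|y - 2| = 2 - y); [ring|rewrite ler0_norm; lra].
Qed.

(** The Fejer kernel: [sinc^2] transforms to a triangle, by writing
    [sin^2 v cos (y v)] through [1 - cos] at the frequencies [y], [y + 2] and
    [y - 2]. *)
Lemma Rintegral_sinc2_cos y :
  (\int[mu]_v (sinc v ^+ 2 * cos (v * y)))%R = idcos / 4 * tri2 y.
Proof.
have ii a c : mu.-integrable setT (EFin \o (fun v => c * dcos a v)).
  exact: (integrableZl measurableT c (integrable_dcos a)).
transitivity (\int[mu]_v (4^-1 * dcos (y + 2) v + 4^-1 * dcos (y - 2) v +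
    - 2^-1 * dcos y v))%R.
  congr fine; apply: ae_eq_integral => //.
  - apply/measurable_EFinP; apply: measurable_funM.
      by apply: measurable_funX; exact: measurable_sinc.
    apply: measurableT_comp.
      by apply: continuous_measurable_fun; exact: continuous_cos.
    exact: measurable_funM.
  - apply/measurable_EFinP.
    by do 2?[apply: measurable_funD]; apply: measurable_funM => //; exact: measurable_dcos.
  - exists [set 0]; split; [exact: measurable_set1|exact: lebesgue_measure_set1|].
    move=> v /=; apply: contra_notP => /eqP v0 _; congr EFin.
    rewrite /sinc (negbTE v0) /dcos.
    have -> : (y + 2) * v = v * y + v * 2 by ring.
    have -> : (y - 2) * v = v * y - v * 2 by ring.
    rewrite cosB cosD (mulrC y v) (_ : v * 2 = v *+ 2); last by rewrite mulr_natr.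
    rewrite cos_mulr2n expr_div_n.
    have -> : sin v ^+ 2 = 1 - cos v ^+ 2 by rewrite -(cos2Dsin2 v) addrC addKr.
    by field.
rewrite RintegralD//; last exact: (integrableD measurableT (ii _ _) (ii _ _)).
rewrite RintegralD// !RintegralZl//; try exact: integrable_dcos.
by rewrite !integral_dcos /tri2; field.
Qed.

Lemma Rintegral_odd (g : R -> R) : mu.-integrable setT (EFin \o g) ->
  (forall x, g (- x) = - g x) -> (\int[mu]_x g x)%R = 0.
Proof.
move=> ig og; have n10 : (- 1 : R) != 0 by rewrite oppr_eq0 oner_neq0.
have h := Rintegral_affine 0 n10 ig; rewrite normrN1 mul1r in h.
have : (\int[mu]_x g x)%R = - (\int[mu]_x g x)%R.
  rewrite -[RHS]mulN1r -(RintegralZl _ measurableT ig) {1}h.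
  by apply: eq_Rintegral => x _; rewrite addr0 !mulN1r og.
by lra.
Qed.

Lemma sinN_sinc (x : R) : sinc (- x) = sinc x.
Proof. by rewrite /sinc oppr_eq0 sinN invrN mulrNN. Qed.

Definition bounded_supp (g : R -> R[i]) (b : R) :=
  [/\ cmeas (g : measurableTypeR R -> R[i]), exists c, forall y, cnorm (g y) <= c &
      forall y, b < `|y| -> g y = 0].

Lemma bounded_supp_dominated g b : bounded_supp g b ->
  exists c, forall y, cnorm (g y) <= c * \1_`[- b, b] y.
Proof.
move=> [_ [c gc] g0]; exists c => y; rewrite indicE.
case: (boolP (y \in _)) => [_|]; first by rewrite mulr1.
rewrite notin_setE/= in_itv/= -ler_norml => /negP; rewrite -ltNge => /g0 ->.
by rewrite cnorm0 mulr0.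
Qed.

Lemma bounded_supp_integrable g b : bounded_supp g b -> Cintegrable mu g.
Proof.
move=> gb; have [mg _ _] := gb; have [c gc] := bounded_supp_dominated gb.
apply: (@Cintegrable_le R _ (measurableTypeR R) mu _ (fun y => c * \1_`[- b, b] y)) => //.
exact: (integrableZl measurableT c (integrable_indic_itv _ _ _ _)).
Qed.

Lemma bounded_suppX g b l : 0 <= b -> bounded_supp g b -> bounded_supp (fun y => (y ^+ l)%:C * g y) b.
Proof.
move=> b0 [mg [c gc] g0]; split.
- by apply: cmeasM => //; apply: cmeas_toC; exact: measurable_funX.
- exists (b ^+ l * c) => y; rewrite cnormM cnorm_toC normrX.
  have [yb|yb] := leP `|y| b; last first.
    by rewrite g0// cnorm0 mulr0 mulr_ge0 ?exprn_ge0// (le_trans (cnorm_ge0 _) (gc 0)).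
  by rewrite ler_pM ?exprn_ge0 ?cnorm_ge0// lerXn2r ?nnegrE.
- by move=> y yb; rewrite g0// mulr0.
Qed.

Definition moment (g : R -> R[i]) l : R[i] := Cint mu (fun y => (y ^+ l)%:C * g y).

(** Moments of a translated kernel, by the binomial formula. *)
Lemma moment_shift g b l (a : R) : 0 <= b -> bounded_supp g b ->
  moment (fun y => g (y - a)) l =
  \sum_(i < l.+1) ('C(l, i)%:R * a ^+ i)%:C * moment g (l - i).
Proof.
move=> b0 gb.
have ii k : Cintegrable mu (fun y => (y ^+ k)%:C * g y).
  exact: bounded_supp_integrable (bounded_suppX k b0 gb).
have eqs y : ((y + a) ^+ l)%:C * g y =
    \sum_(i < l.+1) ('C(l, i)%:R * a ^+ i)%:C * ((y ^+ (l - i))%:C * g y).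
  rewrite exprDn toC_sum mulr_suml; apply: eq_bigr => i _.
  by rewrite mulrA -toCM; congr (_%:C * _); rewrite -mulr_natl; ring.
have ib : Cintegrable mu (fun y => ((y + a) ^+ l)%:C * g y).
  rewrite (_ : (fun _ => _) = (fun y => \sum_(i < l.+1) ('C(l, i)%:R * a ^+ i)%:C *
    ((y ^+ (l - i))%:C * g y))); last by apply/funext => y; exact: eqs.
  by apply: Cintegrable_sum => i; exact: CintegrableZ.
have [_] := Cint_affine (- a) (oner_neq0 R) ib.
rewrite normr1 mul1r => h.
transitivity (Cint mu (fun y => ((y + a) ^+ l)%:C * g y)).
  by rewrite h; apply: eq_Cint => y; rewrite mul1r subrK.
rewrite (eq_Cint mu eqs) Cint_sum; last by move=> i; exact: CintegrableZ.
by apply: eq_bigr => i _; rewrite CintZ.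
Qed.

Definition sinc_pow (del : R) j n (v : R) : R := v ^+ j * sinc (del * v) ^+ n.

Lemma measurable_sinc_pow del j n :
  measurable_fun setT (sinc_pow del j n : measurableTypeR R -> R).
Proof.
apply: measurable_funM; first exact: measurable_funX.
apply: measurable_funX; apply: (measurableT_comp measurable_sinc).
exact: measurable_funM.
Qed.

Lemma sinc_pow_bound del j n : 0 < del ->
  exists2 c, 0 < c & forall v, `|sinc_pow del j n v| * (1 + `|v|) ^+ n <= c * (1 + `|v|) ^+ j.
Proof.
move=> d0; exists ((1 + del^-1) ^+ n); first by rewrite exprn_gt0// addr_gt0// invr_gt0.
move=> v; have v1 : 0 < 1 + `|v| by rewrite ltr_pwDl.
have h : `|sinc (del * v)| * (1 + `|v|) <= 1 + del^-1.
  by rewrite -ler_pdivlMr// ler_sinc.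
rewrite /sinc_pow normrM !normrX -mulrA -exprMn mulrC ler_pM ?exprn_ge0 ?mulr_ge0//.
- by rewrite lerXn2r ?nnegrE ?mulr_ge0 ?(ltW v1) ?addr_ge0 ?invr_ge0 ?(ltW d0).
- by rewrite lerXn2r ?nnegrE ?(ltW v1)// lerDr.
Qed.

Lemma sinc_pow_le del j n : 0 < del -> (j.+2 <= n)%N ->
  exists2 c, 0 < c & forall v, `|sinc_pow del j n v| <= c * (1 + `|v|) ^- 2.
Proof.
move=> d0 jn; have [c c0 h] := sinc_pow_bound j n d0; exists c => // v.
have v1 : 0 < 1 + `|v| by rewrite ltr_pwDl.
rewrite ler_pdivlMr ?exprn_gt0// -(ler_pM2r (exprn_gt0 j v1)) -mulrA -exprD.
apply: le_trans (h v); rewrite ler_wpM2l// ler_weXn2l// ?lerDl//.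
Qed.

Lemma Cintegrable_sinc_pow del j n y : 0 < del -> (j.+2 <= n)%N ->
  Cintegrable mu (fun v => (sinc_pow del j n v)%:C * expi (- (v * y))).
Proof.
move=> d0 jn; have [c c0 h] := sinc_pow_le d0 jn.
apply: (@dominated_invsq _ c) => [|v]; last by rewrite cnormM cnorm_expi mulr1 cnorm_toC.
apply: cmeasM; first by apply: cmeas_toC; exact: measurable_sinc_pow.
by apply: cmeas_expi; apply: measurableT_comp => //; exact: measurable_funM.
Qed.

(** The transform of [v^j sinc(del v)^n]. For [n] at least [j + 2] it is
    compactly supported, and as a [j]-th derivative of a bump it
    annihilates the powers below [j]. *)
Definition sinc_ker del j n (y : R) : R[i] :=
  Cint mu (fun v => (sinc_pow del j n v)%:C * expi (- (v * y))).

Definition good_ker del j n :=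
  [/\ bounded_supp (sinc_ker del j n) (n%:R * del),
     forall l, (l < j)%N -> moment (sinc_ker del j n) l = 0 &
     moment (sinc_ker del j n) j != 0].

Arguments sinc_ker : simpl never.
Arguments moment : simpl never.

Lemma sinc_kerE del y : 0 < del ->
  sinc_ker del 0 2 y = (idcos / (4 * del) * tri2 (y / del))%:C.
Proof.
move=> d0; pose f v := (sinc_pow 1 0 2 v)%:C * expi (- (v * (y / del))).
have fi : Cintegrable mu f by exact: Cintegrable_sinc_pow.
have dn0 : del != 0 by rewrite gt_eqF.
have [_ e1] := Cint_affine 0 dn0 fi.
have -> : sinc_ker del 0 2 y = (del^-1)%:C * Cint mu f.
  rewrite e1 mulrA -toCM gtr0_norm// mulVf// mul1r; apply: eq_Cint => v.
  rewrite /f /sinc_pow mul1r !addr0 expr0 mulrAC; congr (_%:C * expi _).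
  by field.
suff -> : Cint mu f = (idcos / 4 * tri2 (y / del))%:C.
  by rewrite -toCM; congr (_%:C); field.
apply: complex_ext => /=.
  rewrite -Rintegral_sinc2_cos; apply: eq_Rintegral => v _.
  by rewrite cosN /sinc_pow mul1r expr0 mul1r mul0r subr0.
apply: Rintegral_odd; first by case/CintegrableP : fi.
move=> v; rewrite /sinc_pow !expr0 !mul1r sinN_sinc !mulNr opprK sinN.
by ring.
Qed.

Lemma measurable_tri2 : measurable_fun setT (tri2 : measurableTypeR R -> R).
Proof.
apply: measurable_funB; last by apply: measurable_funM => //; exact: measurableT_comp.
by apply: measurable_funD; apply: measurableT_comp => //;
  [exact: measurable_funD|exact: measurable_funB].
Qed.

Lemma tri2_ge0 y : 0 <= tri2 y.
Proof.
have [y2|y2] := leP `|y| 2; first by rewrite tri2_in//; lra.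
by rewrite tri2_out// ltW.
Qed.

Lemma tri2_le4 y : tri2 y <= 4.
Proof.
have [y2|y2] := leP `|y| 2; last by rewrite tri2_out// ltW.
by rewrite tri2_in//; have : 0 <= `|y| by []; lra.
Qed.

Lemma sinc_ker_bounded del j n : 0 < del -> (j.+2 <= n)%N ->
  exists c, forall y, cnorm (sinc_ker del j n y) <= c.
Proof.
move=> d0 jn; exists (\int[mu]_v `|sinc_pow del j n v|)%R => y.
apply: le_trans (cnorm_Cint (Cintegrable_sinc_pow y d0 jn)) _.
rewrite le_eqVlt; apply/orP; left; apply/eqP; apply: eq_Rintegral => v _.
by rewrite cnormM cnorm_expi mulr1 cnorm_toC.
Qed.

(** The transform is a tent, whose integral is positive. *)
Lemma good_ker_base del : 0 < del -> good_ker del 0 2.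
Proof.
move=> d0.
have kE : sinc_ker del 0 2 = fun y => (idcos / (4 * del) * tri2 (y / del))%:C.
  by apply/funext => y; rewrite sinc_kerE.
have k0 : 0 < idcos / (4 * del) by rewrite divr_gt0 ?idcos_gt0// mulr_gt0.
have kb : bounded_supp (sinc_ker del 0 2) (2%:R * del).
  split.
  - rewrite kE; apply: cmeas_toC; apply: measurable_funM => //.
    apply: (measurableT_comp measurable_tri2); exact: measurable_funM.
  - exact: sinc_ker_bounded.
  - move=> y y2; rewrite kE tri2_out ?mulr0// normrM normfV (gtr0_norm d0).
    by rewrite ler_pdivlMr// ltW.
split; [exact: kb|by case|].
have ik := bounded_supp_integrable kb.
suff : 0 < cRe (moment (sinc_ker del 0 2) 0).
  by apply: contraTneq => ->; rewrite ltxx.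
apply: (@lt_le_trans _ _ (\int[mu]_(y in `[- del, del]) (idcos / (4 * del) * 2))%R).
  rewrite Rintegral_itv_cst; last by lra.
  by apply: mulr_gt0; [exact: mulr_gt0|lra].
change (cRe (moment (sinc_ker del 0 2) 0)) with
  (\int[mu]_y cRe ((y ^+ 0)%:C * sinc_ker del 0 2 y))%R.
have b0 : 0 <= 2%:R * del by rewrite mulr_ge0// ltW.
rewrite [leLHS]Rintegral_mkcond; apply: le_Rintegral => //.
- rewrite (_ : _ \o _ = (fun y => (idcos / (4 * del) * 2)%:E *
    (\1_`[- del, del] y : R)%:E)%E).
    exact: (integrableZl measurableT _ (integrable_indic_itv _ _ _ _)).
  by apply/funext => x; rewrite /= patchE indicE; case: (x \in _); rewrite ?mule1 ?mule0.
- by have [] := (CintegrableP mu _).1 (bounded_supp_integrable (bounded_suppX 0 b0 kb)).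
- move=> y _; rewrite patchE expr0 mul1r kE /=; case: ifPn => [|_].
    rewrite inE/= in_itv/= -ler_norml => yd; rewrite ler_pM2l//.
    have yd1 : `|y / del| <= 1 by rewrite normrM normfV (gtr0_norm d0) ler_pdivrMr// mul1r.
    by rewrite tri2_in; lra.
  by rewrite mulr_ge0 ?(ltW k0)// tri2_ge0.
Qed.

(** Multiplying by [sinc (del v)] replaces the transform by its mean over
    the translations of length at most [del]: the support grows by [del]
    and the integral does not change. *)
Lemma good_ker_step0 del n : 0 < del -> (2 <= n)%N ->
  good_ker del 0 n -> good_ker del 0 n.+1.
Proof.
move=> d0 n2 [kb _ m0]; have [mk [c kc] k0] := kb.
have [c' kc'] := bounded_supp_dominated kb.
set g := sinc_ker del 0 n in kb m0 mk kc k0 kc'.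
pose G (z : measurableTypeR R * measurableTypeR R) := itvC (-1) 1 z.2 * g (z.1 - del * z.2).
have mG : cmeas G.
  apply: cmeasM.
    by apply: cmeas_toC; apply: measurableT_comp.
  apply: (cmeas_comp (f := g)) => //.
  by apply: measurable_funB => //; exact: measurable_funM.
have c0 : 0 <= c by apply: le_trans (kc 0); exact: cnorm_ge0.
have GAB y t : cnorm (G (y, t)) <=
    c * \1_`[- (n.+1%:R * del), n.+1%:R * del] y * (\1_`[-1, 1] t).
  rewrite /G cnormM cnorm_toC indicE [(y, t).2]/= [(y, t).1]/=.
  case: (boolP (t \in _)) => [|_]; last by rewrite normr0 mul0r mulr0.
  rewrite inE/= in_itv/= -ler_norml normr1 mul1r mulr1 => t1.
  rewrite indicE; case: (boolP (y \in _)) => [_|]; first by rewrite mulr1.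
  rewrite notin_setE/= in_itv/= -ler_norml => /negP; rewrite -ltNge => y1.
  rewrite mulr0 k0 ?cnorm0//.
  have : `|y| <= `|y - del * t| + `|del * t| by rewrite -{1}(subrK (del * t) y) ler_normD.
  rewrite normrM (gtr0_norm d0) => h1.
  have : del * `|t| <= del by rewrite ler_piMr// ltW.
  by move: y1; rewrite -natr1 mulrDl mul1r; lra.
have iA : mu.-integrable setT (EFin \o (fun y => c * \1_`[- (n.+1%:R * del), n.+1%:R * del] y : R)).
  exact: (integrableZl measurableT c (integrable_indic_itv _ _ _ _)).
have iB : mu.-integrable setT (EFin \o (\1_`[-1, 1] : R -> R)).
  exact: integrable_indic_itv.
have [_ i1 _ e1 e2] := Cfubini mG iA iB GAB.
have kE y : sinc_ker del 0 n.+1 y = (2^-1)%:C * Cint mu (fun t => G (y, t)).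
  have [b b0 hb] := sinc_pow_le d0 n2.
  pose F (z : measurableTypeR R * measurableTypeR R) :=
    (sinc_pow del 0 n z.1)%:C * expi (- (z.1 * y)) * (itvC (-1) 1 z.2 * expi (z.2 * (del * z.1))).
  have mF : cmeas F.
    apply: cmeasM; apply: cmeasM.
    - by apply: cmeas_toC; apply: measurableT_comp => //; exact: measurable_sinc_pow.
    - apply: cmeas_expi; apply: measurableT_comp => //; exact: measurable_funM.
    - by apply: cmeas_toC; apply: measurableT_comp => //; exact: measurable_indic.
    - by apply: cmeas_expi; apply: measurable_funM => //; exact: measurable_funM.
  have iA' : mu.-integrable setT (EFin \o (fun v => b * (1 + `|v|) ^- 2)).
    exact: (integrableZl measurableT b integrable_onesqV).
  have [|_ j1 _ h1 h2] := Cfubini mF iA' iB.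
    move=> v t; rewrite /F !cnormM !cnorm_expi !mulr1 !cnorm_toC /=.
    by rewrite ler_pM// indicE ger0_norm.
  transitivity ((2^-1)%:C * Cint mu (fun v => Cint mu (fun t => F (v, t)))).
    rewrite -CintZ//.
    apply: eq_Cint => v.
    have -> : Cint mu (fun t => F (v, t)) = (sinc_pow del 0 n v)%:C * expi (- (v * y)) *
        Cint mu (fun t => itvC (-1) 1 t * expi (t * (del * v))).
      rewrite -CintZ//; apply: (@Cintegrable_itvC R _ _ _ 1) => [|t _].
        by apply: cmeas_expi; exact: measurable_funM.
      by rewrite cnorm_expi.
    rewrite Cint_expi_sinc /sinc_pow !expr0 !mul1r exprSr.
    rewrite [RHS]mulrC -!mulrA [RHS]mulrCA -!toCM mulrC -mulrA.
    by congr (_ * _%:C); field.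
  rewrite h1 -h2; congr (_ * _); apply: eq_Cint => t.
  rewrite /G /g /sinc_ker -CintZ; last exact: Cintegrable_sinc_pow.
  apply: eq_Cint => v; rewrite /F.
  have -> : - (v * (y - del * t)) = - (v * y) + t * (del * v) by ring.
  by rewrite expiD; ring.
have kb' : bounded_supp (sinc_ker del 0 n.+1) (n.+1%:R * del).
  split.
  - rewrite (_ : sinc_ker _ _ _ = fun y => (2^-1)%:C * Cint mu (fun t => G (y, t))); last exact/funext.
    by apply: cmeasM; [exact: cmeas_cst|exact: Cintegrable_cmeas i1].
  - by apply: sinc_ker_bounded => //; exact: ltnW.
  - move=> y yb; rewrite kE (@eq_Cint _ _ _ _ _ (fun=> 0)) ?Cint0 ?mulr0// => t.
    apply: cnorm_eq0; apply/eqP; rewrite eq_le cnorm_ge0 andbT.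
    apply: le_trans (GAB y t) _; rewrite indicE (_ : (y \in _) = false) ?mulr0 ?mul0r//.
    by apply/negbTE; rewrite notin_setE/= in_itv/= -ler_norml; apply/negP; rewrite -ltNge.
split; [exact: kb'|by case|].
have -> : moment (sinc_ker del 0 n.+1) 0 = moment g 0; last by [].
rewrite /moment; transitivity (Cint mu (fun y => (2^-1)%:C * Cint mu (fun t => G (y, t)))).
  by apply: eq_Cint => y; rewrite expr0 mul1r kE.
rewrite CintZ// e1 -e2.
have ig := bounded_supp_integrable kb.
transitivity ((2^-1)%:C * Cint mu (fun t => itvC (-1) 1 t * expi (t * 0) * Cint mu g)).
  congr (_ * _); apply: eq_Cint => t; rewrite mulr0 expi0 mulr1.
  have [ig' e] := Cint_affine (- (del * t)) (oner_neq0 R) ig.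
  rewrite e normr1 mul1r -(CintZ _ ig'); apply: eq_Cint => y.
  by rewrite /G mul1r.
rewrite CintZr; last first.
  apply: (@Cintegrable_itvC R _ _ _ 1) => [|t _]; last by rewrite cnorm_expi.
  by apply: cmeas_expi; exact: measurable_funM.
rewrite Cint_expi_sinc sinc0 mulr1 mulrA -toCM mulVf// mul1r.
by apply: eq_Cint => y; rewrite expr0 mul1r.
Qed.

(** Multiplying by [v sinc (del v) = sin (del v) / del] replaces the
    transform by a difference of two translates, a discrete derivative,
    which moves every moment up by one order. *)
Lemma good_ker_stepS del j n : 0 < del -> (j.+2 <= n)%N ->
  good_ker del j n -> good_ker del j.+1 n.+1.
Proof.
move=> d0 jn [kb kl kj].
have kE y : sinc_ker del j.+1 n.+1 y = ((2 * del) *i)^-1 *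
    (sinc_ker del j n (y - del) - sinc_ker del j n (y - - del)).
  have i1 := Cintegrable_sinc_pow (y - del) d0 jn.
  have i2 := Cintegrable_sinc_pow (y - - del) d0 jn.
  rewrite /sinc_ker -CintB// -CintZ; last exact: CintegrableB.
  apply: eq_Cint => v.
  have di : (2 * del) *i != 0 :> R[i].
    by rewrite eq_complex /= negb_and mulf_neq0 ?orbT// ?gt_eqF.
  apply: (mulfI di); rewrite mulVKf//.
  have -> : sinc_pow del j.+1 n.+1 v = sinc_pow del j n v * (sin (del * v) / del).
    by rewrite -mul_sinc /sinc_pow exprS exprSr; field; rewrite gt_eqF.
  have -> : - (v * (y - del)) = - (v * y) + del * v by ring.
  have -> : - (v * (y - - del)) = - (v * y) - del * v by ring.
  rewrite !expiD /expi !(cosN, sinN).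
  by apply: complex_ext => /=; field; rewrite gt_eqF.
have b0 : 0 <= n%:R * del by rewrite mulr_ge0// ltW.
have [mk [c kc] k0] := kb.
have kb' : bounded_supp (sinc_ker del j.+1 n.+1) (n.+1%:R * del).
  split.
  - rewrite (_ : sinc_ker _ _ _ = fun y => ((2 * del) *i)^-1 *
      (sinc_ker del j n (y - del) - sinc_ker del j n (y - - del))); last exact/funext.
    apply: cmeasM; first exact: cmeas_cst.
    by apply: cmeasB; apply: (cmeas_comp mk); exact: measurable_funB.
  - by apply: sinc_ker_bounded.
  - move=> y yb; rewrite kE !k0 ?subrr ?mulr0//.
      have : `|y| <= `|y - - del| + `|- del| by rewrite -{1}(subrK (- del) y) ler_normD.
      by rewrite normrN (gtr0_norm d0); move: yb; rewrite -natr1; lra.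
    have : `|y| <= `|y - del| + `|del| by rewrite -{1}(subrK del y) ler_normD.
    by rewrite (gtr0_norm d0); move: yb; rewrite -natr1; lra.
have is_ a l : Cintegrable mu (fun y => (y ^+ l)%:C * sinc_ker del j n (y - a)).
  have : bounded_supp (fun y => sinc_ker del j n (y - a)) (n%:R * del + `|a|).
    split.
    - by apply: (cmeas_comp mk); exact: measurable_funB.
    - by exists c.
    - move=> y ya; apply: k0; have : `|y| <= `|y - a| + `|a|.
        by rewrite -{1}(subrK a y) ler_normD.
      by lra.
  by move=> h; apply: bounded_supp_integrable (bounded_suppX l _ h); rewrite addr_ge0.
have mE l : moment (sinc_ker del j.+1 n.+1) l = ((2 * del) *i)^-1 *
    \sum_(i < l.+1) ('C(l, i)%:R * (del ^+ i - (- del) ^+ i))%:C *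
      moment (sinc_ker del j n) (l - i).
  transitivity (((2 * del) *i)^-1 *
     (moment (fun y => sinc_ker del j n (y - del)) l -
      moment (fun y => sinc_ker del j n (y - (- del))) l)).
    rewrite /moment -CintB// -CintZ; last exact: CintegrableB.
    by apply: eq_Cint => y; rewrite kE; ring.
  rewrite (moment_shift l del b0 kb) (moment_shift l (- del) b0 kb) -sumrB; congr (_ * _); apply: eq_bigr => i _.
  by rewrite -mulrBl; congr (_ * _); apply: complex_ext => /=; ring.
split; first exact: kb'.
  move=> l lj; rewrite mE big1 ?mulr0// => i _.
  have [->|i0] := eqVneq (i : nat) 0%N; first by rewrite !expr0 subrr mulr0 mul0r.
  by rewrite kl ?mulr0//; have := ltn_ord i; lia.
rewrite mE mulf_neq0//.
  by rewrite invr_eq0 eq_complex /= negb_and mulf_neq0 ?orbT// ?gt_eqF.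
(* In the binomial sum the term of index 0 cancels, and those of index at
   least 2 contain moments of order less than [j]. *)
rewrite big_ord_recl big_ord_recl !expr0 subrr mulr0 mul0r add0r big1 ?addr0; last first.
  move=> i _; rewrite kl ?mulr0//= /bump/=.
  by have := ltn_ord i; lia.
rewrite /= /bump/= addn0 subn1 /= !expr1 mulf_neq0//.
rewrite bin1 eq_complex /= negb_and; apply/orP; left.
rewrite mulf_neq0 ?pnatr_eq0// opprK gt_eqF// addr_gt0//.
Qed.

Lemma good_ker_exists del j n : 0 < del -> (j.+2 <= n)%N -> good_ker del j n.
Proof.
move=> d0; elim: j n => [|j IH] n jn; last first.
  case: n jn => [|n] jn; first by [].
  by apply: (good_ker_stepS d0 _ (IH n _)).
elim: n jn => // n IHn; rewrite leq_eqVlt => /predU1P[[<-]|n2].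
  exact: good_ker_base.
exact: (good_ker_step0 d0 n2 (IHn n2)).
Qed.

Lemma moment_sinc_ker_shift del j n m a : 0 < del -> (j.+2 <= n)%N -> (m <= j)%N ->
  moment (fun y => sinc_ker del j n (y - a)) m =
  if m == j then moment (sinc_ker del j n) j else 0.
Proof.
move=> d0 jn mj; have [kb kl _] := good_ker_exists d0 jn.
have b0 : 0 <= n%:R * del by rewrite mulr_ge0// ltW.
rewrite (moment_shift _ _ b0 kb) big_ord_recl subn0 expr0 bin0 mulr1 mul1r.
rewrite big1 ?addr0 => [|i _]; last first.
  by rewrite kl ?mulr0//= /bump/=; have := ltn_ord i; lia.
by case: eqP => [->//|/eqP mj']; rewrite kl// ltn_neqAle mj'.
Qed.

End sinc.

(** * Integration against a measure with a density *)

Section density_integral.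
Context {R : realType} {disp : measure_display} {T : measurableType disp}.
Variables (S m nu : {measure set T -> \bar R}) (s : T -> R).
Hypothesis ms : measurable_fun setT s.
Hypothesis s0 : forall x, 0 <= s x.
Hypothesis SE : forall A, measurable A ->
  (S A = \int[m]_(u in A) (s u)%:E + nu A)%E.
Local Open Scope ereal_scope.
Import HBNNSimple.

Let mEs : measurable_fun setT (EFin \o s).
Proof. exact/measurable_EFinP. Qed.

Let decomp_nnsfun (f : {nnsfun T >-> R}) :
  \int[S]_x (f x)%:E = \int[m]_x ((f x)%:E * (s x)%:E) + \int[nu]_x (f x)%:E.
Proof.
pose A r := f @^-1` [set r].
have mA r : measurable (A r) by rewrite -[A r]setTI; exact: (measurable_funP f).
pose h r x : \bar R := (r * \1_(A r) x)%:E.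
have mh r : measurable_fun setT (h r) by exact/measurable_EFinP/measurable_funM.
have h0 r x : 0 <= h r x by rewrite nnfun_muleindic_ge0.
have fE x : (f x)%:E = \sum_(r \in range f) h r x by rewrite fsumEFin// -fimfunE.
have fin : finite_set (range f) by [].
have fsE x : (f x)%:E * (s x)%:E = \sum_(r \in range f) (h r x * (s x)%:E).
  rewrite fE !fsbig_finite//= ge0_sume_distrl//.
under eq_integral do rewrite fE.
under [X in _ = _ + X]eq_integral do rewrite fE.
under [X in _ = X + _]eq_integral do rewrite fsE.
rewrite !ge0_integral_fsum//; last 2 first.
- by move=> r; exact: emeasurable_funM.
- by move=> r x _; rewrite mule_ge0// lee_fin.
rewrite -fsbig_split//=; apply: eq_fsbigr => r _.
have [r0|r0] := leP 0%R r; last first.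
  have Ar : A r = set0 by rewrite /A preimage_nnfun0.
  have hr x : h r x = 0 by rewrite /h Ar indic0 mulr0.
  under eq_integral do rewrite hr.
  under [X in _ = _ + X]eq_integral do rewrite hr.
  under [X in _ = X + _]eq_integral do rewrite hr mul0e.
  by rewrite !integral0 adde0.
have e1 (mu : {measure set T -> \bar R}) : \int[mu]_x h r x = r%:E * mu (A r).
  rewrite /h; under eq_integral do rewrite EFinM.
  by rewrite ge0_integralZl_EFin// ?integral_indic ?setIT//; exact/measurable_EFinP.
rewrite !e1 SE// ge0_muleDr ?integral_ge0// => [|x _]; last by rewrite lee_fin.
congr (_ + _); rewrite integral_mkcond.
rewrite -ge0_integralZl_EFin//; last 2 first.
- by move=> x _; apply: erestrict_ge0 => y _; rewrite lee_fin.
- by apply/(measurable_restrictT _ (mA r)); exact: measurable_funTS.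
apply: eq_integral => x _; rewrite /h patchE indicE.
by case: (x \in A r); rewrite ?mulr1 ?mulr0 ?mul0e ?mule0.
Qed.

Lemma ge0_integral_decomp (f : T -> \bar R) : measurable_fun setT f ->
  (forall x, 0 <= f x) ->
  \int[S]_x f x = \int[m]_x (f x * (s x)%:E) + \int[nu]_x f x.
Proof.
move=> mf f0; pose f_ := nnsfun_approx measurableT mf.
have cvf x : (fun n => (f_ n x)%:E) @ \oo --> f x by exact: cvg_nnsfun_approx.
have mono (mu : {measure set T -> \bar R}) :
    (fun n => \int[mu]_x (f_ n x)%:E) @ \oo --> \int[mu]_x f x.
  rewrite (_ : \int[mu]_x f x = \int[mu]_x limn (fun n => (f_ n x)%:E)).
    apply: cvg_monotone_convergence => //.
    - by move=> n; exact/measurable_EFinP.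
    - by move=> n x _; rewrite lee_fin.
    - by move=> x _ a b ab; rewrite lee_fin; exact/lefP/nd_nnsfun_approx.
  by apply: eq_integral => x _; apply/esym/cvg_lim => //; exact: cvf.
have mono2 : (fun n => \int[m]_x ((f_ n x)%:E * (s x)%:E)) @ \oo -->
    \int[m]_x (f x * (s x)%:E).
  have cv x : (fun n => (f_ n x)%:E * (s x)%:E) @ \oo --> f x * (s x)%:E.
    by apply: cvgeZr => //; exact: cvf.
  rewrite (_ : \int[m]_x (f x * (s x)%:E) =
      \int[m]_x limn (fun n => (f_ n x)%:E * (s x)%:E)).
    apply: cvg_monotone_convergence => //.
    - move=> n; apply: emeasurable_funM => //; exact/measurable_EFinP.
    - by move=> n x _; rewrite mule_ge0// lee_fin.
    - move=> x _ a b ab; apply: lee_wpmul2r; first by rewrite lee_fin.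
      by rewrite lee_fin; exact/lefP/nd_nnsfun_approx.
  by apply: eq_integral => x _; apply/esym/cvg_lim => //; exact: cv.
have cvS := mono S; rewrite -(cvg_lim _ cvS)//.
under eq_fun do rewrite decomp_nnsfun.
apply/cvg_lim => //; apply: cvgeD; [|exact: mono2|exact: mono].
by rewrite ge0_adde_def// inE integral_ge0// => x _; rewrite mule_ge0// lee_fin.
Qed.

End density_integral.

Lemma cmeas_Cint {R : realType} {d1 d2 : measure_display}
    {T1 : measurableType d1} {T2 : measurableType d2}
    (m2 : {sigma_finite_measure set T2 -> \bar R}) (F : T1 * T2 -> R[i]) :
  cmeas F -> cmeas (fun x => Cint m2 (fun y => F (x, y))).
Proof.
have key (f : T1 * T2 -> R) : measurable_fun setT f ->
    measurable_fun setT (fun x => (\int[m2]_y f (x, y))%R).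
  move=> mf; have mEf : measurable_fun setT (EFin \o f) by exact/measurable_EFinP.
  rewrite /Rintegral; apply: (measurableT_comp (fine_measurable measurableT)).
  have mp : measurable_fun setT (fubini_F m2 (EFin \o f)^\+%E).
    by apply: measurable_fun_fubini_tonelli_F => //; exact: measurable_funepos.
  have mn : measurable_fun setT (fubini_F m2 (EFin \o f)^\-%E).
    by apply: measurable_fun_fubini_tonelli_F => //; exact: measurable_funeneg.
  rewrite (_ : (fun x => _) = (fun x => fubini_F m2 (EFin \o f)^\+%E x -
      fubini_F m2 (EFin \o f)^\-%E x)%E); first exact: emeasurable_funB.
  apply/funext => x; rewrite integralE /fubini_F.
  by congr (_ - _)%E; apply: eq_integral => y _; rewrite ?funeposE ?funenegE.
by move=> [m1 m2']; split; [exact: (key _ m1)|exact: (key _ m2')].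
Qed.

(** * Functions of compact support and the variance of their integrals *)

Section Ccb.
Context {R : realType} {d : nat}.
Local Notation L := (lebesgue_Rn R d).
Implicit Types f g : Rn R d -> R[i].

Lemma Ccb_cmeas f : Ccb f -> cmeas f.
Proof. by case=> -[]. Qed.

Lemma Ccb_bound f : Ccb f -> exists c r, [/\ 0 <= c, 0 <= r,
  forall x, cnorm (f x) <= c & forall x, ~ cube r x -> f x = 0].
Proof.
move=> [[_ _ [c fc]] [r fr]]; exists c, `|r|; split=> //.
  by apply: le_trans (fc vzero); exact: cnorm_ge0.
move=> x nc; case: ((existsNP (fun i => - `|r| <= tnth x i <= `|r|)).2 nc) => i.
rewrite -ler_norml => /negP; rewrite -ltNge => xi.
by apply: fr; rewrite (le_lt_trans (ler_norm r))// (lt_le_trans xi)// ler_norm_tnth.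
Qed.

Lemma Ccb_of_bound f c r : cmeas f -> (forall x, cnorm (f x) <= c) ->
  (forall x, ~ cube r x -> f x = 0) -> Ccb f.
Proof.
move=> [m1 m2] fc fr; split; first by split => //; exists c.
by exists (d%:R * r) => x rx; apply: fr => /enorm_cube; rewrite leNgt rx.
Qed.

Lemma integrable_cst_cube c r : 0 <= r -> L.-integrable setT (EFin \o (fun x => c * \1_(cube r) x)).
Proof.
move=> r0; suff h : L.-integrable setT (fun x => (\1_(cube r) x)%:E : \bar R).
  exact: (integrableZl measurableT c h).
apply/integrableP; split.
  by apply/measurable_EFinP; apply: measurable_indic; exact: measurable_cube.
under eq_integral do rewrite gee0_abs ?lee_fin//.
rewrite (integral_indic _ measurableT (measurable_cube r)) setIT.
suff : (L (cube r) < +oo)%E by [].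
by rewrite lebesgue_cube// ltry.
Qed.

Lemma Ccb_dominated f : Ccb f -> exists2 B : Rn R d -> R, L.-integrable setT (EFin \o B) &
  forall x, cnorm (f x) <= B x.
Proof.
move=> /Ccb_bound[c [r [c0 r0 fc fr]]].
exists (fun x => c * \1_(cube r) x); first exact: integrable_cst_cube.
move=> x; rewrite indicE; case: (boolP (x \in _)) => [_|]; first by rewrite mulr1.
by rewrite notin_setE => /fr ->; rewrite cnorm0 mulr0.
Qed.

Lemma Ccb_integrable f : Ccb f -> Cintegrable L f.
Proof.
move=> fC; have [B iB fB] := Ccb_dominated fC.
exact: Cintegrable_le (Ccb_cmeas fC) iB fB.
Qed.

Lemma fourierE f u : fourier f u = Cint L (fun x => expi (- dotp u x) * f x).
Proof. by []. Qed.

Lemma Cintegrable_fourier f u : Cintegrable L f ->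
  Cintegrable L (fun x => expi (- dotp u x) * f x).
Proof.
move=> fi; apply: Cintegrable_expiM => //; apply: measurableT_comp => //.
by apply: measurable_dotp => //; exact: measurable_cst.
Qed.

Lemma CcbD (a : R) (f g : Rn R d -> R) : Ccb (toC f) -> Ccb (toC g) ->
  Ccb (toC (fun x => a * f x + g x)).
Proof.
move=> fC gC; have [[m1 _ [c fc]] [r fr]] := fC; have [[m2 _ [c' gc]] [r' gr]] := gC.
split.
  split; [|exact: measurable_cst|].
    by apply: measurable_funD => //; exact: measurable_funM.
  exists (`|a| * c + c') => x; rewrite /toC toCD toCM (le_trans (cnormD _ _))//.
  apply: lerD; last exact: gc.
  by rewrite (cnormM a%:C) cnorm_toC; apply: ler_wpM2l => //; exact: fc.
exists (Num.max r r') => x; rewrite gt_max => /andP[h1 h2].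
have := fr x h1; have := gr x h2; rewrite /toC => /(congr1 cRe)/= -> /(congr1 cRe)/= ->.
by rewrite mulr0 addr0.
Qed.

Lemma Ccb_Re f : Ccb f -> Ccb (toC (cRe \o f)).
Proof.
move=> [[m1 m2 [c fc]] [r fr]]; split.
  split; [exact: m1|exact: measurable_cst|].
  by exists c => x; rewrite /toC cnorm_toC (le_trans (ler_Re_cnorm _)).
by exists r => x /fr h; rewrite /toC /= h.
Qed.

Lemma Ccb_Im f : Ccb f -> Ccb (toC (cIm \o f)).
Proof.
move=> [[m1 m2 [c fc]] [r fr]]; split.
  split; [exact: m2|exact: measurable_cst|].
  by exists c => x; rewrite /toC cnorm_toC (le_trans (ler_Im_cnorm _)).
by exists r => x /fr h; rewrite /toC /= h.
Qed.

Lemma Ccb_pair (f g : Rn R d -> R) : Ccb (toC f) -> Ccb (toC g) ->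
  Ccb (fun x => f x +i* g x).
Proof.
move=> [[m1 _ [c fc]] [r fr]] [[m2 _ [c' gc]] [r' gr]]; split.
  split=> //; exists (c + c') => x; rewrite (le_trans (cnorm_le _))//= lerD//.
    by have := fc x; rewrite /toC cnorm_toC.
  by have := gc x; rewrite /toC cnorm_toC.
exists (Num.max r r') => x; rewrite gt_max => /andP[h1 h2].
by have := fr x h1; have := gr x h2; rewrite /toC => /(congr1 cRe)/= -> /(congr1 cRe)/= ->.
Qed.

Lemma cmeas_fourier f : Ccb f -> cmeas (fourier f).
Proof.
move=> /Ccb_cmeas mf.
apply: (cmeas_Cint L (F := fun z => expi (- dotp z.1 z.2) * f z.2)).
apply: cmeasM; last exact: (cmeas_comp mf).
by apply: cmeas_expi; apply: measurableT_comp => //; exact: measurable_dotp.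
Qed.

(** Multiplication formula: the transform can be moved to the other factor. *)
Lemma fourier_dual f (g : Rn R d -> R[i]) : Ccb f -> Cintegrable L g ->
  [/\ Cintegrable L (fun u => fourier f u * g u),
      Cintegrable L (fun x => f x * Cint L (fun u => g u * expi (- dotp u x))) &
      Cint L (fun u => fourier f u * g u) =
      Cint L (fun x => f x * Cint L (fun u => g u * expi (- dotp u x)))].
Proof.
move=> fC gi; have [mg ig] := gi; have mf := Ccb_cmeas fC.
have [B iB fB] := Ccb_dominated fC; have fi := Ccb_integrable fC.
pose F (z : Rn R d * Rn R d) := expi (- dotp z.1 z.2) * f z.2 * g z.1.
have mF : cmeas F.
  apply: cmeasM; last exact: (cmeas_comp mg).
  apply: cmeasM; last exact: (cmeas_comp mf).
  by apply: cmeas_expi; apply: measurableT_comp => //; exact: measurable_dotp.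
have [|_ i1 i2 e1 e2] := Cfubini mF ig iB.
  by move=> u x; rewrite /F !cnormM cnorm_expi mul1r mulrC ler_wpM2l ?cnorm_ge0.
have eF u : Cint L (fun x => F (u, x)) = fourier f u * g u.
  by rewrite fourierE -(CintZr _ (Cintegrable_fourier u fi)).
have eF' : (fun u => fourier f u * g u) = (fun u => Cint L (fun x => F (u, x))).
  by apply/funext => u; rewrite eF.
have eG : (fun x => f x * Cint L (fun u => g u * expi (- dotp u x))) =
    (fun x => Cint L (fun u => F (u, x))).
  apply/funext => x; rewrite -CintZ; first by apply: eq_Cint => u; rewrite /F /=; ring.
  rewrite (_ : (fun u => _) = (fun u => expi (- dotp u x) * g u)); last first.
    by apply/funext => u; rewrite mulrC.
  apply: Cintegrable_expiM => //; apply: measurableT_comp => //.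
  by apply: measurable_dotp => //; exact: measurable_cst.
by rewrite eF' eG; split; [exact: i1|exact: i2|rewrite e1 -e2].
Qed.

End Ccb.

(** * Rigidity in terms of real test functions *)

Section rigidity.
Context {disp : measure_display} {T : measurableType disp} {R : realType}.
Context {P : probability T R} {d : nat}.
Variable M : wss_measure P d.
Local Notation L := (lebesgue_Rn R d).
Local Notation S := (wss_spectral M).
Implicit Types (f h : Rn R d -> R) (A : set (Rn R d)).

Definition energy f : \bar R := (\int[S]_u (cnorm (fourier (toC f) u) ^+ 2)%:E)%E.

Let cd : R := ((2 * pi) ^+ d)^-1.

Let cd_gt0 : 0 < cd.
Proof. by rewrite invr_gt0 exprn_gt0// mulr_gt0// pi_gt0. Qed.

Lemma energy_ge0 f : (0 <= energy f)%E.
Proof. by apply: integral_ge0 => u _; rewrite lee_fin sqr_ge0. Qed.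

Let variance_ae (X Y : T -> R) : measurable_fun setT X -> measurable_fun setT Y ->
  {ae P, forall w, X w = Y w} -> ('V_P[X] = 'V_P[Y])%E.
Proof.
move=> mX mY XY.
have eXY : ('E_P[X] = 'E_P[Y])%E.
  rewrite unlock; apply: ae_eq_integral => //; try exact/measurable_EFinP.
  by apply: filterS XY => w h _; rewrite h.
rewrite /variance covariance.unlock eXY unlock; apply: ae_eq_integral => //.
- by apply/measurable_EFinP; apply: measurable_funM; exact: measurable_funB.
- by apply/measurable_EFinP; apply: measurable_funM; exact: measurable_funB.
- by apply: filterS XY => w h _; rewrite /= /GRing.mul/= h.
Qed.

Let wss_meas f : Ccb (toC f) -> measurable_fun setT (wss_int M f).
Proof. by move=> /(wss_L2 M); rewrite inE => /andP[+ _]; rewrite inE. Qed.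

Lemma energy_lty f : Ccb (toC f) -> (energy f < +oo)%E.
Proof.
move=> fC; have := wss_varianceE M fC; rewrite -/(energy f) -/cd => h.
have : ('V_P[wss_int M f] < +oo)%E.
  by have := variance_fin_num (wss_L2 M fC); rewrite fin_numElt => /andP[].
rewrite h; apply: contraTT; rewrite -!leNgt !leye_eq => /eqP ->.
by rewrite mulry gtr0_sg// mul1e.
Qed.

(** The variance of a complex combination is the sum of the variances of its
    real and imaginary parts, so rigidity is a statement on real functions. *)
Let cvarianceE (g h : Rn R d -> R[i]) : Ccb g -> Ccb h ->
  (cvariance P (fun w => wss_cint M g w - wss_cint M h w)%R =
   cd%:E * (energy (fun x => (- 1) * cRe (h x) + cRe (g x))%R +
            energy (fun x => (- 1) * cIm (h x) + cIm (g x))%R))%E.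
Proof.
move=> gC hC.
have part (p q : Rn R d -> R) : Ccb (toC p) -> Ccb (toC q) ->
    let X := fun w => wss_int M p w - wss_int M q w in
    measurable_fun setT X /\
    ('V_P[X] = cd%:E * energy (fun x => (- 1) * q x + p x)%R)%E.
  move=> pC qC X; have mX : measurable_fun setT X.
    by apply: measurable_funB; exact: wss_meas.
  split=> //; have pqC := CcbD (- 1) qC pC.
  rewrite -(wss_varianceE M pqC); apply: variance_ae => //; first exact: wss_meas.
  by apply: filterS (wss_linear M (- 1) qC pC) => w ->; rewrite /X mulN1r addrC.
have [mX vX] := part _ _ (Ccb_Re gC) (Ccb_Re hC).
have [mY vY] := part _ _ (Ccb_Im gC) (Ccb_Im hC).
rewrite muleDr ?ge0_adde_def ?inE ?energy_ge0//.
rewrite -[X in (X + _)%E]vX -[X in (_ + X)%E]vY.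
set X := fun w => _ in mX vX *; set Y := fun w => _ in mY vY *.
pose a := fine ('E_P[X])%E; pose b := fine ('E_P[Y])%E.
rewrite /cvariance /variance !covariance.unlock [in LHS]expectation.unlock.
rewrite ![in RHS]expectation.unlock -/a -/b -ge0_integralD//=.
- apply: eq_integral => w _; rewrite -EFinD; congr EFin.
  rewrite cnorm2E /cexpectation.
  by rewrite expectation.unlock !expr2.
- by move=> w _; rewrite lee_fin -expr2 sqr_ge0.
- by apply/measurable_EFinP; apply: measurable_funM; exact: measurable_funB.
- by move=> w _; rewrite lee_fin -expr2 sqr_ge0.
- by apply/measurable_EFinP; apply: measurable_funM; exact: measurable_funB.
Qed.

(** The transform of [f] is in the closure, in [L^2(S)], of the transforms
    of the real functions vanishing on [A]. *)
Definition approximable A f := forall e : R, 0 < e -> exists h,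
  [/\ Ccb (toC h), forall x, A x -> h x = 0 &
      (energy (fun x => (- 1) * h x + f x)%R < e%:E)%E].

(** The two parts of [h] are arbitrary real functions vanishing on [A], so
    the two energies whose sum is the variance can be made small
    independently. *)
Lemma linearly_rigidP A (g : Rn R d -> R[i]) : Ccb g ->
  linearly_rigid M A g <-> approximable A (cRe \o g) /\ approximable A (cIm \o g).
Proof.
move=> gC; split=> [rig|[aR aI]].
  have key e : 0 < e -> exists h : Rn R d -> R[i], [/\ Ccb h, forall x, A x -> h x = 0,
      (energy (fun x => (- 1) * cRe (h x) + cRe (g x))%R < e%:E)%E &
      (energy (fun x => (- 1) * cIm (h x) + cIm (g x))%R < e%:E)%E].
    move=> e0; have : (ereal_inf [set cvariance P (fun w => wss_cint M g w - wss_cint M h w)%R |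
        h in [set h : Rn R d -> R[i] | Ccb h /\ forall x, A x -> h x = 0%R]] < (cd * e)%:E)%E.
      by rewrite rig lte_fin mulr_gt0.
    move=> /ereal_inf_lt[_ [h [hC hA] <-]]; rewrite cvarianceE// EFinM lte_pmul2l// => he.
    exists h; split=> //; apply: le_lt_trans he; first by rewrite leeDl// energy_ge0.
    by rewrite leeDr// energy_ge0.
  split=> e /key[h [hC hA h1 h2]].
    exists (cRe \o h); split; [exact: Ccb_Re| |exact: h1].
    by move=> x /hA hx; rewrite /comp hx.
  exists (cIm \o h); split; [exact: Ccb_Im| |exact: h2].
  by move=> x /hA hx; rewrite /comp hx.
apply/eqP; rewrite eq_le; apply/andP; split; last first.
  apply: le_ereal_inf_tmp => _ [h [hC hA] <-]; rewrite cvarianceE// mule_ge0//.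
    by rewrite lee_fin ltW.
  by rewrite adde_ge0// energy_ge0.
apply/lee_addgt0Pr => e e0; rewrite add0e.
have e2 : 0 < e / cd / 2 by rewrite !divr_gt0.
have [h1 [h1C h1A h1e]] := aR _ e2; have [h2 [h2C h2A h2e]] := aI _ e2.
apply: ge_ereal_inf; exists (cvariance P (fun w => wss_cint M g w -
    wss_cint M (fun x => h1 x +i* h2 x) w)%R).
  exists (fun x => h1 x +i* h2 x) => //; split; first exact: Ccb_pair.
  by move=> x Ax; rewrite h1A// h2A.
rewrite cvarianceE//; last exact: Ccb_pair.
rewrite (_ : e = cd * (e / cd / 2 + e / cd / 2)); last by field; rewrite gt_eqF.
rewrite EFinM EFinD; apply: lee_wpmul2l; first by rewrite lee_fin ltW.
by apply: leeD; [exact: (ltW h1e)|exact: (ltW h2e)].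
Qed.

End rigidity.

(** * The duality criterion for non-rigidity *)

Section peval.
Context {R : realType} {d : nat}.
Implicit Types (Q : cpoly R d) (x : Rn R d).

Lemma pevalE Q x : peval Q x = \sum_(m <- mpoly.msupp Q)
  mpoly.mcoeff m Q * \prod_(i < d) (tnth x i)%:C ^+ m i.
Proof. exact: mpoly.mevalE. Qed.

Lemma cmeas_peval Q : cmeas (peval Q).
Proof.
have -> : peval Q = fun x => \sum_(m <- mpoly.msupp Q)
    mpoly.mcoeff m Q * \prod_(i < d) (tnth x i)%:C ^+ m i.
  by apply/funext => x; exact: pevalE.
apply: cmeas_sum => m; apply: cmeasM; first exact: cmeas_cst.
apply: cmeas_prod => i; apply: cmeasX; apply: cmeas_toC; exact: measurable_tnthR.
Qed.

Lemma peval_bound Q r : exists c, forall x, cube r x -> cnorm (peval Q x) <= c.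
Proof.
exists (\sum_(m <- mpoly.msupp Q) cnorm (mpoly.mcoeff m Q) * \prod_(i < d) r ^+ m i).
move=> x xr; rewrite pevalE (le_trans (cnorm_sum _ _))// ler_sum// => m _.
rewrite cnormM ler_wpM2l ?cnorm_ge0// cnorm_prod ler_prod// => i _.
by rewrite cnorm_ge0 cnormX cnorm_toC lerXn2r ?nnegrE//= ?ler_norml//;
  rewrite (le_trans (normr_ge0 (tnth x i)))// ler_norml.
Qed.

Lemma Ccb_peval Q (A : set (Rn R d)) r : measurable A -> A `<=` cube r ->
  Ccb (fun x => peval Q x * (\1_A x)%:C).
Proof.
move=> mA Ar; have [c Qc] := peval_bound Q r.
apply: (@Ccb_of_bound _ _ _ `|c| r).
- apply: cmeasM; first exact: cmeas_peval.
  by apply: cmeas_toC; exact: measurable_indic.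
- move=> x; rewrite cnormM cnorm_toC indicE; case: (boolP (x \in A)) => xA.
    by rewrite normr1 mulr1 (le_trans (Qc _ _))// ?ler_norm//; apply: Ar; rewrite inE in xA.
  by rewrite normr0 mulr0.
- move=> x nx; rewrite indicE; case: (boolP (x \in A)) => xA; last by rewrite mulr0.
  by exfalso; apply: nx; apply: Ar; rewrite inE in xA.
Qed.

End peval.

Section duality.
Context {disp : measure_display} {T : measurableType disp} {R : realType}.
Context {P : probability T R} {d : nat}.
Variables (M : wss_measure P d) (s : Rn R d -> R).
Hypothesis hs : is_spectral_density M s.
Local Notation L := (lebesgue_Rn R d).
Local Notation S := (wss_spectral M).

Lemma measurable_sinv : measurable_fun setT (sinv s).
Proof.
have [ms s0 _] := hs.
have -> : sinv s = fun u => if s u == 0 then +oo%E else ((s u)^-1)%:E.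
  apply/funext => u; rewrite /sinv; case: eqP => [->|/eqP su]; first by rewrite inve0.
  by rewrite inver (negbTE su).
apply: measurable_fun_ifT => //.
  by apply: (measurable_fun_eqr ms); exact: measurable_cst.
by apply/measurable_EFinP; apply: measurableT_comp; [exact: measurable_invr|exact: ms].
Qed.

Lemma sinv_ge0 u : (0 <= sinv s u)%E.
Proof. by have [_ s0 _] := hs; rewrite /sinv inve_ge0 lee_fin. Qed.

Let mEsqr (f : Rn R d -> R[i]) : cmeas f ->
  measurable_fun setT (fun u => (cnorm (f u) ^+ 2)%:E).
Proof.
by move=> mf; apply/measurable_EFinP; apply: measurable_funX; exact: measurable_cnorm.
Qed.

Section pairing.
Variable g : Rn R d -> R[i].
Hypothesis gi : Cintegrable L g.
Local Notation E := (\int[L]_u ((cnorm (g u) ^+ 2)%:E * sinv s u))%E.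

(** Arithmetic-geometric form of the Cauchy-Schwarz inequality, with the
    weight [s] on one factor and [1 / s] on the other. *)
Let pairing_le (f : Rn R d -> R) (t : R) : Ccb (toC f) -> 0 < t ->
  ((cnorm (Cint L (fun u => fourier (toC f) u * g u)))%:E <=
   t%:E * energy M f + t^-1%:E * E)%E.
Proof.
move=> fC t0; have [ms s0 [nu _ SE]] := hs.
have [fgi _ _] := fourier_dual fC gi; have mg := gi.1.
have mf := cmeas_fourier fC.
set a := fun u => cnorm (fourier (toC f) u); set b := fun u => cnorm (g u).
apply: (@le_trans _ _ (\int[L]_u (a u * b u)%:E)%E).
  have [_ ifg] := fgi.
  apply: (@le_trans _ _ (\int[L]_x cnorm (fourier (toC f) x * g x))%:E).
    by rewrite lee_fin; exact: cnorm_Cint.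
  rewrite /Rintegral fineK; last exact: integrable_fin_num.
  by under eq_integral do rewrite cnormM.
apply: (@le_trans _ _ (t%:E * (\int[L]_u ((a u ^+ 2)%:E * (s u)%:E)) + t^-1%:E * E)%E);
    last first.
  rewrite leeD2r// lee_pmul2l// /energy (ge0_integral_decomp ms s0 SE).
  - by rewrite leeDl// integral_ge0// => u _; rewrite lee_fin sqr_ge0.
  - exact: mEsqr.
  - by move=> u; rewrite lee_fin sqr_ge0.
have m1 : measurable_fun setT (fun u => (a u ^+ 2)%:E * (s u)%:E)%E.
  by apply: emeasurable_funM; [exact: mEsqr|exact/measurable_EFinP].
have m2 : measurable_fun setT (fun u => (b u ^+ 2)%:E * sinv s u)%E.
  by apply: emeasurable_funM; [exact: mEsqr|exact: measurable_sinv].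
have p1 u : (0 <= (a u ^+ 2)%:E * (s u)%:E)%E by rewrite mule_ge0// lee_fin// sqr_ge0.
have p2 u : (0 <= (b u ^+ 2)%:E * sinv s u)%E.
  by rewrite mule_ge0// ?sinv_ge0// lee_fin sqr_ge0.
have e1 : (t%:E * \int[L]_u ((a u ^+ 2)%:E * (s u)%:E) =
    \int[L]_u (t%:E * ((a u ^+ 2)%:E * (s u)%:E)))%E.
  by rewrite ge0_integralZl_EFin// ltW.
have e2 : (t^-1%:E * E = \int[L]_u (t^-1%:E * ((b u ^+ 2)%:E * sinv s u)))%E.
  by rewrite ge0_integralZl_EFin// invr_ge0 ltW.
rewrite e1 e2 -ge0_integralD//; last 4 first.
- by move=> u _; rewrite mule_ge0// lee_fin ltW.
- exact: measurable_funeM.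
- by move=> u _; rewrite mule_ge0// lee_fin invr_ge0 ltW.
- exact: measurable_funeM.
apply: ge0_le_integral => //.
- by move=> u _; rewrite lee_fin mulr_ge0// cnorm_ge0.
- by apply/measurable_EFinP; apply: measurable_funM; exact: measurable_cnorm.
- by apply: emeasurable_funD; exact: measurable_funeM.
move=> u _; have [su|su] := eqVneq (s u) 0; last first.
  have sp : 0 < s u by rewrite lt_neqAle eq_sym su s0.
  rewrite /sinv inver (negbTE su) -!EFinM -EFinD lee_fin.
  rewrite (_ : t * _ + _ = ((t * s u * a u) ^+ 2 + b u ^+ 2) / (t * s u)); last first.
    by field; rewrite !gt_eqF.
  rewrite ler_pdivlMr ?mulr_gt0//.
  have := sqr_ge0 (t * s u * a u - b u); have : 0 <= t * s u * a u * b u.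
    by rewrite !mulr_ge0 ?cnorm_ge0// ltW.
  by nra.
rewrite /sinv su inve0; have [bu|bu] := eqVneq (b u) 0.
  by rewrite bu mulr0 expr0n/= mul0e !mule0 adde0.
have bp : 0 < b u by rewrite lt_neqAle eq_sym bu cnorm_ge0.
rewrite [((b u ^+ 2)%:E * +oo)%E]gt0_muley ?lte_fin ?exprn_gt0//.
by rewrite gt0_muley ?lte_fin ?invr_gt0// !mule0 add0e leey.
Qed.

(** Applied to an approximation error of energy at most [t ^- 2], the
    pairing inequality bounds the integral by a multiple of [t^-1]. *)
Lemma dual_vanishes A (f : Rn R d -> R) : (E < +oo)%E ->
  (forall x, ~ A x -> Cint L (fun u => g u * expi (- dotp u x)) = 0) ->
  Ccb (toC f) -> approximable M A f ->
  Cint L (fun x => (f x)%:C * Cint L (fun u => g u * expi (- dotp u x))) = 0.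
Proof.
move=> Eoo GA fC af; pose G x := Cint L (fun u => g u * expi (- dotp u x)).
rewrite -/G.
have Ef : E \is a fin_num.
  rewrite ge0_fin_numE// integral_ge0// => u _.
  by rewrite mule_ge0// ?sinv_ge0// lee_fin sqr_ge0.
set c := Cint _ _; apply: cnorm_eq0; apply/eqP; rewrite eq_le cnorm_ge0 andbT.
have E0 : 0 <= fine E.
  by rewrite fine_ge0// integral_ge0// => u _; rewrite mule_ge0// ?sinv_ge0// lee_fin sqr_ge0.
have key t : 0 < t -> cnorm c <= t^-1 * (1 + fine E).
  move=> t0; have t2 : 0 < t ^- 2 by rewrite invr_gt0 exprn_gt0.
  have [h [hC hA he]] := af _ t2.
  have fhC := CcbD (- 1) hC fC.
  have := pairing_le fhC t0; rewrite (let: And3 _ _ e := fourier_dual fhC gi in e).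
  rewrite (_ : Cint _ _ = c); last first.
    apply: eq_Cint => x; rewrite /toC; have [Ax|nAx] := pselect (A x).
      by rewrite hA// mulr0 add0r.
    by rewrite (GA x nAx) !mulr0.
  move=> h1; rewrite -lee_fin; apply: (le_trans h1).
  rewrite mulrDr mulr1 EFinD EFinM fineK//; apply: leeD => //.
  rewrite (_ : t^-1 = t * t ^- 2); last by field; rewrite gt_eqF.
  by rewrite EFinM; apply: lee_wpmul2l; [rewrite lee_fin ltW|exact: ltW he].
apply/ler_addgt0Pr => e e0; rewrite add0r.
have p : 0 < (1 + fine E) / e by rewrite divr_gt0// ltr_wpDr.
apply: (le_trans (key _ p)); rewrite invf_div -mulrA mulVf ?mulr1//.
by rewrite gt_eqF// ltr_wpDr.
Qed.

End pairing.
(** A function of the weighted space [L^2(1/s)] whose transform is supported in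
    [A] is a linear functional that vanishes on every approximable function. *)
Lemma not_rigid_of_dual A r Q (g : Rn R d -> R[i]) :
  measurable A -> A `<=` cube r -> Cintegrable L g ->
  (\int[L]_u ((cnorm (g u) ^+ 2)%:E * sinv s u) < +oo)%E ->
  (forall x, ~ A x -> Cint L (fun u => g u * expi (- dotp u x)) = 0) ->
  Cint L (fun x => peval Q x * Cint L (fun u => g u * expi (- dotp u x))) != 0 ->
  ~ linearly_poly_rigid M A Q.
Proof.
move=> mA Ar gi Eoo GA /eqP QG.
have qC := Ccb_peval Q mA Ar.
pose q x := peval Q x * (\1_A x)%:C.
pose G x := Cint L (fun u => g u * expi (- dotp u x)).
move=> /(linearly_rigidP M _ qC)[aR aI]; apply: QG.
have vR := dual_vanishes gi Eoo GA (Ccb_Re qC) aR.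
have vI := dual_vanishes gi Eoo GA (Ccb_Im qC) aI.
rewrite -/G; transitivity (Cint L (fun x => (cRe (q x))%:C * G x + (0 +i* 1) * ((cIm (q x))%:C * G x))).
  apply: eq_Cint => x; rewrite mulrA -mulrDl; have [Ax|nAx] := pselect (A x); last first.
    by rewrite -/(G x) (_ : G x = 0) ?mulr0//; exact: GA.
  congr (_ * _); rewrite /q indicE mem_set//= mulr1.
  by apply: complex_ext => /=; ring.
have Gi (f : Rn R d -> R) : Ccb (toC f) -> Cintegrable L (fun x => (f x)%:C * G x).
  by move=> fC; have [_ +_] := fourier_dual fC gi.
rewrite CintD; [|exact: Gi (Ccb_Re qC)|apply: CintegrableZ; exact: Gi (Ccb_Im qC)].
by rewrite vR CintZ ?vI ?mulr0 ?addr0//; exact: Gi (Ccb_Im qC).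
Qed.

End duality.

(** * Kernels whose transform lives near a prescribed set *)

Section brep.
Context {R : realType} {d : nat}.
Local Notation L := (lebesgue_Rn R d).
Local Notation mu := (@lebesgue_measure R).
Implicit Types (B : set (Rn R d)) (chi : Rn R d -> R[i]).

(** The inverse Fourier transforms of complex measures carried by [B].  The
    measure is the image under [X] of a density [a] on an arbitrary space, which
    makes the class obviously stable under products and averages. *)
Definition brep B chi := exists (disp : measure_display) (T : measurableType disp)
    (m : {sigma_finite_measure set T -> \bar R}) (a : T -> R[i]) (X : T -> Rn R d),
  [/\ Cintegrable m a, measurable_fun setT X, forall w, a w != 0 -> B (X w) &
      forall u, chi u = Cint m (fun w => a w * expi (dotp u (X w)))].

Lemma cmeas_expi_dot (disp : measure_display) (T : measurableType disp)
    (X : T -> Rn R d) : measurable_fun setT X ->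
  cmeas (fun z : Rn R d * T => expi (dotp z.1 (X z.2))).
Proof.
move=> mX; apply: cmeas_expi; apply: measurable_dotp => //.
by apply: measurableT_comp => //; exact: measurable_snd.
Qed.

Lemma Cintegrable_rep (disp : measure_display) (T : measurableType disp)
    (m : {sigma_finite_measure set T -> \bar R}) (a : T -> R[i]) (X : T -> Rn R d) u :
  Cintegrable m a -> measurable_fun setT X ->
  Cintegrable m (fun w => a w * expi (dotp u (X w))).
Proof.
move=> ia mX; rewrite (_ : (fun w => _) = fun w => expi (dotp u (X w)) * a w); last first.
  by apply/funext => w; rewrite mulrC.
apply: Cintegrable_expiM => //; apply: measurable_dotp => //; exact: measurable_cst.
Qed.

Lemma Cintegrable_dual (g : Rn R d -> R[i]) x : Cintegrable L g ->
  Cintegrable L (fun u => g u * expi (- dotp u x)).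
Proof.
move=> gi; rewrite (_ : (fun u => _) = fun u => expi (- dotp u x) * g u); last first.
  by apply/funext => u; rewrite mulrC.
apply: Cintegrable_expiM => //; apply: measurableT_comp => //.
by apply: measurable_dotp => //; exact: measurable_cst.
Qed.

Lemma brep_cmeas B chi : brep B chi -> cmeas chi.
Proof.
move=> [disp [T [m [a [X [ia mX _ E]]]]]].
rewrite (_ : chi = fun u => Cint m (fun w => a w * expi (dotp u (X w)))); last exact/funext.
apply: (cmeas_Cint m (F := fun z => a z.2 * expi (dotp z.1 (X z.2)))).
apply: cmeasM; last exact: cmeas_expi_dot.
by apply: (cmeas_comp ia.1); exact: measurable_snd.
Qed.

Lemma brep_bounded B chi : brep B chi -> exists c, forall u, cnorm (chi u) <= c.
Proof.
move=> [disp [T [m [a [X [ia mX _ E]]]]]].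
exists (\int[m]_w cnorm (a w)) => u; rewrite E.
apply: le_trans (cnorm_Cint (Cintegrable_rep u ia mX)) _.
rewrite le_eqVlt; apply/orP; left; apply/eqP; apply: eq_Rintegral => w _.
by rewrite cnormM cnorm_expi mulr1.
Qed.

Lemma sub_brep B B' chi : B `<=` B' -> brep B chi -> brep B' chi.
Proof.
move=> BB' [disp [T [m [a [X [ia mX aX E]]]]]].
by exists disp, T, m, a, X; split=> // w /aX /BB'.
Qed.

Lemma eq_cube x r : (forall i, `|tnth x i| <= r) -> cube r (x : Rn R d).
Proof. by move=> h i; rewrite -ler_norml. Qed.

Section kernel.
Variables (del : R) (n : nat) (j : multi_index d).
Hypothesis del0 : 0 < del.
Hypothesis jn : forall i, ((j i).+1 < n)%N.

Definition sinc_mon (u : Rn R d) : R := \prod_(i < d) sinc_pow del (j i) n (tnth u i).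

Let sinc_ker_norm_le : exists2 c, 0 <= c &
  forall i y, cnorm (sinc_ker del (j i) n y) <= c.
Proof.
have /choice[c hc] : forall i, exists c, forall y, cnorm (sinc_ker del (j i) n y) <= c.
  by move=> i; exact: sinc_ker_bounded.
exists (\sum_i `|c i|) => [|i y]; first by rewrite sumr_ge0.
rewrite (le_trans (hc i y))// (le_trans (ler_norm _))// (bigD1 i)//= lerDl.
by rewrite sumr_ge0.
Qed.

Let sinc_ker_out i y : n%:R * del < `|y| -> sinc_ker del (j i) n y = 0.
Proof. by have [[_ _ h] _ _] := good_ker_exists del0 (jn i); exact: h. Qed.

Let cmeas_sinc_ker i : cmeas (sinc_ker del (j i) n : measurableTypeR R -> R[i]).
Proof. by have [[h _ _] _ _] := good_ker_exists del0 (jn i). Qed.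

Lemma Cintegrable_sinc_mon :
  Cintegrable L (fun u => (sinc_mon u)%:C).
Proof.
have h i : Cintegrable mu (fun v => (sinc_pow del (j i) n v)%:C * expi (- (v * 0))).
  exact: Cintegrable_sinc_pow.
have [+ _] := Cint_prod h; congr Cintegrable; apply/funext => u.
by rewrite /sinc_mon toC_prod; apply: eq_bigr => i _; rewrite mulr0 oppr0 expi0 mulr1.
Qed.

Let sinc_mon_expi u x : (sinc_mon u)%:C * expi (- dotp u x) =
  \prod_(i < d) ((sinc_pow del (j i) n (tnth u i))%:C * expi (- (tnth u i * tnth x i))).
Proof.
rewrite big_split -toC_prod -expi_sum; congr (_ * expi _).
by rewrite /dotp -sumrN.
Qed.

Section one_kernel.
Context (disp : measure_display) (T : measurableType disp).
Variables (m : {sigma_finite_measure set T -> \bar R}) (a : T -> R[i]) (X : T -> Rn R d).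
Variables (chi : Rn R d -> R[i]) (B : set (Rn R d)).
Hypotheses (ia : Cintegrable m a) (mX : measurable_fun setT X).
Hypothesis aX : forall w, a w != 0 -> B (X w).
Hypothesis chiE : forall u, chi u = Cint m (fun w => a w * expi (dotp u (X w))).

Let ker (x : Rn R d) w := \prod_(i < d) sinc_ker del (j i) n (tnth x i - tnth (X w) i).
Let G x := Cint m (fun w => a w * ker x w).

(** By Fubini the transform is a superposition of product kernels
    translated by the points [X w]. *)
Lemma Cint_kernel x : Cintegrable L (fun u => chi u * (sinc_mon u)%:C) /\
  Cint L (fun u => chi u * (sinc_mon u)%:C * expi (- dotp u x)) = G x.
Proof.
pose F (z : Rn R d * T) := (sinc_mon z.1)%:C * expi (- dotp z.1 x) *
  (a z.2 * expi (dotp z.1 (X z.2))).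
have is_ := Cintegrable_sinc_mon.
have mF : cmeas F.
  apply: cmeasM; [apply: cmeasM|apply: cmeasM].
  - exact: (cmeas_comp is_.1).
  - apply: cmeas_expi; apply: measurableT_comp => //.
    by apply: measurable_dotp => //; exact: measurable_cst.
  - by apply: (cmeas_comp ia.1); exact: measurable_snd.
  - exact: cmeas_expi_dot.
have [|_ i1 _ e1 e2] := Cfubini mF is_.2 ia.2.
  by move=> u w; rewrite /F !cnormM !cnorm_expi !mulr1.
have eF u : Cint m (fun w => F (u, w)) = chi u * (sinc_mon u)%:C * expi (- dotp u x).
  by rewrite /F /= (CintZ _ (Cintegrable_rep u ia mX)) -chiE; ring.
have i3 : Cintegrable L (fun u => chi u * (sinc_mon u)%:C).
  have mchi : cmeas chi by apply: (@brep_cmeas B); exists disp, T, m, a, X.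
  have [c hc] : exists c, forall u, cnorm (chi u) <= c.
    by apply: (@brep_bounded B); exists disp, T, m, a, X.
  exact: CintegrableM_bounded hc.
split=> //; transitivity (Cint L (fun u => Cint m (fun w => F (u, w)))).
  by apply: eq_Cint => u; rewrite eF.
rewrite e1 -e2; apply: eq_Cint => w; rewrite /ker.
transitivity (Cint L (fun u => a w * \prod_(i < d)
    ((sinc_pow del (j i) n (tnth u i))%:C * expi (- (tnth u i * (tnth x i - tnth (X w) i)))))).
  apply: eq_Cint => u; rewrite /F /=; set t := _ * (_ * _).
  have -> : t = a w * ((sinc_mon u)%:C * expi (- dotp u (vsub x (X w)))).
    rewrite dotpBr (_ : - (_ - _) = - dotp u x + dotp u (X w)); last by ring.
    by rewrite /t expiD; ring.
  rewrite sinc_mon_expi; congr (_ * _); apply: eq_bigr => i _.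
  by rewrite tnthE.
have h i : Cintegrable mu (fun v => (sinc_pow del (j i) n v)%:C *
    expi (- (v * (tnth x i - tnth (X w) i)))) by exact: Cintegrable_sinc_pow.
by have [i4 e4] := Cint_prod h; rewrite (CintZ _ i4) e4.
Qed.

Lemma kernel_support A x :
  (forall x t, B t -> cube (n%:R * del) (vsub x t) -> A x) -> ~ A x -> G x = 0.
Proof.
move=> BA nAx; rewrite -[RHS](Cint0 m); apply: eq_Cint => w.
have [->|aw] := eqVneq (a w) 0; first by rewrite mul0r.
have : exists i, n%:R * del < `|tnth x i - tnth (X w) i|.
  apply: contrapT => /forallNP h; apply/nAx/(BA _ _ (aX aw))/eq_cube => i.
  by rewrite tnthE leNgt; apply/negP.
by move=> [i /sinc_ker_out hi]; rewrite /ker (bigD1 i)//= hi mul0r mulr0.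
Qed.

Hypothesis Br : exists r, B `<=` cube r.

(** The moments of a translated product kernel are products of moments in
    one variable: a factor of too low an order makes them vanish, and at
    the order [j] they do not depend on the translation, which leaves the
    total mass [chi vzero] of the measure. *)
Lemma kernel_moment (k : multi_index d) :
  (exists i, (k i < j i)%N) \/ k = j ->
  Cintegrable L (fun x => (\prod_(i < d) (tnth x i)%:C ^+ k i) * G x) /\
  Cint L (fun x => (\prod_(i < d) (tnth x i)%:C ^+ k i) * G x) =
  if k == j then chi vzero * \prod_(i < d) moment (sinc_ker del (j i) n) (j i) else 0.
Proof.
move=> kj; have [r Brr] := Br; have [c c0 kc] := sinc_ker_norm_le.
pose r' := `|r| + n%:R * del.
have r'0 : 0 <= r' by rewrite addr_ge0// mulr_ge0// ltW.
pose F (z : Rn R d * T) := (\prod_(i < d) (tnth z.1 i)%:C ^+ k i) * (a z.2 * ker z.1 z.2).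
have mF : cmeas F.
  apply: cmeasM; last apply: cmeasM.
  - apply: cmeas_prod => i; apply: cmeasX; apply: cmeas_toC.
    by apply: measurableT_comp (measurable_tnthR i) _; exact: measurable_fst.
  - by apply: (cmeas_comp ia.1); exact: measurable_snd.
  - apply: cmeas_prod => i; apply: (cmeas_comp (cmeas_sinc_ker i)).
    apply: measurable_funB.
      by apply: measurableT_comp (measurable_tnthR i) _; exact: measurable_fst.
    by apply: measurableT_comp (measurable_tnthR i) _; apply: measurableT_comp.
pose C := (\prod_(i < d) r' ^+ k i) * (\prod_(i < d) c).
have FB x w : cnorm (F (x, w)) <= C * \1_(cube r') x * cnorm (a w).
  have [aw|aw] := eqVneq (a w) 0.
    by rewrite /F /= aw mul0r mulr0 cnorm0 mulr0.
  rewrite /F /= !cnormM !cnorm_prod indicE; case: (boolP (x \in _)) => xr; last first.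
    have [i hi] : exists i, n%:R * del < `|tnth x i - tnth (X w) i|.
      apply: contrapT => /forallNP h; move: xr; rewrite notin_setE; apply.
      apply: eq_cube => i; have /negP := h i; rewrite -leNgt => hi.
      have := Brr _ (aX aw) i; rewrite -ler_norml => Xi.
      rewrite -[tnth x i](subrK (tnth (X w) i)) (le_trans (ler_normD _ _))// addrC lerD//.
      by rewrite (le_trans Xi)// ler_norm.
    have -> : \prod_i0 cnorm (sinc_ker del (j i0) n (tnth x i0 - tnth (X w) i0)) = 0.
      by rewrite (bigD1 i)//= sinc_ker_out// cnorm0 mul0r.
    by rewrite !mulr0 mul0r.
  rewrite mulr1 mulrCA mulrC ler_wpM2r ?cnorm_ge0// ler_pM ?prodr_ge0//.
  - by move=> i _; exact: cnorm_ge0.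
  - by move=> i _; exact: cnorm_ge0.
  - rewrite ler_prod// => i _; rewrite cnorm_ge0 cnormX cnorm_toC lerXn2r ?nnegrE//.
    by move: xr; rewrite inE => /(_ i); rewrite ler_norml.
  - rewrite ler_prod// => i _.
    by rewrite cnorm_ge0 kc.
have [_ i1 _ e1 e2] := Cfubini mF (integrable_cst_cube C r'0) ia.2 FB.
pose P w := \prod_(i < d) moment (fun y => sinc_ker del (j i) n (y - tnth (X w) i)) (k i).
have eG : (fun x => (\prod_(i < d) (tnth x i)%:C ^+ k i) * G x) =
    (fun x => Cint m (fun w => F (x, w))).
  apply/funext => x; rewrite /G -CintZ//.
  rewrite (_ : (fun w => _) = (fun w => ker x w * a w)); last first.
    by apply/funext => w; rewrite mulrC.
  apply: (@CintegrableM_bounded _ _ _ _ _ _ (\prod_(i < d) c)) => // [|w].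
    apply: cmeas_prod => i; apply: (cmeas_comp (cmeas_sinc_ker i)).
    by apply: measurable_funB => //; apply: measurableT_comp (measurable_tnthR i) _.
  rewrite cnorm_prod ler_prod// => i _.
  by rewrite cnorm_ge0 kc.
rewrite eG; split; first exact: i1.
rewrite e1 -e2; transitivity (Cint m (fun w => a w * P w)).
  apply: eq_Cint => w; rewrite /P.
  have h i : Cintegrable mu (fun y => (y ^+ k i)%:C * sinc_ker del (j i) n (y - tnth (X w) i)).
    have [[mk [c' kc'] k0] _ _] := good_ker_exists del0 (jn i).
    pose b := `|n%:R * del| + `|tnth (X w) i|.
    have b0 : 0 <= b by rewrite addr_ge0.
    apply: (@bounded_supp_integrable _ _ b); apply: bounded_suppX => //; split.
    - by apply: (cmeas_comp mk); exact: measurable_funB.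
    - by exists c' => y.
    - move=> y yb; apply: k0; rewrite (le_lt_trans (ler_norm _))//.
      have := ler_normD (y - tnth (X w) i) (tnth (X w) i); rewrite subrK.
      by move: yb; rewrite /b; lra.
  have [i2 e3] := Cint_prod h; rewrite -e3 -(CintZ _ i2); apply: eq_Cint => x.
  rewrite /F /= mulrCA; congr (_ * _); rewrite big_split; congr (_ * _).
  by apply: eq_bigr => i _; rewrite toCX.
have [kjE|kjN] := eqVneq k j.
  rewrite chiE -CintZr; last exact: Cintegrable_rep.
  have PE w : P w = \prod_(i < d) moment (sinc_ker del (j i) n) (j i).
    apply: eq_bigr => i _; rewrite kjE (moment_sinc_ker_shift _ del0 (jn i) (leqnn _)).
    by rewrite eqxx.
  by apply: eq_Cint => w; rewrite dotpC dotp0r expi0 mulr1 PE.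
case: kj => [[i ki]|/eqP]; last by rewrite (negbTE kjN).
rewrite -[RHS](Cint0 m); apply: eq_Cint => w; rewrite /P (bigD1 i)//=.
by rewrite (moment_sinc_ker_shift _ del0 (jn i) (ltnW ki)) (ltn_eqF ki) mul0r mulr0.
Qed.

End one_kernel.
End kernel.
End brep.

Lemma Cint_sum_seq {R : realType} {disp : measure_display} {T : measurableType disp}
    (m : {measure set T -> \bar R}) (I : eqType) (r : seq I) (F : I -> T -> R[i]) :
  (forall i, i \in r -> Cintegrable m (F i)) ->
  Cintegrable m (fun x => \sum_(i <- r) F i x) /\
  Cint m (fun x => \sum_(i <- r) F i x) = \sum_(i <- r) Cint m (F i).
Proof.
move=> h; pose F' i := if i \in r then F i else fun=> 0.
have iF' i : Cintegrable m (F' i).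
  by rewrite /F'; case: ifP => [/h//|_]; exact: Cintegrable0.
have -> : (fun x => \sum_(i <- r) F i x) = fun x => \sum_(i <- r) F' i x.
  by apply/funext => x; apply: eq_big_seq => i ir; rewrite /F' ir.
split; first exact: Cintegrable_sum.
by rewrite Cint_sum//; apply: eq_big_seq => i ir; rewrite /F' ir.
Qed.

Section assembly.
Context {disp : measure_display} {T : measurableType disp} {R : realType}.
Context {P : probability T R} {d : nat}.
Variables (M : wss_measure P d) (s : Rn R d -> R).
Hypothesis hs : is_spectral_density M s.
Local Notation L := (lebesgue_Rn R d).

(** The monomials of [W] select the moment of order [k0] only: those of [Q] are
    below [k0], and the moments of order [m] of the kernel of index [j] vanish
    as soon as [m] is not above [j]. *)
Lemma brep_not_rigid (A B : set (Rn R d)) rA rB rho chi k0 (Q W : cpoly R d) :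
  measurable A -> A `<=` cube rA -> B `<=` cube rB -> brep B chi -> chi vzero != 0 ->
  0 < rho -> (forall x t, B t -> cube rho (vsub x t) -> A x) ->
  mpoly.mcoeff k0 Q != 0 -> (forall m, mpoly.mcoeff m Q != 0 -> mpoly.lem m k0) ->
  mpoly.mcoeff k0 W != 0 ->
  (forall j, mpoly.mcoeff j W != 0 -> mpoly.lem j k0 -> j = k0) ->
  (exists N, forall n del, (N <= n)%N -> 0 < del ->
    (\int[L]_u ((cnorm (chi u * peval W u *
       (\prod_(i < d) sinc (del * tnth u i) ^+ n)%:C) ^+ 2)%:E * sinv s u) < +oo)%E) ->
  ~ linearly_poly_rigid M A Q.
Proof.
move=> mA Ar Br brepchi chi0 rho0 BA Qk0 Qle Wk0 Wle [N hN].
(* [n] exceeds the exponents of [W] by 2, which makes the kernels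
   integrable, and [del] is such that their supports have half side [n del =
   rho]. *)
pose n := (N + 2 + \sum_(j <- mpoly.msupp W) \sum_(i < d) j i)%N.
have n0 : (0 < n)%N by rewrite /n -addnA addnCA.
pose del := rho / n%:R; have del0 : 0 < del by rewrite divr_gt0// ltr0n.
have ndel : n%:R * del = rho by rewrite mulrC divfK// pnatr_eq0 -lt0n.
have jn j : j \in mpoly.msupp W -> forall i, ((j i).+1 < n)%N.
  by move=> jW i; rewrite /n (big_rem j)//= (bigD1 i)//=; lia.
have [ds [T' [m [a [X [ia mX aX chiE]]]]]] := brepchi.
pose g u := chi u * peval W u * (\prod_(i < d) sinc (del * tnth u i) ^+ n)%:C.
pose K j u := chi u * (sinc_mon del n j u)%:C.
have gE u : g u = \sum_(j <- mpoly.msupp W) mpoly.mcoeff j W * K j u.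
  rewrite /g pevalE mulr_sumr mulr_suml; apply: eq_bigr => j _.
  rewrite /K /sinc_mon /sinc_pow big_split toCM !toC_prod.
  rewrite (eq_bigr (fun i => (tnth u i ^+ j i)%:C)) => [|i _]; last by rewrite toCX.
  ring.
have ck j x (jW : j \in mpoly.msupp W) :=
  Cint_kernel del0 (jn j jW) ia mX aX chiE x.
pose G j x := Cint L (fun u => K j u * expi (- dotp u x)).
have iK j : j \in mpoly.msupp W -> Cintegrable L (K j).
  by move=> jW; have [] := ck j vzero jW.
have iKe j x : j \in mpoly.msupp W -> Cintegrable L (fun u => K j u * expi (- dotp u x)).
  by move=> jW; exact: Cintegrable_dual (iK j jW).
have ig : Cintegrable L g.
  rewrite (_ : g = fun u => \sum_(j <- mpoly.msupp W) mpoly.mcoeff j W * K j u); last exact/funext.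
  have ii j : j \in mpoly.msupp W -> Cintegrable L (fun u => mpoly.mcoeff j W * K j u).
    by move=> jW; apply: CintegrableZ; exact: iK.
  by have [] := Cint_sum_seq ii.
have GE x : Cint L (fun u => g u * expi (- dotp u x)) =
    \sum_(j <- mpoly.msupp W) mpoly.mcoeff j W * G j x.
  pose F j u := mpoly.mcoeff j W * (K j u * expi (- dotp u x)).
  have iF j : j \in mpoly.msupp W -> Cintegrable L (F j).
    by move=> jW; apply: CintegrableZ; exact: iKe.
  have [_ e] := Cint_sum_seq iF.
  transitivity (Cint L (fun u => \sum_(j <- mpoly.msupp W) F j u)).
    apply: eq_Cint => u; rewrite gE mulr_suml; apply: eq_bigr => j _.
    exact/esym/mulrA.
  rewrite e; apply: eq_big_seq => j jW; rewrite /F CintZ//; exact: iKe.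
have Ggood j x : j \in mpoly.msupp W -> ~ A x -> G j x = 0.
  move=> jW nAx; rewrite /G (ck j x jW).2.
  have BA' y t : B t -> cube (n%:R * del) (vsub y t) -> A y by rewrite ndel; exact: BA.
  exact: (kernel_support del0 (jn j jW) m aX BA' nAx).
apply: (not_rigid_of_dual hs mA Ar ig); first by apply: hN => //; rewrite /n -addnA leq_addr.
  by move=> x nAx; rewrite GE big_seq big1// => j jW; rewrite Ggood// mulr0.
pose H k j x := \prod_(i < d) (tnth x i)%:C ^+ k i * G j x.
have km k j : k \in mpoly.msupp Q -> j \in mpoly.msupp W ->
    Cintegrable L (H k j) /\ Cint L (H k j) =
    if k == j then chi vzero * \prod_(i < d) moment (sinc_ker del (j i) n) (j i) else 0.
  move=> kQ jW.
  have eG : G j = (fun x => Cint m (fun w => a w *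
      \prod_(i < d) sinc_ker del (j i) n (tnth x i - tnth (X w) i))).
    by apply/funext => x; rewrite /G (ck j x jW).2.
  rewrite /H eG; apply: (kernel_moment del0 (jn j jW) ia mX aX chiE); first by exists rB.
  have [->|kj] := eqVneq k j; [by right|left].
  apply: contrapT => /forallNP h; move/eqP: kj; apply.
  (* Otherwise [j] is below [k], itself below [k0], and both are equal to
     [k0]. *)
  have jk : mpoly.lem j k.
    by apply/mpoly.mnm_lepP => i; rewrite leqNgt; apply/negP/h.
  have kk0 := Qle _ (etrans (esym (mpoly.mcoeff_msupp _ _)) kQ).
  have jk0 : j = k0.
    by apply: Wle; [rewrite -mpoly.mcoeff_msupp|exact: mpoly.lepm_trans jk kk0].
  apply/mpoly.mnmP => i; apply/eqP; rewrite eqn_leq (mpoly.mnm_lepP jk) andbT jk0.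
  exact: (mpoly.mnm_lepP kk0).
have k0Q : k0 \in mpoly.msupp Q by rewrite mpoly.mcoeff_msupp.
have k0W : k0 \in mpoly.msupp W by rewrite mpoly.mcoeff_msupp.
have [cc cc0 km'] : exists2 cc : multi_index d -> R[i], cc k0 != 0 &
    forall k j, k \in mpoly.msupp Q -> j \in mpoly.msupp W ->
    Cintegrable L (H k j) /\ Cint L (H k j) = if k == j then cc j else 0.
  exists (fun j => chi vzero * \prod_(i < d) moment (sinc_ker del (j i) n) (j i)); last exact: km.
  rewrite mulf_neq0// prodf_seq_neq0; apply/allP => i _ /=.
  by have [_ _] := good_ker_exists del0 (jn k0 k0W i).
pose HQ k x := mpoly.mcoeff k Q * \sum_(j <- mpoly.msupp W) mpoly.mcoeff j W * H k j x.
have i1 k j : k \in mpoly.msupp Q -> j \in mpoly.msupp W ->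
    Cintegrable L (fun x => mpoly.mcoeff j W * H k j x).
  by move=> kQ jW; apply: CintegrableZ; have [] := km' k j kQ jW.
have i2 k : k \in mpoly.msupp Q -> Cintegrable L (HQ k) /\
    Cint L (HQ k) = mpoly.mcoeff k Q * \sum_(j <- mpoly.msupp W)
      (mpoly.mcoeff j W * if k == j then cc j else 0).
  move=> kQ; have [i3 e3] := Cint_sum_seq (fun j jW => i1 k j kQ jW).
  split; first by apply: CintegrableZ.
  rewrite CintZ// e3; congr (_ * _); apply: eq_big_seq => j jW.
  by have [i4 <-] := km' k j kQ jW; rewrite CintZ.
have [_ e] := Cint_sum_seq (fun k kQ => (i2 k kQ).1).
rewrite (_ : Cint _ _ = Cint L (fun x => \sum_(k <- mpoly.msupp Q) HQ k x)); last first.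
  apply: eq_Cint => x; rewrite GE pevalE mulr_suml; apply: eq_bigr => k _.
  rewrite /HQ -mulrA; congr (_ * _); rewrite mulr_sumr; apply: eq_bigr => j _.
  by rewrite /H mulrCA.
rewrite e (bigD1_seq k0)//= ?mpoly.msupp_uniq// big_seq_cond big1 ?addr0 => [|k /andP[kQ kk0]].
  rewrite (i2 k0 k0Q).2 (bigD1_seq k0)//= ?mpoly.msupp_uniq// eqxx big1 ?addr0.
    by rewrite !mulf_neq0.
  by move=> j jk0; rewrite eq_sym (negbTE jk0) mulr0.
rewrite (i2 k kQ).2 big_seq big1 ?mulr0// => j jW; case: eqP => [kj|_]; last by rewrite mulr0.
move: kk0; rewrite kj (Wle j) ?eqxx//; first by rewrite -mpoly.mcoeff_msupp.
by rewrite -kj; apply: Qle; rewrite -mpoly.mcoeff_msupp.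
Qed.

End assembly.

(** * Integrability of weighted kernels *)

Section growth.
Context {R : realType} {d : nat}.
Local Notation L := (lebesgue_Rn R d).
Implicit Types (F : Rn R d -> \bar R).

Lemma one_enorm_le_prod (u : Rn R d) : 1 + enorm u <= \prod_(i < d) (1 + `|tnth u i|).
Proof.
apply: (@le_trans _ _ (1 + \sum_(i < d) `|tnth u i|)).
  by rewrite lerD2l enorm_le_sum.
suff [] : 0 <= \sum_(i < d) `|tnth u i| /\
    1 + \sum_(i < d) `|tnth u i| <= \prod_(i < d) (1 + `|tnth u i|) by [].
elim/big_rec2 : _ => [|i p q _ [q0 qp]]; first by rewrite addr0.
have := normr_ge0 (tnth u i); split; first by rewrite addr_ge0.
by nra.
Qed.

Lemma sinc_prod_le del n : 0 < del -> exists2 C, 0 < C & forall u : Rn R d,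
  `|\prod_(i < d) sinc (del * tnth u i) ^+ n| <= C * (1 + enorm u) ^- n.
Proof.
move=> del0; have [c c0 h] := sinc_pow_bound 0 n del0.
exists (\prod_(i < d) c) => [|u]; first by rewrite prodr_gt0.
have u0 : 0 < 1 + enorm u by rewrite ltr_pwDl// enorm_ge0.
rewrite ler_pdivlMr ?exprn_gt0//.
apply: (@le_trans _ _ (`|\prod_(i < d) sinc (del * tnth u i) ^+ n| *
    (\prod_(i < d) (1 + `|tnth u i|)) ^+ n)).
  rewrite ler_wpM2l// lerXn2r ?one_enorm_le_prod// nnegrE ?ltW// .
  by rewrite prodr_gt0// => i _; rewrite ltr_pwDl.
rewrite normr_prod -prodrXl -big_split ler_prod// => i _; apply/andP; split.
  by rewrite mulr_ge0// exprn_ge0// addr_ge0.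
by have := h (tnth u i); rewrite /sinc_pow !expr0 mul1r mulr1.
Qed.

Lemma peval_growth (P : cpoly R d) : exists D C, 0 <= C /\
  forall u, cnorm (peval P u) <= C * (1 + enorm u) ^+ D.
Proof.
pose D := (\sum_(m <- mpoly.msupp P) \sum_(i < d) m i)%N.
exists D, (\sum_(m <- mpoly.msupp P) cnorm (mpoly.mcoeff m P)); split.
  by rewrite sumr_ge0// => m _; exact: cnorm_ge0.
move=> u; rewrite pevalE (le_trans (cnorm_sum _ _))// mulr_suml.
rewrite big_seq [leRHS]big_seq ler_sum// => m mP; rewrite cnormM ler_wpM2l ?cnorm_ge0//.
have u1 : 1 <= 1 + enorm u by rewrite lerDl enorm_ge0.
apply: (@le_trans _ _ (\prod_(i < d) (1 + enorm u) ^+ m i)).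
  rewrite cnorm_prod ler_prod// => i _; rewrite cnorm_ge0 cnormX cnorm_toC/=.
  rewrite lerXn2r ?nnegrE// ?(le_trans ler01)//.
  by rewrite (le_trans (ler_norm_tnth _ _))// lerDr.
by rewrite prodrXr ler_weXn2l// /D (big_rem m)//= leq_addr.
Qed.

(** The power is at most a product of [d] integrable functions of one
    variable. *)
Lemma integral_enorm_pow_lty m : (2 * d <= m)%N ->
  (\int[L]_u ((1 + enorm u) ^- m)%:E < +oo)%E.
Proof.
move=> dm; have h (i : 'I_d) : Cintegrable (@lebesgue_measure R)
    (fun v => ((1 + `|v|) ^- 2)%:C).
  apply: (@dominated_invsq _ _ 1) => [|v].
    apply: cmeas_toC; apply: (measurableT_comp measurable_invr); apply: measurable_funX.
    by apply: measurable_funD => //; exact: measurableT_comp.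
  by rewrite cnorm_toC mul1r ger0_norm// invr_ge0 exprn_ge0// addr_ge0.
have [[mp /integrableP[_ ip]] _] := Cint_prod h; apply: le_lt_trans ip.
apply: ge0_le_integral => //.
- by move=> u _; rewrite lee_fin invr_ge0 exprn_ge0// addr_ge0// enorm_ge0.
- apply/measurable_EFinP; apply: (measurableT_comp measurable_invr).
  by apply: measurable_funX; apply: measurable_funD => //; exact: measurable_enorm.
- apply: measurableT_comp => //; apply/measurable_EFinP; exact: measurable_cnorm.
move=> u _; rewrite /= lee_fin -toC_prod cnorm_toC normr_id prodfV prodrXl.
have p1 : 1 <= 1 + enorm u by rewrite lerDl enorm_ge0.
have p0 : 0 < \prod_(i < d) (1 + `|tnth u i|) by apply: prodr_gt0 => i _; rewrite ltr_pwDl.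
rewrite ger0_norm ?invr_ge0 ?exprn_ge0 ?(ltW p0)//.
rewrite lef_pV2 ?posrE ?exprn_gt0 ?(lt_le_trans ltr01 p1)//.
apply: (@le_trans _ _ ((1 + enorm u) ^+ (2 * d))); last exact: ler_weXn2l.
rewrite mulnC exprM lerXn2r ?nnegrE ?exprn_ge0 ?(ltW p0) ?(le_trans ler01 p1)//.
apply: (@le_trans _ _ (\prod_(i < d) (1 + enorm u))); last by rewrite prodr_const card_ord.
by apply: ler_prod => i _; rewrite addr_ge0//= lerD2l ler_norm_tnth.
Qed.

(** Compactness of cubes. *)
Lemma integral_cube_lty F : measurable_fun setT F -> (forall u, 0 <= F u)%E ->
  (forall v, exists2 e : R, 0 < e & (\int[L]_(u in eball v e) F u < +oo)%E) ->
  forall r, (\int[L]_(u in cube r) F u < +oo)%E.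
Proof.
move=> mF F0 Fl r.
have /choice[e he] : forall v, exists e : R, 0 < e /\ (\int[L]_(u in eball v e) F u < +oo)%E.
  by move=> v; have [e e0 h] := Fl v; exists e.
pose tov (x : 'rV[R]_d) : Rn R d := [tuple x ord0 i | i < d].
(* Balls of row vectors are cubes; such a cube is inside the Euclidean ball
   of radius [e] when its half side is at most [e / (d + 1)]. *)
pose rad x := e (tov x) / (d%:R + 1).
have rad0 x : 0 < rad x by rewrite divr_gt0 ?(he _).1// ltr_wpDl.
have := @rV_compact R d (fun _ => `[- r, r]%classic) (fun _ => @segment_compact _ _ _).
set K := [set v | _]; rewrite compact_cover => /(_ _ setT (fun x => ball x (rad x))).
move=> []; [by move=> x _; exact: ball_open|by move=> x _; exists x => //; exact: ballxx|].
move=> D _ KD; pose B x := eball (tov x) (e (tov x)).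
have mB x : measurable (B x) by exact: measurable_eball.
have mFB x : measurable_fun setT (F \_ (B x)).
  by apply/(measurable_restrictT _ (mB x)); exact: measurable_funTS.
have FB0 x u : (0 <= (F \_ (B x)) u)%E by apply: erestrict_ge0.
apply: (@le_lt_trans _ _ (\sum_(x <- finmap.enum_fset D) \int[L]_(u in B x) F u)%E);
    last first.
  elim/big_ind : _ => //; first by move=> *; exact: lte_add_pinfty.
  by move=> x _; exact: (he _).2.
under eq_bigr do rewrite integral_mkcond.
rewrite -ge0_integral_sum// [leLHS]integral_mkcond.
apply: ge0_le_integral => //.
- by move=> u _; apply: erestrict_ge0.
- by apply/(measurable_restrictT _ (measurable_cube r)); exact: measurable_funTS.
- by apply: emeasurable_sum.
move=> u _; rewrite patchE; case: ifPn => [|_]; last first.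
  by apply: sume_ge0 => x _; exact: FB0.
rewrite inE => ur; pose x : 'rV[R]_d := \row_i tnth u i.
have [|y yD xy] := KD x; first by move=> i; rewrite /= mxE in_itv/=; exact: ur.
rewrite (big_rem y)//= -[leLHS]adde0 leeD//; last by apply: sume_ge0 => z _; exact: FB0.
rewrite patchE mem_set// /B /eball /=.
have : enorm (vsub u (tov y)) <= d%:R * rad y.
  apply: enorm_cube => i; rewrite -ler_norml !tnthE -normrN opprB ltW//.
  by have := xy.2 ord0 i; rewrite mxE /tov tnth_mktuple.
move=> /le_lt_trans; apply.
by rewrite /rad mulrA ltr_pdivrMr ?ltr_wpDl// mulrC ltr_pM2l ?(he _).1// ltrDl.
Qed.

End growth.

(** * Lowest monomials *)

Section lowest.
Context {R : realType} {d : nat}.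
Implicit Types (P : cpoly R d) (k : multi_index d).

(** The exponent [k] is minimal in [P], so that its coefficient survives
    under multiplication by a polynomial with non-zero constant term. *)
Definition lowest k P := mpoly.mcoeff k P != 0 /\
  forall j, mpoly.mcoeff j P != 0 -> mpoly.lem j k -> j = k.

Lemma mcoeffM_neq0 P P' j : mpoly.mcoeff j (P * P') != 0 ->
  exists a b, [/\ j = mpoly.mnm_add a b, mpoly.mcoeff a P != 0 & mpoly.mcoeff b P' != 0].
Proof.
rewrite mpoly.mcoeffM => h; apply: contrapT => nex; move/eqP: h; apply.
apply: big1 => -[a b] /= /eqP jab; apply/eqP; rewrite mulf_eq0.
have [//|a0] := eqVneq (mpoly.mcoeff a P) 0; have [//|b0] := eqVneq (mpoly.mcoeff b P') 0.
by exfalso; apply: nex; exists a, b.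
Qed.

Lemma lowest_exists k P : mpoly.mcoeff k P != 0 -> exists2 k', mpoly.lem k' k & lowest k' P.
Proof.
have [n] := ubnP (mpoly.mdeg k); elim: n k => // n IH k kn Pk.
have [[j [Pj jk jk']]|nex] := pselect (exists j, [/\ mpoly.mcoeff j P != 0, mpoly.lem j k & j != k]).
  have [|k' k'j lk'] := IH j _ Pj; last by exists k' => //; exact: mpoly.lepm_trans k'j jk.
  suff : (0 < mpoly.mdeg (mpoly.mnm_sub k j))%N.
    by move: kn; rewrite -{1}(mpoly.submK jk) mpoly.mdegD; lia.
  rewrite lt0n mpoly.mdeg_eq0; apply: contra jk' => /eqP kj0.
  by rewrite -(mpoly.submK jk) kj0 mpoly.add0m.
exists k; first exact: mpoly.lepm_refl.
split=> // j Pj jk; apply/eqP; apply: contrapT => /negP jk'.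
by apply: nex; exists j.
Qed.

(** A product of monomials that gives the exponent [k], or one below,
    contains an exponent of [P] below [k], hence [k] itself by minimality. *)
Lemma lowestM k P P' : lowest k P -> mpoly.mcoeff (mpoly.mnm0) P' != 0 -> lowest k (P * P').
Proof.
move=> [Pk Pl] P'0; split=> [|j /mcoeffM_neq0[a [b [-> Pa Pb]]] jk]; last first.
  have ak : a = k by apply: Pl => //; apply: mpoly.lepm_trans jk; exact: mpoly.lem_addr.
  rewrite ak in jk *; apply/mpoly.mnmP => i; have := mpoly.mnm_lepP jk i.
  by rewrite mpoly.mnmDE; lia.
pose c := mpoly.mcoeff (mpoly.mnm0) P'; pose P1 := P' - mpoly.mpolyC d c.
have -> : P' = mpoly.mpolyC d c + P1 by rewrite addrC subrK.
rewrite mulrDr mpoly.mcoeffD mulrC mpoly.mcoeffCM.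
suff -> : mpoly.mcoeff k (P * P1) = 0 by rewrite addr0 mulf_neq0.
apply/eqP; apply: contrapT => /negP /mcoeffM_neq0[a [b [kab Pa]]].
have ak : a = k by apply: Pl => //; rewrite kab; exact: mpoly.lem_addr.
have -> : b = mpoly.mnm0.
  apply/mpoly.mnmP => i; have := congr1 (fun m : multi_index d => m i) kab.
  by rewrite ak mpoly.mnmDE mpoly.mnm0E; lia.
by rewrite /P1 mpoly.mcoeffB mpoly.mcoeffC eqxx mulr1 subrr eqxx.
Qed.

Lemma lowestMX k m P : lowest k P -> lowest (mpoly.mnm_add m k) (P * mpoly.mpolyX _ m).
Proof.
move=> [Pk Pl]; split; first by rewrite mpoly.mcoeffMX.
move=> j /mcoeffM_neq0[a [b [-> Pa]]]; rewrite mpoly.mcoeffX => mb.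
have {mb}<- : m = b by apply/eqP; apply: contraNT mb => /negbTE ->.
move=> /mpoly.mnm_lepP h; rewrite (Pl a Pa) 1?mpoly.addmC//.
by apply/mpoly.mnm_lepP => i; have := h i; rewrite !mpoly.mnmDE; lia.
Qed.

End lowest.

(** * Simple densities *)

Section simple.
Context {disp : measure_display} {T : measurableType disp} {R : realType}.
Context {P : probability T R} {d : nat}.
Variables (M : wss_measure P d) (s : Rn R d -> R).
Hypothesis hs : is_spectral_density M s.
Local Notation L := (lebesgue_Rn R d).
Implicit Types (u v : Rn R d) (W : cpoly R d).

Lemma peval_vzero W : peval W vzero = mpoly.mcoeff mpoly.mnm0 W.
Proof.
rewrite pevalE; have h m : m != mpoly.mnm0 ->
    mpoly.mcoeff m W * \prod_(i < d) (tnth (@vzero R d) i)%:C ^+ m i = 0.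
  move=> m0; have [i mi] : exists i, m i != 0%N.
    apply: contrapT => /forallNP h; move/eqP: m0; apply; apply/mpoly.mnmP => i.
    by rewrite mpoly.mnm0E; apply/eqP; have /negP := h i; rewrite negbK.
  by rewrite (bigD1 i)//= tnthE expr0n (negbTE mi) mul0r mulr0.
have h0 : \prod_(i < d) (tnth (@vzero R d) i)%:C ^+ (mpoly.mnm0 : multi_index d) i = 1.
  by apply: big1 => i _; rewrite mpoly.mnm0E expr0.
have [m0|m0] := boolP (mpoly.mnm0 \in mpoly.msupp W).
  by rewrite (bigD1_seq _ m0 (mpoly.msupp_uniq W))//= h0 mulr1 big1 ?addr0.
rewrite (mpoly.memN_msupp_eq0 m0) big_seq big1// => m mW; apply: h.
by apply: contraNneq m0 => <-.
Qed.

Lemma peval_local_bound W v e : 0 < e -> exists2 K, 0 <= K &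
  forall u, eball v e u -> cnorm (peval W u) ^+ 2 <= K.
Proof.
move=> e0; have [c hc] := peval_bound W (enorm v + e).
exists (`|c| ^+ 2) => [|u uv]; first exact: sqr_ge0.
rewrite lerXn2r ?nnegrE ?cnorm_ge0// (le_trans _ (ler_norm c))// hc//.
apply: eq_cube => i; rewrite (le_trans (ler_norm_tnth u i))//.
have -> : u = vadd (vsub u v) v by apply: eq_from_tnth => j; rewrite !tnthE subrK.
by rewrite (le_trans (enormD _ _))// addrC lerD2l ltW.
Qed.

Definition weighted W u : \bar R := ((cnorm (peval W u) ^+ 2)%:E * sinv s u)%E.

Lemma measurable_weighted W : measurable_fun setT (weighted W).
Proof.
apply: emeasurable_funM; last exact: measurable_sinv hs.
apply/measurable_EFinP; apply: measurable_funX; apply: measurable_cnorm.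
exact: cmeas_peval.
Qed.

Lemma weighted_ge0 W u : (0 <= weighted W u)%E.
Proof. by rewrite mule_ge0// ?(sinv_ge0 hs)// lee_fin sqr_ge0. Qed.

Let weighted_local W v e (H : Rn R d -> R) : 0 < e ->
  measurable_fun setT H -> (forall u, 0 <= H u) ->
  (exists2 K, 0 <= K & forall u, eball v e u -> cnorm (peval W u) ^+ 2 <= K * H u) ->
  (\int[L]_(u in eball v e) ((H u)%:E * sinv s u) < +oo)%E ->
  (\int[L]_(u in eball v e) weighted W u < +oo)%E.
Proof.
move=> e0 mH H0 [K K0 WK] Hoo; have mB := measurable_eball v e.
have mHs : measurable_fun setT (fun u => (H u)%:E * sinv s u)%E.
  by apply: emeasurable_funM; [exact/measurable_EFinP|exact: measurable_sinv hs].
apply: (@le_lt_trans _ _ (\int[L]_(u in eball v e) (K%:E * ((H u)%:E * sinv s u)))%E).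
  apply: ge0_le_integral => //.
  - by move=> u _; exact: weighted_ge0.
  - by apply: measurable_funTS; exact: measurable_weighted.
  - by apply: measurable_funTS; apply: measurable_funeM.
  - move=> u uv; rewrite muleA -EFinM; apply: lee_wpmul2r; first exact: sinv_ge0 hs _.
    by rewrite lee_fin WK.
rewrite ge0_integralZl_EFin//; first by rewrite lte_mul_pinfty.
- by move=> u _; rewrite mule_ge0// ?(sinv_ge0 hs)// lee_fin.
- exact: measurable_funTS.
Qed.

Lemma pevalM (W1 W2 : cpoly R d) u : peval (W1 * W2) u = peval W1 u * peval W2 u.
Proof. exact: (mpoly.mevalM (fun i => (tnth u i)%:C)). Qed.

Lemma pevalX W q u : peval (W ^+ q) u = peval W u ^+ q.
Proof.
elim: q => [|q IH]; last by rewrite !exprS pevalM IH.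
by rewrite !expr0; exact: mpoly.meval1.
Qed.

Let weighted_factor W1 W2 v e : 0 < e ->
  (\int[L]_(u in eball v e) weighted W1 u < +oo)%E ->
  (\int[L]_(u in eball v e) weighted (W1 * W2)%R u < +oo)%E.
Proof.
move=> e0 W1oo.
have [K K0 hK] := peval_local_bound W2 v e0.
apply: (@weighted_local _ _ _ (fun u => cnorm (peval W1 u) ^+ 2) e0 _ _ _ W1oo).
- by apply: measurable_funX; apply: measurable_cnorm; exact: cmeas_peval.
- by move=> u; exact: sqr_ge0.
- exists K => // u ue; rewrite pevalM cnormM exprMn mulrC.
  by apply: ler_wpM2r; [exact: sqr_ge0|exact: hK].
Qed.

(** Its powers cancel the pole [v]; not vanishing at the origin when [v]
    is another point, it preserves the lowest exponents. *)
Definition sqdist v : cpoly R d :=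
  \sum_(i < d) (mpoly.mpolyX _ (mpoly.mnm1 i) - mpoly.mpolyC d (tnth v i)%:C) ^+ 2.

Lemma peval_sqdist v u : peval (sqdist v) u = (enorm (vsub u v) ^+ 2)%:C.
Proof.
rewrite /peval /sqdist (raddf_sum (mpoly.meval _)) sqr_enorm toC_sum.
apply: eq_bigr => i _; rewrite expr2 [LHS](mpoly.mevalM (fun j => (tnth u j)%:C)).
rewrite mpoly.mevalB mpoly.mevalXU mpoly.mevalC tnthE toCM.
by congr (_ * _); apply: complex_ext; rewrite /= ?oppr0 ?addr0.
Qed.

Lemma Cint_Rn0 (f : Rn R 0 -> R[i]) : cmeas f ->
  Cintegrable (lebesgue_Rn R 0) f /\ Cint (lebesgue_Rn R 0) f = f (@tnil R).
Proof.
move=> mf; split.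
  split=> //; apply/integrableP; split.
    by apply/measurable_EFinP; exact: measurable_cnorm.
  rewrite ge0_integral_Rn0 ?ltry//; apply: measurableT_comp => //.
  by apply/measurable_EFinP; exact: measurable_cnorm.
have [m1 m2] := mf.
apply: complex_ext; rewrite /= /Rintegral integral_dirac ?diracT ?mul1e//; exact/measurable_EFinP.
Qed.

Lemma brep1 : brep [set vzero] (fun _ : Rn R d => 1).
Proof.
exists _, _, (lebesgue_Rn R 0), (fun=> 1), (fun=> vzero); split=> //.
  by have [] := Cint_Rn0 (cmeas_cst 1).
move=> u; have [|_ ->] := Cint_Rn0 (f := fun=> 1 * expi (dotp u vzero)); first exact: cmeas_cst.
by rewrite dotp0r expi0 mulr1.
Qed.

Lemma weighted_sqdist v q e : 0 < e ->
  (\int[L]_(u in eball v e) ((enorm (vsub u v) ^+ (2 * q))%:E * sinv s u) < +oo)%E ->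
  (\int[L]_(u in eball v e) weighted (sqdist v ^+ q)%R u < +oo)%E.
Proof.
move=> e0 voo; have n0 u : 0 <= enorm (vsub u v) by exact: enorm_ge0.
apply: (@weighted_local _ _ _ (fun u => enorm (vsub u v) ^+ (2 * q)) e0 _ _ _ voo).
- apply: measurable_funX; apply: measurable_enorm; apply: measurable_vsub => //.
- by move=> u; rewrite exprn_ge0.
- exists (e ^+ (2 * q)) => [|u ue]; first by rewrite exprn_ge0// ltW.
  rewrite pevalX cnormX peval_sqdist cnorm_toC ger0_norm ?sqr_ge0// -exprM expr2.
  by rewrite exprMn (mulnC q) ler_wpM2r ?exprn_ge0// lerXn2r ?nnegrE// ?ltW.
Qed.

(** Taking [n] large makes the kernel decay faster than [s], so that only the
    integrability on a bounded set remains to be known. *)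
Lemma integral_weighted_lty W p c r n del D C : 0 < c -> 0 < del -> 0 <= C ->
  (forall u, cnorm (peval W u) <= C * (1 + enorm u) ^+ D) -> (D + p + d <= n)%N ->
  (forall u, ~ cube r u -> c * (1 + enorm u) ^- p <= s u) ->
  (\int[L]_(u in cube r) weighted W u < +oo)%E ->
  (\int[L]_u ((cnorm (1 * peval W u *
    (\prod_(i < d) sinc (del * tnth u i) ^+ n)%:C) ^+ 2)%:E * sinv s u) < +oo)%E.
Proof.
move=> c0 del0 C0 WC Dn sc Woo.
have [C' C'0 hC'] := @sinc_prod_le R d del n del0.
pose sp u := \prod_(i < d) sinc (del * tnth u i) ^+ n.
have msp : measurable_fun setT sp.
  have h : cmeas (fun u : Rn R d => \prod_(i < d) (sinc (del * tnth u i))%:C ^+ n).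
    apply: cmeas_prod => i; apply: cmeasX; apply: cmeas_toC.
    apply: (measurableT_comp measurable_sinc); apply: measurable_funM => //.
    exact: measurable_tnthR.
  have [h1 _] := h; apply: eq_measurable_fun h1 => u _ /=.
  by under eq_bigr do rewrite -toCX; rewrite -toC_prod.
pose F u := ((cnorm (1 * peval W u * (sp u)%:C) ^+ 2)%:E * sinv s u)%E.
have mF : measurable_fun setT F.
  apply: emeasurable_funM; last exact: measurable_sinv hs.
  apply/measurable_EFinP; apply: measurable_funX; apply: measurable_cnorm.
  apply: cmeasM; last exact: cmeas_toC.
  apply: cmeasM; [exact: cmeas_cst|exact: cmeas_peval].
pose G u := ((C' ^+ 2)%:E * (weighted W \_ (cube r)) u)%E.
pose H u : \bar R := (((C * C') ^+ 2 / c)%:E * ((1 + enorm u) ^- (2 * d))%:E)%E.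
have Wr0 u : (0 <= (weighted W \_ (cube r)) u)%E by apply: erestrict_ge0 => x _; exact: weighted_ge0.
have mWr : measurable_fun setT (weighted W \_ (cube r)).
  apply/(measurable_restrictT _ (measurable_cube r)); apply: measurable_funTS.
  exact: measurable_weighted.
have K0 : 0 <= (C * C') ^+ 2 / c by rewrite divr_ge0 ?sqr_ge0// ltW.
have u1 u : 1 <= 1 + enorm u by rewrite lerDl enorm_ge0.
have u0 u : 0 < 1 + enorm u := lt_le_trans ltr01 (u1 u).
have me : measurable_fun setT (fun u : Rn R d => ((1 + enorm u) ^- (2 * d))%:E).
  apply/measurable_EFinP; apply: (measurableT_comp measurable_invr).
  by apply: measurable_funX; apply: measurable_funD => //; exact: measurable_enorm.
have e0 (u : Rn R d) : (0 <= ((1 + enorm u) ^- (2 * d))%:E)%E.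
  by rewrite lee_fin invr_ge0 exprn_ge0// ltW.
have FGH u : (F u <= G u + H u)%E.
  rewrite /F /G /H patchE; case: ifPn => [_|/negP]; last first.
    rewrite inE => ur; rewrite mule0 add0e.
    have su := sc u ur; have s0 : 0 < s u.
      by apply: lt_le_trans su; rewrite divr_gt0// exprn_gt0.
    rewrite /sinv inver gt_eqF// -!EFinM lee_fin mul1r cnormM cnorm_toC.
    have -> : (C * C') ^+ 2 / c * (1 + enorm u) ^- (2 * d) =
        (C * C') ^+ 2 * (c^-1 * (1 + enorm u) ^- (2 * d)) by rewrite mulrA.
    apply: (@le_trans _ _ ((C * (1 + enorm u) ^+ D * (C' * (1 + enorm u) ^- n)) ^+ 2 *
        (c^-1 * (1 + enorm u) ^+ p))).
      apply: ler_pM; rewrite ?sqr_ge0 ?invr_ge0 ?(ltW s0)//.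
        rewrite lerXn2r ?nnegrE ?mulr_ge0 ?cnorm_ge0 ?exprn_ge0 ?invr_ge0 ?exprn_ge0 ?(ltW (u0 u)) ?(ltW C'0)//.
        by apply: ler_pM; [exact: cnorm_ge0|exact: normr_ge0|exact: WC|exact: hC'].
      rewrite -[X in _ <= _ * X]invrK -invfM lef_pV2 ?posrE//.
      by rewrite divr_gt0// exprn_gt0.
    rewrite (_ : _ ^+ 2 * _ = (C * C') ^+ 2 * (c^-1 * ((1 + enorm u) ^+ (2 * D + p) *
        (1 + enorm u) ^- (2 * n)))); last first.
      rewrite exprD (mulnC 2 D) (mulnC 2 n) !exprM; field.
      by rewrite !gt_eqF// ?exprn_gt0.
    rewrite ler_wpM2l ?sqr_ge0// ler_wpM2l ?invr_ge0 ?(ltW c0)//.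
    rewrite ler_pdivrMr ?exprn_gt0// ler_pdivlMl ?exprn_gt0// -exprD.
    by rewrite ler_weXn2l//; lia.
  rewrite -[leLHS]adde0 leeD//; last by rewrite mule_ge0// lee_fin.
  rewrite muleA -EFinM; apply: lee_wpmul2r; first exact: sinv_ge0 hs _.
  rewrite lee_fin mul1r cnormM cnorm_toC exprMn mulrC ler_wpM2r ?sqr_ge0//.
  rewrite lerXn2r ?nnegrE ?(ltW C'0)// (le_trans (hC' u))//.
  by rewrite ler_pdivrMr ?exprn_gt0// ler_peMr ?(ltW C'0)// exprn_ege1.
apply: (@le_lt_trans _ _ (\int[L]_u (G u + H u))%E).
  apply: ge0_le_integral => //.
  - by move=> u _; rewrite mule_ge0// ?(sinv_ge0 hs)// lee_fin sqr_ge0.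
  - by apply: emeasurable_funD; exact: measurable_funeM.
  - by move=> u _; exact: FGH.
rewrite ge0_integralD//; last 4 first.
- by move=> u _; rewrite mule_ge0// lee_fin sqr_ge0.
- exact: measurable_funeM.
- by move=> u _; rewrite mule_ge0.
- exact: measurable_funeM.
rewrite !ge0_integralZl_EFin ?sqr_ge0//; apply: lte_add_pinfty.
  by rewrite lte_mul_pinfty ?lee_fin ?sqr_ge0// -integral_mkcond.
by rewrite lte_mul_pinfty// integral_enorm_pow_lty.
Qed.

(** The weight is the product of a polynomial [Q0] that makes [s^-1]
    integrable near the origin, of powers of squared distances that do so
    near the other poles, and of the monomial that moves up to [k0] a
    minimal exponent of [Q0] chosen below [k]. *)
Lemma simple_not_rigid (k : multi_index d) : ~ pole_of_order s k -> simple_density s ->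
  forall eta : R, 0 < eta -> forall Q : cpoly R d, is_kpoly k Q ->
  ~ linearly_poly_rigid M (eball vzero eta) Q.
Proof.
move=> nk [/finite_seqP[ps psE] fin [p [c [eps [c0 eps0 sge]]]]] eta eta0 Q [k0 [kk0 Qk0 Qle]].
have isp v : is_pole s v <-> v \in ps.
  by rewrite -[X in X <-> _]/([set v | is_pole s v] v) psE.
have [Q0 [[e0 e00 Q0i] /eqP Q0k]] : exists Q0 : cpoly R d, (exists2 e0 : R, 0 < e0 &
    (\int[L]_(u in eball vzero e0) weighted Q0 u < +oo)%E) /\ mpoly.mcoeff k Q0 <> 0.
  apply: contrapT => h; apply: nk => Q0 Q0i; apply: contrapT => Q0k.
  by apply: h; exists Q0.
have [k' k'k lk'] := lowest_exists Q0k.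
have k'k0 : mpoly.lem k' k0 := mpoly.lepm_trans k'k kk0.
have /choice[q hq] : forall v, exists q : nat, is_pole s v ->
    exists2 e : R, 0 < e & (\int[L]_(u in eball v e)
       ((enorm (vsub u v) ^+ (2 * q))%:E * sinv s u) < +oo)%E.
  move=> v; have [/fin[e [q [e1 h]]]|np] := pselect (is_pole s v); last by exists 0%N.
  by exists q => _; exists e.
pose Pi : cpoly R d := \prod_(v <- ps | v != vzero) sqdist v ^+ q v.
pose Wm := mpoly.mpolyX R[i] (mpoly.mnm_sub k0 k').
pose W : cpoly R d := Q0 * Pi * Wm.
have Pi0 : mpoly.mcoeff mpoly.mnm0 Pi != 0.
  rewrite -peval_vzero /Pi; elim/big_ind : _ => [|A B A0 B0|v v0].
  - by rewrite /peval mpoly.meval1 oner_neq0.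
  - by rewrite pevalM mulf_neq0.
  - rewrite pevalX expf_neq0// peval_sqdist; apply: contra v0 => /eqP /(congr1 cRe)/= /eqP.
    rewrite sqrf_eq0 => /eqP/enorm_eq0 v0; apply/eqP/eq_from_tnth => i.
    by have := congr1 (fun t => tnth t i) v0; rewrite !tnthE => h; apply/eqP; rewrite -oppr_eq0 -sub0r h.
have lW : lowest k0 W.
  by rewrite -(mpoly.submK k'k0); apply: lowestMX; exact: lowestM.
have Wloc v : exists2 e : R, 0 < e & (\int[L]_(u in eball v e) weighted W u < +oo)%E.
  have [->|v0] := eqVneq v vzero.
    exists e0; first exact: e00.
    rewrite /W -mulrA; exact: (weighted_factor (Pi * Wm) e00 Q0i).
  have [vp|nv] := pselect (is_pole s v).
    have [e e1 he] := hq v vp; exists e; first exact: e1.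
    have -> : W = sqdist v ^+ q v *
        (Q0 * (\prod_(w <- rem v ps | w != vzero) sqdist w ^+ q w) * Wm).
      rewrite /W /Pi (big_rem v ((isp v).1 vp)) v0.
      by rewrite [in LHS]mulrCA -!mulrA.
    exact: (weighted_factor _ e1 (weighted_sqdist e1 he)).
  have [e [e1 he]] : exists e, 0 < e /\ (\int[L]_(u in eball v e) sinv s u)%E <> +oo%E.
    apply: contrapT => h; apply: nv => e e1; apply: contrapT => he.
    by apply: h; exists e.
  exists e; first exact: e1.
  rewrite -[W]mul1r; apply: (weighted_factor W e1).
  rewrite (_ : weighted 1 = sinv s); first by rewrite ltey; exact/eqP.
  apply/funext => u; rewrite /weighted /peval mpoly.meval1.
  by rewrite (cnorm_toC 1) normr1 expr1n mul1e.
have dd : 0 < eta / (d%:R + 1) by rewrite divr_gt0// ltr_wpDl.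
apply: (@brep_not_rigid _ _ _ _ _ M s hs (eball vzero eta) [set vzero] eta 0 (eta / (d%:R + 1))
  (fun=> 1) k0 Q W).
- exact: measurable_eball.
- by move=> x; rewrite /eball/= (_ : vsub x vzero = x) => [/ltW/cube_enorm//|]; apply: eq_from_tnth => i; rewrite !tnthE subr0.
- by move=> x -> i; rewrite tnthE oppr0 lexx.
- exact: brep1.
- exact: oner_neq0.
- exact: dd.
- move=> x t -> /enorm_cube; rewrite /eball/= => /le_lt_trans; apply.
  by rewrite mulrA ltr_pdivrMr ?ltr_wpDl// mulrC ltr_pM2l// ltrDl.
- exact: Qk0.
- exact: Qle.
- exact: lW.1.
- exact: lW.2.
have [D [C [C0 WD]]] := peval_growth W.
pose r := \sum_(v <- ps) enorm v + eps.
have sr u : ~ cube r u -> c * (1 + enorm u) ^- p <= s u.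
  move=> ur; apply: sge => v /isp vp; rewrite leNgt; apply/negP => uv.
  apply: ur; apply: cube_enorm.
  have -> : u = vadd (vsub u v) v by apply: eq_from_tnth => j; rewrite !tnthE subrK.
  apply: (le_trans (enormD _ _)); rewrite /r (big_rem v vp)/=.
  have : 0 <= \sum_(w <- rem v ps) enorm w by apply: sumr_ge0 => w _; exact: enorm_ge0.
  by move: uv; lra.
exists (D + p + d)%N => n del nN del0.
apply: (integral_weighted_lty c0 del0 C0 WD nN sr).
apply: integral_cube_lty => //; [exact: measurable_weighted|exact: weighted_ge0].
Qed.

End simple.

(** * Square-integrable functions *)

Section L2.
Context {R : realType} {disp : measure_display} {T : measurableType disp}.
Variable S : {measure set T -> \bar R}.
Implicit Types (f g : T -> R[i]).

Definition inL2 f := cmeas f /\ S.-integrable setT (EFin \o (fun x => cnorm (f x) ^+ 2)).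

Definition sqn f : R := (\int[S]_x (cnorm (f x) ^+ 2))%R.

Let msqr f : cmeas f -> measurable_fun setT (fun x => cnorm (f x) ^+ 2).
Proof. by move=> mf; apply: measurable_funX; exact: measurable_cnorm. Qed.

Lemma inL2_le f (B : T -> R) : cmeas f -> S.-integrable setT (EFin \o B) ->
  (forall x, cnorm (f x) ^+ 2 <= B x) -> inL2 f.
Proof.
move=> mf iB fB; split=> //; apply: le_integrable iB => //.
  by apply/measurable_EFinP; exact: msqr.
move=> x _; rewrite !abse_EFin lee_fin ger0_norm ?sqr_ge0//.
by rewrite (le_trans (fB x))// ler_norm.
Qed.

Lemma inL2_lty f : cmeas f -> (\int[S]_x (cnorm (f x) ^+ 2)%:E < +oo)%E -> inL2 f.
Proof.
move=> mf foo; split=> //; apply/integrableP; split.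
  by apply/measurable_EFinP; exact: msqr.
by under eq_integral do rewrite /= ger0_norm ?sqr_ge0//.
Qed.

Lemma sqnE f : inL2 f -> (\int[S]_x (cnorm (f x) ^+ 2)%:E = (sqn f)%:E)%E.
Proof. by move=> [_ fi]; rewrite /sqn /Rintegral fineK//; exact: integrable_fin_num. Qed.

Lemma sqn_ge0 f : 0 <= sqn f.
Proof. by apply: Rintegral_ge0 => x _; exact: sqr_ge0. Qed.

Lemma le_sqn f (B : T -> R) : inL2 f -> S.-integrable setT (EFin \o B) ->
  (forall x, cnorm (f x) ^+ 2 <= B x) -> sqn f <= (\int[S]_x B x)%R.
Proof. by move=> [_ fi] Bi fB; apply: le_Rintegral => // x _; exact: fB. Qed.

Lemma sqr_cnormD_le (a b : R[i]) (t : R) : 0 < t ->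
  cnorm (a + b) ^+ 2 <= (1 + t) * cnorm a ^+ 2 + (1 + t^-1) * cnorm b ^+ 2.
Proof.
move=> t0; apply: (@le_trans _ _ ((cnorm a + cnorm b) ^+ 2)).
  by rewrite lerXn2r ?nnegrE ?addr_ge0 ?cnorm_ge0 ?cnormD.
have : 0 <= t^-1 * (t * cnorm a - cnorm b) ^+ 2 by rewrite mulr_ge0 ?sqr_ge0 ?invr_ge0 ?ltW.
rewrite (_ : t^-1 * _ = t * cnorm a ^+ 2 - 2 * (cnorm a * cnorm b) + t^-1 * cnorm b ^+ 2).
  by rewrite sqrrD; lra.
by field; rewrite gt_eqF.
Qed.

Let iZD (a b : R) f g : inL2 f -> inL2 g ->
  S.-integrable setT (EFin \o (fun x => a * cnorm (f x) ^+ 2 + b * cnorm (g x) ^+ 2)).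
Proof.
move=> [_ fi] [_ gi]; have := integrableD measurableT (integrableZl measurableT a fi)
  (integrableZl measurableT b gi).
by apply: eq_integrable.
Qed.

Let RiZD (a b : R) f g : inL2 f -> inL2 g ->
  (\int[S]_x (a * cnorm (f x) ^+ 2 + b * cnorm (g x) ^+ 2) = a * sqn f + b * sqn g)%R.
Proof.
move=> [_ fi] [_ gi]; rewrite RintegralD ?RintegralZl//.
  exact: (integrableZl measurableT a fi).
exact: (integrableZl measurableT b gi).
Qed.

Lemma inL2D f g : inL2 f -> inL2 g -> inL2 (fun x => f x + g x).
Proof.
move=> f2 g2; apply: inL2_le (iZD (1 + 1) (1 + 1^-1) f2 g2) _.
  by apply: cmeasD; [exact: f2.1|exact: g2.1].
by move=> x; exact: sqr_cnormD_le.
Qed.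

Lemma sqnD_le f g t : 0 < t -> inL2 f -> inL2 g ->
  sqn (fun x => f x + g x) <= (1 + t) * sqn f + (1 + t^-1) * sqn g.
Proof.
move=> t0 f2 g2; rewrite -RiZD//; apply: le_sqn; [exact: inL2D|exact: iZD|].
by move=> x; exact: sqr_cnormD_le.
Qed.

Lemma inL2Z c f : inL2 f -> inL2 (fun x => c * f x).
Proof.
move=> f2; apply: (@inL2_le _ (fun x => cnorm c ^+ 2 * cnorm (f x) ^+ 2)).
- by apply: cmeasM; [exact: cmeas_cst|exact: f2.1].
- exact: (integrableZl measurableT (cnorm c ^+ 2) f2.2).
- by move=> x; rewrite cnormM exprMn.
Qed.

Lemma sqnZ c f : inL2 f -> sqn (fun x => c * f x) = cnorm c ^+ 2 * sqn f.
Proof.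
move=> [_ fi]; rewrite /sqn -RintegralZl//; apply: eq_Rintegral => x _.
by rewrite cnormM exprMn.
Qed.

Lemma inL2B f g : inL2 f -> inL2 g -> inL2 (fun x => f x - g x).
Proof.
move=> f2 g2; have := inL2D f2 (inL2Z (-1) g2); congr inL2.
by apply/funext => x; rewrite mulN1r.
Qed.

Lemma parallelogram f g : inL2 f -> inL2 g ->
  sqn (fun x => f x - g x) + sqn (fun x => f x + g x) = 2 * sqn f + 2 * sqn g.
Proof.
move=> f2 g2; rewrite -RiZD// -[LHS]mul1r -[X in 1 * (_ + X)]mul1r -{1}[sqn _]mul1r.
rewrite mul1r -RiZD; [|exact: inL2B|exact: inL2D].
by apply: eq_Rintegral => x _; rewrite !cnorm2E !(cReD, cImD) /=; ring.
Qed.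

Lemma inL2_conj f : inL2 f -> inL2 (fun x => (f x)^*).
Proof.
move=> [mf fi]; split; first exact: cmeas_conj.
apply: eq_integrable fi => // x _ /=; congr (_ ^+ 2)%:E; apply/eqP.
by rewrite -(eqrXn2 (_ : 0 < 2)%N) ?cnorm_ge0// !cnorm2E; case: (f x) => a b /=; rewrite sqrrN.
Qed.

Lemma inL2_pairing f g : inL2 f -> inL2 g -> Cintegrable S (fun x => f x * g x) /\
  forall t, 0 < t -> cnorm (Cint S (fun x => f x * g x)) <= t * sqn f + t^-1 * sqn g.
Proof.
move=> f2 g2; have le t x : 0 < t ->
    cnorm (f x * g x) <= t * cnorm (f x) ^+ 2 + t^-1 * cnorm (g x) ^+ 2.
  move=> t0; rewrite cnormM.
  have : 0 <= t^-1 * (t * cnorm (f x) - cnorm (g x)) ^+ 2.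
    by rewrite mulr_ge0 ?sqr_ge0 ?invr_ge0 ?ltW.
  rewrite (_ : t^-1 * _ = t * cnorm (f x) ^+ 2 - 2 * (cnorm (f x) * cnorm (g x)) +
    t^-1 * cnorm (g x) ^+ 2); last by field; rewrite gt_eqF.
  by have := mulr_ge0 (cnorm_ge0 (f x)) (cnorm_ge0 (g x)); lra.
have fg : Cintegrable S (fun x => f x * g x).
  apply: Cintegrable_le (iZD 1 1^-1 f2 g2) _; first by apply: cmeasM; [exact: f2.1|exact: g2.1].
  by move=> x; exact: le.
split=> // t t0; apply: (le_trans (cnorm_Cint fg)); rewrite -RiZD//.
apply: le_Rintegral => //; [exact: fg.2|exact: iZD|].
by move=> x _; exact: le.
Qed.

Lemma sqnDZ f g (t : R) : inL2 f -> inL2 g ->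
  sqn (fun x => f x + t%:C * g x) =
  sqn f + 2 * t * cRe (Cint S (fun x => g x * (f x)^*)) + t ^+ 2 * sqn g.
Proof.
move=> f2 g2; have [gf _] := inL2_pairing g2 (inL2_conj f2).
have [gfR _] := (CintegrableP S _).1 gf.
transitivity (\int[S]_x (1 * cnorm (f x) ^+ 2 + t ^+ 2 * cnorm (g x) ^+ 2 +
    2 * t * cRe (g x * (f x)^*)))%R.
  apply: eq_Rintegral => x _; rewrite !cnorm2E !(cReD, cImD, cReM, cImM) /=.
  by case: (f x) (g x) => a b [c e] /=; ring.
rewrite RintegralD ?RintegralZl//.
- by rewrite RiZD// mul1r addrAC.
- exact: iZD.
- exact: (integrableZl measurableT (2 * t) gfR).
Qed.


Lemma geometric_limit (x : nat -> R) (c : R) :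
  (forall n, `|x n.+1 - x n| <= c / 2 ^+ n) ->
  exists L, forall n, `|L - x n| <= 2 * c / 2 ^+ n.
Proof.
move=> xc; have p2 n : 0 < 2 ^+ n :> R by rewrite exprn_gt0.
pose y n := x n - 2 * c / 2 ^+ n; pose z n := x n + 2 * c / 2 ^+ n.
have e n : 2 * c / 2 ^+ n = c / 2 ^+ n + 2 * c / 2 ^+ n.+1.
  by rewrite exprS; field; rewrite gt_eqF.
have ny n : y n <= y n.+1 by have := xc n; rewrite ler_norml /y (e n); lra.
have nz n : z n.+1 <= z n by have := xc n; rewrite ler_norml /z (e n); lra.
have c0 : 0 <= c by have := le_trans (normr_ge0 _) (xc 0%N); rewrite expr0 divr1.
have yz n : y n <= z n.
  have : 0 <= 2 * c / 2 ^+ n by rewrite divr_ge0 ?mulr_ge0// ltW.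
  by rewrite /y /z; lra.
have hy : {homo y : m n / (m <= n)%N >-> m <= n} by exact: (homo_leq (@lexx _ _) (@le_trans _ _)).
have hz m k : z (m + k)%N <= z m.
  by elim: k => [|k IH]; rewrite ?addn0// addnS (le_trans (nz _)).
have yz' m n : y m <= z n.
  apply: (le_trans (hy m (n + m)%N (leq_addl _ _))); exact: (le_trans (yz _) (hz _ _)).
have ub : has_ubound (range y) by exists (z 0%N) => _ [n _ <-].
exists (sup (range y)) => n; rewrite ler_distl; apply/andP; split.
  by apply: ub_le_sup => //; exists n.
by apply: ge_sup; [exists (y 0%N); exists 0%N|move=> _ [m _ <-]; exact: yz'].
Qed.

Lemma geometric_cvg (x : nat -> R) (c L : R) :
  (forall n, `|L - x n| <= 2 * c / 2 ^+ n) -> x @ \oo --> L.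
Proof.
move=> h; have cv : (fun n => (2 * c) * 2^-1 ^+ n) @ \oo --> 2 * c * (0 : R).
  apply: cvgM; first exact: cvg_cst.
  by apply: cvg_expr; rewrite ger0_norm ?invr_ge0// invf_lt1 ?ltr1n.
move: cv; rewrite mulr0 => /cvgrPdist_le cv.
apply/cvgrPdist_le => e e0; near=> n; apply: (le_trans (h n)).
have : `|0 - 2 * c * 2^-1 ^+ n| <= e by near: n; exact: cv.
by rewrite sub0r normrN exprVn; apply: le_trans; exact: ler_norm.
Unshelve. all: by end_near. Qed.

(** Completeness, for sequences that converge at a fixed geometric rate: the
    increments are square-summable with weights [4 ^ n], hence summable almost
    everywhere. *)
Lemma riesz_fischer (F : nat -> T -> R[i]) (C : R) : (forall n, inL2 (F n)) ->
  (forall n, sqn (fun x => F n.+1 x - F n x) <= C / 16 ^+ n) ->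
  exists F', inL2 F' /\
    exists2 K, 0 <= K & forall n, sqn (fun x => F n x - F' x) <= K / 4 ^+ n.
Proof.
move=> F2 FC; pose D n x := F n.+1 x - F n x.
have D2 n : inL2 (D n) by exact: inL2B.
pose d n x : \bar R := (4 ^+ n * cnorm (D n x) ^+ 2)%:E.
have d0 n x : (0 <= d n x)%E by rewrite lee_fin mulr_ge0 ?sqr_ge0 ?exprn_ge0.
have md n : measurable_fun setT (d n).
  by apply/measurable_EFinP; apply: measurable_funM => //; exact: msqr (D2 n).1.
pose G x := (\sum_(n <oo) d n x)%E.
have mG : measurable_fun setT G by apply: ge0_emeasurable_sum => // n x _ _.
have G0 x : (0 <= G x)%E by apply: nneseries_ge0.
have C0 : 0 <= C by have := le_trans (sqn_ge0 _) (FC 0%N); rewrite expr0 divr1.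
have GC : (\int[S]_x G x <= (2 * C)%:E)%E.
  rewrite /G integral_nneseries//.
  apply: (@le_trans _ _ (\sum_(n <oo) ((2 * C) / (2 ^ n.+1)%:R)%:E)%E).
    apply: lee_nneseries => [n _|n _].
      by move=> _; apply: integral_ge0 => x _; exact: d0.
    rewrite /d; under eq_integral do rewrite EFinM.
    rewrite ge0_integralZl_EFin ?exprn_ge0//; last 2 first.
    - by move=> x _; rewrite lee_fin sqr_ge0.
    - by apply/measurable_EFinP; exact: msqr (D2 n).1.
    rewrite sqnE// -EFinM lee_fin.
    apply: (@le_trans _ _ (4 ^+ n * (C / 16 ^+ n))); first by rewrite ler_wpM2l ?exprn_ge0//; exact: FC.
    have -> : 4 ^+ n * (C / 16 ^+ n) = C / 4 ^+ n.
      rewrite (_ : 16 = 4 * 4); last by ring.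
      by rewrite exprMn; field; rewrite gt_eqF// exprn_gt0.
    have -> : 2 * C / (2 ^ n.+1)%:R = C / 2 ^+ n.
      by rewrite natrX exprS; field; rewrite gt_eqF// exprn_gt0.
    rewrite ler_wpM2l// lef_pV2 ?posrE ?exprn_gt0//.
    by rewrite lerXn2r ?nnegrE//; lra.
  by apply: epsilon_trick0; rewrite mulr_ge0.
have dG n x : (d n x <= G x)%E.
  apply: (le_trans _ (nneseries_lim_ge n.+1 (fun k _ _ => d0 k x))).
  by rewrite big_nat_recr//= leeDr// sume_ge0.
(* Where [G x] is finite, the increments at [x] are at most [g x / 2 ^+ n]. *)
pose g x := Num.sqrt (fine (G x)).
have gx x : (G x < +oo)%E -> forall n, cnorm (D n x) <= g x / 2 ^+ n.
  move=> Goo n; have Gf : G x \is a fin_num by rewrite ge0_fin_numE.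
  have := dG n x; rewrite -(fineK Gf) lee_fin => h.
  rewrite ler_pdivlMr ?exprn_gt0// -ler_sqr ?nnegrE ?mulr_ge0 ?cnorm_ge0 ?sqrtr_ge0 ?exprn_ge0//.
  rewrite sqr_sqrtr ?fine_ge0// (le_trans _ h)// exprMn mulrC -exprM mulnC exprM.
  by rewrite (_ : 2 ^+ 2 = 4 :> R)//; ring.
have /choice[L hL] : forall x, exists L : R[i], (G x < +oo)%E -> forall n,
    `|cRe L - cRe (F n x)| <= 2 * g x / 2 ^+ n /\ `|cIm L - cIm (F n x)| <= 2 * g x / 2 ^+ n.
  move=> x; have [Goo|_] := boolP (G x < +oo)%E; last by exists 0.
  have [|a ha] := @geometric_limit (fun n => cRe (F n x)) (g x).
    move=> n; apply: le_trans (gx x Goo n); apply: le_trans (ler_Re_cnorm _).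
    by rewrite /D; case: (F n.+1 x) (F n x) => a1 b1 [a2 b2].
  have [|b hb] := @geometric_limit (fun n => cIm (F n x)) (g x).
    move=> n; apply: le_trans (gx x Goo n); apply: le_trans (ler_Im_cnorm _).
    by rewrite /D; case: (F n.+1 x) (F n x) => a1 b1 [a2 b2].
  by exists (a +i* b) => _ n; split; [exact: ha|exact: hb].
pose Z := [set x | (G x < +oo)%E].
have mZ : measurable Z.
  by rewrite -[Z]setTI; exact: emeasurable_fun_infty_o.
pose F' x := L x * (\1_Z x)%:C.
have hF' x : (G x < +oo)%E -> F' x = L x.
  by move=> Zx; rewrite /F' indicE mem_set// mulr1.
have mF' : cmeas F'.
  have cv (p : R[i] -> R) x : (p (F' x) = p (L x) * \1_Z x) ->
      ((G x < +oo)%E -> forall n, `|p (L x) - p (F n x)| <= 2 * g x / 2 ^+ n) ->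
      (fun n => p (F n x) * \1_Z x) @ \oo --> p (F' x).
    move=> -> h; rewrite indicE; have [xZ|xZ] := boolP (x \in Z).
      rewrite mulr1; under eq_fun do rewrite mulr1.
      by apply: geometric_cvg (h _); rewrite inE in xZ.
    rewrite mulr0; under eq_fun do rewrite mulr0.
    exact: cvg_cst.
  split.
    apply: (measurable_fun_cvg (h := fun n x => cRe (F n x) * \1_Z x)).
      by move=> n; apply: measurable_funM; [exact: (F2 n).1.1|exact: measurable_indic].
    move=> x _; apply: (cv cRe) => [|Zx n]; last by have [] := hL x Zx n.
    by rewrite /F' cReM /= mulr0 subr0.
  apply: (measurable_fun_cvg (h := fun n x => cIm (F n x) * \1_Z x)).
    by move=> n; apply: measurable_funM; [exact: (F2 n).1.2|exact: measurable_indic].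
  move=> x _; apply: (cv cIm) => [|Zx n]; last by have [] := hL x Zx n.
  by rewrite /F' cImM /= mulr0 add0r.
have FF' n x : ((cnorm (F n x - F' x) ^+ 2)%:E <= (8 / 4 ^+ n)%:E * G x)%E.
  have [Goo|] := boolP (G x < +oo)%E; last first.
    rewrite -leNgt leye_eq => /eqP ->.
    by rewrite gt0_muley ?leey// lte_fin divr_gt0// exprn_gt0.
  have Gf : G x \is a fin_num by rewrite ge0_fin_numE.
  have [h1 h2] := hL x Goo n.
  rewrite -(fineK Gf) -EFinM lee_fin cnorm2E hF'// !(cReD, cImD) /=.
  have gG : g x ^+ 2 = fine (G x) by rewrite sqr_sqrtr// fine_ge0.
  have p4 : 4 ^+ n = (2 ^+ n) ^+ 2 :> R by rewrite -exprM mulnC exprM; congr (_ ^+ _); ring.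
  have b0 : 0 <= 2 * g x / 2 ^+ n by rewrite divr_ge0 ?mulr_ge0 ?sqrtr_ge0 ?exprn_ge0.
  have sq (a b : R) : `|a - b| <= 2 * g x / 2 ^+ n -> (b - a) ^+ 2 <= (2 * g x / 2 ^+ n) ^+ 2.
    by move=> h; rewrite -(real_normK (num_real (b - a))) distrC lerXn2r ?nnegrE.
  rewrite -gG p4.
  rewrite (_ : 8 / _ * _ = (2 * g x / 2 ^+ n) ^+ 2 + (2 * g x / 2 ^+ n) ^+ 2); last first.
    by field; rewrite gt_eqF// exprn_gt0.
  by apply: lerD; [move: (sq _ _ h1)|move: (sq _ _ h2)];
    case: (F n x) (L x) => a1 b1 [a2 b2].
have FF2 n : inL2 (fun x => F n x - F' x) /\ sqn (fun x => F n x - F' x) <= 16 * C / 4 ^+ n.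
  have mFF : cmeas (fun x => F n x - F' x) by apply: cmeasB => //; exact: (F2 n).1.
  have le : (\int[S]_x (cnorm (F n x - F' x) ^+ 2)%:E <= (16 * C / 4 ^+ n)%:E)%E.
    apply: (@le_trans _ _ (\int[S]_x ((8 / 4 ^+ n)%:E * G x))%E).
      apply: ge0_le_integral => //.
      - by move=> x _; rewrite lee_fin sqr_ge0.
      - by apply/measurable_EFinP; exact: msqr.
      - exact: measurable_funeM.
    rewrite ge0_integralZl_EFin ?divr_ge0 ?exprn_ge0//.
    rewrite (_ : 16 * C / 4 ^+ n = 8 / 4 ^+ n * (2 * C)); last first.
      by field; rewrite gt_eqF// exprn_gt0.
    rewrite (EFinM (8 / 4 ^+ n) (2 * C)); exact: lee_wpmul2l.
  have h2 : inL2 (fun x => F n x - F' x).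
    by apply: inL2_lty => //; apply: le_lt_trans le _; rewrite ltry.
  by split=> //; rewrite -lee_fin -sqnE.
exists F'; split.
  have := inL2B (F2 0%N) (FF2 0%N).1; congr inL2; apply/funext => x.
  by rewrite opprB addrC subrK.
by exists (16 * C) => [|n]; [rewrite mulr_ge0|have [] := FF2 n].
Qed.

End L2.

(** * The residual of a function that is not approximable *)

Section residual.
Context {disp : measure_display} {T : measurableType disp} {R : realType}.
Context {P : probability T R} {d : nat}.
Variable M : wss_measure P d.
Local Notation S := (wss_spectral M).
Local Notation ft h := (fourier (toC h)).
Implicit Types (f h : Rn R d -> R) (A : set (Rn R d)).

Lemma inL2_fourier h : Ccb (toC h) -> inL2 S (ft h).
Proof. by move=> hC; apply: inL2_lty; [exact: cmeas_fourier|exact: energy_lty]. Qed.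

Lemma Cint_conj (d' : measure_display) (T' : measurableType d')
    (m : {measure set T' -> \bar R}) (p : T' -> R[i]) : Cintegrable m p ->
  Cintegrable m (fun x => (p x)^*) /\ Cint m (fun x => (p x)^*) = (Cint m p)^*.
Proof.
move=> ip; have [_ iI] := (CintegrableP m _).1 ip; split.
  split; first exact: cmeas_conj ip.1.
  apply: eq_integrable ip.2 => // x _ /=; congr EFin; apply/eqP.
  by rewrite -(eqrXn2 (_ : 0 < 2)%N) ?cnorm_ge0// !cnorm2E; case: (p x) => a b /=; rewrite sqrrN.
apply: complex_ext; rewrite /Cint /=.
  by apply: eq_Rintegral => x _; case: (p x).
rewrite -[RHS]mulN1r -RintegralZl//; apply: eq_Rintegral => x _.
by rewrite mulN1r; case: (p x).
Qed.

Lemma fourier_vopp h u : Ccb (toC h) -> ft h (vopp u) = (ft h u)^*.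
Proof.
move=> /Ccb_integrable /(Cintegrable_fourier u) hi; rewrite !fourierE.
rewrite -(Cint_conj hi).2; apply: eq_Cint => x.
rewrite dotpN opprK /toC; apply: complex_ext; rewrite /expi /= cosN sinN; ring.
Qed.

Lemma measurable_vopp : measurable_fun setT (@vopp R d).
Proof.
apply: measurable_tuple_fun => i; under eq_fun do rewrite tnthE.
by apply: measurableT_comp => //; exact: measurable_tnthR.
Qed.

(** The change of [u] into [- u], which preserves the spectral measure,
    conjugates the transforms of real functions. *)
Lemma fourier_pairing_real h f : Ccb (toC h) -> Ccb (toC f) ->
  cIm (Cint S (fun u => ft h u * (ft f u)^*)) = 0.
Proof.
move=> hC fC; set p := fun u => _.
have [ip _] : Cintegrable S p /\ _ := inL2_pairing (inL2_fourier hC) (inL2_conj (inL2_fourier fC)).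
have pE : p \o @vopp R d = fun u => (p u)^*.
  by apply/funext => u; rewrite /p /comp !fourier_vopp// rmorphM.
have [ic ec] := Cint_conj ip.
have SE A : measurable A -> S A = S (@vopp R d @^-1` A) by move=> mA; rewrite wss_spectral_sym.
have ipv : Cintegrable S (p \o @vopp R d) by rewrite pE.
have [_] := @Cint_image _ _ _ _ _ S S _ measurable_vopp SE p ip.1 ipv.
by rewrite pE ec => /(congr1 cIm) /= e; lra.
Qed.

Lemma fourierDZ (a b : R) f g u : Ccb (toC f) -> Ccb (toC g) ->
  ft (fun x => a * f x + b * g x) u = a%:C * ft f u + b%:C * ft g u.
Proof.
move=> /Ccb_integrable/(Cintegrable_fourier u) fi /Ccb_integrable/(Cintegrable_fourier u) gi.
rewrite !fourierE -(CintZ a%:C fi) -(CintZ b%:C gi) -CintD; try exact: CintegrableZ.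
by apply: eq_Cint => x; rewrite /toC toCD !toCM; ring.
Qed.

Let le_squeeze (a b : R) : (forall t, 0 < t -> exists C, forall n, a <= (1 + t) * b + C / 4 ^+ n) ->
  a <= b.
Proof.
move=> h; have h2 t : 0 < t -> a <= (1 + t) * b.
  move=> t0; have [C hC] := h t t0.
  rewrite leNgt; apply/negP => ab; pose e := a - (1 + t) * b.
  have e0 : 0 < e by rewrite subr_gt0.
  have : (fun=> 0 : R) @ \oo --> e.
    apply: (@geometric_cvg _ _ (`|C| / 2)) => n; rewrite subr0 gtr0_norm//.
    have -> : 2 * (`|C| / 2) = `|C| by field.
    apply: (@le_trans _ _ (C / 4 ^+ n)); first by rewrite /e lerBlDl.
    apply: (@le_trans _ _ (`|C| / 4 ^+ n)).
      by rewrite ler_wpM2r ?ler_norm// invr_ge0 exprn_ge0.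
    rewrite ler_wpM2l// lef_pV2 ?posrE ?exprn_gt0// lerXn2r ?nnegrE//; lra.
  by move=> /(cvg_unique (@Rhausdorff R) (cvg_cst 0)) e00; move: e0; rewrite -e00 ltxx.
apply/ler_addgt0Pr => e e0.
have t0 : 0 < e / (`|b| + 1) by rewrite divr_gt0// ltr_wpDl.
apply: (le_trans (h2 _ t0)); rewrite mulrDl mul1r lerD2l.
apply: (@le_trans _ _ (e / (`|b| + 1) * `|b|)); first by rewrite ler_wpM2l ?ler_norm// ltW.
by rewrite mulrAC ler_pdivrMr ?ltr_wpDl// ler_pM2l// lerDl.
Qed.

Let toC2 : 2 = 2%:C :> R[i].
Proof. by apply: complex_ext => /=; rewrite ?addr0. Qed.

(** The residual of the orthogonal projection of [f] on the transforms of the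
    functions that vanish on [A], as a limit of a minimizing sequence. *)
Lemma residual_exists A f : Ccb (toC f) -> ~ approximable M A f ->
  exists F, [/\ inL2 S F, 0 < sqn S F & forall h, Ccb (toC h) ->
    (forall x, A x -> h x = 0) -> Cint S (fun u => ft h u * (F u)^*) = 0].
Proof.
move=> fC nap; pose K h := Ccb (toC h) /\ forall x, A x -> h x = 0.
pose D h x := (- 1) * h x + f x.
have DC h : K h -> Ccb (toC (D h)) by move=> [hC _]; exact: CcbD.
have sqE h : Ccb (toC h) -> energy M h = (sqn S (ft h))%:E.
  by move=> hC; rewrite -sqnE//; exact: inL2_fourier.
have [e0 e00 De] : exists2 e, 0 < e & forall h, K h -> e <= sqn S (ft (D h)).
  apply: contrapT => nex; apply: nap => e e0; apply: contrapT => nh; apply: nex.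
  exists e => // h [hC hA]; rewrite leNgt; apply/negP => he; apply: nh; exists h.
  by split=> //; rewrite sqE ?lte_fin//; exact: DC.
have K0 : K (fun=> 0).
  split=> //; split; last by exists 0.
  split; [exact: measurable_cst|exact: measurable_cst|].
  by exists 0 => x; rewrite /toC cnorm_toC normr0.
have KD (a b : R) h k : K h -> K k -> K (fun x => a * h x + b * k x).
  move=> [hC hA] [kC kA]; split=> [|x Ax]; last by rewrite hA// kA// !mulr0 addr0.
  have zC : Ccb (toC (fun=> 0 : R)) := K0.1.
  have := CcbD a hC (CcbD b kC zC); congr (Ccb (toC _)).
  by apply/funext => x; rewrite addr0.
pose E := [set sqn S (ft (D h)) | h in K].
have Elb : has_lbound E by exists e0 => _ [h Kh <-]; exact: De.
have Einf : has_inf E by split=> //; exists (sqn S (ft (D (fun=> 0)))); exists (fun=> 0).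
pose m := inf E.
have mle h : K h -> m <= sqn S (ft (D h)).
  by move=> Kh; apply: ge_inf => //; exists h.
have em : e0 <= m by apply: lb_le_inf; [exact: Einf.1|move=> _ [h Kh <-]; exact: De].
have m0 : 0 < m by exact: lt_le_trans em.
have /choice[h_ hh] : forall n : nat, exists h, K h /\ sqn S (ft (D h)) < m + 16 ^- n.
  move=> n; have n0 : 0 < 16 ^- n :> R by rewrite invr_gt0 exprn_gt0.
  by have [_ [h Kh <-] hm] := inf_adherent n0 Einf; exists h.
pose F_ n := ft (D (h_ n)).
have Kh n : K (h_ n) := (hh n).1.
have F2 n : inL2 S (F_ n) by apply: inL2_fourier; exact: DC.
have ftD h k u : K h -> K k -> ft (D h) u + ft (D k) u =
    2 * ft (D (fun x => 2^-1 * h x + 2^-1 * k x)) u.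
  move=> Kh' Kk'; have Km := KD 2^-1 2^-1 _ _ Kh' Kk'.
  have := fourierDZ 1 1 u (DC _ Kh') (DC _ Kk'); rewrite !mul1r => <-.
  have := fourierDZ 2 0 u (DC _ Km) K0.1; rewrite -toC2.
  rewrite [X in _ = X -> _](_ : _ = 2 * ft (D (fun x => 2^-1 * h x + 2^-1 * k x)) u); last first.
    by rewrite (_ : 0%:C = 0)// mul0r addr0.
  move=> <-.
  by congr (fourier (toC _) _); apply/funext => x; rewrite /D; field.
(* By the parallelogram law a minimizing sequence is a Cauchy sequence,
   since the midpoint of two admissible functions is admissible. *)
have [|F [F2' [C C0 FC]]] := @riesz_fischer _ _ _ S F_ 4 F2.
  move=> n.
  have := parallelogram (F2 n.+1) (F2 n).
  pose k x := 2^-1 * h_ n.+1 x + 2^-1 * h_ n x.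
  have Kk : K k by exact: KD.
  have -> : (fun x => F_ n.+1 x + F_ n x) = (fun x => 2 * ft (D k) x).
    by apply/funext => u; exact: ftD.
  rewrite sqnZ; last by apply: inL2_fourier; exact: DC.
  have := mle k Kk; have := (hh n).2; have := (hh n.+1).2.
  rewrite -/(F_ n) -/(F_ n.+1).
  have -> : cnorm 2 = 2 :> R by rewrite toC2 cnorm_toC ger0_norm.
  have : 16 ^- n.+1 <= 16 ^- n :> R.
    by rewrite lef_pV2 ?posrE ?exprn_gt0// ler_weXn2l//; lra.
  move: (sqn S (F_ n.+1)) (sqn S (F_ n)) (sqn S (ft (D k)))
    (sqn S (fun x => F_ n.+1 x - F_ n x)) (16 ^- n.+1) (16 ^- n) => a b c e p q.
  by lra.
have F2B n : inL2 S (fun u => F u - F_ n u) by exact: inL2B.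
have FC' n : sqn S (fun u => F u - F_ n u) <= C / 4 ^+ n.
  apply: le_trans (FC n); rewrite le_eqVlt; apply/orP; left; apply/eqP.
  by apply: eq_Rintegral => u _; rewrite -(cnormN (F u - F_ n u)) opprB.
(* The limit is still minimal when moved in an admissible direction, which
   makes it orthogonal to that direction. *)
have Fm (h : Rn R d -> R) (t : R) : K h -> m <= sqn S (fun u => F u + t%:C * ft h u).
  move=> Kh'; have h2 : inL2 S (fun u => t%:C * ft h u).
    by apply: inL2Z; exact: inL2_fourier Kh'.1.
  apply: le_squeeze => e e1; exists ((1 + e^-1) * C) => n.
  have Kn : K (fun x => 1 * h_ n x + (- t) * h x) by exact: KD.
  apply: (le_trans (mle _ Kn)).
  rewrite (_ : ft _ = fun u => (F u + t%:C * ft h u) + (F_ n u - F u)); last first.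
    apply/funext => u; transitivity (F_ n u + t%:C * ft h u); last by ring.
    rewrite /F_.
    rewrite (_ : D _ = fun x => 1 * D (h_ n) x + t * h x); last first.
      by apply/funext => x; rewrite /D; ring.
    by rewrite (fourierDZ _ _ _ (DC _ (Kh n)) Kh'.1) mul1r.
  apply: (le_trans (sqnD_le e1 (inL2D F2' h2) (inL2B (F2 n) F2'))).
  rewrite lerD2l -mulrA ler_wpM2l//.
  by rewrite addr_ge0// invr_ge0 ltW.
have Fle : sqn S F <= m.
  apply: le_squeeze => e e1; exists ((1 + e) + (1 + e^-1) * C) => n.
  have := sqnD_le e1 (F2 n) (F2B n); rewrite (_ : (fun u => _) = F); last first.
    by apply/funext => u; rewrite addrC subrK.
  move=> h1; apply: (le_trans h1).
  rewrite (_ : _ + _ / _ = (1 + e) * (m + 4 ^- n) + (1 + e^-1) * (C / 4 ^+ n)); last first.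
    by move: (e^-1) (4 ^- n) => a b; ring.
  apply: lerD; last by apply: ler_wpM2l (FC' n); rewrite addr_ge0// invr_ge0 ltW.
  apply: ler_wpM2l; first by rewrite addr_ge0// ltW.
  apply: (le_trans (ltW (hh n).2)); rewrite lerD2l.
  by rewrite lef_pV2 ?posrE ?exprn_gt0// lerXn2r ?nnegrE//; lra.
exists F; split=> // [|h hC hA].
  have := Fm (fun=> 0) 0 K0; rewrite (_ : (fun u => _) = F).
    exact: lt_le_trans.
  by apply/funext => u; rewrite mul0r addr0.
have [ih _] := inL2_pairing (inL2_fourier hC) (inL2_conj F2').
set c := Cint _ _; apply: complex_ext.
  have N0 := sqn_ge0 S (ft h); set N := sqn S (ft h) in N0.
  (* The minimum in [t] of the quadratic polynomial would be at [- cRe c /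
     N]; adding 1 avoids the case [N = 0]. *)
  pose t := - cRe c / (N + 1).
  have := Fm h t (conj hC hA).
  rewrite (sqnDZ t F2' (inL2_fourier hC)) -/c -/N => h1.
  have {h1}: 0 <= 2 * t * cRe c + t ^+ 2 * N by move: Fle h1; lra.
  rewrite (_ : _ + _ = - (cRe c / (N + 1)) ^+ 2 * (N + 2)); last first.
    by rewrite /t; field; rewrite gt_eqF// ltr_wpDl.
  rewrite mulNr oppr_ge0 => h1.
  have : (cRe c / (N + 1)) ^+ 2 <= 0.
    by rewrite -(pmulr_lle0 _ (_ : 0 < N + 2))// ltr_wpDl.
  move=> h2; have : (cRe c / (N + 1)) ^+ 2 == 0 by rewrite eq_le h2 sqr_ge0.
  rewrite sqrf_eq0 mulf_eq0 invr_eq0 (gt_eqF (_ : 0 < N + 1)) ?ltr_wpDl// orbF.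
  by move/eqP.
(* Along the sequence the pairings are real, and they converge to [c]. *)
have cn n : `|cIm c - 0| <= 2 * ((sqn S (ft h) + C) / 2) / 2 ^+ n.
  have [_ /(_ (2 ^- n))] := inL2_pairing (inL2_fourier hC) (inL2_conj (F2B n)).
  rewrite invr_gt0 exprn_gt0// => /(_ isT); rewrite invrK.
  have [icn _] := inL2_pairing (inL2_fourier hC) (inL2_conj (F2 n)).
  have -> : Cint S (fun u => ft h u * (F u - F_ n u)^*) =
      c - Cint S (fun u => ft h u * (F_ n u)^*).
    by rewrite -CintB//; apply: eq_Cint => u; rewrite rmorphB mulrBr.
  have cj : sqn S (fun u => (F u - F_ n u)^*) = sqn S (fun u => F u - F_ n u).
    by apply: eq_Rintegral => u _; rewrite !cnorm2E; case: (F u - F_ n u) => a b /=; rewrite sqrrN.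
  rewrite cj => h1; have := le_trans (ler_Im_cnorm _) h1.
  rewrite cImD (_ : cIm (- _) = 0) ?addr0; last first.
    have := fourier_pairing_real hC (DC _ (Kh n)); rewrite -/(F_ n).
    by case: (Cint _ _) => a b /= ->; rewrite oppr0.
  rewrite subr0 => h2; apply: (le_trans h2).
  have h3 : 2 ^+ n * sqn S (fun u => F u - F_ n u) <= C / 2 ^+ n.
    apply: (@le_trans _ _ (2 ^+ n * (C / 4 ^+ n))); first by rewrite ler_wpM2l ?exprn_ge0.
    rewrite (_ : 4 = 2 * 2 :> R); last by ring.
    by rewrite exprMn le_eqVlt; apply/orP; left; apply/eqP; field; rewrite gt_eqF// exprn_gt0.
  rewrite (_ : _ / 2 ^+ n = 2 ^- n * sqn S (ft h) + C / 2 ^+ n); last by field; rewrite gt_eqF// exprn_gt0.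
  by rewrite lerD2l.
have := geometric_cvg (x := fun=> 0) cn.
by move=> /(cvg_unique (@Rhausdorff R) (cvg_cst 0)) <-.
Qed.

(** One of the two parts of a function that is not rigid is not
    approximable. *)
Lemma rigidity_defect A r : A `<=` cube r -> ~ linearly_maximally_rigid M A ->
  exists F, [/\ inL2 S F, 0 < sqn S F & forall h, Ccb (toC h) ->
    (forall x, A x -> h x = 0) -> Cint S (fun u => ft h u * (F u)^*) = 0].
Proof.
move=> Ar nmax.
have [g [gb gA ng]] : exists g, [/\ bounded_measurable g, forall x, ~ A x -> g x = 0 &
    ~ linearly_rigid M A g].
  apply: contrapT => h; apply: nmax => g gb gA; apply: contrapT => ng.
  by apply: h; exists g.
have gC : Ccb g.
  split=> //; exists (d%:R * r) => x rx; apply: gA => /Ar/enorm_cube.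
  by rewrite leNgt rx.
have [aR|aR] := pselect (approximable M A (cRe \o g)); last first.
  exact: residual_exists (Ccb_Re gC) aR.
have [aI|aI] := pselect (approximable M A (cIm \o g)); last first.
  exact: residual_exists (Ccb_Im gC) aI.
by exfalso; apply: ng; apply/linearly_rigidP.
Qed.

End residual.

(** * Complex measures with equal integrals of tent functions *)

Section trapezoid.
Context {R : realType}.

(** A sum of [N + 1] translated tents; the integer points being the peaks, it
    is equal to [1] between the first and the last one. *)
Definition trapezoid (N : nat) (y : R) : R := \sum_(j < N.+1) tri2 (2 * (y - j%:R)) / 4.

Lemma trapezoidE N y :
  trapezoid N y = (`|y + 1| - `|y| - `|y - N%:R| + `|y - N%:R - 1|) / 2.
Proof.
have n2 (z : R) : `|2 * z| = 2 * `|z| by rewrite normrM ger0_norm.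
have tE (z : R) : tri2 (2 * z) / 4 = (`|z + 1| + `|z - 1| - 2 * `|z|) / 2.
  rewrite /tri2 (_ : 2 * z + 2 = 2 * (z + 1)); last by ring.
  rewrite (_ : 2 * z - 2 = 2 * (z - 1)); last by ring.
  by rewrite !n2; field.
rewrite /trapezoid; elim: N => [|N IH].
  by rewrite big_ord1 tE subr0; lra.
rewrite big_ord_recr/= IH tE -(natr1 N).
rewrite (_ : y - (N%:R + 1) = y - N%:R - 1); last by ring.
rewrite (_ : y - N%:R - 1 + 1 = y - N%:R); last by ring.
by field.
Qed.

Lemma trapezoid_itv N y : 0 <= trapezoid N y <= 1.
Proof.
rewrite trapezoidE; have N0 : 0 <= N%:R :> R by [].
move: N0; move: (N%:R) => n n0.
case: (lerP 0 (y + 1)) => h1; case: (lerP 0 y) => h2; case: (lerP 0 (y - n)) => h3;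
  case: (lerP 0 (y - n - 1)) => h4;
  rewrite ?(ger0_norm h1) ?(ltr0_norm h1) ?(ger0_norm h2) ?(ltr0_norm h2)
    ?(ger0_norm h3) ?(ltr0_norm h3) ?(ger0_norm h4) ?(ltr0_norm h4); lra.
Qed.

Lemma trapezoid1 N y : 0 <= y <= N%:R -> trapezoid N y = 1.
Proof.
move=> /andP[y0 yN]; rewrite trapezoidE (ger0_norm y0) (@ger0_norm _ (y + 1)) ?addr_ge0//.
by rewrite (@ler0_norm _ (y - _)) ?subr_le0// (@ler0_norm _ (y - _ - _)); lra.
Qed.

Lemma trapezoid0 N y : y <= -1 \/ N%:R + 1 <= y -> trapezoid N y = 0.
Proof.
have N0 : 0 <= N%:R :> R by []; rewrite trapezoidE; move: N0; move: (N%:R) => n n0.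
case=> h.
  rewrite (@ler0_norm _ (y + 1)); last by lra.
  rewrite (@ler0_norm _ y); last by lra.
  rewrite (@ler0_norm _ (y - _)); last by lra.
  by rewrite (@ler0_norm _ (y - _ - _)); lra.
rewrite (@ger0_norm _ (y + 1)); last by lra.
rewrite (@ger0_norm _ y); last by lra.
rewrite (@ger0_norm _ (y - _)); last by lra.
by rewrite (@ger0_norm _ (y - _ - _)); lra.
Qed.

Lemma measurable_trapezoid N : measurable_fun setT (trapezoid N : measurableTypeR R -> R).
Proof.
rewrite (_ : trapezoid N = fun y => \sum_(j < N.+1) tri2 (2 * (y - j%:R)) / 4)//.
apply: measurable_sum => j; apply: measurable_funM => //.
apply: (measurableT_comp measurable_tri2); apply: measurable_funM => //.
exact: measurable_funB.
Qed.

Lemma trapezoid_seq (a b : R) : a <= b -> exists (m : nat -> R) (N : nat -> nat),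
  [/\ forall n, n.+1%:R <= m n & forall n, (N n)%:R = m n * (b - a)].
Proof.
rewrite le_eqVlt => /orP[/eqP ->|ab].
  by exists (fun n => n.+1%:R), (fun=> 0%N); split=> // n; rewrite subrr mulr0.
have ba : 0 < b - a by rewrite subr_gt0.
pose K := (Num.trunc (b - a)).+1.
exists (fun n => (n.+1 * K)%:R / (b - a)), (fun n => (n.+1 * K)%N); split=> n; last first.
  by rewrite divfK// gt_eqF.
rewrite natrM -mulrA ler_peMr// ler_pdivlMr// mul1r ltW// .
exact: truncnS_gt.
Qed.

Lemma trapezoid_lim (a b x : R) (m : nat -> R) (N : nat -> nat) :
  (forall n, n.+1%:R <= m n) -> (forall n, (N n)%:R = m n * (b - a)) -> a <= b ->
  (fun n => trapezoid (N n) (m n * (x - a))) @ \oo --> (\1_`[a, b]%classic x : R).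
Proof.
move=> mn Nn ab; have m0 n : 0 < m n by apply: lt_le_trans (mn n); rewrite ltr0n.
have ev (z : R) : 0 < z -> \forall n \near \oo, 1 <= m n * z.
  move=> z0; near=> n; rewrite -ler_pdivrMr// (le_trans _ (mn n))//.
  rewrite (le_trans (ltW (truncnS_gt _)))// ler_nat.
  by rewrite ltnS; near: n; exact: nbhs_infty_ge.
rewrite indicE; case: (boolP (x \in _)) => [|/negP].
  rewrite inE/= in_itv/= => /andP[ax xb]; apply: cvg_near_cst; near=> n.
  apply/eqP; rewrite trapezoid1//; apply/andP; split; first by rewrite mulr_ge0 ?subr_ge0// ltW.
  by rewrite Nn ler_pM2l// lerD2r.
rewrite inE/= in_itv/= => /negP; rewrite negb_and -!ltNge => /orP[xa|bx].
  apply: cvg_near_cst; near=> n; apply/eqP; rewrite trapezoid0//; left.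
  have : 1 <= m n * (a - x) by near: n; apply: ev; rewrite subr_gt0.
  by rewrite -(opprB x a) mulrN lerNr.
apply: cvg_near_cst; near=> n; apply/eqP; rewrite trapezoid0//; right.
have : 1 <= m n * (x - b) by near: n; apply: ev; rewrite subr_gt0.
rewrite Nn => h; have -> : m n * (x - a) = m n * (b - a) + m n * (x - b) by ring.
by rewrite lerD2l.
Unshelve. all: by end_near. Qed.

Lemma trapezoid_out (a b x : R) (m : nat -> R) (N : nat -> nat) n :
  (forall n, n.+1%:R <= m n) -> (forall n, (N n)%:R = m n * (b - a)) ->
  ~~ (a - 1 <= x <= b + 1) -> trapezoid (N n) (m n * (x - a)) = 0.
Proof.
move=> mn Nn; have m1 : 1 <= m n by apply: le_trans (mn n); rewrite ler1n.
rewrite negb_and -!ltNge => /orP[xa|bx]; apply: trapezoid0; [left|right].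
  have : m n * (x - a) <= m n * (-1) by rewrite ler_pM2l ?(lt_le_trans ltr01)//; lra.
  lra.
rewrite Nn; have -> : m n * (x - a) = m n * (b - a) + m n * (x - b) by ring.
have : m n * 1 <= m n * (x - b) by rewrite ler_pM2l ?(lt_le_trans ltr01)//; lra.
lra.
Qed.

End trapezoid.

Section uniqueness.
Context {R : realType} {d : nat}.
Implicit Types (k : Rn R d -> R) (v : Rn R d) (E : set (Rn R d)).

Definition box (a b : Rn R d) : set (Rn R d) :=
  [set u | forall i, `[tnth a i, tnth b i]%classic (tnth u i)].

Lemma measurable_box a b : measurable (box a b).
Proof.
rewrite (_ : box a b = \bigcap_(i in [set: 'I_d])
    ((fun u : Rn R d => tnth u i) @^-1` `[tnth a i, tnth b i]%classic)); last first.
  by apply/seteqP; split=> u /= h i; [move=> _; exact: h|exact: (h i)].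
apply: fin_bigcap_measurable; first exact: finite_finset.
by move=> i _; rewrite -[X in measurable X]setTI; exact: measurable_tnthR.
Qed.

Lemma boxI a b a' b' : box a b `&` box a' b' =
  box [tuple Num.max (tnth a i) (tnth a' i) | i < d]
      [tuple Num.min (tnth b i) (tnth b' i) | i < d].
Proof.
apply/seteqP; split=> u.
  move=> [h1 h2] i; have := h1 i; have := h2 i; rewrite /= !in_itv/= !tnth_mktuple.
  by rewrite ge_max le_min => /andP[-> ->] /andP[-> ->].
by move=> h; split=> i; have := h i; rewrite /= !in_itv/= !tnth_mktuple ge_max le_min
  => /andP[/andP[h1 h2] /andP[h3 h4]]; apply/andP.
Qed.

Definition boxes : set (set (Rn R d)) := [set E | exists a b, E = box a b].

(** The boxes generate: a half-space orthogonal to an axis is a countable union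
    of boxes. *)
Lemma measurable_boxes E : measurable E -> <<s boxes >> E.
Proof.
move=> mE; pose T' := g_sigma_algebraType boxes.
have mid : measurable_fun [set: T'] (fun u : T' => u : Rn R d).
  apply: measurable_tuple_fun => i.
  apply: (measurability (@RGenCInfty.G R)); first exact: RGenCInfty.measurableE.
  move=> _ [_ [x ->] <-]; rewrite setTI.
  rewrite (_ : _ @^-1` _ = \bigcup_n box
      [tuple if j == i then x else - n%:R | j < d] [tuple n%:R | j < d]).
    apply: (@bigcupT_measurable _ T') => n; apply: sub_sigma_algebra.
    by eexists; eexists.
  apply/seteqP; split=> u /=.
    rewrite in_itv/= andbT => xu; exists (Num.trunc (enorm u)).+1 => // j.
    have h : `|tnth u j| <= (Num.trunc (enorm u)).+1%:R.
      by rewrite (le_trans (ler_norm_tnth _ _))// ltW// truncnS_gt.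
    move: h; rewrite ler_norml /= in_itv/= !tnth_mktuple => /andP[h1 ->]; rewrite andbT.
    by case: eqP => // ->.
  move=> [n _ /(_ i)]; rewrite /= !in_itv/= !tnth_mktuple eqxx andbT.
  by move=> /andP[].
by have := mid measurableT E mE; rewrite setTI.
Qed.

Section pair.
Context (d1 d2 : measure_display) (T1 : measurableType d1) (T2 : measurableType d2).
Variables (m1 : {measure set T1 -> \bar R}) (m2 : {measure set T2 -> \bar R}).
Variables (a1 : T1 -> R[i]) (a2 : T2 -> R[i]) (X1 : T1 -> Rn R d) (X2 : T2 -> Rn R d).
Hypotheses (mX1 : measurable_fun setT X1) (mX2 : measurable_fun setT X2).

(** Only bounded sets are considered, so as to allow densities with
    respect to Lebesgue measure that are merely bounded. *)
Definition locally_Cintegrable (d' : measure_display) (T' : measurableType d')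
    (m : {measure set T' -> \bar R}) (a : T' -> R[i]) (X : T' -> Rn R d) :=
  cmeas a /\ forall r, Cintegrable m (fun w => a w * (\1_(cube r) (X w))%:C).

Hypotheses (i1 : locally_Cintegrable m1 a1 X1) (i2 : locally_Cintegrable m2 a2 X2).

Let test c r k := measurable_fun setT k /\ forall u, `|k u| <= c * \1_(cube r) u.

Let agree k := Cint m1 (fun w => a1 w * (k (X1 w))%:C) = Cint m2 (fun w => a2 w * (k (X2 w))%:C).

Section one.
Context (d' : measure_display) (T' : measurableType d').
Variables (m : {measure set T' -> \bar R}) (a : T' -> R[i]) (X : T' -> Rn R d).
Hypotheses (mX : measurable_fun setT X) (ia : locally_Cintegrable m a X).

Let dominated c r k w : test c r k ->
  cnorm (a w * (k (X w))%:C) <= c * cnorm (a w * (\1_(cube r) (X w))%:C).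
Proof.
move=> [_ kc]; rewrite !cnormM !cnorm_toC mulrCA ler_wpM2l ?cnorm_ge0//.
by rewrite (le_trans (kc _))// [X in _ <= _ * X]ger0_norm.
Qed.

Let integrable_dom c r :
  m.-integrable setT (EFin \o (fun w => c * cnorm (a w * (\1_(cube r) (X w))%:C))).
Proof. exact: (integrableZl measurableT c (ia.2 r).2). Qed.

Let cmeas_test k : measurable_fun setT k -> cmeas (fun w => a w * (k (X w))%:C).
Proof.
move=> mk; apply: cmeasM; first exact: ia.1.
by apply: cmeas_toC; exact: measurableT_comp.
Qed.

Lemma Cintegrable_test c r k : test c r k -> Cintegrable m (fun w => a w * (k (X w))%:C).
Proof.
move=> tk; apply: Cintegrable_le (cmeas_test tk.1) (integrable_dom c r) _ => w.
exact: dominated.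
Qed.

Lemma test_lim c r (k_ : nat -> Rn R d -> R) k : (forall n, test c r (k_ n)) -> test c r k ->
  (forall u, k_ n u @[n --> \oo] --> k u) ->
  (fun n => cnorm (Cint m (fun w => a w * (k_ n (X w))%:C) -
                   Cint m (fun w => a w * (k (X w))%:C))) @ \oo --> (0 : R).
Proof.
move=> tk_ tk kk; apply: Cint_dominated.
- by move=> n; exact: cmeas_test (tk_ n).1.
- exact: cmeas_test tk.1.
- exact: (integrable_dom c r).
- move=> w; have h : (fun n => `|k_ n (X w) - k (X w)|) @ \oo --> (0 : R).
    apply/cvgrPdist_le => e e0; near=> n; rewrite sub0r normrN normr_id distrC.
    by near: n; move/cvgrPdist_le : (kk (X w)); exact.
  have e := cvgM (cvg_cst (cnorm (a w))) h; rewrite mulr0 in e.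
  rewrite (_ : (fun n => _) = (fun n => cnorm (a w) * `|k_ n (X w) - k (X w)|)); first exact: e.
  by apply/funext => n; rewrite -mulrBr -raddfB cnormM cnorm_toC.
- by move=> n w; exact: dominated (tk_ n).
- by move=> w; exact: dominated tk.
Unshelve. all: by end_near. Qed.

End one.

Let agree_lim c r (k_ : nat -> Rn R d -> R) k : (forall n, test c r (k_ n)) -> test c r k ->
  (forall u, k_ n u @[n --> \oo] --> k u) -> (forall n, agree (k_ n)) -> agree k.
Proof.
move=> tk_ tk kk ag; have l1 := test_lim mX1 i1 tk_ tk kk; have l2 := test_lim mX2 i2 tk_ tk kk.
set x1 := Cint m1 (fun w => a1 w * (k (X1 w))%:C) in l1 *.
set x2 := Cint m2 (fun w => a2 w * (k (X2 w))%:C) in l2 *.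
apply/eqP; rewrite -subr_eq0; apply/eqP/cnorm_eq0/eqP; rewrite eq_le cnorm_ge0 andbT.
apply/ler_addgt0Pr => e e0; rewrite add0r; have e2 : 0 < e / 2 by rewrite divr_gt0.
move/cvgrPdist_le : l1 => /(_ _ e2) l1; move/cvgrPdist_le : l2 => /(_ _ e2) l2.
near \oo => n; rewrite (_ : x1 - x2 = (x1 - Cint m1 (fun w => a1 w * (k_ n (X1 w))%:C)) +
    (Cint m2 (fun w => a2 w * (k_ n (X2 w))%:C) - x2)); last by rewrite (ag n) addrA subrK.
rewrite (le_trans (cnormD _ _))// (splitr e) lerD//.
  rewrite -cnormN opprB; have : `|0 - cnorm (Cint m1 (fun w => a1 w * (k_ n (X1 w))%:C) - x1)| <= e / 2.
    by near: n.
  by rewrite sub0r normrN; apply: le_trans; exact: ler_norm.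
have : `|0 - cnorm (Cint m2 (fun w => a2 w * (k_ n (X2 w))%:C) - x2)| <= e / 2 by near: n.
by rewrite sub0r normrN; apply: le_trans; exact: ler_norm.
Unshelve. all: by end_near. Qed.

Definition tents (del v u : Rn R d) : R :=
  \prod_(i < d) tri2 ((tnth u i - tnth v i) / tnth del i).

Hypothesis tents_agree : forall del v, (forall i, 0 < tnth del i) -> agree (tents del v).

Let test_tents del v : (forall i, 0 < tnth del i) ->
  test (\prod_(i < d) 4) (\sum_(i < d) (`|tnth v i| + 2 * tnth del i)) (tents del v).
Proof.
move=> del0; split=> [|u].
  apply: measurable_prod => i _; apply: (measurableT_comp measurable_tri2).
  by apply: measurable_funM => //; apply: measurable_funB => //; exact: measurable_tnthR.
rewrite indicE; case: (boolP (u \in _)) => [_|]; rewrite ?mulr1 ?mulr0 /tents.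
  rewrite normr_prod ler_prod// => i _; rewrite normr_ge0/= ger0_norm ?tri2_ge0//.
  exact: tri2_le4.
rewrite notin_setE => ur.
have [i ui] : exists i, `|tnth v i| + 2 * tnth del i < `|tnth u i|.
  apply: contrapT => /forallNP h; apply: ur; apply: eq_cube => i.
  have /negP := h i; rewrite -leNgt => /le_trans; apply.
  rewrite (bigD1 i)//= lerDl sumr_ge0// => j _.
  by rewrite addr_ge0// mulr_ge0// ltW.
rewrite (bigD1 i)//= tri2_out ?mul0r ?normr0//.
rewrite normrM normfV (gtr0_norm (del0 i)) ler_pdivlMr//.
have := ler_normD (tnth u i - tnth v i) (tnth v i); rewrite subrK.
by move: ui; lra.
Qed.

Let test_indic E r : measurable E -> E `<=` cube r -> test 1 r (\1_E).
Proof.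
move=> mE Er; split=> [|u]; first exact: measurable_indic.
rewrite mul1r !indicE ger0_norm//; case: (boolP (u \in E)) => // /set_mem /Er ur.
by rewrite mem_set.
Qed.

Let agree_sum (I : finType) (k : I -> Rn R d -> R) :
  (forall f, exists c r, test c r (k f)) -> (forall f, agree (k f)) ->
  agree (fun u => \sum_f k f u).
Proof.
move=> tk ak; rewrite /agree.
have i1' f : Cintegrable m1 (fun w => a1 w * (k f (X1 w))%:C).
  by have [c [r h]] := tk f; exact: Cintegrable_test h.
have i2' f : Cintegrable m2 (fun w => a2 w * (k f (X2 w))%:C).
  by have [c [r h]] := tk f; exact: Cintegrable_test h.
transitivity (\sum_f Cint m1 (fun w => a1 w * (k f (X1 w))%:C)).
  rewrite -Cint_sum//; apply: eq_Cint => w; rewrite raddf_sum/= mulr_sumr.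
  exact: eq_bigr.
transitivity (\sum_f Cint m2 (fun w => a2 w * (k f (X2 w))%:C)).
  by apply: eq_bigr => f _; exact: ak.
rewrite -Cint_sum//; apply: eq_Cint => w; rewrite raddf_sum/= mulr_sumr.
exact: eq_bigr.
Qed.

Let agreeZ c r k b : test c r k -> agree k -> agree (fun u => b * k u).
Proof.
move=> tk ak; rewrite /agree.
transitivity (b%:C * Cint m1 (fun w => a1 w * (k (X1 w))%:C)).
  rewrite -CintZ; last exact: (Cintegrable_test mX1 i1 tk).
  by apply: eq_Cint => w; rewrite toCM mulrCA.
rewrite ak -CintZ; last exact: (Cintegrable_test mX2 i2 tk).
by apply: eq_Cint => w; rewrite toCM mulrCA.
Qed.

Let agreeB c r c' r' k l : test c r k -> test c' r' l -> agree k -> agree l ->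
  agree (fun u => k u - l u).
Proof.
move=> tk tl ak al; rewrite /agree.
transitivity (Cint m1 (fun w => a1 w * (k (X1 w))%:C) - Cint m1 (fun w => a1 w * (l (X1 w))%:C)).
  rewrite -CintB; try exact: (Cintegrable_test mX1 i1 _).
    by apply: eq_Cint => w; rewrite raddfB mulrBr.
  - exact: (Cintegrable_test mX1 i1 tk).
  - exact: (Cintegrable_test mX1 i1 tl).
rewrite ak al -CintB; [|exact: (Cintegrable_test mX2 i2 tk)|exact: (Cintegrable_test mX2 i2 tl)].
by apply: eq_Cint => w; rewrite raddfB mulrBr.
Qed.

(** Expanding a product of trapezoids gives a sum of products of tents. *)
Let agree_trapezoids (m : 'I_d -> R) (N : 'I_d -> nat) (a : Rn R d) : (forall i, 0 < m i) ->
  agree (fun u => \prod_(i < d) trapezoid (N i) (m i * (tnth u i - tnth a i))).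
Proof.
move=> m0; pose K := \sum_(i < d) N i.
pose F i (j : 'I_K.+1) (y : R) := if (j <= N i)%N then tri2 (2 * (m i * (y - tnth a i) - j%:R)) / 4 else 0.
have tF i y : trapezoid (N i) (m i * (y - tnth a i)) = \sum_(j < K.+1) F i j y.
  have NK : ((N i).+1 <= K.+1)%N by rewrite ltnS /K (bigD1 i)//= leq_addr.
  rewrite /trapezoid (big_ord_widen _ (fun j => tri2 (2 * (m i * (y - tnth a i) - j%:R)) / 4) NK).
  by rewrite big_mkcond/=; apply: eq_bigr => j _; rewrite /F ltnS.
rewrite (_ : (fun u => _) = fun u => \sum_(f : {ffun 'I_d -> 'I_K.+1}) \prod_(i < d) F i (f i) (tnth u i));
  last first.
  apply/funext => u; rewrite -(bigA_distr_bigA (fun i j => F i j (tnth u i))).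
  by apply: eq_bigr => i _; exact: tF.
pose del : Rn R d := [tuple (2 * m i)^-1 | i < d].
have del0 i : 0 < tnth del i by rewrite tnth_mktuple invr_gt0 mulr_gt0.
have PE (f : {ffun 'I_d -> 'I_K.+1}) : (exists i, (N i < f i)%N) /\
      (fun u : Rn R d => \prod_(i < d) F i (f i) (tnth u i)) = (fun=> 0) \/
    (fun u : Rn R d => \prod_(i < d) F i (f i) (tnth u i)) =
      (fun u => (\prod_(i < d) 4^-1) * tents del [tuple tnth a i + (f i)%:R / m i | i < d] u).
  have [[i hi]|nh] := pselect (exists i, (N i < f i)%N).
    left; split; first by exists i.
    by apply/funext => u; rewrite (bigD1 i)//= /F leqNgt hi mul0r.
  right; apply/funext => u; rewrite /tents -big_split; apply: eq_bigr => i _.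
  rewrite /F leqNgt; case: (boolP (N i < f i)%N) => [h|_] /=; first by exfalso; apply: nh; exists i.
  rewrite mulrC !tnth_mktuple invrK; congr (_ * tri2 _).
  by field; rewrite gt_eqF.
apply: agree_sum => f; case: (PE f) => [[_ ->]|->].
- exists 0, 0; split=> [|u]; first exact: measurable_cst.
  by rewrite normr0 mul0r.
- have [mt ht] := test_tents [tuple tnth a i + (f i)%:R / m i | i < d] del0.
  eexists; eexists; split=> [|u].
    by apply: measurable_funM => //; exact: mt.
  rewrite normrM; apply: le_trans (ler_wpM2l (normr_ge0 _) (ht u)) _.
  by rewrite mulrA.
- by rewrite /agree; under eq_Cint do rewrite mulr0; under [RHS]eq_Cint do rewrite mulr0;
    rewrite !Cint0.
- exact: agreeZ (test_tents _ del0) (tents_agree _ del0).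
Qed.

Let cvg_prod_seq (I : Type) (s : seq I) (f : I -> nat -> R) (l : I -> R) :
  (forall i, f i n @[n --> \oo] --> l i) ->
  (fun n => \prod_(i <- s) f i n) @ \oo --> \prod_(i <- s) l i.
Proof.
move=> fl; elim: s => [|i s IH].
  by rewrite big_nil; under eq_fun do rewrite big_nil; exact: cvg_cst.
by rewrite big_cons; under eq_fun do rewrite big_cons; exact: cvgM.
Qed.

(** Steeper and steeper trapezoids converge to the indicators of
    intervals. *)
Let agree_box a b r : box a b `<=` cube r -> agree (\1_(box a b)).
Proof.
move=> abr; have [ab|nab] := pselect (forall i, tnth a i <= tnth b i); last first.
  have -> : box a b = set0.
    apply/seteqP; split=> // u uab; apply: nab => i.
    by have := uab i; rewrite /= in_itv/= => /andP[]; exact: le_trans.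
  by rewrite /agree; under eq_Cint do rewrite indic0 mulr0; under [RHS]eq_Cint do rewrite indic0 mulr0;
    rewrite !Cint0.
have /choice[mN hmN] : forall i, exists mN : (nat -> R) * (nat -> nat),
    (forall n, n.+1%:R <= mN.1 n) /\ (forall n, (mN.2 n)%:R = mN.1 n * (tnth b i - tnth a i)).
  by move=> i; have [m [N [h1 h2]]] := trapezoid_seq (ab i); exists (m, N).
pose m i := (mN i).1; pose N i := (mN i).2.
have hm i n : n.+1%:R <= m i n := (hmN i).1 n.
have hN i n : (N i n)%:R = m i n * (tnth b i - tnth a i) := (hmN i).2 n.
have m0 i n : 0 < m i n by apply: lt_le_trans (hm i n); rewrite ltr0n.
pose k_ n u : R := \prod_(i < d) trapezoid (N i n) (m i n * (tnth u i - tnth a i)).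
pose r' := \sum_(i < d) (`|tnth a i| + `|tnth b i| + 1).
have r'i i : `|tnth a i| + `|tnth b i| + 1 <= r'.
  by rewrite /r' (bigD1 i)//= lerDl sumr_ge0// => j _; rewrite !addr_ge0.
have tk_ n : test 1 r' (k_ n).
  split=> [|u].
    apply: measurable_prod => i _; apply: (measurableT_comp (measurable_trapezoid _)).
    by apply: measurable_funM => //; apply: measurable_funB => //; exact: measurable_tnthR.
  rewrite mul1r indicE; case: (boolP (u \in _)) => [_|].
    rewrite normr_prod; apply: (@le_trans _ _ (\prod_(i < d) 1)); last by rewrite big1.
    rewrite ler_prod// => i _; have /andP[t0 t1] := trapezoid_itv (N i n) (m i n * (tnth u i - tnth a i)).
    by rewrite normr_ge0/= ger0_norm.
  rewrite notin_setE => ur; have [i ui] : exists i, r' < `|tnth u i|.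
    apply: contrapT => /forallNP h; apply: ur; apply: eq_cube => i.
    by have /negP := h i; rewrite -leNgt.
  rewrite /k_ (bigD1 i)//= (trapezoid_out n (hm i) (hN i)) ?mul0r ?normr0//.
  apply/negP => /andP[h1 h2]; move: ui; rewrite ltNge => /negP; apply.
  apply: le_trans (r'i i); rewrite ler_norml; apply/andP; split.
    by have := lerNnormlW (lexx `|tnth a i|); have := normr_ge0 (tnth b i); lra.
  by have := ler_norm (tnth b i); have := normr_ge0 (tnth a i); lra.
have tk : test 1 r' (\1_(box a b)).
  apply: test_indic; first exact: measurable_box.
  move=> u uab; apply: eq_cube => i; apply: le_trans (r'i i).
  have := uab i; rewrite /= in_itv/= => /andP[h1 h2]; rewrite ler_norml; apply/andP; split.
    by have := lerNnormlW (lexx `|tnth a i|); have := normr_ge0 (tnth b i); lra.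
  by have := ler_norm (tnth b i); have := normr_ge0 (tnth a i); lra.
apply: (agree_lim tk_ tk) => [u|n]; last exact: agree_trapezoids.
have -> : \1_(box a b) u = \prod_(i < d) (\1_`[tnth a i, tnth b i]%classic (tnth u i) : R).
  rewrite indicE; case: (boolP (u \in _)) => [|].
    by rewrite inE => h; rewrite big1// => i _; rewrite indicE mem_set//; exact: h.
  rewrite notin_setE => h; have [i hi] := (existsNP _).2 h.
  by rewrite (bigD1 i)//= indicE memNset// mul0r.
by apply: cvg_prod_seq => i; exact: trapezoid_lim.
Qed.

Let cubeE r : cube r = box [tuple - r | i < d] [tuple r | i < d].
Proof. by apply/seteqP; split=> u h i; have := h i; rewrite /= in_itv/= !tnth_mktuple. Qed.

(** Boxes being stable under intersections, Dynkin's theorem applies. *)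
Let agree_cube E r : measurable E -> agree (\1_(E `&` cube r)).
Proof.
have ti A : measurable A -> test 1 r (\1_(A `&` cube r)).
  by move=> mA; apply: test_indic; [apply: measurableI => //; exact: measurable_cube|exact: subIsetr].
have lam : lambda_system setT [set E | measurable E /\ agree (\1_(E `&` cube r))].
  split=> //.
  - by split=> //; rewrite setTI cubeE; apply: (@agree_box _ _ r); rewrite -cubeE.
  - move=> A B BA [mA hA] [mB hB]; split; first exact: measurableD.
    rewrite (_ : \1_ _ = fun u => \1_(A `&` cube r) u - \1_(B `&` cube r) u).
      exact: agreeB (ti _ mA) (ti _ mB) hA hB.
    apply/funext => u; rewrite !indicE; have [cu|cu] := pselect (cube r u); last first.
      by rewrite !memNset ?subrr//; case.
    have [Bu|Bu] := pselect (B u).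
      rewrite memNset; last by move=> [[_ /(_ Bu)]].
      by rewrite !mem_set ?subrr//; split=> //; exact: BA.
    rewrite [u \in B `&` _]memNset ?subr0; last by case.
    have [Au|Au] := pselect (A u); first by rewrite !mem_set.
    by rewrite !memNset//; [case|case=> -[]].
  - move=> F ndF hF; split; first by apply: bigcupT_measurable => n; exact: (hF n).1.
    have mU : measurable (\bigcup_n F n) by apply: bigcupT_measurable => n; exact: (hF n).1.
    apply: (@agree_lim 1 r (fun n => \1_(F n `&` cube r))) => [n| |u|n].
    - exact: ti (hF n).1.
    - exact: ti mU.
    - rewrite !indicE in_setI; case: (boolP (u \in \bigcup_n F n)) => [|uF] /=.
        rewrite inE => -[n _ Fn]; apply: cvg_near_cst; near=> p.
        rewrite indicE in_setI mem_set//; apply: (subsetPset _ _ (ndF n p _)) Fn.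
        by near: p; exact: nbhs_infty_ge.
      apply: cvg_near_cst; apply: nearW => p; rewrite indicE in_setI memNset//.
      by move: uF; rewrite notin_setE => h Fp; apply: h; exists p.
    - exact: (hF n).2.
have sub : boxes `<=` [set E | measurable E /\ agree (\1_(E `&` cube r))].
  move=> _ [a [b ->]]; split; first exact: measurable_box.
  by rewrite cubeE boxI; apply: (@agree_box _ _ r); rewrite -boxI -cubeE; exact: subIsetr.
have sI : setI_closed boxes.
  by move=> A B [a [b ->]] [a' [b' ->]]; rewrite boxI; eexists; eexists; reflexivity.
move=> mE; have := lambda_system_subset sI lam sub (fun X _ => @subsetT _ X).
by move=> /(_ _ (measurable_boxes mE))[].
Unshelve. all: by end_near. Qed.

(** Sums of tents give products of trapezoids, limits of these give boxes,
    and boxes generate the measurable sets. *)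
Lemma unique_of_tents E r : measurable E ->
  Cint m1 (fun w => a1 w * (\1_(E `&` cube r) (X1 w))%:C) =
  Cint m2 (fun w => a2 w * (\1_(E `&` cube r) (X2 w))%:C).
Proof. exact: agree_cube. Qed.

End pair.
End uniqueness.

(** * Transforms of boxes and tents *)

Section transforms.
Context {R : realType}.
Local Notation mu := (@lebesgue_measure R).

Let cmeas_expiM (y : R) : cmeas (fun t : measurableTypeR R => expi (t * y)).
Proof. by apply: cmeas_expi; exact: measurable_funM. Qed.

(** [sinc y] is the mean of [cos (t y)] over the [t] such that [|t| <= 1]. *)
Lemma sinc_ge_half (y : R) : `|y| <= 1 -> 2^-1 <= sinc y.
Proof.
move=> y1; have := congr1 (@complex.Re R) (Cint_expi_sinc y); rewrite Cint_itvC /= => e.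
suff : 1 <= 2 * sinc y by lra.
rewrite -e -[leLHS](_ : 2^-1 * (1 - (-1)) = 1); last by field.
rewrite -(@Rintegral_itv_cst _ (-1) 1); last by lra.
have ic (f : R -> R) : continuous f -> mu.-integrable `[-1, 1]%classic (EFin \o f).
  move=> cf; apply: continuous_compact_integrable; first exact: segment_compact.
  exact: continuous_subspaceT.
apply: le_Rintegral => //.
- by apply: ic => x; exact: cvg_cst.
- apply: ic => x; apply: continuous_comp; first exact: mulrr_continuous.
  exact: continuous_cos.
- move=> t; rewrite /= in_itv/= => /andP[t1 t2].
  have := one_sub_cos_le (t * y); have : (t * y) ^+ 2 <= 1.
    rewrite exprMn -(mulr1 1) ler_pM ?sqr_ge0// -(real_normK (num_real _)) exprn_ile1//.
    by rewrite ler_norml t1.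
  by lra.
Qed.

(** A tent is the convolution square of an interval. *)
Lemma Cint_tri2_expi (y : R) : Cintegrable mu (fun t => (tri2 t)%:C * expi (t * y)) /\
  Cint mu (fun t => (tri2 t)%:C * expi (t * y)) = (8 * sinc y ^+ 2)%:C.
Proof.
pose F (z : measurableTypeR R * measurableTypeR R) : R[i] :=
  itvC (-1) 1 z.1 * itvC (-1) 1 (z.2 - z.1) * expi (z.2 * y).
have mF : cmeas F.
  apply: cmeasM; last by apply: cmeas_expi; exact: measurable_funM.
  apply: cmeasM; apply: cmeas_toC; apply/measurable_EFinP.
    by apply: measurable_indic_comp.
  by apply: measurable_indic_comp => //; exact: measurable_funB.
have i1 c r : mu.-integrable setT (EFin \o (fun t : measurableTypeR R => c * \1_`[- r, r]%classic t)).
  have [_ h] : Cintegrable mu (fun t => itvC (- r) r t * 1).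
    by apply: (@Cintegrable_itvC R _ _ _ 1) => [|t _]; [exact: cmeas_cst|rewrite cnorm_toC normr1].
  apply: eq_integrable (integrableZl measurableT c h) => // t _ /=.
  by rewrite mulr1 cnorm_toC ger0_norm.
have [|_ _ i2 e1 e2] := Cfubini mF (i1 1 1) (i1 1 2).
  move=> s t; rewrite /F /itvC /= !cnormM cnorm_expi mulr1 !cnorm_toC !mul1r !indicE.
  case: (boolP (s \in _)) => [|_]; last by rewrite normr0 !mul0r.
  rewrite inE/= in_itv/= => /andP[s1 s2]; rewrite normr1 !mul1r.
  case: (boolP (_ \in _)) => [|_]; last by rewrite normr0.
  rewrite inE/= in_itv/= => /andP[t1 t2]; rewrite normr1 mem_set//= in_itv/=.
  by apply/andP; split; lra.
have inner t : Cint mu (fun s => F (s, t)) = (2^-1)%:C * ((tri2 t)%:C * expi (t * y)).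
  have lin a b : a <= b -> (forall s, itvC (-1) 1 s * itvC (-1) 1 (t - s) = itvC a b s :> R[i]) ->
      tri2 t = 2 * (b - a) -> Cint mu (fun s => F (s, t)) = (2^-1)%:C * ((tri2 t)%:C * expi (t * y)).
    move=> ab h1 h2; have ia : Cintegrable mu (itvC a b).
      rewrite (_ : itvC a b = fun t => itvC a b t * 1); last by apply/funext => z; rewrite mulr1.
      by apply: (@Cintegrable_itvC R _ _ _ 1) => [|z _]; [exact: cmeas_cst|rewrite cnorm_toC normr1].
    transitivity (Cint mu (fun s => itvC a b s * expi (t * y))).
      by apply: eq_Cint => s; rewrite /F /= h1.
    rewrite CintZr// mulrA; congr (_ * _).
    have -> : Cint mu (itvC a b) = Cint mu (fun s => itvC a b s * 1).
      by apply: eq_Cint => s; rewrite mulr1.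
    rewrite Cint_itvC/= Rintegral_itv_cst// Rintegral_itv_cst// h2.
    by apply: complex_ext => /=; field.
  have iE (a b a' b' c c' s z : R) : (a <= s <= b) && (a' <= z <= b') = (c <= s <= c') ->
      itvC a b s * itvC a' b' z = itvC c c' s :> R[i].
    move=> h; rewrite /itvC -toCM; congr (_%:C); rewrite !indicE.
    have e3 (p q w : R) : (w \in `[p, q]%classic) = (p <= w <= q).
      by apply/idP/idP; rewrite inE/= in_itv.
    by rewrite !e3 -h; case: (a <= s <= b); case: (a' <= z <= b') => /=; rewrite ?mulr1 ?mulr0.
  have [t2|t2] := lerP `|t| 2; last first.
    rewrite (tri2_out (ltW t2)) mul0r mulr0 -[RHS](Cint0 mu); apply: eq_Cint => s.
    rewrite /F /= (@iE _ _ _ _ 1 0); first by rewrite /itvC indicE memNset ?mul0r//= in_itv/=; move=> /andP[]; lra.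
    apply/idP/idP => [/andP[/andP[h1 h2] /andP[h3 h4]]|/andP[]]; last by lra.
    by exfalso; move: t2; rewrite ltNge ler_norml => /negP; apply; apply/andP; split; lra.
  have [t0|t0] := lerP 0 t.
    apply: (lin (t - 1) 1).
    - by move: t2; rewrite ger0_norm//; lra.
    - move=> s; apply: iE; apply/idP/idP => [/andP[/andP[h1 h2] /andP[h3 h4]]|/andP[h1 h2]].
        by apply/andP; split; lra.
      by apply/andP; split; apply/andP; split; lra.
    - by rewrite /tri2 (ger0_norm t0) ger0_norm ?addr_ge0// ler0_norm; move: t2; rewrite ger0_norm//; lra.
  apply: (lin (-1) (t + 1)).
  - by move: t2; rewrite ltr0_norm//; lra.
  - move=> s; apply: iE; apply/idP/idP => [/andP[/andP[h1 h2] /andP[h3 h4]]|/andP[h1 h2]].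
      by apply/andP; split; lra.
    by apply/andP; split; apply/andP; split; lra.
  - move: t2; rewrite /tri2 (ltr0_norm t0) => t2; rewrite ger0_norm; last by lra.
    by rewrite ler0_norm; lra.
have outer s : Cint mu (fun t => F (s, t)) = (2 * sinc y)%:C * (itvC (-1) 1 s * expi (s * y)).
  have i0 : Cintegrable mu (fun t => itvC (-1) 1 t * expi (t * y)).
    by apply: (@Cintegrable_itvC R _ _ _ 1) => [|t _]; [exact: cmeas_expiM|rewrite cnorm_expi].
  have [i3 e3] := Cint_affine (- s) (oner_neq0 R) i0.
  rewrite -Cint_expi_sinc e3 normr1 mul1r mulrC -(CintZ _ i3); apply: eq_Cint => t.
  rewrite /F /= mul1r -!mulrA; congr (_ * _); rewrite mulrCA -expiD; congr (_ * expi _).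
  by ring.
have c2 : 2%:C * (2^-1)%:C = 1 :> R[i] by rewrite -toCM mulfV.
have eq2 : (fun t => (tri2 t)%:C * expi (t * y)) = (fun t => 2%:C * Cint mu (fun s => F (s, t))).
  by apply/funext => t; rewrite inner mulrA c2 mul1r.
rewrite eq2; split; first exact: CintegrableZ.
rewrite (CintZ _ i2) e2 -e1.
under eq_Cint do rewrite outer.
rewrite CintZ; last first.
  by apply: (@Cintegrable_itvC R _ _ _ 1) => [|t _]; [exact: cmeas_expiM|rewrite cnorm_expi].
by rewrite Cint_expi_sinc -!toCM; congr (_%:C); ring.
Qed.

Lemma Cint_tents (del v x : R) : 0 < del ->
  Cintegrable mu (fun t => (tri2 ((t - v) / del))%:C * expi (t * x)) /\
  Cint mu (fun t => (tri2 ((t - v) / del))%:C * expi (t * x)) =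
  (8 * del * sinc (del * x) ^+ 2)%:C * expi (v * x).
Proof.
move=> d0; have dn0 : del != 0 by rewrite gt_eqF.
have di0 : del^-1 != 0 by rewrite invr_eq0.
have [i1 e1] := Cint_tri2_expi (del * x).
have [i2 e2] := Cint_affine (- (v / del)) di0 i1.
have eq2 : (fun t => (tri2 ((t - v) / del))%:C * expi (t * x)) =
    (fun t => expi (v * x) * ((tri2 (del^-1 * t + - (v / del)))%:C *
       expi ((del^-1 * t + - (v / del)) * (del * x)))).
  apply/funext => t; rewrite mulrCA -expiD; congr (_%:C * expi _).
    by congr tri2; field.
  by field.
rewrite eq2; split; first exact: CintegrableZ.
rewrite (CintZ _ i2).
have -> : Cint mu (fun t => (tri2 (del^-1 * t + - (v / del)))%:C *
    expi ((del^-1 * t + - (v / del)) * (del * x))) = del%:C * (8 * sinc (del * x) ^+ 2)%:C.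
  rewrite -e1 e2 mulrA -toCM gtr0_norm ?invr_gt0// mulfV//.
  by rewrite mul1r.
by rewrite -toCM mulrC; congr (_%:C * _); ring.
Qed.

Context {d : nat}.
Local Notation L := (lebesgue_Rn R d).

Lemma fourier_box (e : R) (x u : Rn R d) : 0 < e ->
  fourier (toC (fun y => \1_(cube e) (vsub y x))) u =
  (\prod_(i < d) (2 * e * sinc (e * tnth u i)))%:C * expi (- dotp u x).
Proof.
move=> e0; have en0 : e^-1 != 0 by rewrite invr_eq0 gt_eqF.
have key (ui xi : R) : Cintegrable mu (fun t => itvC (- e) e (t - xi) * expi (- (ui * t))) /\
    Cint mu (fun t => itvC (- e) e (t - xi) * expi (- (ui * t))) =
    (2 * e * sinc (e * ui))%:C * expi (- (ui * xi)).
  have i0 : Cintegrable mu (fun t => itvC (-1) 1 t * expi (t * (- (e * ui)))).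
    by apply: (@Cintegrable_itvC R _ _ _ 1) => [|t _]; [exact: cmeas_expiM|rewrite cnorm_expi].
  have [i1 e1] := Cint_affine (- (xi / e)) en0 i0.
  have eq1 : (fun t => itvC (- e) e (t - xi) * expi (- (ui * t))) =
      (fun t => expi (- (ui * xi)) * (itvC (-1) 1 (e^-1 * t + - (xi / e)) *
         expi ((e^-1 * t + - (xi / e)) * (- (e * ui))))).
    apply/funext => t; rewrite mulrCA -expiD; congr (_ * expi _); last first.
      by field; rewrite gt_eqF.
    have ez : t - xi = e * (e^-1 * t + - (xi / e)) by field; rewrite gt_eqF.
    rewrite /itvC !indicE; congr ((_ : bool)%:R)%:C.
    by rewrite !mem_setE !in_itv/= -!ler_norml ez normrM gtr0_norm// -[X in _ <= X]mulr1 ler_pM2l.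
  rewrite eq1; split; first exact: CintegrableZ.
  rewrite (CintZ _ i1) mulrC; congr (_ * _).
  have -> : Cint mu (fun t => itvC (-1) 1 (e^-1 * t + - (xi / e)) *
      expi ((e^-1 * t + - (xi / e)) * (- (e * ui)))) =
      e%:C * Cint mu (fun t => itvC (-1) 1 t * expi (t * (- (e * ui)))).
    rewrite e1 mulrA -toCM gtr0_norm ?invr_gt0// mulfV ?gt_eqF//.
    by rewrite mul1r.
  rewrite Cint_expi_sinc -toCM; congr (_%:C).
  have sN z : sinc (- z) = sinc z :> R.
    rewrite /sinc oppr_eq0; case: eqP => // /eqP z0.
    by rewrite sinN invrN mulrNN.
  by rewrite sN; ring.
have [_ e1] := Cint_prod (fun i : 'I_d => (key (tnth u i) (tnth x i)).1).
rewrite fourierE (_ : (fun y => _) = (fun y : Rn R d => \prod_(i < d)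
    (itvC (- e) e (tnth y i - tnth x i) * expi (- (tnth u i * tnth y i))))).
  rewrite e1 (eq_bigr _ (fun i _ => (key (tnth u i) (tnth x i)).2)) big_split/= -toC_prod.
  by rewrite -expi_sum /dotp -sumrN.
apply/funext => y; rewrite big_split -expi_sum mulrC; congr (_ * expi _); last first.
  by rewrite /dotp -sumrN.
rewrite /toC -toC_prod; congr (_%:C); rewrite indicE.
case: (boolP (_ \in _)) => [|].
  rewrite inE => h; rewrite big1// => i _; rewrite indicE mem_set//=.
  by have := h i; rewrite tnthE in_itv/=.
rewrite notin_setE => h; have [i hi] := (existsNP _).2 h.
by rewrite (bigD1 i)//= indicE memNset ?mul0r//= in_itv/=; move: hi; rewrite tnthE.
Qed.

Lemma Ccb_box (e : R) (x : Rn R d) : 0 < e -> Ccb (toC (fun y => \1_(cube e) (vsub y x))).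
Proof.
move=> e0; split.
  split; [|exact: measurable_cst|].
    apply/measurable_EFinP; apply: measurable_indic_comp; first exact: measurable_cube.
    by apply: measurable_vsub => //; exact: measurable_cst.
  by exists 1 => y; rewrite /toC cnorm_toC indicE; case: (_ \in _); rewrite ?normr1 ?normr0.
exists (d%:R * e + enorm x) => y yx; rewrite /toC indicE memNset// => /enorm_cube h.
have : y = vadd (vsub y x) x by apply: eq_from_tnth => i; rewrite !tnthE subrK.
move=> ye; have := enormD (vsub y x) x; rewrite -ye; move: yx h; lra.
Qed.

End transforms.

(** * A function with bounded spectrum dominated by the spectral density *)

(** Turns a proof of sigma-finiteness into the structure on which Fubini's
    theorem is stated. *)
Lemma sigma_finite_pack (R : realType) (disp : measure_display) (T : measurableType disp)
    (m : {measure set T -> \bar R}) : sigma_finite setT m ->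
  exists m' : {sigma_finite_measure set T -> \bar R}, (m' : {measure set T -> \bar R}) = m.
Proof.
case: m => f [fc fm] h.
pose m' := HB.pack_for (SigmaFiniteMeasure.type T R) f fc fm
  (@Measure_isSigmaFinite.Axioms_ _ _ _ f fc fm h).
by exists m'.
Qed.

Section singular_part.
Context {R : realType} {disp : measure_display} {T : measurableType disp}.
Variables (S m nu : {measure set T -> \bar R}) (s : T -> R) (N : set T).
Hypothesis ms : measurable_fun setT s.
Hypothesis s0 : forall x, 0 <= s x.
Hypothesis SE : forall A, measurable A -> (S A = \int[m]_(u in A) (s u)%:E + nu A)%E.
Hypotheses (mN : measurable N) (nuN : nu (~` N) = 0%E).

Let ge0_off_singular (f : T -> R) : measurable_fun setT f -> (forall x, 0 <= f x) ->
  (forall x, N x -> f x = 0) -> (\int[S]_x (f x)%:E = \int[m]_x (f x * s x)%:E)%E.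
Proof.
move=> mf f0 fN; rewrite (ge0_integral_decomp ms s0 SE); last 2 first.
- exact/measurable_EFinP.
- by move=> x; rewrite lee_fin.
rewrite [X in (_ + X)%E](_ : _ = 0)%E ?adde0//.
rewrite -(setUv N) ge0_integral_setU//=; last 4 first.
- exact: measurableC.
- by apply/measurable_EFinP; rewrite setUv.
- by move=> x _; rewrite lee_fin.
- by apply/disj_setPS => x [].
rewrite integral0_eq ?add0e; last by move=> x Nx; rewrite fN.
apply/eqP; rewrite eq_le integral_ge0 ?andbT//; last by move=> x _; rewrite lee_fin.
rewrite -(@integral_abs_eq0 _ _ _ nu _ (EFin \o f) (measurableC mN) _ nuN); last first.
  by apply/measurable_EFinP; apply: measurable_funS mf.
by apply: ge0_le_integral => //; [exact: measurableC|move=> x _; rewrite lee_fin|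
   apply/measurable_EFinP; apply: measurable_funS mf|
   apply: measurableT_comp => //; apply/measurable_EFinP; apply: measurable_funS mf|
   move=> x _; rewrite /= lee_fin ler_norm].
Qed.

Let real_off_singular (f : T -> R) : S.-integrable setT (EFin \o f) ->
  (forall x, N x -> f x = 0) -> m.-integrable setT (EFin \o (fun x => f x * s x)) /\
  (\int[S]_x f x = \int[m]_x (f x * s x))%R.
Proof.
move=> fi fN; have mf : measurable_fun setT f by apply/measurable_EFinP; case/integrableP: fi.
have mfs : measurable_fun setT (fun x => f x * s x) by exact: measurable_funM.
have e1 : (\int[m]_x `|(f x * s x)%:E| = \int[S]_x `|(f x)%:E|)%E.
  rewrite [RHS](ge0_off_singular (f := fun x => `|f x|))//; last 2 first.
  - exact: measurableT_comp.
  - by move=> x /fN ->; rewrite normr0.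
  by apply: eq_integral => x _; rewrite /= normrM (ger0_norm (s0 x)).
split.
  apply/integrableP; split; first exact/measurable_EFinP.
  by rewrite e1; case/integrableP: fi.
pose p x := Num.max (f x) 0; pose q x := Num.max (- f x) 0.
have mp : measurable_fun setT p by apply: measurable_maxr => //; exact: measurable_cst.
have mq : measurable_fun setT q.
  by apply: measurable_maxr; [exact: measurableT_comp|exact: measurable_cst].
have pq0 x : 0 <= p x /\ 0 <= q x by rewrite /p /q !le_max lexx !orbT.
rewrite /Rintegral integralE [in RHS]integralE; congr (fine (_ - _)%E).
  transitivity (\int[S]_x (p x)%:E)%E.
    by apply: eq_integral => x _; rewrite funeposE /= /p -EFin_max.
  rewrite ge0_off_singular//; last 2 first.
  - by move=> x; exact: (pq0 x).1.
  - by move=> x /fN; rewrite /p => ->; rewrite maxxx.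
  apply: eq_integral => x _; rewrite funeposE /= /p -EFin_max; congr EFin.
  by rewrite maxr_pMl// mul0r.
transitivity (\int[S]_x (q x)%:E)%E.
  by apply: eq_integral => x _; rewrite funenegE /= /q -EFin_max.
rewrite ge0_off_singular//; last 2 first.
- by move=> x; exact: (pq0 x).2.
- by move=> x /fN; rewrite /q => ->; rewrite oppr0 maxxx.
apply: eq_integral => x _; rewrite funenegE /= /q -EFin_max -mulNr; congr EFin.
by rewrite maxr_pMl// mul0r.
Qed.

(** Off a set that carries [nu], [S] has the density [s]. *)
Lemma Cint_off_singular (f : T -> R[i]) : Cintegrable S f -> (forall x, N x -> f x = 0) ->
  Cintegrable m (fun x => f x * (s x)%:C) /\ Cint S f = Cint m (fun x => f x * (s x)%:C).
Proof.
move=> /CintegrableP[f1 f2] fN.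
have [|g1 e1] := real_off_singular f1; first by move=> x /fN /= ->.
have [|g2 e2] := real_off_singular f2; first by move=> x /fN /= ->.
have eR x : cRe (f x * (s x)%:C) = cRe (f x) * s x by rewrite cReM/= mulr0 subr0.
have eI x : cIm (f x * (s x)%:C) = cIm (f x) * s x by rewrite cImM/= mulr0 add0r.
split.
  by apply/CintegrableP; split; [move: g1|move: g2]; congr (_.-integrable _ _);
    apply/funext => x /=; rewrite ?eR ?eI.
rewrite /Cint /= e1 e2; congr (_ +i* _); apply: eq_Rintegral => x _;
  by rewrite ?eR ?eI.
Qed.

End singular_part.

Section ae_zero.
Context {R : realType} {d : nat}.
Implicit Type m : {measure set (Rn R d) -> \bar R}.

Let Rae_zero m n (f : Rn R d -> R) :
  m.-integrable setT (EFin \o (fun u => f u * \1_(cube n) u)) ->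
  (forall E, measurable E -> (\int[m]_u (f u * \1_(E `&` cube n) u))%R = 0) ->
  {ae m, forall u, cube n u -> f u = 0}.
Proof.
move=> fi f0; pose g u := (f u * \1_(cube n) u)%:E.
have : ae_eq m setT g (cst 0%E).
  apply: (@integral_ae_eq _ _ _ m setT) => // E _ mE.
  rewrite integral0 integral_mkcond.
  have iE : m.-integrable setT (EFin \o (fun u => f u * \1_(E `&` cube n) u)).
    have /measurable_EFinP mg := measurable_int _ fi.
    apply: le_integrable fi => //.
      apply/measurable_EFinP; rewrite (_ : (fun _ => _) = (fun u => f u * \1_(cube n) u * \1_E u)).
        by apply: measurable_funM.
      by apply/funext => u; rewrite -mulrA; congr (_ * _); rewrite indicI /= mulrC.
    move=> u _; rewrite !abse_EFin lee_fin !normrM ler_wpM2l//.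
    by rewrite indicI /= normrM ler_piMl// indicE; case: (_ \in _); rewrite ?normr1 ?normr0.
  have := f0 _ mE; rewrite /Rintegral => h.
  transitivity ((fine (\int[m]_u (f u * \1_(E `&` cube n) u)%:E))%:E); last by rewrite h.
  rewrite fineK; last exact: (integrable_fin_num _ iE).
  apply: eq_integral => u _; rewrite patchE /g indicI /= [\1_E u]indicE.
  by case: (u \in E); [rewrite mul1r|rewrite mul0r mulr0].
apply: filterS => u h cu; have := h I; rewrite /g indicE mem_set// mulr1.
by case.
Qed.

(** Exhaustion by cubes, for the real and imaginary parts. *)
Lemma Cint_cube_ae m (f : Rn R d -> R[i]) : locally_Cintegrable m f id ->
  (forall E r, measurable E -> Cint m (fun u => f u * (\1_(E `&` cube r) u)%:C) = 0) ->
  {ae m, forall u, f u = 0}.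
Proof.
move=> [mf lf] f0.
have ER A u : cRe (f u * (\1_A u)%:C) = cRe (f u) * \1_A u by rewrite cReM/= mulr0 subr0.
have EI A u : cIm (f u * (\1_A u)%:C) = cIm (f u) * \1_A u by rewrite cImM/= mulr0 add0r.
have aR n : {ae m, forall u, cube n%:R u -> cRe (f u) = 0}.
  apply: Rae_zero => [|E mE].
    have [] := (CintegrableP m _).1 (lf n%:R); move=> h _; move: h; congr (_.-integrable _ _).
    by apply/funext => u; rewrite /= ER.
  have := congr1 (@complex.Re R) (f0 E n%:R mE); rewrite /= => <-.
  by apply: eq_Rintegral => u _; rewrite ER.
have aI n : {ae m, forall u, cube n%:R u -> cIm (f u) = 0}.
  apply: Rae_zero => [|E mE].
    have [] := (CintegrableP m _).1 (lf n%:R); move=> _ h; move: h; congr (_.-integrable _ _).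
    by apply/funext => u; rewrite /= EI.
  have := congr1 (@complex.Im R) (f0 E n%:R mE); rewrite /= => <-.
  by apply: eq_Rintegral => u _; rewrite EI.
apply: filterS2 (ae_foralln aR) (ae_foralln aI) => u hR hI.
have [n cn] : exists n : nat, cube n%:R u.
  exists (Num.truncn (enorm u)).+1; apply: cube_enorm; apply/ltW/truncnS_gt.
by apply: complex_ext; [exact: (hR n)|exact: (hI n)].
Qed.

End ae_zero.

Lemma Cint_exchange {R : realType} {d1 d2 : measure_display}
    {T1 : measurableType d1} {T2 : measurableType d2}
    (m1 : {sigma_finite_measure set T1 -> \bar R})
    (m2 : {sigma_finite_measure set T2 -> \bar R})
    (f : T1 -> R[i]) (g : T2 -> R[i]) (h : T1 * T2 -> R) :
  Cintegrable m1 f -> Cintegrable m2 g -> measurable_fun setT h ->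
  Cint m1 (fun x => f x * Cint m2 (fun y => g y * expi (h (x, y)))) =
  Cint m2 (fun y => g y * Cint m1 (fun x => f x * expi (h (x, y)))).
Proof.
move=> fi gi mh; pose F (z : T1 * T2) := f z.1 * g z.2 * expi (h z).
have mF : cmeas F.
  by apply: cmeasM (cmeas_expi mh); apply: cmeasM;
    [apply: cmeas_comp fi.1 _ | apply: cmeas_comp gi.1 _].
have [|_ _ _ e1 e2] := Cfubini mF fi.2 gi.2.
  by move=> x y; rewrite /F !cnormM cnorm_expi mulr1.
have hx x : measurable_fun setT (fun y => h (x, y)) by exact: measurableT_comp (measurable_pair1 x).
have hy y : measurable_fun setT (fun x => h (x, y)) by exact: measurableT_comp (measurable_pair2 y).
have ig x : Cintegrable m2 (fun y => g y * expi (h (x, y))).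
  have := Cintegrable_expiM (hx x) gi; congr Cintegrable; apply/funext => y; exact: mulrC.
have if_ y : Cintegrable m1 (fun x => f x * expi (h (x, y))).
  have := Cintegrable_expiM (hy y) fi; congr Cintegrable; apply/funext => x; exact: mulrC.
transitivity (Cint m1 (fun x => Cint m2 (fun y => F (x, y)))).
  by apply: eq_Cint => x; rewrite -CintZ//; apply: eq_Cint => y; rewrite /F mulrA.
rewrite e1 -e2; apply: eq_Cint => y; rewrite -CintZ//; apply: eq_Cint => x.
by rewrite /F mulrA; congr (_ * _); exact: mulrC.
Qed.

Lemma cnorm_conj {R : realType} (z : R[i]) : cnorm z^* = cnorm z.
Proof.
by apply/eqP; rewrite -(eqrXn2 (_ : 0 < 2)%N) ?cnorm_ge0// !cnorm2E; case: z => a b /=; rewrite sqrrN.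
Qed.

Section tents_transform.
Context {R : realType} {d : nat}.
Local Notation L := (lebesgue_Rn R d).
Variables (del v : Rn R d).
Hypothesis del0 : forall i, 0 < tnth del i.

Let c0 : idcos != 0 :> R. Proof. by rewrite gt_eqF ?idcos_gt0. Qed.

(** A modulated Fejer kernel, normalized to have a tent as its transform. *)
Definition tents_ker1 (i : 'I_d) (t : R) : R[i] := (4 * tnth del i / idcos)%:C *
  ((sinc_pow (tnth del i) 0 2 t)%:C * expi (- (t * - tnth v i))).

Definition tents_ker (x : Rn R d) : R[i] := \prod_(i < d) tents_ker1 i (tnth x i).

Lemma Cintegrable_tents_ker : Cintegrable L tents_ker.
Proof.
apply: (@Cint_prod R d tents_ker1 _).1 => i; apply: CintegrableZ; exact: Cintegrable_sinc_pow.
Qed.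

Lemma tents_kerE u : (tents del v u)%:C = Cint L (fun x => tents_ker x * expi (- dotp u x)).
Proof.
pose f (i : 'I_d) (t : R) : R[i] := (4 * tnth del i / idcos)%:C *
  ((sinc_pow (tnth del i) 0 2 t)%:C * expi (- (t * (tnth u i - tnth v i)))).
have [|_ e1] := @Cint_prod R d f.
  by move=> i; apply: CintegrableZ; exact: Cintegrable_sinc_pow.
transitivity (Cint L (fun x => \prod_(i < d) f i (tnth x i))).
  rewrite e1 /tents toC_prod; apply: eq_bigr => i _; rewrite /f CintZ; last exact: Cintegrable_sinc_pow.
  have := sinc_kerE (tnth u i - tnth v i) (del0 i); rewrite /sinc_ker => ->.
  rewrite -toCM; congr (_%:C); field.
  by rewrite c0 gt_eqF.
apply: eq_Cint => x; rewrite /tents_ker /dotp -sumrN expi_sum -big_split /=; apply: eq_bigr => i _.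
rewrite /f /tents_ker1 -!mulrA; congr (_ * (_ * _)); rewrite -expiD; congr expi; ring.
Qed.

End tents_transform.

Section dual_kernel.
Context {R : realType} {d : nat}.
Local Notation L := (lebesgue_Rn R d).
Local Notation mu := (@lebesgue_measure R).
Variables (S : {sigma_finite_measure set (Rn R d) -> \bar R}).
Variables (F : Rn R d -> R[i]) (A : set (Rn R d)) (r e : R).
Hypotheses (e0 : 0 < e) (Ar : A `<=` cube r).

Definition box_transform (c : R) (u : Rn R d) : R :=
  \prod_(i < d) (2 * c * sinc (c * tnth u i)).

Let b u := box_transform e u.
Hypotheses (F2 : inL2 S F) (b2 : inL2 S (fun u => (b u)%:C)).
Hypothesis orth : forall x, (forall t, A t -> ~ cube e (vsub t x)) ->
  Cint S (fun u => (b u)%:C * expi (- dotp u x) * (F u)^*) = 0.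

Let a u := (b u)%:C * (F u)^*.

Let ia : Cintegrable S a.
Proof. exact: (inL2_pairing b2 (inL2_conj F2)).1. Qed.

Let phi x := Cint S (fun u => a u * expi (- dotp u x)).

Definition blur (c : R) : set (Rn R d) := [set x | exists2 t, A t & cube c (vsub t x)].

Lemma blur_cube c : blur c `<=` cube (r + c).
Proof.
by move=> x [t /Ar At ct] i; have := At i; have := ct i; rewrite tnthE;
  move=> /andP[? ?] /andP[? ?]; apply/andP; split; lra.
Qed.

Let mdot : measurable_fun setT (fun z : Rn R d * Rn R d => dotp z.1 z.2).
Proof. exact: measurable_dotp. Qed.

Let phi_int : Cintegrable L phi.
Proof.
apply: Ccb_integrable; apply: (@Ccb_of_bound _ _ _ (\int[S]_u cnorm (a u))%R (r + e)).
- apply: (@cmeas_Cint _ _ _ _ _ S (fun z : Rn R d * Rn R d => a z.2 * expi (- dotp z.2 z.1))).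
  apply: cmeasM; first by apply: cmeas_comp ia.1 _.
  by apply: cmeas_expi; apply: measurableT_comp => //; exact: measurable_dotp.
- move=> x; have ix : Cintegrable S (fun u => a u * expi (- dotp u x)).
    have mx : measurable_fun setT (fun u : Rn R d => - dotp u x).
      by apply: measurableT_comp => //; apply: measurable_dotp => //; exact: measurable_cst.
    have := Cintegrable_expiM mx ia; congr Cintegrable; apply/funext => u; exact: mulrC.
  apply: (le_trans (cnorm_Cint ix)); rewrite le_eqVlt; apply/orP; left; apply/eqP.
  by apply: eq_Rintegral => u _; rewrite cnormM cnorm_expi mulr1.
- move=> x nx; rewrite -[RHS](orth (x := x)).
    by apply: eq_Cint => u; rewrite /a mulrAC.
  by move=> t At ct; apply: nx; apply: blur_cube; exists t.
Qed.

(** With [b] the transform of a box, [phi] is the transform of the measure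
    [b F^* S]; it vanishes away from [A], because the translated boxes
    that miss [A] are orthogonal to [F]. Transforming back gives, up to a
    constant, the density of [b F^* S] with respect to Lebesgue measure. *)
Definition dual_fun u := Cint L (fun x => phi x * expi (dotp u x)).
Local Notation chi := dual_fun.

Lemma brep_dual_fun : brep (blur e) chi.
Proof.
exists _, _, L, phi, id; split=> //.
move=> x; apply: contra_neqP => nB; rewrite -[RHS](orth (x := x)).
  by apply: eq_Cint => u; rewrite /a mulrAC.
by move=> t At ct; apply: nB; exists t.
Qed.

Section tents.
Variables (del v : Rn R d).
Hypothesis del0 : forall i, 0 < tnth del i.

Let c0 : idcos != 0 :> R. Proof. by rewrite gt_eqF ?idcos_gt0. Qed.

Let kappa := tents_ker del v.

Let kap_int : Cintegrable L kappa.
Proof. exact: Cintegrable_tents_ker. Qed.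

Let tents_trans x : Cintegrable L (fun u => (tents del v u)%:C * expi (dotp u x)) /\
  Cint L (fun u => (tents del v u)%:C * expi (dotp u x)) = ((2 * idcos) ^+ d)%:C * kappa x.
Proof.
have [i1 e1] := Cint_prod (fun i : 'I_d => (Cint_tents (tnth v i) (tnth x i) (del0 i)).1).
have eqf : (fun u => (tents del v u)%:C * expi (dotp u x)) = (fun u : Rn R d => \prod_(i < d)
    ((tri2 ((tnth u i - tnth v i) / tnth del i))%:C * expi (tnth u i * tnth x i))).
  by apply/funext => u; rewrite big_split /= -toC_prod -expi_sum.
rewrite eqf; split=> //; rewrite e1 -[X in (_ ^+ X)%:C](card_ord d) -prodr_const toC_prod.
rewrite -big_split /=; apply: eq_bigr => i _.
rewrite (Cint_tents _ _ (del0 i)).2 /tents_ker1 !mulrA -!toCM; congr (_%:C * expi _); last by ring.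
rewrite /sinc_pow expr0 mul1r; field; exact: c0.
Qed.

(** Fourier inversion, tested on tents, whose transforms are explicit and
    integrable. *)
Lemma dual_fun_tents : Cintegrable L (fun u => (tents del v u)%:C) /\
  Cint L (fun u => chi u * (tents del v u)%:C) =
  ((2 * idcos) ^+ d)%:C * Cint S (fun u => a u * (tents del v u)%:C).
Proof.
have tint : Cintegrable L (fun u => (tents del v u)%:C).
  have := (tents_trans vzero).1; congr Cintegrable; apply/funext => u.
  by rewrite dotp0r expi0 mulr1.
split=> //; have E1 : Cint S (fun u => a u * (tents del v u)%:C) = Cint L (fun x => kappa x * phi x).
  transitivity (Cint S (fun u => a u * Cint L (fun x => kappa x * expi (- dotp u x)))).
    by apply: eq_Cint => u; rewrite tents_kerE.
  by apply: (@Cint_exchange _ _ _ _ _ S L a kappa (fun z => - dotp z.1 z.2) ia kap_int); exact: measurableT_comp.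
have E2 : Cint L (fun u => chi u * (tents del v u)%:C) =
    Cint L (fun x => phi x * (((2 * idcos) ^+ d)%:C * kappa x)).
  transitivity (Cint L (fun u => (tents del v u)%:C * chi u)).
    by apply: eq_Cint => u; exact: mulrC.
  rewrite (@Cint_exchange _ _ _ _ _ L L _ phi (fun z => dotp z.1 z.2) tint phi_int mdot).
  by apply: eq_Cint => x; rewrite (tents_trans x).2.
rewrite E1 E2 -CintZ; first by apply: eq_Cint => x; rewrite mulrCA (mulrC (phi x)).
have [c hc] : exists c, forall x, cnorm (phi x) <= c.
  exists (\int[S]_u cnorm (a u))%R => x.
  have mx : measurable_fun setT (fun u : Rn R d => - dotp u x).
    by apply: measurableT_comp => //; apply: measurable_dotp => //; exact: measurable_cst.
  have ix : Cintegrable S (fun u => a u * expi (- dotp u x)).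
    have := Cintegrable_expiM mx ia; congr Cintegrable; apply/funext => u; exact: mulrC.
  apply: (le_trans (cnorm_Cint ix)); rewrite le_eqVlt; apply/orP; left; apply/eqP.
  by apply: eq_Rintegral => u _; rewrite cnormM cnorm_expi mulr1.
have := CintegrableM_bounded phi_int.1 kap_int hc; congr Cintegrable.
by apply/funext => x; exact: mulrC.
Qed.

End tents.

Let c : R[i] := ((2 * idcos) ^- d)%:C.

Let lS : locally_Cintegrable S a id.
Proof.
split=> [|r']; first exact: ia.1.
have := CintegrableM_bounded (cmeas_toC (measurable_indic (measurable_cube r'))) ia
  (c := 1) _; rewrite (_ : (fun x => _) = (fun w => a w * (\1_(cube r') w)%:C)); last first.
  by apply/funext => u; exact: mulrC.
by apply=> u; rewrite cnorm_toC indicE; case: (_ \in _); rewrite ?normr1 ?normr0.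
Qed.

Let lL : locally_Cintegrable L (fun u => c * chi u) id.
Proof.
have mchi := brep_cmeas brep_dual_fun; have [k hk] := brep_bounded brep_dual_fun.
split=> [|r']; first by apply: cmeasM => //; exact: cmeas_cst.
apply: (@Cintegrable_le _ _ _ _ _ (fun u => cnorm c * k * \1_(cube `|r'|) u)) => [||u].
- apply: cmeasM; first by apply: cmeasM => //; exact: cmeas_cst.
  by apply: cmeas_toC; apply: measurable_indic; exact: measurable_cube.
- exact: integrable_cst_cube.
rewrite !cnormM [cnorm (\1__ _)%:C]cnorm_toC !indicE normr_nat ler_pM ?mulr_ge0 ?cnorm_ge0//.
  by rewrite ler_wpM2l ?cnorm_ge0.
rewrite ler_nat; case: (boolP (u \in cube r')) => // /set_mem h; rewrite mem_set// => i.
have /andP[h1 h2] := h i; have := ler_norm r'; move: h1 h2; move: (`|r'|) => q h1 h2 h3.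
by apply/andP; split; lra.
Qed.

Lemma dual_fun_cube E r' : measurable E ->
  Cint S (fun u => a u * (\1_(E `&` cube r') u)%:C) =
  Cint L (fun u => c * chi u * (\1_(E `&` cube r') u)%:C).
Proof.
move=> mE; apply: (unique_of_tents (@measurable_id _ _ _) (@measurable_id _ _ _) lS lL) => //.
move=> del v del0.
have cc : c * ((2 * idcos) ^+ d)%:C = 1.
  by rewrite -toCM mulVf// expf_eq0 mulf_eq0 pnatr_eq0 /= (gt_eqF idcos_gt0) andbF.
have [ti te] := dual_fun_tents v del0; have [k hk] := brep_bounded brep_dual_fun.
rewrite -[LHS]mul1r -cc -mulrA -te -CintZ; first by apply: eq_Cint => u; rewrite mulrA.
exact: CintegrableM_bounded (brep_cmeas brep_dual_fun) ti hk.
Qed.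

Lemma dual_fun_eq0 : (forall u, chi u = 0) -> {ae S, forall u, b u = 0 \/ F u = 0}.
Proof.
move=> chi0; have : {ae S, forall u, a u = 0}.
  apply: Cint_cube_ae lS _ => E r' mE; rewrite dual_fun_cube// -[RHS](Cint0 L).
  by apply: eq_Cint => u; rewrite chi0 mulr0 mul0r.
apply: filterS => u /(congr1 cnorm); rewrite cnormM cnorm_conj cnorm0 cnorm_toC => /eqP.
rewrite mulf_eq0 normr_eq0 => /orP[/eqP ->|/eqP /cnorm_eq0 ->]; first by left.
by right.
Qed.

Variables (nu : {measure set (Rn R d) -> \bar R}) (s : Rn R d -> R) (N : set (Rn R d)).
Hypothesis ms : measurable_fun setT s.
Hypothesis s0 : forall x, 0 <= s x.
Hypothesis SE : forall E, measurable E -> (S E = \int[L]_(u in E) (s u)%:E + nu E)%E.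
Hypothesis msi : measurable_fun setT (sinv s).
Hypotheses (mN : measurable N) (LN : L N = 0%E) (nuN : nu (~` N) = 0%E).

Let normI E (u : Rn R d) : cnorm (\1_E u : R)%:C <= 1.
Proof. by rewrite cnorm_toC indicE; case: (_ \in _); rewrite ?normr1 ?normr0. Qed.

Let cI E : measurable E -> cmeas (fun u : Rn R d => (\1_E u : R)%:C).
Proof. by move=> mE; apply: cmeas_toC; exact: measurable_indic. Qed.

Let mulI (E E' : set (Rn R d)) (u : Rn R d) (z : R[i]) :
  z * (\1_E u)%:C * (\1_E' u)%:C = z * (\1_(E `&` E') u)%:C.
Proof. by rewrite -mulrA -toCM indicI. Qed.

(** Equal complex measures have equal densities off the set [N] that
    carries the singular part. *)
Lemma dual_fun_ae : {ae L, forall u, c * chi u = a u * (s u)%:C}.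
Proof.
pose f u := c * chi u * (\1_(~` N) u)%:C - a u * (\1_(~` N) u)%:C * (s u)%:C.
have mC := measurableC mN.
have off E : measurable E -> Cintegrable L (fun u => a u * (\1_(E `&` ~` N) u)%:C * (s u)%:C) /\
    Cint S (fun u => a u * (\1_(E `&` ~` N) u)%:C) =
    Cint L (fun u => a u * (\1_(E `&` ~` N) u)%:C * (s u)%:C).
  move=> mE; apply: (Cint_off_singular ms s0 SE mN nuN).
    have := CintegrableM_bounded (cI (measurableI _ _ mE mC)) ia (normI _).
    by congr Cintegrable; apply/funext => u; exact: mulrC.
  by move=> u Nu; rewrite indicE memNset ?mulr0// => -[].
have as_int : Cintegrable L (fun u => a u * (\1_(~` N) u)%:C * (s u)%:C).
  by have := (off setT measurableT).1; rewrite setTI.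
have lI r' E : measurable E -> Cintegrable L (fun u => c * chi u * (\1_(E `&` cube r') u)%:C).
  move=> mE; have := CintegrableM_bounded (cI mE) (lL.2 r') (normI _).
  by congr Cintegrable; apply/funext => u /=; rewrite mulrC mulI setIC.
have fE E r' u : f u * (\1_(E `&` cube r') u)%:C =
    c * chi u * (\1_((E `&` ~` N) `&` cube r') u)%:C -
    a u * (\1_((E `&` cube r') `&` ~` N) u)%:C * (s u)%:C.
  rewrite /f mulrBl; congr (_ - _).
    by rewrite mulI setIA (setIC (~` N)).
  by rewrite mulrAC mulI setIC.
have mEC (E : set (Rn R d)) (r' : R) : measurable E -> measurable (E `&` cube r').
  by move=> mE; apply: measurableI => //; exact: measurable_cube.
have fi E r' : measurable E -> Cintegrable L (fun u => f u * (\1_(E `&` cube r') u)%:C).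
  move=> mE; rewrite (funext (fE E r')); apply: CintegrableB.
    by apply: lI; exact: measurableI.
  by apply: (off _ _).1; exact: mEC.
have : {ae L, forall u, f u = 0}.
  apply: Cint_cube_ae => [|E r' mE].
    split=> [|r'].
      apply: cmeasB as_int.1; apply: cmeasM (cI mC); apply: cmeasM; first exact: cmeas_cst.
      exact: brep_cmeas brep_dual_fun.
    by have := fi setT r' measurableT; rewrite setTI.
  rewrite (funext (fE E r')) CintB; last 2 first.
  - by apply: lI; exact: measurableI.
  - by apply: (off _ _).1; exact: mEC.
  rewrite -(off _ (mEC _ _ mE)).2 -dual_fun_cube; last exact: measurableI.
  by rewrite setIAC subrr.
have aN : {ae L, forall u, ~ N u}.
  by exists N; split=> // u /= /contrapT.
apply: filterS2 aN => u; rewrite /f => nN.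
by rewrite indicE mem_set//= !mulr1 => /subr0_eq.
Qed.

(** Up to a constant [|chi|^2 / s] is equal to [|b F|^2 s], and [b] is
    bounded. *)
Lemma dual_fun_sinv : (\int[L]_u ((cnorm (chi u) ^+ 2)%:E * sinv s u) < +oo)%E.
Proof.
pose K : R := ((2 * idcos) ^+ d * (2 * e) ^+ d) ^+ 2.
have ci : ((2 * idcos) ^+ d)%:C * c = 1.
  by rewrite -toCM mulfV// expf_eq0 mulf_eq0 pnatr_eq0 /= (gt_eqF idcos_gt0) andbF.
have i0 : 0 <= (2 * idcos) ^+ d :> R by rewrite exprn_ge0// mulr_ge0// ltW ?idcos_gt0.
have be u : `|b u| <= (2 * e) ^+ d.
  rewrite /b /box_transform normr_prod -[X in _ ^+ X](card_ord d) -prodr_const.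
  apply: ler_prod => i _; rewrite normr_ge0 /= normrM ger0_norm ?mulr_ge0 ?(ltW e0)//.
  by rewrite ler_piMr ?ler_sinc1// mulr_ge0// ltW.
have mF : measurable_fun setT (fun u => (cnorm (F u) ^+ 2)%:E).
  by apply/measurable_EFinP; apply: measurable_funX; exact: measurable_cnorm F2.1.
have mFs : measurable_fun setT (fun u => (cnorm (F u) ^+ 2)%:E * (s u)%:E)%E.
  by apply: emeasurable_funM => //; exact/measurable_EFinP.
apply: (@le_lt_trans _ _ (\int[L]_u (K%:E * ((cnorm (F u) ^+ 2)%:E * (s u)%:E)))%E).
  apply: ae_ge0_le_integral => //.
  - by move=> u _; rewrite mule_ge0 ?lee_fin ?sqr_ge0// /sinv inve_ge0 lee_fin.
  - apply: emeasurable_funM msi; apply/measurable_EFinP; apply: measurable_funX.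
    exact: measurable_cnorm (brep_cmeas brep_dual_fun).
  - by move=> u _; rewrite !mule_ge0 ?lee_fin ?sqr_ge0.
  - exact: emeasurable_funM (measurable_cst _) mFs.
  apply: filterS dual_fun_ae => u ca _.
  have -> : chi u = ((2 * idcos) ^+ d)%:C * (a u * (s u)%:C) by rewrite -ca mulrA ci mul1r.
  rewrite /sinv; have [->|su] := eqVneq (s u) 0.
    by rewrite !mulr0 cnorm0 expr0n mul0e !mule0.
  rewrite inver (negbTE su) -!EFinM lee_fin /a !cnormM !cnorm_toC cnorm_conj (ger0_norm i0) (ger0_norm (s0 u)).
  rewrite (_ : _ / s u = ((2 * idcos) ^+ d * `|b u|) ^+ 2 * (cnorm (F u) ^+ 2 * s u)); last by field.
  rewrite /K; apply: ler_wpM2r; first by rewrite mulr_ge0 ?sqr_ge0.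
  rewrite lerXn2r ?nnegrE ?mulr_ge0 ?exprn_ge0 ?mulr_ge0 ?(ltW e0) ?(ltW idcos_gt0)//.
  by rewrite ler_wpM2l.
rewrite ge0_integralZl//; last 2 first.
- by move=> u _; rewrite mule_ge0 ?lee_fin ?sqr_ge0.
- by rewrite lee_fin sqr_ge0.
apply: lte_mul_pinfty; rewrite ?lee_fin ?sqr_ge0//.
apply: le_lt_trans (_ : (\int[S]_u (cnorm (F u) ^+ 2)%:E < +oo)%E).
  rewrite (ge0_integral_decomp ms s0 SE)//; last first.
    by move=> u; rewrite lee_fin sqr_ge0.
  by rewrite leeDl// integral_ge0// => u _; rewrite lee_fin sqr_ge0.
by rewrite sqnE// ltry.
Qed.

End dual_kernel.

Section non_rigidity.
Context {disp : measure_display} {T : measurableType disp} {R : realType}.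
Context {P : probability T R} {d : nat}.
Variables (M : wss_measure P d) (s : Rn R d -> R).
Hypothesis hs : is_spectral_density M s.
Local Notation L := (lebesgue_Rn R d).
Local Notation S := (wss_spectral M).

Let fourier_boxE e (x u : Rn R d) : 0 < e -> fourier (toC (fun y => \1_(cube e) (vsub y x))) u =
  (box_transform e u)%:C * expi (- dotp u x).
Proof. by move=> e0; rewrite fourier_box. Qed.

Lemma box_transform_gt0 e (u : Rn R d) : 0 < e -> (forall i, `|e * tnth u i| <= 1) ->
  e ^+ d <= box_transform e u.
Proof.
move=> e0 eu; rewrite -[X in _ ^+ X](card_ord d) -prodr_const; apply: ler_prod => i _.
rewrite (ltW e0) /=; have := sinc_ge_half (eu i); have := e0; move: (sinc _) => t h1 h2.
by nra.
Qed.

Let inL2_box e : 0 < e -> inL2 S (fun u => (box_transform e u)%:C).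
Proof.
move=> e0; have := inL2_fourier M (Ccb_box (@vzero R d) e0); congr inL2.
by apply/funext => u; rewrite fourier_boxE// dotp0r oppr0 expi0 mulr1.
Qed.

(** The transform of a small box is square-integrable and bounded below on
    the cube. *)
Lemma spectral_cube r : 0 < r -> (S (cube r) < +oo)%E.
Proof.
move=> r0; have e0 : 0 < r^-1 by rewrite invr_gt0.
have B2 := inL2_box e0; have p0 : 0 < (r^-1 ^+ d) ^+ 2 :> R by rewrite !exprn_gt0.
rewrite -(@lte_pmul2l _ ((r^-1 ^+ d) ^+ 2)%:E)//.
rewrite -integral_cst; last exact: measurable_cube.
have : (\int[S]_u (cnorm (box_transform r^-1 u)%:C ^+ 2)%:E < +oo)%E by rewrite sqnE// ltry.
rewrite mulry gtr0_sg// mul1e.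
apply: le_lt_trans; rewrite [leLHS]integral_mkcond; apply: ge0_le_integral => //.
- by move=> u _; rewrite patchE; case: ifP => // _; rewrite lee_fin ltW.
- by apply/(measurable_restrictT _ (measurable_cube r)); exact: measurable_cst.
- by apply/measurable_EFinP; apply: measurable_funX; apply: measurable_cnorm B2.1.
move=> u _; rewrite patchE; case: ifP => [/set_mem ur|_]; rewrite lee_fin ?sqr_ge0//.
rewrite cnorm_toC lerXn2r ?nnegrE ?normr_ge0 ?exprn_ge0 ?(ltW e0)//.
rewrite (le_trans _ (ler_norm _))// box_transform_gt0// => i.
rewrite normrM gtr0_norm// ler_pdivrMl// mulr1 ler_norml; exact: ur.
Qed.

Lemma spectral_sigma_finite : sigma_finite setT S.
Proof.
exists (fun n => cube n.+1%:R).
  apply/esym/seteqP; split=> // u _; exists (Num.truncn (enorm u)) => //.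
  by apply: cube_enorm; apply/ltW/truncnS_gt.
by move=> n; split; [exact: measurable_cube|exact: spectral_cube].
Qed.

(** The spectral measure might be carried by the zeros of the transform of
    one box. The boxes of half sides [eps / n.+1] have transforms without
    common zero, and one of them gives a function that is not zero. *)
Lemma dual_kernel A r eps : A `<=` cube r -> ~ linearly_maximally_rigid M A ->
  0 < eps -> exists e chi, [/\ 0 < e <= eps, brep (blur A e) chi, exists u0, chi u0 != 0 &
    (\int[L]_u ((cnorm (chi u) ^+ 2)%:E * sinv s u) < +oo)%E].
Proof.
move=> Ar nmax eps0; have [F [F2 sF orth]] := rigidity_defect Ar nmax.
have [S' S'E] := sigma_finite_pack spectral_sigma_finite.
have [ms s0 [nu [N [mN LN nuN]] SE]] := hs.
pose e n : R := eps / n.+1%:R.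
have e0 n : 0 < e n by rewrite divr_gt0.
have F2' : inL2 S' F by rewrite S'E.
have b2 n : inL2 S' (fun u => (box_transform (e n) u)%:C) by rewrite S'E; exact: inL2_box.
have orth' n x : (forall t, A t -> ~ cube (e n) (vsub t x)) ->
    Cint S' (fun u => (box_transform (e n) u)%:C * expi (- dotp u x) * (F u)^*) = 0.
  move=> tx; rewrite S'E -(orth _ (Ccb_box x (e0 n))).
    by apply: eq_Cint => u; rewrite fourier_boxE.
  by move=> t At; rewrite indicE memNset//; exact: tx.
have SE' E : measurable E -> (S' E = \int[L]_(u in E) (s u)%:E + nu E)%E.
  by move=> mE; rewrite -SE//; exact: (congr1 (fun m : {measure set _ -> \bar R} => m E) S'E).
have [[n [u0 chi0]]|chi0] := pselect (exists n u0, dual_fun S' F (e n) u0 != 0).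
  exists (e n), (dual_fun S' F (e n)); split.
  - by rewrite e0 /= /e ler_pdivrMr// ler_peMr ?(ltW eps0) ?ler1n.
  - exact: (brep_dual_fun Ar F2' (b2 n) (@orth' n)).
  - by exists u0.
  - exact: (dual_fun_sinv (e0 n) Ar F2' (b2 n) (@orth' n) ms s0 SE' (measurable_sinv hs) mN LN nuN).
exfalso; have z n : {ae S', forall u, box_transform (e n) u = 0 \/ F u = 0}.
  apply: (dual_fun_eq0 Ar F2' (b2 n) (@orth' n)) => u.
  by apply: contrapT => /eqP nz; apply: chi0; exists n, u.
have Fz : {ae S', forall u, F u = 0}.
  apply: filterS (ae_foralln z) => u h.
  pose n := Num.truncn (eps * enorm u).
  have [b0|//] := h n; exfalso.
  have : (e n) ^+ d <= box_transform (e n) u.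
    apply: box_transform_gt0 => // i; rewrite normrM gtr0_norm// /e mulrAC ler_pdivrMr// mul1r.
    apply: le_trans (ltW (truncnS_gt _)); apply: ler_wpM2l; [exact: ltW|exact: ler_norm_tnth].
  by rewrite b0 leNgt exprn_gt0.
move: sF; rewrite /sqn /Rintegral (@ae_eq_integral _ _ _ _ _ (cst 0%E)) ?integral0 ?ltxx//.
- by apply/measurable_EFinP; apply: measurable_funX; exact: measurable_cnorm F2.1.
- rewrite -S'E; apply: filterS Fz => u -> _ /=.
  by rewrite cnorm0 expr0n.
Qed.

End non_rigidity.

(** * Band-limited functions of one variable *)

Section one_variable.
Context {R : realType}.
Local Notation mu := (@lebesgue_measure R).

(** Transforms of complex measures of mass at most [c] carried by [[-r, r]]. *)
Definition rep1 (r c : R) (f : R -> R[i]) := exists (disp : measure_display)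
    (T : measurableType disp) (m : {sigma_finite_measure set T -> \bar R})
    (a : T -> R[i]) (X : T -> measurableTypeR R),
  [/\ Cintegrable m a, measurable_fun setT X, forall w, a w != 0 -> `|X w| <= r,
      forall v, f v = Cint m (fun w => a w * expi (v * X w)) &
      (\int[m]_w cnorm (a w))%R <= c].

Let rep1_int (disp : measure_display) (T : measurableType disp)
    (m : {sigma_finite_measure set T -> \bar R}) (a : T -> R[i]) (X : T -> measurableTypeR R) v :
  Cintegrable m a -> measurable_fun setT X -> Cintegrable m (fun w => a w * expi (v * X w)).
Proof.
move=> ia mX; have mv : measurable_fun setT (fun w => v * X w).
  by apply: measurable_funM.
by have := Cintegrable_expiM mv ia; congr Cintegrable; apply/funext => w; exact: mulrC.
Qed.

Lemma rep1_bound r c f v : rep1 r c f -> cnorm (f v) <= c.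
Proof.
move=> [disp [T [m [a [X [ia mX _ -> mc]]]]]].
apply: le_trans (cnorm_Cint (rep1_int v ia mX)) _; apply: le_trans mc.
rewrite le_eqVlt; apply/orP; left; apply/eqP; apply: eq_Rintegral => w _.
by rewrite cnormM cnorm_expi mulr1.
Qed.

Lemma rep1_cmeas r c f : rep1 r c f -> cmeas (f : measurableTypeR R -> R[i]).
Proof.
move=> [disp [T [m [a [X [ia mX _ fE _]]]]]]; rewrite (funext fE).
apply: (@cmeas_Cint _ _ _ _ _ m (fun z : measurableTypeR R * T => a z.2 * expi (z.1 * X z.2))).
apply: cmeasM; first exact: cmeas_comp ia.1 _.
by apply: cmeas_expi; apply: measurable_funM => //; exact: measurableT_comp.
Qed.

Lemma rep1_shift r c f v0 : rep1 r c f -> rep1 r c (fun v => f (v0 + v)).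
Proof.
move=> [disp [T [m [a [X [ia mX aX fE mc]]]]]].
exists disp, T, m, (fun w => a w * expi (v0 * X w)), X; split=> //.
- exact: rep1_int.
- by move=> w aw; apply: aX; apply: contraNneq aw => ->; rewrite mul0r.
- by move=> v; rewrite fE; apply: eq_Cint => w; rewrite -mulrA -expiD mulrDl.
- apply: le_trans mc; rewrite le_eqVlt; apply/orP; left; apply/eqP.
  by apply: eq_Rintegral => w _; rewrite cnormM cnorm_expi mulr1.
Qed.

(** The difference quotient at the origin, by integrating the derivative of
    the exponentials. *)
Lemma rep1_div r c f : 0 <= r -> rep1 r c f ->
  exists2 g, rep1 r (r * c) g & forall v, f v = f 0 + v%:C * g v.
Proof.
move=> r0 [disp [T [m [a [X [ia mX aX fE mc]]]]]].
have [M' M'E] := sigma_finite_pack (sigma_finite_product m mu).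
pose b (z : T * measurableTypeR R) := a z.1 * (X z.1) *i * itvC 0 1 z.2.
pose Y (z : T * measurableTypeR R) : measurableTypeR R := z.2 * X z.1.
have mX1 : measurable_fun setT (fun z : T * measurableTypeR R => X z.1) by exact: measurableT_comp.
have mY : measurable_fun setT Y by apply: measurable_funM.
have mb : cmeas b.
  apply: cmeasM; first apply: cmeasM.
  - exact: cmeas_comp ia.1 _.
  - by split=> //=; exact: measurable_cst.
  - apply: cmeas_toC; apply/measurable_EFinP; exact: measurable_indic_comp.
have i01 (h : R -> R[i]) : cmeas (h : measurableTypeR R -> R[i]) -> (forall t, cnorm (h t) <= 1) ->
    Cintegrable mu (fun t => itvC 0 1 t * h t).
  by move=> mh h1; apply: (@Cintegrable_itvC R _ _ _ 1).
have cI t : cnorm (itvC 0 1 t : R[i]) = \1_`[0, 1] t.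
  by rewrite /itvC cnorm_toC ger0_norm// indicE.
have iI : mu.-integrable setT (EFin \o (fun t => \1_`[0, 1]%classic t)).
  have := (i01 (fun=> 1) (cmeas_cst 1) _).2; rewrite -[1]/(1%:C).
  move=> h; have {}h := h _; apply: eq_integrable (h _) => // [t _|t].
    by rewrite mulr1 cI.
  by rewrite cnorm_toC normr1.
have bnd w t : cnorm (b (w, t)) <= (r * cnorm (a w)) * \1_`[0, 1] t.
  rewrite /b /= !cnormM cI ler_wpM2r// cnorm_toCi.
  have [->|aw] := eqVneq (a w) 0; first by rewrite cnorm0 mul0r mulr0.
  by rewrite mulrC ler_wpM2r ?cnorm_ge0//; exact: aX.
have ira : m.-integrable setT (EFin \o (fun w => r * cnorm (a w))).
  exact: (integrableZl measurableT r ia.2).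
have [ib _ _ _ _] := Cfubini mb ira iI bnd.
have mnb := measurable_cnorm mb.
have bnd' w t : `|cnorm (b (w, t))| <= (r * cnorm (a w)) * \1_`[0, 1] t.
  by rewrite ger0_norm ?cnorm_ge0.
have [i1 i2 _ e1 _] := Rfubini_dominated mnb ira iI bnd'.
have I1 : (\int[mu]_t \1_`[0, 1]%classic t)%R = 1 :> R.
  rewrite /Rintegral integral_indic// setIT.
  have h := @lebesgue_measure_itv R `[0, 1]; rewrite /= lte_fin ltr01 oppr0 adde0 in h.
  exact: (congr1 fine h).
(* The derivative in [t] of [expi (t v X)] is [v] times the exponential of
   spectrum [t X], with the weight [i X]. *)
exists (fun v => Cint M' (fun z => b z * expi (v * Y z))).
  exists _, _, M', b, Y; rewrite M'E; split=> //.
  - move=> [w t]; rewrite /b /Y /= !mulf_eq0 !negb_or => /andP[/andP[aw _]].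
    rewrite /itvC indicE; case: (boolP (t \in _)) => [|_]; last by rewrite eqxx.
    rewrite inE/= in_itv/= => /andP[t0 t1] _; rewrite normrM (ger0_norm t0).
    by rewrite (le_trans _ (aX _ aw))// ler_piMl.
  - rewrite -e1; apply: le_trans (_ : (\int[m]_w (r * cnorm (a w)))%R <= _).
      apply: le_Rintegral => // w _; rewrite -[leRHS]mulr1 -I1 -RintegralZl//.
      have ii : mu.-integrable setT (EFin \o (fun t => (r * cnorm (a w)) * \1_`[0, 1]%classic t)).
        exact: (integrableZl measurableT _ iI).
      apply: le_Rintegral => //; apply: le_integrable (ii) => //.
        apply/measurable_EFinP; exact: measurableT_comp mnb (measurable_pair1 w).
      move=> t _; rewrite /= lee_fin (le_trans (bnd' w t))//; exact: ler_norm.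
    by rewrite RintegralZl ?ler_wpM2l//; exact: ia.2.
move=> v; rewrite M'E !fE -CintZ; last first.
  have mvY : measurable_fun setT (fun z => v * Y z) by exact: measurable_funM.
  by have := Cintegrable_expiM mvY ib; congr Cintegrable; apply/funext => z; exact: mulrC.
pose B (z : T * measurableTypeR R) := v%:C * (b z * expi (v * Y z)).
have mB : cmeas B.
  apply: cmeasM; first exact: cmeas_cst.
  by apply: cmeasM => //; apply: cmeas_expi; exact: measurable_funM.
have irb : m.-integrable setT (EFin \o (fun w => `|v| * (r * cnorm (a w)))).
  exact: (integrableZl measurableT `|v| ira).
have [|_ i3 _ <- _] := Cfubini mB irb iI.
  move=> w t; rewrite /B cnormM cnorm_toC cnormM cnorm_expi mulr1 -mulrA; by apply: ler_wpM2l => //; exact: bnd.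
have inner w : Cint mu (fun t => B (w, t)) = a w * expi (v * X w) - a w * expi (0 * X w).
  have it : Cintegrable mu (fun t => itvC 0 1 t * expi (t * (v * X w))).
    apply: i01 => [|t]; last by rewrite cnorm_expi.
    by apply: cmeas_expi; exact: measurable_funM.
  have := @Cint_expi_itv R 0 1 (v * X w) ler01; rewrite mul1r !mul0r -mulrBr => <-.
  rewrite mulrA -(CintZ _ it); apply: eq_Cint => t; rewrite /B /b /Y /=.
  rewrite (_ : v * (t * X w) = t * (v * X w)); last by ring.
  have -> : (v * X w) *i = v%:C * (X w) *i by apply: complex_ext; rewrite ?cReM ?cImM /=; ring.
  by ring.
rewrite (eq_Cint _ inner) CintB; [|exact: rep1_int|exact: rep1_int].
by rewrite addrC subrK.
Qed.

(** While the value at the origin is zero one more factor [v] can be taken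
    out; if this never stops, the bounds [r ^+ n * c] on the quotients
    leave no room for [f] near the origin. *)
Lemma rep1_order r c f : 0 <= r -> rep1 r c f ->
  (exists m g c', [/\ rep1 r c' g, g 0 != 0 & forall v, f v = v%:C ^+ m * g v]) \/
  (forall v, `|v| * r < 1 -> f v = 0).
Proof.
move=> r0 rf.
have [?|nf] := pselect (exists m g c', [/\ rep1 r c' g, g 0 != 0 & forall v, f v = v%:C ^+ m * g v]).
  by left.
right=> v vr.
have step n : exists2 g, rep1 r (r ^+ n * c) g & forall v, f v = v%:C ^+ n * g v.
  elim: n => [|n [g gr fg]]; first by exists f => [|w]; rewrite ?mul1r.
  have g0 : g 0 = 0.
    by apply: contrapT => /eqP gn; apply: nf; exists n, g, (r ^+ n * c); split.
  have [h hr gh] := rep1_div r0 gr; exists h; first by rewrite exprS -mulrA.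
  by move=> w; rewrite fg gh g0 add0r exprSr mulrA.
have le n : cnorm (f v) <= (`|v| * r) ^+ n * c.
  have [g gr fg] := step n; rewrite fg cnormM cnormX cnorm_toC exprMn -mulrA ler_wpM2l ?exprn_ge0//.
  exact: rep1_bound gr.
have cv : (fun n => (`|v| * r) ^+ n * c) @ \oo --> (0 * c : R).
  apply: cvgM; last exact: cvg_cst.
  by apply: cvg_expr; rewrite ger0_norm// mulr_ge0.
apply: cnorm_eq0; apply/eqP; rewrite eq_le cnorm_ge0 andbT.
rewrite mul0r in cv; apply: (@ler_cvg_to _ _ _ _ (fun=> cnorm (f v)) _ _ _ (cvg_cst _) cv).
by apply: nearW => n; exact: le.
Qed.

(** A continuous factor with a non-zero value at the origin. *)
Lemma rep1_near0 r c f m g del : 0 <= r -> rep1 r c g -> g 0 != 0 ->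
  (forall v, f v = v%:C ^+ m * g v) -> 0 < del -> exists2 v, `|v| < del & f v != 0.
Proof.
move=> r0 gr g0 fg del0; have [h hr gh] := rep1_div r0 gr.
have c0 : 0 <= r * c by apply: le_trans (rep1_bound 0 hr); exact: cnorm_ge0.
pose v := Num.min (del / 2) (cnorm (g 0) / (2 * (r * c + 1))).
have v0 : 0 < v.
  by rewrite lt_min !divr_gt0 ?cnorm_gt0// mulr_gt0// ltr_wpDl.
exists v; first by rewrite gtr0_norm// gt_min; apply/orP; left; lra.
rewrite fg mulf_neq0 ?expf_neq0//.
  by apply/eqP => /(congr1 (@complex.Re R)) /= e; move: v0; rewrite e ltxx.
rewrite gh; apply/eqP => /eqP; rewrite addr_eq0 => /eqP e.
have := congr1 cnorm e; rewrite cnormN cnormM cnorm_toC gtr0_norm// => e'.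
have : cnorm (g 0) <= v * (r * c) by rewrite e' ler_wpM2l ?(ltW v0)//; exact: rep1_bound hr.
have : v <= cnorm (g 0) / (2 * (r * c + 1)) by rewrite ge_min lexx orbT.
rewrite ler_pdivlMr; last by rewrite mulr_gt0// ltr_wpDl.
have := cnorm_gt0 g0; move: v0 c0; clear; move: (r * c) v (cnorm (g 0)) => p q w; nra.
Qed.

(** The radius [1 / r] on which vanishing spreads is the same at every
    point, so that the zero set extends by steps of fixed length. *)
Lemma rep1_eq0 r c f del : 0 < r -> rep1 r c f -> 0 < del ->
  (forall v, `|v| < del -> f v = 0) -> forall v, f v = 0.
Proof.
move=> r0 fr del0 f0.
have loc h e : rep1 r c h -> 0 < e -> (forall v, `|v| < e -> h v = 0) ->
    forall v, `|v| * r < 1 -> h v = 0.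
  move=> hr e0 h0; have [[m [g [c' [gr g0 hg]]]]|//] := rep1_order (ltW r0) hr.
  by have [v /h0 ->] := rep1_near0 (ltW r0) gr g0 hg e0; rewrite eqxx.
have step n v : `|v| < n.+1%:R / (2 * r) -> f v = 0.
  elim: n v => [|n IH] v vn.
    apply: (loc f del) => //; move: vn; rewrite ltr_pdivlMr ?mulr_gt0//.
    have := normr_ge0 v; have := r0; move: (`|v|) => q; nra.
  pose v0 := v * (n.+1%:R / n.+2%:R).
  have [d0 d2] : 0 < n.+1%:R :> R /\ 0 < n.+2%:R :> R by split; rewrite ltr0n.
  have v0n : `|v0| < n.+1%:R / (2 * r).
    rewrite normrM [`|_ / _|]ger0_norm; last by rewrite divr_ge0// ltW.
    rewrite mulrA ltr_pdivrMr// mulrAC ltr_pdivlMr ?mulr_gt0//.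
    move: vn; rewrite ltr_pdivlMr ?mulr_gt0// => vn.
    by rewrite mulrAC [ltRHS]mulrC ltr_pM2r.
  have -> : v = v0 + v / n.+2%:R.
    have e2 : n.+2%:R = n.+1%:R + 1 :> R by rewrite natr1.
    rewrite /v0; move: d2; rewrite e2; move: n.+1%:R => p p0; field.
    by rewrite gt_eqF.
  apply: (loc (fun w => f (v0 + w)) (n.+1%:R / (2 * r) - `|v0|)).
  - exact: rep1_shift.
  - by rewrite subr_gt0.
  - by move=> w hw; apply: IH; apply: le_lt_trans (ler_normD _ _) _; lra.
  rewrite normrM normfV (ger0_norm (ltW d2)) mulrAC ltr_pdivrMr// mul1r.
  move: vn; rewrite ltr_pdivlMr ?mulr_gt0//; have : 1 <= n.+2%:R :> R by rewrite ler1n.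
  have := normr_ge0 v; have := r0; move: (`|v|) n.+2%:R => q p; nra.
move=> v; apply: (step (Num.truncn (`|v| * (2 * r)))).
by rewrite ltr_pdivlMr ?mulr_gt0// truncnS_gt.
Qed.

Lemma rep1_factor r c f v1 : 0 < r -> rep1 r c f -> f v1 != 0 ->
  exists m g c', [/\ rep1 r c' g, g 0 != 0 & forall v, f v = v%:C ^+ m * g v].
Proof.
move=> r0 fr f1; have [//|f0] := rep1_order (ltW r0) fr.
have := rep1_eq0 (del := r^-1) r0 fr; rewrite invr_gt0 => /(_ r0) h.
by move: f1; rewrite h ?eqxx// => v vr; apply: f0; by rewrite -ltr_pdivlMr// mul1r.
Qed.

End one_variable.

(** * Separable densities *)

Section brep_more.
Context {R : realType} {d : nat}.
Local Notation L := (lebesgue_Rn R d).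

Lemma brep_lipschitz (B : set (Rn R d)) chi r : brep B chi -> B `<=` cube r ->
  exists2 K, 0 <= K & forall u v, cnorm (chi u - chi v) <= K * enorm (vsub u v).
Proof.
move=> [disp [T [m [a [X [ia mX aX chiE]]]]]] Br.
have I0 : 0 <= (\int[m]_w cnorm (a w))%R by apply: Rintegral_ge0 => w _; exact: cnorm_ge0.
have K0 : 0 <= d%:R * `|r| * (\int[m]_w cnorm (a w))%R by rewrite !mulr_ge0.
exists (d%:R * `|r| * (\int[m]_w cnorm (a w))%R) => // u v.
rewrite !chiE -CintB; try exact: Cintegrable_rep.
have ii := CintegrableB (Cintegrable_rep u ia mX) (Cintegrable_rep v ia mX).
apply: le_trans (cnorm_Cint ii) _.
rewrite mulrAC -RintegralZl//; last exact: ia.2.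
apply: le_Rintegral => //; first exact: ii.2.
  exact: (integrableZl measurableT _ ia.2).
move=> w _; rewrite -mulrBr cnormM mulrC.
have [->|aw] := eqVneq (a w) 0; first by rewrite cnorm0 !mulr0.
rewrite ler_wpM2r ?cnorm_ge0//.
have -> : expi (dotp u (X w)) - expi (dotp v (X w)) =
    expi (dotp v (X w)) * (expi (dotp (vsub u v) (X w)) - 1).
  by rewrite mulrBr mulr1 -expiD dotpBl [dotp v _ + _]addrC subrK.
rewrite cnormM cnorm_expi mul1r (le_trans (cnorm_expi_sub1 _))//.
have h : `|dotp (vsub u v) (X w)| <= enorm (vsub u v) * enorm (X w).
  by rewrite ler_norml ler_dotp andbT lerNl -dotpN (le_trans (ler_dotp _ _))// enormN.
apply: le_trans h _; rewrite mulrC; apply: ler_wpM2r; first exact: enorm_ge0.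
apply: enorm_cube => i; have := Br _ (aX _ aw) i => /andP[h1 h2].
by have := ler_norm r; move: h1 h2; move: (`|r|) => q h1 h2 h3; apply/andP; split; lra.
Qed.

Lemma brep_neq0_near (B : set (Rn R d)) chi r u0 : brep B chi -> B `<=` cube r -> chi u0 != 0 ->
  exists2 del, 0 < del & forall u, cube del (vsub u u0) -> chi u != 0.
Proof.
move=> bc Br c0; have [K K0 lip] := brep_lipschitz bc Br.
pose D := 2 * (K + 1) * (d%:R + 1).
have D0 : 0 < D by rewrite !mulr_gt0// ltr_wpDl.
exists (cnorm (chi u0) / D); first by rewrite divr_gt0// cnorm_gt0.
move=> u /enorm_cube ud; apply/negP => /eqP cu.
have := lip u u0; rewrite cu sub0r cnormN => h.
have h1 : K * enorm (vsub u u0) <= K * (d%:R * (cnorm (chi u0) / D)) by rewrite ler_wpM2l.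
have : K * (d%:R * (cnorm (chi u0) / D)) <= cnorm (chi u0) / 2.
  rewrite /D (_ : _ * _ = (K / (K + 1)) * (d%:R / (d%:R + 1)) * (cnorm (chi u0) / 2)); last first.
    by field; rewrite !gt_eqF// ltr_wpDl.
  rewrite ler_piMl ?divr_ge0 ?cnorm_ge0// mulr_ile1 ?divr_ge0 ?addr_ge0//.
  - by rewrite ler_pdivrMr ?mul1r ?lerDl// ltr_wpDl.
  - by rewrite ler_pdivrMr ?mul1r ?lerDl// ltr_wpDl.
by have := cnorm_gt0 c0; move: h h1; clear; lra.
Qed.

(** The measures are convolved: the sum of the two variables lives on the
    product space. *)
Lemma brepM (B1 B2 B : set (Rn R d)) chi1 chi2 : brep B1 chi1 -> brep B2 chi2 ->
  (forall x y, B1 x -> B2 y -> B (vadd x y)) -> brep B (fun u => chi1 u * chi2 u).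
Proof.
move=> [d1 [T1 [m1 [a1 [X1 [i1 mX1 aX1 e1]]]]]] [d2 [T2 [m2 [a2 [X2 [i2 mX2 aX2 e2]]]]]] BB.
have [M' M'E] := sigma_finite_pack (sigma_finite_product m1 m2).
pose a (z : T1 * T2) := a1 z.1 * a2 z.2; pose X (z : T1 * T2) := vadd (X1 z.1) (X2 z.2).
have ma : cmeas a by apply: cmeasM; [apply: cmeas_comp i1.1 _|apply: cmeas_comp i2.1 _].
have mX : measurable_fun setT X by apply: measurable_vadd; exact: measurableT_comp.
have [|ia _ _ _ _] := Cfubini ma i1.2 i2.2; first by move=> x y; rewrite cnormM.
exists _, _, M', a, X; rewrite M'E; split=> //.
  move=> [w1 w2]; rewrite /a /X /= mulf_eq0 negb_or => /andP[/aX1 h1 /aX2 h2].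
  exact: BB.
move=> u; pose F (z : T1 * T2) := a z * expi (dotp u (X z)).
have mF : cmeas F.
  apply: cmeasM => //; apply: cmeas_expi; apply: measurable_dotp => //; exact: measurable_cst.
have [|_ _ _ <- _] := Cfubini mF i1.2 i2.2.
  by move=> x y; rewrite /F cnormM cnorm_expi mulr1 cnormM.
rewrite e1 -CintZr; last exact: Cintegrable_rep.
apply: eq_Cint => w1; rewrite e2 -CintZ; last exact: Cintegrable_rep.
by apply: eq_Cint => w2; rewrite /F /a /X /= dotpDr expiD; ring.
Qed.

(** The spectrum is carried by the [i]-th axis. *)
Lemma brep_rep1 (i : 'I_d) r c g : rep1 r c g ->
  brep [set x : Rn R d | forall j, `|tnth x j| <= if j == i then r else 0] (fun u => g (tnth u i)).
Proof.
move=> [disp [T [m [a [X [ia mX aX gE _]]]]]].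
exists disp, T, m, a, (fun w => [tuple if j == i then X w else 0 | j < d]); split=> //.
- apply: measurable_tuple_fun => j; under eq_fun do rewrite tnth_mktuple.
  by case: (j == i) => //; exact: measurable_cst.
- by move=> w aw j; rewrite tnth_mktuple; case: ifP; [move=> _; exact: aX|rewrite normr0].
- move=> u; rewrite gE; apply: eq_Cint => w; congr (_ * expi _).
  rewrite /dotp (bigD1 i)//= tnth_mktuple eqxx big1 ?addr0// => j /negbTE ji.
  by rewrite tnth_mktuple ji mulr0.
Qed.

Lemma brep_prod_rep1 (g : 'I_d -> R -> R[i]) r : 0 <= r ->
  (forall i, exists c, rep1 r c (g i)) -> brep (cube r) (fun u => \prod_(i < d) g i (tnth u i)).
Proof.
move=> r0 gr; pose Bs (l : seq 'I_d) := [set x : Rn R d | forall j, `|tnth x j| <= if j \in l then r else 0].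
have key l : uniq l -> brep (Bs l) (fun u => \prod_(i <- l) g i (tnth u i)).
  elim: l => [_|i l IH /= /andP[il ul]].
    under eq_fun do rewrite big_nil.
    by apply: sub_brep brep1 => x -> j; rewrite tnthE normr0.
  under eq_fun do rewrite big_cons.
  have [c gi] := gr i; apply: brepM (brep_rep1 i gi) (IH ul) _ => x y hx hy j.
  rewrite tnthE (le_trans (ler_normD _ _))// inE.
  have := hx j; have := hy j; case: eqVneq => [->|_ /=]; first by rewrite (negbTE il)/=; lra.
  by case: (j \in l); lra.
have := key _ (index_enum_uniq 'I_d); apply: sub_brep => x hx; apply: eq_cube => j.
by have := hx j; rewrite mem_index_enum.
Qed.

End brep_more.

Section slices.
Context {R : realType}.
Local Notation mu := (@lebesgue_measure R).

Lemma lebesgue_itv (a b : R) : a <= b -> mu `[a, b]%classic = (b - a)%:E.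
Proof.
move=> ab; rewrite lebesgue_measure_itv/= lte_fin EFinB; case: ltgtP ab => // -> _.
by rewrite subee.
Qed.

Lemma vsubv0 d (x : Rn R d) : vsub x vzero = x.
Proof. by apply: eq_from_tnth => i; rewrite !tnthE subr0. Qed.

Definition upd {d} (p : Rn R d) (i : 'I_d) (v : R) : Rn R d :=
  [tuple if j == i then v else tnth p j | j < d].

Lemma measurable_upd d (p : Rn R d) i : measurable_fun setT (upd p i : measurableTypeR R -> Rn R d).
Proof.
apply: measurable_tuple_fun => j; under eq_fun do rewrite tnth_mktuple.
by case: (j == i); [exact: measurable_id|exact: measurable_cst].
Qed.

Lemma slice_rep1 d (B : set (Rn R d)) chi r p i : brep B chi -> B `<=` cube r ->
  exists c, rep1 r c (fun v => chi (upd p i v)).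
Proof.
move=> [disp [T [m [a [X [ia mX aX chiE]]]]]] Br.
pose q w := \sum_(j < d | j != i) tnth p j * tnth (X w) j.
have mq : measurable_fun setT q.
  have -> : q = fun w => \sum_(j < d) (if j != i then tnth p j * tnth (X w) j else 0).
    by apply/funext => w; rewrite /q big_mkcond.
  apply: measurable_sum => j; case: (j != i); last exact: measurable_cst.
  by apply: measurable_funM; [exact: measurable_cst|exact: measurable_tnth_comp].
have ii : Cintegrable m (fun w => a w * expi (q w)).
  have := Cintegrable_expiM mq ia; congr Cintegrable; apply/funext => w; exact: mulrC.
exists (\int[m]_w cnorm (a w * expi (q w)))%R, disp, T, m, (fun w => a w * expi (q w)),
  (fun w => tnth (X w) i); split=> //.
- exact: measurable_tnth_comp.
- move=> w; rewrite mulf_eq0 negb_or => /andP[/aX /Br h _]; rewrite ler_norml; exact: h.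
- move=> v; rewrite chiE; apply: eq_Cint => w; rewrite -mulrA -expiD; congr (_ * expi _).
  rewrite /dotp (bigD1 i)//= tnth_mktuple eqxx addrC; congr (_ + _); apply: eq_bigr => j /negbTE ji.
  by rewrite tnth_mktuple ji.
Qed.

Let swap0 {n} (i j : 'I_n.+1) : 'I_n.+1 := if j == ord0 then i else if j == i then ord0 else j.

Let swap0K n (i : 'I_n.+1) : involutive (swap0 i).
Proof.
move=> j; rewrite /swap0; have [->|j0] := eqVneq j ord0.
  by rewrite eqxx; case: eqVneq.
by have [->|ji] := eqVneq j i; [rewrite eqxx|rewrite (negbTE j0) (negbTE ji)].
Qed.

(** Tonelli: the integral is finite along almost all the parallels to the
    axis, hence along one that passes near [u0]. *)
Lemma good_slice d (g : Rn R d -> \bar R) i u0 del : measurable_fun setT g ->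
  (forall u, 0 <= g u)%E -> (\int[lebesgue_Rn R d]_u g u < +oo)%E -> 0 < del ->
  exists p, (forall v, `|v - tnth u0 i| <= del -> cube del (vsub (upd p i v) u0)) /\
    (\int[mu]_v g (upd p i v) < +oo)%E.
Proof.
case: d g i u0 => [|n] g i u0; first by case: i.
move=> mg g0 gfin del0; pose P z := permute (swap0 i) (@tcons _ (measurableTypeR R) n z).
have mP : measurable_fun setT P by apply: measurableT_comp; [exact: measurable_permute|exact: measurable_tcons].
pose G (z : measurableTypeR R * Rn R n) := g (P z).
have mG : measurable_fun setT G by exact: measurableT_comp.
have G0 z : (0 <= G z)%E by exact: g0.
pose h t := (\int[mu]_v G (v, t))%E.
have hfin : (\int[lebesgue_Rn R n]_t h t < +oo)%E.
  rewrite /h -(fubini_tonelli (m1 := mu) (m2 := lebesgue_Rn R n) _ mG G0).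
  rewrite -(@ge0_integral_Rn_cons _ n (fun x => g (permute (swap0 i) x))); last 2 first.
  - by apply: measurableT_comp => //; exact: measurable_permute.
  - by move=> x; exact: g0.
  by rewrite ge0_integral_permute//; exact: swap0K.
have h0 t : (0 <= h t)%E by apply: integral_ge0 => v _; exact: G0.
have mh : measurable_fun setT h.
  exact: (@measurable_fun_fubini_tonelli_G _ _ _ _ _ mu G mG G0).
pose t0 : Rn R n := [tuple tnth u0 (swap0 i (lift ord0 j)) | j < n].
have [t tc ht] : exists2 t, cube del (vsub t t0) & (h t < +oo)%E.
  apply: contrapT => nt; move: hfin; rewrite -(ge0_integral_shift t0)// ltNge; apply/negP/negPn.
  apply: (@le_trans _ _ (\int[lebesgue_Rn R n]_(t in cube del) h (vadd t t0))%E); last first.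
    apply: ge0_subset_integral => //; first exact: measurable_cube.
    by apply: measurableT_comp => //; apply: measurable_vadd => //; exact: measurable_cst.
  rewrite (eq_integral (cst +oo%E)) => [|t /set_mem tc].
    rewrite integral_cst; last exact: measurable_cube.
    rewrite [X in (_ <= _ * X)%E](_ : _ = ((2 * del) ^+ n)%:E); last first.
      by apply: lebesgue_cube; exact: ltW.
    by rewrite gt0_mulye// lte_fin exprn_gt0// mulr_gt0.
  apply/eqP; rewrite /= -leye_eq leNgt; apply/negP => hl; apply: nt; exists (vadd t t0) => //.
  by move: tc; congr cube; apply: eq_from_tnth => j; rewrite !tnthE addrK.
pose p := P (0, t); exists p.
have PE v : P (v, t) = upd p i v.
  apply: eq_from_tnth => j; rewrite /p /P !tnth_mktuple /swap0.
  have [->|j0] := eqVneq j ord0.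
    have [->|i0] := eqVneq i ord0; first by [].
    by case: (unliftP ord0 i) i0 => [k ->|->//] _; rewrite !tnth_tconsS.
  case: eqVneq => [_|_] //.
  by case: (unliftP ord0 j) j0 => [k ->|->//] _; rewrite !tnth_tconsS.
split; last by under eq_integral do rewrite -PE.
move=> v hv j; rewrite -PE /P tnthE tnth_mktuple -ler_norml.
case: (unliftP ord0 (swap0 i j)) => [k jk|jk].
  rewrite jk tnth_tconsS; have := tc k; rewrite tnthE tnth_mktuple -jk swap0K -ler_norml.
  by [].
rewrite jk; have -> : j = i by rewrite -(swap0K i j) jk /swap0 eqxx.
exact: hv.
Qed.

End slices.

Section separable.
Context {disp : measure_display} {T : measurableType disp} {R : realType}.
Context {P : probability T R} {d : nat}.
Variables (M : wss_measure P d) (s : Rn R d -> R).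
Hypothesis hs : is_spectral_density M s.
Local Notation L := (lebesgue_Rn R d).
Local Notation mu := (@lebesgue_measure R).
Variable s_ : 'I_d -> R -> R.
Hypotheses (s_ge0 : forall i x, 0 <= s_ i x) (sE : forall u, s u = \prod_(i < d) s_ i (tnth u i)).

Lemma pevalX1 (k : multi_index d) (u : Rn R d) :
  peval (mpoly.mpolyX R[i] k) u = (monomial k u)%:C.
Proof.
rewrite /peval mpoly.mevalX /monomial toC_prod; apply: eq_bigr => i _.
by rewrite toCX.
Qed.

Lemma ler_pow_sinc (k n : nat) (del v : R) : (k <= n)%N -> 0 < del ->
  `|v| ^+ k * `|sinc (del * v)| ^+ n <= del ^- k.
Proof.
move=> kn del_gt0; rewrite -(subnKC kn) exprD mulrA -exprMn -exprVn.
have vs : `|v| * `|sinc (del * v)| <= del^-1.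
  rewrite -normrM -[leRHS]mulr1 ler_pdivlMl// -[X in X * _](gtr0_norm del_gt0) -normrM mulrA mul_sinc ler_norml.
  by rewrite sin_geN1 sin_le1.
rewrite -[leRHS]mulr1 ler_pM ?exprn_ge0 ?mulr_ge0//.
  by rewrite lerXn2r ?nnegrE ?mulr_ge0 ?invr_ge0 ?(ltW del_gt0).
by rewrite exprn_ile1 ?ler_sinc1.
Qed.

Let w_ i (v : R) : \bar R := ((s_ i v)%:E^-1)%E.

Let w_gt0 i v : (0 < w_ i v)%E.
Proof.
rewrite /w_; have [->|sz] := eqVneq (s_ i v) 0; first by rewrite inve0.
by rewrite inver (negbTE sz) lte_fin invr_gt0 lt_neqAle eq_sym sz s_ge0.
Qed.

Let sinv_prod u : sinv s u = (\big[*%E/1%E]_(i < d) w_ i (tnth u i))%E.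
Proof.
have invM (x y : R) : 0 <= x -> 0 <= y -> ((x * y)%:E^-1 = x%:E^-1 * y%:E^-1)%E.
  move=> x0 y0; have pos (z : R) : 0 <= z -> (0 < z%:E^-1)%E.
    move=> z0; have [->|zn] := eqVneq z 0; first by rewrite inve0.
    by rewrite inver (negbTE zn) lte_fin invr_gt0 lt_neqAle eq_sym zn.
  have [->|xn] := eqVneq x 0; first by rewrite mul0r inve0 gt0_mulye ?pos.
  have [->|yn] := eqVneq y 0; first by rewrite mulr0 inve0 gt0_muley ?pos.
  by rewrite !inver mulf_eq0 (negbTE xn) (negbTE yn) /= -EFinM invfM.
rewrite /sinv sE /w_.
suff [] : 0 <= \prod_(i < d) s_ i (tnth u i) /\
  ((\prod_(i < d) s_ i (tnth u i))%:E^-1 = \big[*%E/1%E]_(i < d) ((s_ i (tnth u i))%:E^-1))%E by [].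
elim/big_rec2: _ => [|i y z _ [z0 IH]]; first by rewrite inver oner_eq0 invr1.
by split; [rewrite mulr_ge0|rewrite invM// IH].
Qed.

(** Obtained from the restriction of [chi] to a line parallel to the
    [i]-th axis, on which it is not zero and is square-integrable against
    [1 / s_ i]. *)
Lemma separable_factor (B : set (Rn R d)) chi r u0 i : 0 < r -> brep B chi -> B `<=` cube r ->
  chi u0 != 0 -> (\int[L]_u ((cnorm (chi u) ^+ 2)%:E * sinv s u) < +oo)%E ->
  exists m g c, [/\ measurable_fun setT (s_ i : measurableTypeR R -> R), rep1 r c g, g 0 != 0 &
    (\int[mu]_v ((cnorm (v%:C ^+ m * g v) ^+ 2)%:E * w_ i v) < +oo)%E].
Proof.
move=> r0 bc Br c0 fin; have [ms s0 _] := hs.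
have [del del0 near] := brep_neq0_near bc Br c0.
pose G u := ((cnorm (chi u) ^+ 2)%:E * sinv s u)%E.
have G0 u : (0 <= G u)%E by rewrite mule_ge0// ?(sinv_ge0 hs)// lee_fin sqr_ge0.
have mG : measurable_fun setT G.
  apply: emeasurable_funM (measurable_sinv hs); apply/measurable_EFinP; apply: measurable_funX.
  exact: measurable_cnorm (brep_cmeas bc).
have [p [pn pfin]] := good_slice i u0 mG G0 fin del0.
have mGu : measurable_fun setT (fun v : measurableTypeR R => G (upd p i v)).
  by apply: measurableT_comp => //; exact: measurable_upd.
pose f v := chi (upd p i v).
have [c fr] : exists c, rep1 r c f := slice_rep1 p i bc Br.
have f0 : f (tnth u0 i) != 0 by apply/near/pn; rewrite subrr normr0 ltW.
(* If [s] vanished along the line, [1 / s] would be infinite near [u0],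
   where [chi] does not vanish. *)
have [v sv] : exists v, s (upd p i v) != 0.
  apply: contrapT => /forallNP sz; move: pfin; rewrite ltNge => /negP; apply.
  pose I := `[tnth u0 i - del, tnth u0 i + del]%classic.
  apply: (@le_trans _ _ (\int[mu]_(v in I) G (upd p i v))%E); last first.
    by apply: ge0_subset_integral => //; exact: measurable_itv.
  rewrite (eq_integral (cst +oo%E)) => [|v /set_mem].
    rewrite integral_cst; last exact: measurable_itv.
    rewrite [X in (_ <= _ * X)%E](_ : _ = (tnth u0 i + del - (tnth u0 i - del))%:E); last first.
      by apply: lebesgue_itv; move: del0; lra.
    by rewrite gt0_mulye// lte_fin; move: del0; lra.
  rewrite /I /= in_itv/= => /andP[v1 v2]; rewrite /G /sinv.
  have -> : s (upd p i v) = 0 by apply/eqP/negPn/negP; exact: sz.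
  rewrite inve0 gt0_muley// lte_fin exprn_gt0// cnorm_gt0//.
  by apply/near/pn; rewrite ler_norml; apply/andP; split; move: v1 v2; lra.
pose k : R := \prod_(j < d | j != i) s_ j (tnth p j).
have su v' : s (upd p i v') = s_ i v' * k.
  rewrite sE (bigD1 i)//= tnth_mktuple eqxx; congr (_ * _); apply: eq_bigr => j /negbTE ji.
  by rewrite tnth_mktuple ji.
have k0 : 0 < k.
  rewrite lt_neqAle prodr_ge0// andbT eq_sym; apply: contraNneq sv => kz.
  by rewrite su kz mulr0.
(* Along a line where the other factors do not vanish, [s_ i] is
   proportional to the measurable function [s]. *)
have msi : measurable_fun setT (s_ i : measurableTypeR R -> R).
  have -> : s_ i = fun v' => s (upd p i v') / k.
    by apply/funext => v'; rewrite su mulfK// gt_eqF.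
  apply: measurable_funM; last exact: measurable_cst.
  apply: measurableT_comp => //; exact: measurable_upd.
have [m [g [c' [gr g0 fg]]]] := rep1_factor r0 fr f0.
exists m, g, c'; split=> //.
have eG v' : ((cnorm (v'%:C ^+ m * g v') ^+ 2)%:E * w_ i v' = k%:E * G (upd p i v'))%E.
  rewrite -fg /G /sinv su /w_ /f.
  have [sz|snz] := eqVneq (s_ i v') 0.
    rewrite sz mul0r inve0; have [->|cz] := eqVneq (chi (upd p i v')) 0.
      by rewrite cnorm0 expr0n !mul0e mule0.
    rewrite gt0_muley ?gt0_muley// lte_fin// exprn_gt0// cnorm_gt0//.
  rewrite !inver mulf_eq0 (negbTE snz) (gt_eqF k0) /= -!EFinM; congr EFin.
  by field; rewrite snz gt_eqF.
under eq_integral do rewrite eG.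
rewrite ge0_integralZl//; last by rewrite lee_fin ltW.
by apply: lte_mul_pinfty => //; rewrite lee_fin ltW.
Qed.


Let mw i : measurable_fun setT (s_ i : measurableTypeR R -> R) ->
  measurable_fun setT (w_ i : measurableTypeR R -> \bar R).
Proof.
move=> msi; have -> : w_ i = fun u => if s_ i u == 0 then +oo%E else ((s_ i u)^-1)%:E.
  apply/funext => u; rewrite /w_; case: eqP => [->|/eqP su]; first by rewrite inve0.
  by rewrite inver (negbTE su).
apply: measurable_fun_ifT => //.
  by apply: (measurable_fun_eqr msi); exact: measurable_cst.
by apply/measurable_EFinP; apply: measurableT_comp; [exact: measurable_invr|exact: msi].
Qed.

Let EFin_prod (f : 'I_d -> R) : (\prod_(j < d) f j)%:E = (\big[*%E/1%E]_(j < d) (f j)%:E)%E.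
Proof. by elim/big_rec2: _ => // j x y _ <-. Qed.

Let nearf (k : multi_index d) del i v : \bar R :=
  ((\1_`[- del, del]%classic v * (v ^+ k i) ^+ 2)%:E * w_ i v)%E.

Let nearf_ge0 k del i v : (0 <= nearf k del i v)%E.
Proof. by rewrite mule_ge0 ?(ltW (w_gt0 _ _))// lee_fin mulr_ge0 ?sqr_ge0. Qed.

Let mnearf k del i : measurable_fun setT (s_ i : measurableTypeR R -> R) ->
  measurable_fun setT (nearf k del i : measurableTypeR R -> \bar R).
Proof.
move=> msi; apply: emeasurable_funM (mw msi); apply/measurable_EFinP; apply: measurable_funM.
  by apply: measurable_indic; exact: measurable_itv.
by apply: measurable_funX; exact: exprn_measurable.
Qed.

Let nearf_gt0 k del i : measurable_fun setT (s_ i : measurableTypeR R -> R) -> 0 < del ->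
  (0 < \int[mu]_v nearf k del i v)%E.
Proof.
move=> msi del0; rewrite lt_neqAle integral_ge0 ?andbT//.
apply/eqP => z; have : (\int[mu]_v `|nearf k del i v| = 0)%E.
  by rewrite [RHS]z; apply: eq_integral => v _; rewrite gee0_abs.
move=> /(ae_eq_integral_abs _ measurableT (mnearf _ _ msi)) [A [mA A0 hA]].
have sub : `[del / 2, del]%classic `<=` A.
  move=> v /=; rewrite in_itv/= => /andP[v1 v2]; apply: hA => /(_ I)/eqP; apply/negP.
  have v0 : 0 < v by lra.
  rewrite /nearf indicE mem_set ?mul1r; last by rewrite /= in_itv/=; apply/andP; split; lra.
  by rewrite gt_eqF// mule_gt0// lte_fin !exprn_gt0.
have : ((del - del / 2)%:E <= 0 :> \bar R)%E.
  rewrite -(lebesgue_itv (_ : del / 2 <= del)); last by lra.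
  by rewrite -A0; apply: le_measure; rewrite ?inE//; exact: measurable_itv.
by rewrite lee_fin; lra.
Qed.

Let prode_gt0 (F : 'I_d -> \bar R) (p : pred 'I_d) : (forall i, 0 < F i)%E ->
  (0 < \big[*%E/1%E]_(i < d | p i) F i)%E.
Proof. by move=> F0; elim/big_ind: _ => // x y x0 y0; exact: mule_gt0. Qed.

(** The integral over a small cube is a product of integrals in one
    variable, none of which is zero. *)
Let nearf_lty k eps : (forall i, measurable_fun setT (s_ i : measurableTypeR R -> R)) -> 0 < eps ->
  (\int[L]_(u in eball vzero eps) ((monomial k u ^+ 2)%:E * sinv s u) < +oo)%E ->
  forall i, (\int[mu]_v nearf k (eps / (d%:R + 1)) i v < +oo)%E.
Proof.
move=> msi eps0 fin i; set del := eps / _.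
have d1 : 0 < d%:R + 1 :> R by rewrite ltr_wpDl.
have del0 : 0 < del by rewrite divr_gt0.
have prodE u : (\big[*%E/1%E]_(j < d) nearf k del j (tnth u j) =
    (\1_(cube del) u)%:E * ((monomial k u ^+ 2)%:E * sinv s u))%E.
  have eI : \1_(cube del) u = \prod_(j < d) \1_`[- del, del]%classic (tnth u j) :> R.
    rewrite indicE; case: (boolP (u \in _)) => [/set_mem uc|].
      by rewrite big1// => j _; rewrite indicE mem_set//= in_itv/=; exact: uc.
    rewrite notin_setE => /(existsNP _).2[j uj]; rewrite (bigD1 j)//= indicE memNset ?mul0r//=.
  rewrite sinv_prod eI /monomial -prodrXl /nearf muleA -EFinM -big_split /=.
  by rewrite EFin_prod big_split.
have pf : (\big[*%E/1%E]_(j < d) \int[mu]_v nearf k del j v < +oo)%E.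
  rewrite -ge0_integral_prod; [|by move=> j; exact: mnearf|by move=> j v; exact: nearf_ge0].
  under eq_integral do rewrite prodE.
  apply: le_lt_trans fin.
  rewrite [leLHS](_ : _ = \int[L]_(u in cube del) ((monomial k u ^+ 2)%:E * sinv s u))%E; last first.
    rewrite [RHS]integral_mkcond; apply: eq_integral => u _; rewrite patchE indicE.
    by case: (u \in cube del); rewrite ?mul1e ?mul0e.
  apply: ge0_subset_integral.
  - exact: measurable_cube.
  - exact: measurable_eball.
  - apply: emeasurable_funM; last exact: measurable_funS (measurable_sinv hs).
    apply/measurable_EFinP; apply: measurable_funX.
    apply: measurable_prod => j _; apply: measurable_funX.
    exact: measurable_funS (measurable_tnthR j).
  - by move=> u _; rewrite mule_ge0 ?(sinv_ge0 hs)// lee_fin sqr_ge0.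
  - move=> u /enorm_cube uc; rewrite /eball /= vsubv0; apply: le_lt_trans uc _.
    by rewrite /del mulrA ltr_pdivrMr// mulrC ltr_pM2l// ltrDl.
rewrite ltey; apply/eqP => e; move: pf; rewrite (bigD1 i)//= e gt0_mulye//.
by apply: prode_gt0 => j; exact: nearf_gt0.
Qed.


(** The factors found along the axes are multiplied. In each variable, the
    hypothesis on [k] gives integrability near the origin, and away from
    it the power of [v] that was divided out is bounded below. *)
Lemma separable_kernel (k : multi_index d) r eps0 : 0 <= r -> 0 < eps0 ->
  ~ linearly_maximally_rigid M (cube r) ->
  ~ (forall eps : R, 0 < eps ->
      (\int[L]_(u in eball vzero eps) ((monomial k u ^+ 2)%:E * sinv s u) = +oo)%E) ->
  exists chi, [/\ brep (cube (r + eps0)) chi, chi vzero != 0 &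
    forall k0, mpoly.lem k k0 -> exists N, forall n del, (N <= n)%N -> 0 < del ->
    (\int[L]_u ((cnorm (chi u * peval (mpoly.mpolyX _ k0) u *
       (\prod_(i < d) sinc (del * tnth u i) ^+ n)%:C) ^+ 2)%:E * sinv s u) < +oo)%E].
Proof.
move=> r0 e0 nmax knear.
have [e [chi [/andP[ep ele] bc [u0 c0] fin]]] := dual_kernel hs (@subset_refl _ (cube r)) nmax e0.
have Br : blur (cube r) e `<=` (cube (r + eps0) : set (Rn R d)).
  move=> x xB i; have /andP[h1 h2] := blur_cube (@subset_refl _ (cube r)) xB i.
  by apply/andP; split; move: h1 h2 ele; lra.
have re0 : 0 < r + eps0 by rewrite ltr_wpDl.
have /choice[m_ hm] : forall i, exists m, exists g c, [/\ measurable_fun setT (s_ i : measurableTypeR R -> R),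
    rep1 (r + eps0) c g, g 0 != 0 &
    (\int[mu]_v ((cnorm (v%:C ^+ m * g v) ^+ 2)%:E * w_ i v) < +oo)%E].
  by move=> i; exact: separable_factor re0 bc Br c0 fin.
have /choice[g_ hg] := hm; have /choice[c_ hc] := hg.
have msi i : measurable_fun setT (s_ i : measurableTypeR R -> R) by have [] := hc i.
have [eps eps_gt0 epsfin] : exists2 eps, 0 < eps &
    (\int[L]_(u in eball vzero eps) ((monomial k u ^+ 2)%:E * sinv s u) < +oo)%E.
  apply: contrapT => nex; apply: knear => eps eps0'; apply/eqP; rewrite -leye_eq leNgt.
  by apply/negP => h; apply: nex; exists eps.
have nfin := nearf_lty msi eps_gt0 epsfin; set del0 := eps / (d%:R + 1) in nfin.
have del0_gt0 : 0 < del0 by rewrite divr_gt0// ltr_wpDl.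
exists (fun u => \prod_(i < d) g_ i (tnth u i)); split.
- by apply: brep_prod_rep1 (ltW re0) _ => i; exists (c_ i); have [] := hc i.
- by apply/prodf_neq0 => i _; rewrite tnthE; have [] := hc i.
move=> k0 kk0; exists (\sum_(i < d) k0 i)%N => n del Nn del_gt0.
pose q i (v : R) := cnorm (g_ i v) * `|v| ^+ k0 i * `|sinc (del * v)| ^+ n.
pose h i (v : R) := ((q i v ^+ 2)%:E * w_ i v)%E.
have prodE u : ((cnorm (\prod_(i < d) g_ i (tnth u i) * peval (mpoly.mpolyX _ k0) u *
    (\prod_(i < d) sinc (del * tnth u i) ^+ n)%:C) ^+ 2)%:E * sinv s u =
    \big[*%E/1%E]_(i < d) h i (tnth u i))%E.
  rewrite pevalX1 !cnormM !cnorm_toC !cnorm_prod /monomial !normr_prod -!big_split /= -prodrXl.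
  rewrite sinv_prod /h EFin_prod -big_split /=; apply: eq_bigr => i _.
  by rewrite !normrX.
under eq_integral do rewrite prodE.
have mq i : measurable_fun setT (q i : measurableTypeR R -> R).
  have [_ gr _ _] := hc i.
  apply: measurable_funM; first apply: measurable_funM.
  - exact: measurable_cnorm (rep1_cmeas gr).
  - by apply: measurable_funX; exact: normr_measurable.
  - apply: measurable_funX; apply: measurableT_comp => //; apply: (measurableT_comp measurable_sinc).
    exact: measurable_funM.
have mh i : measurable_fun setT (h i : measurableTypeR R -> \bar R).
  by apply: emeasurable_funM (mw (msi i)); apply/measurable_EFinP; exact: measurable_funX.
have h_ge0 i v : (0 <= h i v)%E.
  by rewrite mule_ge0 ?(ltW (w_gt0 _ _))// lee_fin sqr_ge0.
rewrite ge0_integral_prod//.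
have hfin i : (\int[mu]_v h i v < +oo)%E.
  have [_ gr _ gfin] := hc i.
  have c0' : 0 <= c_ i by apply: le_trans (rep1_bound 0 gr); exact: cnorm_ge0.
  pose C1 : R := (c_ i * del0 ^+ (k0 i - k i)) ^+ 2.
  pose C2 : R := (del0 ^- m_ i * del ^- k0 i) ^+ 2.
  pose G v : \bar R := ((cnorm (v%:C ^+ m_ i * g_ i v) ^+ 2)%:E * w_ i v)%E.
  have mG : measurable_fun setT (G : measurableTypeR R -> \bar R).
    apply: emeasurable_funM (mw (msi i)); apply/measurable_EFinP; apply: measurable_funX.
    apply: measurable_cnorm; apply: cmeasM (rep1_cmeas gr); apply: cmeasX.
    by apply: cmeas_toC; exact: measurable_id.
  have G_ge0 v : (0 <= G v)%E by rewrite mule_ge0 ?(ltW (w_gt0 _ _))// lee_fin sqr_ge0.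
  have mN := mnearf k del0 (msi i).
  have C10 : 0 <= C1 by exact: sqr_ge0.
  have I0 v : 0 <= \1_`[- del0, del0]%classic v * (v ^+ k i) ^+ 2 :> R.
    by rewrite mulr_ge0 ?sqr_ge0.
  have le v : (h i v <= C1%:E * nearf k del0 i v + C2%:E * G v)%E.
    rewrite /h /nearf /G !muleA -!EFinM -ge0_muleDl; last 2 first.
    - by rewrite lee_fin (mulr_ge0 C10 (I0 v)).
    - by rewrite lee_fin mulr_ge0 ?sqr_ge0.
    apply: lee_wpmul2r; first exact: ltW (w_gt0 _ _).
    rewrite -EFinD lee_fin.
    have s1 : `|sinc (del * v)| ^+ n <= 1 by rewrite exprn_ile1 ?ler_sinc1.
    have [vd|vd] := lerP `|v| del0.
      rewrite -[leLHS]addr0; apply: lerD; last by rewrite mulr_ge0 ?sqr_ge0.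
      rewrite indicE mem_set ?mul1r; last first.
        by rewrite /= in_itv/= -ler_norml.
      rewrite -(real_normK (num_real (v ^+ _))) normrX -exprMn lerXn2r ?nnegrE ?mulr_ge0 ?cnorm_ge0 ?exprn_ge0 ?(ltW del0_gt0)//.
      rewrite /q -[leRHS]mulr1 ler_pM ?mulr_ge0 ?cnorm_ge0 ?exprn_ge0// -mulrA ler_pM ?cnorm_ge0 ?exprn_ge0//.
        exact: rep1_bound gr.
      have -> : k0 i = (k0 i - k i + k i)%N by rewrite subnK//; have /mpoly.mnm_lepP := kk0; apply.
      by rewrite addnK exprD ler_wpM2r ?exprn_ge0// lerXn2r ?nnegrE// ltW.
    rewrite -[leLHS]add0r; apply: lerD; first by rewrite mulr_ge0.
    have v0 : 0 < `|v| by exact: lt_trans vd.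
    rewrite /C2 -exprMn lerXn2r ?nnegrE ?mulr_ge0 ?cnorm_ge0 ?invr_ge0 ?exprn_ge0 ?(ltW del0_gt0) ?(ltW del_gt0)//.
    rewrite cnormM cnormX cnorm_toC.
    have key1 : `|v| ^+ k0 i * `|sinc (del * v)| ^+ n <= del ^- k0 i.
      by apply: ler_pow_sinc => //; apply: leq_trans Nn; rewrite (bigD1 i)//= leq_addr.
    have key2 : 1 <= del0 ^- m_ i * `|v| ^+ m_ i.
      by rewrite -exprVn -exprMn exprn_ege1// ler_pdivlMl// mulr1 ltW.
    rewrite /q -mulrA.
    apply: le_trans (_ : cnorm (g_ i v) * del ^- k0 i <= _); first by rewrite ler_wpM2l ?cnorm_ge0.
    rewrite [leRHS](_ : _ = (del0 ^- m_ i * `|v| ^+ m_ i) * (cnorm (g_ i v) * del ^- k0 i)); last by ring.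
    by rewrite ler_peMl// mulr_ge0 ?cnorm_ge0// invr_ge0 exprn_ge0// ltW.
  have m1 : measurable_fun setT (fun v : measurableTypeR R => (C1%:E * nearf k del0 i v)%E).
    by apply: emeasurable_funM => //; exact: measurable_cst.
  have m2 : measurable_fun setT (fun v : measurableTypeR R => (C2%:E * G v)%E).
    by apply: emeasurable_funM => //; exact: measurable_cst.
  apply: (@le_lt_trans _ _ (\int[mu]_v (C1%:E * nearf k del0 i v + C2%:E * G v))%E).
    apply: ge0_le_integral => //.
    by apply: emeasurable_funD.
  rewrite ge0_integralD//; [|by move=> v _; rewrite mule_ge0 ?lee_fin ?sqr_ge0..].
  rewrite !ge0_integralZl ?lee_fin ?sqr_ge0//.
  by rewrite lte_add_pinfty// lte_mul_pinfty ?lee_fin ?sqr_ge0.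
suff : (\big[*%E/1%E]_(i < d) \int[mu]_v h i v)%E \is a fin_num by rewrite ltey_eq => ->.
elim/big_ind: _ => // [x y|i _]; first exact: fin_numM.
by rewrite ge0_fin_numE// integral_ge0.
Qed.

End separable.

(** * Division of radial transforms by the square of the norm *)

Section radial.
Context {R : realType} {d : nat}.
Local Notation L := (lebesgue_Rn R d).
Local Notation mu := (@lebesgue_measure R).

Definition cball (r : R) : set (Rn R d) := [set x | enorm x <= r].

Definition radial (f : Rn R d -> R[i]) := forall u v, enorm u = enorm v -> f u = f v.

Lemma cball_cube r : cball r `<=` cube r.
Proof. by move=> x; exact: cube_enorm. Qed.

Lemma le0_of_small (x C : R) : (forall t, 0 < t -> t < 1 -> x <= t * C) -> x <= 0.
Proof.
move=> h; rewrite leNgt; apply/negP => x0.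
pose t := Num.min 2^-1 (x / (2 * (`|C| + 1))).
have C0 : 0 < 2 * (`|C| + 1) by rewrite mulr_gt0// ltr_wpDl.
have t0 : 0 < t by rewrite lt_min invr_gt0 ltr0n/= divr_gt0.
have t1 : t < 1 by rewrite gt_min; apply/orP; left; lra.
have := h t t0 t1; have : t <= x / (2 * (`|C| + 1)) by rewrite ge_min lexx orbT.
rewrite ler_pdivlMr//; have := ler_norm C; have := normr_ge0 C.
move: (`|C|) t0 x0 => q t0 x0; clear -t0 x0; nra.
Qed.

Lemma brep_product (d1 d2 : measure_display) (T1 : measurableType d1) (T2 : measurableType d2)
    (m1 : {sigma_finite_measure set T1 -> \bar R}) (m2 : {sigma_finite_measure set T2 -> \bar R})
    (a : T1 -> R[i]) (b : T2 -> R[i]) (Y : T1 * T2 -> Rn R d) (B : set (Rn R d)) :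
  Cintegrable m1 a -> Cintegrable m2 b -> measurable_fun setT Y ->
  (forall w t, a w != 0 -> b t != 0 -> B (Y (w, t))) ->
  brep B (fun u => Cint m1 (fun w => a w * Cint m2 (fun t => b t * expi (dotp u (Y (w, t)))))).
Proof.
move=> ia ib mY aB; have [M' M'E] := sigma_finite_pack (sigma_finite_product m1 m2).
pose c (z : T1 * T2) := a z.1 * b z.2.
have mc : cmeas c by apply: cmeasM; [apply: cmeas_comp ia.1 _|apply: cmeas_comp ib.1 _].
have [|ic _ _ _ _] := Cfubini mc ia.2 ib.2; first by move=> x y; rewrite cnormM.
exists _, _, M', c, Y; rewrite M'E; split=> //.
  by move=> [w t]; rewrite /c /= mulf_eq0 negb_or => /andP[]; exact: aB.
move=> u; pose F (z : T1 * T2) := c z * expi (dotp u (Y z)).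
have me : measurable_fun setT (fun z => dotp u (Y z)).
  by apply: measurable_dotp => //; exact: measurable_cst.
have mF : cmeas F by apply: cmeasM => //; exact: cmeas_expi.
have [|_ _ _ <- _] := Cfubini mF ia.2 ib.2.
  by move=> x y; rewrite /F cnormM cnorm_expi mulr1 cnormM.
apply: eq_Cint => w; rewrite -CintZ; first by apply: eq_Cint => t; rewrite /F /c mulrA.
have := Cintegrable_expiM (measurableT_comp me (measurable_pair1 w)) ib.
by congr Cintegrable; apply/funext => t; exact: mulrC.
Qed.

Lemma Cintegrable_iterated (d1 d2 : measure_display) (T1 : measurableType d1)
    (T2 : measurableType d2) (m1 : {sigma_finite_measure set T1 -> \bar R})
    (m2 : {sigma_finite_measure set T2 -> \bar R})
    (f : T1 -> R[i]) (g : T2 -> R[i]) (h : T1 * T2 -> R) :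
  Cintegrable m1 f -> Cintegrable m2 g -> measurable_fun setT h ->
  Cintegrable m1 (fun x => f x * Cint m2 (fun y => g y * expi (h (x, y)))).
Proof.
move=> fi gi mh; pose F (z : T1 * T2) := f z.1 * g z.2 * expi (h z).
have mF : cmeas F.
  by apply: cmeasM (cmeas_expi mh); apply: cmeasM;
    [apply: cmeas_comp fi.1 _ | apply: cmeas_comp gi.1 _].
have [|_ i1 _ _ _] := Cfubini mF fi.2 gi.2.
  by move=> x y; rewrite /F !cnormM cnorm_expi mulr1.
move: i1; congr Cintegrable; apply/funext => x; rewrite -CintZ.
  by apply: eq_Cint => y; rewrite /F mulrA.
have hx : measurable_fun setT (fun y => h (x, y)) by exact: measurableT_comp (measurable_pair1 x).
have := Cintegrable_expiM hx gi; congr Cintegrable; apply/funext => y; exact: mulrC.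
Qed.

(** The remainder is [i z] times an integral of [expi (t z) - 1]. *)
Lemma cnorm_expi_taylor (z : R) : cnorm (expi z - 1 - z *i) <= z ^+ 2.
Proof.
have i0 (f : R -> R[i]) : cmeas (f : measurableTypeR R -> R[i]) -> (forall t, 0 <= t <= 1 -> cnorm (f t) <= `|z|) ->
    Cintegrable mu (fun t => itvC 0 1 t * f t) /\ cnorm (Cint mu (fun t => itvC 0 1 t * f t)) <= `|z|.
  move=> mf fz; have ii := Cintegrable_itvC mf fz; split=> //.
  apply: le_trans (cnorm_Cint ii) _; rewrite -[leRHS]mulr1 -[X in _ * X](subr0 1).
  rewrite -(Rintegral_itv_cst `|z| ler01) [leRHS]Rintegral_mkcond.
  apply: le_Rintegral => //; first exact: ii.2.
    rewrite (_ : EFin \o _ = (EFin \o (cst `|z| : measurableTypeR R -> R)) \_ `[0, 1]%classic); last first.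
      by apply/funext => t; rewrite /= !patchE; case: ifP.
    apply/(integrable_mkcond _ _).1 => //; apply: continuous_compact_integrable.
      exact: segment_compact.
    by apply: continuous_subspaceT => t; exact: cvg_cst.
  move=> t _; rewrite /itvC cnormM cnorm_toC patchE indicE.
  case: (boolP (t \in _)) => [|_]; last by rewrite normr0 mul0r.
  by rewrite inE/= in_itv/= normr1 mul1r; exact: fz.
have h1 : z *i * Cint mu (fun t => itvC 0 1 t * expi (t * z)) = expi z - 1.
  by rewrite Cint_expi_itv// mul1r mul0r expi0.
have me : cmeas (fun t : measurableTypeR R => expi (t * z)) by apply: cmeas_expi; exact: measurable_funM.
have e1 : Cintegrable mu (fun t => itvC 0 1 t * expi (t * z)).
  by apply: (@Cintegrable_itvC R _ _ _ 1) => // t _; rewrite cnorm_expi.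
have e2 : Cintegrable mu (fun t => itvC 0 1 t * 1).
  by apply: (@Cintegrable_itvC R _ _ _ 1) => [|t _]; [exact: cmeas_cst|rewrite cnorm_toC normr1].
have I1 : Cint mu (fun t => itvC 0 1 t * 1) = 1 :> R[i].
  rewrite Cint_itvC /= !Rintegral_itv_cst//.
  by apply: complex_ext => /=; ring.
have -> : expi z - 1 - z *i = z *i * Cint mu (fun t => itvC 0 1 t * (expi (t * z) - 1)).
  rewrite -h1 -[X in _ - X](mulr1 (z *i)) -[X in _ - _ * X]I1 -mulrBr -CintB//.
  by congr (_ * _); apply: eq_Cint => t; rewrite mulrBr.
rewrite cnormM cnorm_toCi -(real_normK (num_real z)) expr2 ler_wpM2l//.
have [||_ //] := i0 (fun t => expi (t * z) - 1); first by apply: cmeasB => //; exact: cmeas_cst.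
move=> t /andP[t0 t1]; rewrite (le_trans (cnorm_expi_sub1 _))// normrM ger0_norm//.
by rewrite ler_piMl.
Qed.


Section division.
Variable i0 : 'I_d.
Context (disp : measure_display) (T : measurableType disp).
Variables (m : {sigma_finite_measure set T -> \bar R}) (a : T -> R[i]) (X : T -> Rn R d).
Variables (rho : R) (psi : Rn R d -> R[i]).
Hypotheses (rho0 : 0 <= rho) (ia : Cintegrable m a) (mX : measurable_fun setT X).
Hypothesis aX : forall w, a w != 0 -> enorm (X w) <= rho.
Hypothesis psiE : forall u, psi u = Cint m (fun w => a w * expi (dotp u (X w))).
Hypothesis rad : radial psi.

Let psi_brep : brep (cball rho) psi.
Proof. by exists disp, T, m, a, X. Qed.

Let weight_int (q : T -> R[i]) c : cmeas q -> 0 <= c -> (forall w, a w != 0 -> cnorm (q w) <= c) ->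
  Cintegrable m (fun w => a w * q w).
Proof.
move=> mq c0 qc; apply: (@Cintegrable_le _ _ _ _ _ (fun w => c * cnorm (a w))).
- by apply: cmeasM => //; exact: ia.1.
- exact: (integrableZl measurableT c ia.2).
- move=> w; rewrite cnormM mulrC; have [->|aw] := eqVneq (a w) 0; first by rewrite cnorm0 !mulr0.
  by rewrite ler_wpM2r ?cnorm_ge0//; exact: qc.
Qed.

Let dotX (h : Rn R d) w : a w != 0 -> `|dotp h (X w)| <= enorm h * rho.
Proof.
move=> /aX aw; have n := enorm_ge0 h.
have h1 := ler_dotp h (X w); have h2 := ler_dotp (vopp h) (X w).
rewrite dotpN enormN in h2; apply: le_trans (ler_wpM2l n aw).
by rewrite ler_norml h1 andbT lerNl.
Qed.

Let mdot (h : Rn R d) : measurable_fun setT (fun w => dotp h (X w)).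
Proof. by apply: measurable_dotp => //; exact: measurable_cst. Qed.

Let cmeas_i (q : T -> R) : measurable_fun setT q -> cmeas (fun w => (q w) *i).
Proof. by move=> mq; split=> //=; exact: measurable_cst. Qed.

(** The derivative of the transform at [v] in the direction [h]. *)
Let D (v h : Rn R d) := Cint m (fun w => a w * (dotp h (X w)) *i * expi (dotp v (X w))).

Let D0_int h : Cintegrable m (fun w => a w * (dotp h (X w)) *i).
Proof.
apply: (@weight_int _ (enorm h * rho)) => [||w aw]; first by apply: cmeas_i; exact: mdot.
  by rewrite mulr_ge0 ?enorm_ge0.
by rewrite cnorm_toCi; exact: dotX.
Qed.

Let expi_int (b : T -> R[i]) v : Cintegrable m b -> Cintegrable m (fun w => b w * expi (dotp v (X w))).
Proof.
by move=> ib; have := Cintegrable_expiM (mdot v) ib; congr Cintegrable; apply/funext => w; exact: mulrC.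
Qed.

Let D_int v h : Cintegrable m (fun w => a w * (dotp h (X w)) *i * expi (dotp v (X w))).
Proof. exact: expi_int. Qed.

Let toiM (b z : R) : (b * z) *i = b%:C * z *i :> R[i].
Proof. by apply: complex_ext; rewrite ?cReM ?cImM /=; ring. Qed.

Let DZ v c h : D v (vscale c h) = c%:C * D v h.
Proof.
rewrite /D -CintZ//; apply: eq_Cint => w.
by rewrite dotpZl toiM; ring.
Qed.

Let DB v h k : D v (vsub h k) = D v h - D v k.
Proof.
rewrite /D -CintB//; apply: eq_Cint => w; rewrite dotpBl -mulrBl -mulrBr.
by congr (_ * _ * _); apply: complex_ext => /=; ring.
Qed.

Let taylor : exists2 C, 0 <= C & forall v h t,
  cnorm (psi (vadd v (vscale t h)) - psi v - t%:C * D v h) <= C * t ^+ 2 * enorm h ^+ 2.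
Proof.
exists (rho ^+ 2 * (\int[m]_w cnorm (a w))%R).
  by rewrite mulr_ge0 ?sqr_ge0//; apply: Rintegral_ge0 => w _; exact: cnorm_ge0.
move=> v h t; rewrite /D -CintZ// !psiE -CintB; [|exact: expi_int..].
rewrite -CintB; [|apply: CintegrableB; exact: expi_int|exact: CintegrableZ].
set F := fun w => _.
have FE w : F w = a w * expi (dotp v (X w)) *
    (expi (t * dotp h (X w)) - 1 - (t * dotp h (X w)) *i).
  by rewrite /F dotpDl dotpZl expiD toiM; ring.
have iF : Cintegrable m F.
  by apply: CintegrableB; [apply: CintegrableB; exact: expi_int|exact: CintegrableZ].
apply: le_trans (cnorm_Cint iF) _.
rewrite (_ : _ * _ * _ = (rho ^+ 2 * t ^+ 2 * enorm h ^+ 2) * (\int[m]_w cnorm (a w))%R); last by ring.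
rewrite -RintegralZl//; last exact: ia.2.
apply: le_Rintegral => //; [exact: iF.2|exact: (integrableZl measurableT _ ia.2)|].
move=> w _; rewrite FE !cnormM cnorm_expi mulr1 mulrC.
have [->|aw] := eqVneq (a w) 0; first by rewrite cnorm0 !mulr0.
rewrite ler_wpM2r ?cnorm_ge0// (le_trans (cnorm_expi_taylor _))//.
rewrite exprMn [leRHS](_ : _ = t ^+ 2 * (enorm h * rho) ^+ 2); last by ring.
apply: ler_wpM2l; first exact: sqr_ge0.
rewrite -(real_normK (num_real (dotp _ _))) lerXn2r ?nnegrE ?mulr_ge0 ?enorm_ge0//.
exact: dotX.
Qed.

Let lipschitz : exists2 K, 0 <= K & forall u v, cnorm (psi u - psi v) <= K * enorm (vsub u v).
Proof. exact: brep_lipschitz psi_brep (@cball_cube rho). Qed.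

(** Along a tangent to a sphere the norm is stationary, hence so is a radial
    function. *)
Let D_tangent v h : dotp v h = 0 -> v != vzero -> D v h = 0.
Proof.
move=> vh vn0; have [C C0 tay] := taylor; have [K K0 lip] := lipschitz.
have v0 : 0 < enorm v.
  by rewrite lt_neqAle enorm_ge0 andbT eq_sym; apply: contraNneq vn0 => /enorm_eq0 ->.
apply: cnorm_eq0; apply/eqP; rewrite eq_le cnorm_ge0 andbT.
apply: (@le0_of_small _ (C * enorm h ^+ 2 + K * (enorm h ^+ 2 / enorm v))) => t t0 _.
pose w := vadd v (vscale t h); pose c := enorm w / enorm v.
have w2 : enorm w ^+ 2 = enorm v ^+ 2 + t ^+ 2 * enorm h ^+ 2.
  by rewrite !sqr_enorm /w !(dotpDl, dotpDr, dotpZl, dotpZr) (dotpC h v) vh; ring.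
have vw : enorm v <= enorm w.
  by rewrite -ler_sqr ?nnegrE ?enorm_ge0// w2 lerDl mulr_ge0 ?sqr_ge0.
have wc : psi w = psi (vscale c v).
  apply: rad; rewrite enormZ /c ger0_norm ?divr_ge0 ?enorm_ge0//.
  by rewrite divfK// gt_eqF.
have l1 := lip (vscale c v) v; rewrite -wc in l1.
have e1 : enorm (vsub (vscale c v) v) = enorm w - enorm v.
  have -> : vsub (vscale c v) v = vscale (c - 1) v.
    by apply: eq_from_tnth => i; rewrite !tnthE; ring.
  rewrite enormZ ger0_norm; last by rewrite subr_ge0 /c ler_pdivlMr// mul1r.
  by rewrite mulrBl mul1r divfK// gt_eqF.
have e2 : enorm w - enorm v <= t ^+ 2 * (enorm h ^+ 2 / enorm v).
  rewrite mulrA ler_pdivlMr// (_ : t ^+ 2 * _ = enorm w ^+ 2 - enorm v ^+ 2); last by rewrite w2; ring.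
  by rewrite subr_sqr ler_wpM2l ?subr_ge0// lerDr enorm_ge0.
have l2 : cnorm (psi w - psi v) <= K * (t ^+ 2 * (enorm h ^+ 2 / enorm v)).
  by apply: le_trans l1 _; rewrite e1 ler_wpM2l.
have l3 : t * cnorm (D v h) <= K * (t ^+ 2 * (enorm h ^+ 2 / enorm v)) + C * t ^+ 2 * enorm h ^+ 2.
  rewrite -[X in X * cnorm _](gtr0_norm t0) -cnorm_toC -cnormM.
  have -> : t%:C * D v h = (psi w - psi v) + - (psi w - psi v - t%:C * D v h) by ring.
  by apply: le_trans (cnormD _ _) (lerD l2 _); rewrite cnormN; exact: tay.
rewrite -(ler_pM2l t0); apply: le_trans l3 _; rewrite le_eqVlt; apply/orP; left; apply/eqP.
by ring.
Qed.

(** A radial function is even. *)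
Let D_origin h : D vzero h = 0.
Proof.
have [C C0 tay] := taylor; apply: cnorm_eq0; apply/eqP; rewrite eq_le cnorm_ge0 andbT.
apply: (@le0_of_small _ (C * enorm h ^+ 2)) => t t0 _.
have tp := tay vzero h t; have tm := tay vzero h (- t).
have pm : psi (vadd vzero (vscale t h)) = psi (vadd vzero (vscale (- t) h)).
  apply: rad; have e c : vadd vzero (vscale c h) = vscale c h.
    by apply: eq_from_tnth => i; rewrite !tnthE add0r.
  by rewrite !e !enormZ normrN.
rewrite -pm sqrrN rmorphN mulNr opprK in tm.
have : cnorm (2 * (t%:C * D vzero h)) <= 2 * (C * t ^+ 2 * enorm h ^+ 2).
  have -> : 2 * (t%:C * D vzero h) = (psi (vadd vzero (vscale t h)) - psi vzero + t%:C * D vzero h) +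
    - (psi (vadd vzero (vscale t h)) - psi vzero - t%:C * D vzero h) by ring.
  apply: le_trans (cnormD _ _) _; rewrite cnormN mulr_natl mulr2n.
  exact: lerD tm tp.
rewrite cnormM cnormM cnorm_toC (gtr0_norm t0).
rewrite (_ : cnorm (2 : R[i]) = 2); last first.
  by rewrite (_ : (2 : R[i]) = 2%:C) ?cnorm_toC ?ger0_norm//; apply: complex_ext => /=; rewrite ?addr0.
rewrite ler_pM2l// => h1; rewrite -(ler_pM2l t0); apply: le_trans h1 _.
by rewrite le_eqVlt; apply/orP; left; apply/eqP; ring.
Qed.

Let ibC : Cintegrable mu (itvC 0 1).
Proof.
rewrite (_ : itvC 0 1 = fun t => itvC 0 1 t * 1); last by apply/funext => t; rewrite mulr1.
by apply: (@Cintegrable_itvC R _ _ _ 1) => [|t _]; [exact: cmeas_cst|rewrite cnorm_toC normr1].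
Qed.

Let itvC_neq0 (t : R) : itvC 0 1 t != 0 :> R[i] -> 0 <= t <= 1.
Proof.
rewrite /itvC indicE; case: (boolP (t \in _)) => [|_]; last by rewrite eqxx.
by rewrite inE/= in_itv.
Qed.

Let e1 : Rn R d := [tuple (i == i0)%:R | i < d].

Let dot_e1 x : dotp e1 x = tnth x i0.
Proof.
rewrite /dotp (bigD1 i0)//= tnth_mktuple eqxx mul1r big1 ?addr0// => i /negbTE ii.
by rewrite tnth_mktuple ii mul0r.
Qed.

Let dot_upd (v x : Rn R d) c : dotp v (upd x i0 c) = dotp (upd v i0 0) x + tnth v i0 * c.
Proof.
rewrite /dotp (bigD1 i0)//= [in RHS](bigD1 i0)//= !tnth_mktuple !eqxx mul0r add0r addrC.
by congr (_ + _); apply: eq_bigr => i /negbTE ii; rewrite !tnth_mktuple ii.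
Qed.

Let dot_upd0 (v x : Rn R d) : dotp v x = dotp (upd v i0 0) x + tnth v i0 * tnth x i0.
Proof.
rewrite -dot_upd; congr dotp; apply: eq_from_tnth => i; rewrite tnth_mktuple.
by case: eqP => // ->.
Qed.

(** The radial derivative divided by the radius, which is also the derivative
    along the first axis divided by the first coordinate. *)
Let H u := Cint m (fun w => a w * (- (tnth (X w) i0 ^+ 2))%:C *
  Cint mu (fun t => itvC 0 1 t * expi (dotp u (upd (X w) i0 (t * tnth (X w) i0))))).

Let mXi : measurable_fun setT (fun w => tnth (X w) i0).
Proof. exact: measurable_tnth_comp. Qed.

Let H_weight : Cintegrable m (fun w => a w * (- (tnth (X w) i0 ^+ 2))%:C).
Proof.
apply: (@weight_int _ (rho ^+ 2)) => [||w aw]; last 2 first.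
- exact: sqr_ge0.
- rewrite cnorm_toC normrN normrX lerXn2r ?nnegrE//.
  by rewrite (le_trans (ler_norm_tnth _ _))// aX.
by apply: cmeas_toC; apply: measurableT_comp => //; exact: measurable_funX.
Qed.

Let Y (z : T * measurableTypeR R) := upd (X z.1) i0 (z.2 * tnth (X z.1) i0).

Let mY : measurable_fun setT Y.
Proof.
apply: measurable_tuple_fun => i; rewrite /Y; under eq_fun do rewrite tnth_mktuple.
have mXj j : measurable_fun setT (fun z : T * measurableTypeR R => tnth (X z.1) j).
  exact: (measurableT_comp (measurable_tnth_comp j mX) measurable_fst).
case: (i == i0) => /=; last exact: mXj.
by apply: measurable_funM; [exact: measurable_snd|exact: mXj].
Qed.

Let measurable_dot_Y u : measurable_fun setT (fun z => dotp u (Y z)).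
Proof. by apply: measurable_dotp; [exact: measurable_cst|exact: mY]. Qed.

Let H_brep : brep (cball rho) H.
Proof.
apply: (@brep_product _ _ _ _ m mu _ _ Y) => //.
move=> w t; rewrite mulf_eq0 negb_or => /andP[/aX aw _] /itvC_neq0/andP[t0 t1].
rewrite /cball /= /Y /=; apply: le_trans aw.
rewrite -ler_sqr ?nnegrE ?enorm_ge0// !sqr_enorm dot_upd tnth_mktuple eqxx.
have -> : dotp (upd (upd (X w) i0 (t * tnth (X w) i0)) i0 0) (X w) = dotp (upd (X w) i0 0) (X w).
  congr dotp; apply: eq_from_tnth => i; rewrite !tnth_mktuple; by case: (i == i0).
rewrite [leRHS]dot_upd0 lerD2l.
have : 0 <= tnth (X w) i0 ^+ 2 by exact: sqr_ge0.
rewrite -expr2 exprMn -expr2; move: (_ ^+ 2) => x x0; apply: ler_piMl => //.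
by rewrite exprn_ile1.
Qed.

(** The first axis is tangent to the spheres along the hyperplane
    orthogonal to it, so that the derivative vanishes there and can be
    divided by the first coordinate as in one variable. *)
Let H_first v : (tnth v i0)%:C * H v = D v e1.
Proof.
have D0 : D (upd v i0 0) e1 = 0.
  have [->|v0] := eqVneq (upd v i0 0) vzero; first exact: D_origin.
  by apply: D_tangent => //; rewrite dotpC dot_e1 tnth_mktuple eqxx.
rewrite -[RHS]subr0 -[X in _ - X]D0 /D -CintB//.
rewrite /H -CintZ; last exact: Cintegrable_iterated (measurable_dot_Y v).
apply: eq_Cint => w; rewrite dot_e1.
have ei : Cint mu (fun t => itvC 0 1 t * expi (dotp v (upd (X w) i0 (t * tnth (X w) i0)))) =
    expi (dotp (upd v i0 0) (X w)) * Cint mu (fun t => itvC 0 1 t * expi (t * (tnth v i0 * tnth (X w) i0))).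
  rewrite -CintZ; last first.
    apply: (@Cintegrable_itvC R _ _ _ 1) => [|t _]; last by rewrite cnorm_expi.
    by apply: cmeas_expi; exact: measurable_funM.
  apply: eq_Cint => t; rewrite dot_upd expiD mulrCA; congr (_ * (_ * expi _)); ring.
have := @Cint_expi_itv R 0 1 (tnth v i0 * tnth (X w) i0) ler01.
rewrite mul1r mul0r expi0 ei [dotp v (X w)]dot_upd0 expiD.
move: (Cint mu _) => I hI.
have -> : (- (tnth (X w) i0 ^+ 2))%:C = (tnth (X w) i0) *i * (tnth (X w) i0) *i :> R[i].
  by apply: complex_ext; rewrite ?cReM ?cImM /=; ring.
have -> : expi (tnth v i0 * tnth (X w) i0) = (tnth v i0)%:C * (tnth (X w) i0) *i * I + 1.
  by rewrite -toiM hI subrK.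
by ring.
Qed.

(** The vector [|v|^2 e1 - v_1 v] is tangent to the sphere. *)
Let H_euler v : tnth v i0 != 0 -> D v v = (enorm v ^+ 2)%:C * H v.
Proof.
move=> v1; have vn0 : v != vzero by apply: contraNneq v1 => ->; rewrite tnthE.
have := D_tangent (v := v) (h := vsub (vscale (dotp v v) e1) (vscale (tnth v i0) v)).
rewrite dotpBr !dotpZr (dotpC v e1) dot_e1 mulrC subrr => /(_ erefl vn0).
rewrite DB !DZ -H_first => /eqP; rewrite subr_eq0 mulrCA => /eqP /mulfI h.
rewrite sqr_enorm h//; apply: contra v1 => /eqP /(congr1 (@complex.Re R)) /= ->.
by rewrite eqxx.
Qed.

Let ramp_int : Cintegrable mu (fun t => itvC 0 1 t * t%:C).
Proof.
apply: (@Cintegrable_itvC R _ _ _ 1) => [|t /andP[t0 t1]].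
  by apply: cmeas_toC; exact: measurable_id.
by rewrite cnorm_toC ger0_norm.
Qed.

Let ftc u : psi u - psi vzero = Cint mu (fun t => itvC 0 1 t * D (vscale t u) u).
Proof.
transitivity (Cint m (fun w => a w * (dotp u (X w)) *i *
    Cint mu (fun t => itvC 0 1 t * expi (t * dotp u (X w))))).
  rewrite !psiE -CintB; [|exact: expi_int..]; apply: eq_Cint => w.
  have := @Cint_expi_itv R 0 1 (dotp u (X w)) ler01; rewrite mul1r mul0r expi0 -mulrA => ->.
  by rewrite (dotpC vzero) dotp0r expi0 mulrBr.
have mh : measurable_fun setT (fun z : T * measurableTypeR R => z.2 * dotp u (X z.1)).
  apply: measurable_funM; first exact: measurable_snd.
  exact: (measurableT_comp (mdot u) measurable_fst).
rewrite (Cint_exchange (D0_int u) ibC mh); apply: eq_Cint => t; congr (_ * _).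
by apply: eq_Cint => w; rewrite dotpZl.
Qed.

(** The derivative of [psi] along a radius is [t |u|^2 H (t u)], and the
    integral of [t H (t u)] over [0 <= t <= 1] stays in the class. Points
    with a zero first coordinate are reached by continuity. *)
Lemma radial_div : psi vzero = 0 ->
  exists2 G, brep (cball rho) G & forall u, psi u = (enorm u ^+ 2)%:C * G u.
Proof.
move=> psi0; have [d1 [T1 [m1 [b [Z [ib mZ bZ HE]]]]]] := H_brep.
pose Y1 (z : T1 * measurableTypeR R) := vscale z.2 (Z z.1).
have mY1 : measurable_fun setT Y1.
  apply: measurable_vscale; first exact: measurable_snd.
  exact: (measurableT_comp mZ measurable_fst).
pose G u := Cint m1 (fun w => b w * Cint mu (fun t => itvC 0 1 t * t%:C * expi (dotp u (Y1 (w, t))))).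
have Gb : brep (cball rho) G.
  apply: (@brep_product _ _ _ _ m1 mu _ _ Y1) => // w t /bZ bw.
  rewrite mulf_eq0 negb_or => /andP[/itvC_neq0/andP[t0 t1] _].
  rewrite /cball /= enormZ ger0_norm// (le_trans _ bw)// ler_piMl ?enorm_ge0//.
exists G => // u.
have main v : tnth v i0 != 0 -> psi v = (enorm v ^+ 2)%:C * G v.
  move=> v1; rewrite -[LHS]subr0 -[X in _ - X]psi0 ftc.
  have mh : measurable_fun setT (fun z => dotp v (Y1 z)).
    by apply: measurable_dotp => //; exact: measurable_cst.
  rewrite /G (Cint_exchange ib ramp_int mh) -CintZ; last first.
    apply: (Cintegrable_iterated (h := fun z => dotp v (Y1 (z.2, z.1))) ramp_int ib).
    apply: (measurableT_comp mh).
    by apply: measurable_fun_pair; [exact: measurable_snd|exact: measurable_fst].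
  apply: eq_Cint => t; have [->|t0] := eqVneq t 0.
    have -> : vscale 0 v = vzero by apply: eq_from_tnth => i; rewrite !tnthE mul0r.
    by rewrite D_origin !mulr0 mul0r mulr0.
  rewrite (_ : Cint m1 _ = H (vscale t v)); last first.
    by rewrite HE; apply: eq_Cint => w; rewrite /Y1 dotpZr dotpZl.
  have := H_euler (v := vscale t v); rewrite tnthE mulf_neq0// => /(_ isT).
  rewrite DZ enormZ exprMn real_normK ?num_real// toCM.
  have tC : t%:C != 0 :> R[i] by apply: contra t0 => /eqP /(congr1 (@complex.Re R)) /= ->.
  move=> h; have {}h : D (vscale t v) v = t%:C * (enorm v ^+ 2)%:C * H (vscale t v).
    by apply: (mulfI tC); rewrite h toCX; ring.
  by rewrite h; ring.
have [u1|u1] := eqVneq (tnth u i0) 0; last exact: main.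
have [K K0 lip] := lipschitz; have [K' K'0 lip'] := brep_lipschitz Gb (@cball_cube rho).
have [M GM] := brep_bounded Gb.
apply/eqP; rewrite -subr_eq0; apply/eqP; apply: cnorm_eq0; apply/eqP.
rewrite eq_le cnorm_ge0 andbT.
apply: (@le0_of_small _ (K + enorm u ^+ 2 * K' + M)) => t t0 t1.
pose v := vadd u (vscale t e1).
have v1 : tnth v i0 != 0 by rewrite !tnthE u1 add0r tnth_mktuple eqxx mulr1 gt_eqF.
have ee : enorm e1 = 1 by rewrite enormE dot_e1 tnth_mktuple eqxx sqrtr1.
have uv : enorm (vsub u v) = t.
  have -> : vsub u v = vscale (- t) e1 by apply: eq_from_tnth => i; rewrite !tnthE; ring.
  by rewrite enormZ ee mulr1 normrN gtr0_norm.
have v2 : enorm v ^+ 2 = enorm u ^+ 2 + t ^+ 2.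
  rewrite !sqr_enorm /v !(dotpDl, dotpDr, dotpZl, dotpZr) (dotpC u e1) !dot_e1 u1 tnth_mktuple eqxx /=.
  by ring.
have -> : psi u - (enorm u ^+ 2)%:C * G u =
    (psi u - psi v) + ((enorm u ^+ 2)%:C * (- (G u - G v)) + (t ^+ 2)%:C * G v).
  rewrite (main v v1) v2 toCD.
  by move: (G u) (G v) (psi u) ((enorm u ^+ 2)%:C) ((t ^+ 2)%:C) => x1 x2 x3 x4 x5; ring.
have l1 := lip u v; have l2 := lip' u v; rewrite uv in l1 l2.
apply: le_trans (cnormD _ _) _; rewrite mulrDr mulrDr -addrA; apply: lerD; first by rewrite mulrC.
apply: le_trans (cnormD _ _) _; apply: lerD.
  rewrite cnormM cnorm_toC ger0_norm ?sqr_ge0// cnormN mulrCA ler_wpM2l ?sqr_ge0//.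
  by rewrite mulrC.
rewrite cnormM cnorm_toC ger0_norm ?sqr_ge0// expr2 -mulrA ler_wpM2l ?(ltW t0)//.
rewrite -[leRHS]mul1r ler_pM ?cnorm_ge0 ?(ltW t0) ?(ltW t1)//.
Qed.

End division.

Let axis (i0 : 'I_d) (t : R) : enorm (upd (vzero : Rn R d) i0 t) = `|t|.
Proof.
rewrite /enorm (bigD1 i0)//= tnth_mktuple eqxx big1 ?addr0 ?sqrtr_sqr// => i /negbTE ii.
by rewrite tnth_mktuple ii tnthE expr0n.
Qed.

(** The division terminates since the restriction to an axis vanishes to a
    finite order at the origin. *)
Lemma radial_factor (i0 : 'I_d) rho psi : 0 <= rho -> brep (cball rho) psi -> radial psi ->
  (exists u, psi u != 0) -> exists q chi, [/\ brep (cball rho) chi, chi vzero != 0 &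
    forall u, psi u = (enorm u ^+ (2 * q))%:C * chi u].
Proof.
move=> rho0 psib rad [u0 pu0].
have [k [c [del [c0 /andP[del0 del1] low]]]] : exists k c del, [/\ 0 < c, 0 < del <= 1 &
    forall t, 0 < t -> t < del -> c * t ^+ k <= cnorm (psi (upd vzero i0 t))].
  have r1 : 0 < rho + 1 by rewrite ltr_wpDl.
  have Br : cball rho `<=` (cube (rho + 1) : set (Rn R d)).
    by move=> x xb; apply: cube_enorm; apply: le_trans xb _; rewrite lerDl.
  have [c fr] := slice_rep1 vzero i0 psib Br.
  have f0 : psi (upd vzero i0 (enorm u0)) != 0.
    by rewrite (rad _ u0)// axis ger0_norm ?enorm_ge0.
  have [k [g [c' [gr g0 fg]]]] := rep1_factor r1 fr f0.
  have [h hr gh] := rep1_div (ltW r1) gr; set K := _ * c' in hr.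
  have K0 : 0 <= K by apply: le_trans (rep1_bound 0 hr); exact: cnorm_ge0.
  have g0' := cnorm_gt0 g0.
  exists k, (cnorm (g 0) / 2), (Num.min 1 (cnorm (g 0) / (2 * (K + 1)))); split.
  - by rewrite divr_gt0.
  - by rewrite lt_min ltr01 divr_gt0 ?mulr_gt0 ?ltr_wpDl//= ge_min lexx.
  - move=> t t0; rewrite lt_min => /andP[t1]; rewrite ltr_pdivlMr ?mulr_gt0 ?ltr_wpDl// => tK.
    rewrite fg cnormM cnormX cnorm_toC gtr0_norm// mulrC ler_wpM2l ?exprn_ge0 ?(ltW t0)//.
    have : cnorm (g 0) <= cnorm (g t) + t * K.
      have -> : g 0 = g t + - (t%:C * h t) by rewrite (gh t) addrK.
      apply: le_trans (cnormD _ _) _; rewrite lerD2l cnormN cnormM cnorm_toC gtr0_norm//.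
      by rewrite ler_wpM2l ?(ltW t0)//; exact: rep1_bound hr.
    by move: tK t0 K0; move: (cnorm (g 0)) (cnorm (g t)) => x y; nra.
(* The lower bound along the axis loses two degrees at each division, which
   therefore stops. *)
have [n] := ubnP k; elim: n k psi psib rad low {u0 pu0} => // n IH k psi psib rad low kn.
have [psi0|psi0] := eqVneq (psi vzero) 0; last first.
  by exists 0%N, psi; split=> // u; rewrite muln0 expr0 mul1r.
have [disp [T [m [a [X [ia mX aX psiE]]]]]] := psib.
have [G Gb GE] := radial_div i0 rho0 ia mX aX psiE rad psi0.
have Grad : radial G.
  move=> u v uv; have [u00|un0] := eqVneq (enorm u) 0.
    by rewrite (enorm_eq0 u00) (@enorm_eq0 _ _ v)// -uv.
  have uC : (enorm u ^+ 2)%:C != 0 :> R[i].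
    apply: contra un0 => /eqP /(congr1 (@complex.Re R)) /= /eqP.
    by rewrite sqrf_eq0.
  by apply: (mulfI uC); rewrite -GE uv -GE; exact: rad.
have lowG t : 0 < t -> t < del -> c * t ^+ k <= t ^+ 2 * cnorm (G (upd vzero i0 t)).
  move=> t0 tdel; apply: le_trans (low t t0 tdel) _.
  by rewrite GE cnormM cnorm_toC axis ger0_norm ?sqr_ge0// (gtr0_norm t0).
case: k kn low lowG => [|k] kn low lowG.
  have [M GM] := brep_bounded Gb.
  have M0 : 0 <= M by apply: le_trans (GM vzero); exact: cnorm_ge0.
  exfalso; move: c0; rewrite ltNge => /negP; apply.
  apply: (@le0_of_small _ M) => t t0 t1.
  have td0 : 0 < t * del by rewrite mulr_gt0.
  have := lowG (t * del) td0; rewrite gtr_pMl// => /(_ t1); rewrite expr0 mulr1.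
  move=> h; apply: le_trans h _; apply: ler_pM; rewrite ?cnorm_ge0 ?sqr_ge0//.
  have h1 : t * del <= t by rewrite ler_piMr// ltW.
  by rewrite expr2 (le_trans _ h1)// ler_piMr ?(ltW td0)// (le_trans h1)// ltW.
have [|//|q [chi [chib chi0 chiE]]] := IH k.-1 G Gb Grad.
- move=> t t0 tdel; have t1 : t <= 1 by apply: le_trans del1; exact: ltW.
  have := lowG t t0 tdel; have t2 : 0 < t ^+ 2 by rewrite exprn_gt0.
  move=> lo; rewrite -(ler_pM2l t2); apply: le_trans lo.
  rewrite mulrCA ler_wpM2l ?(ltW c0)// -exprD; apply: ler_wiXn2l; rewrite ?(ltW t0)//.
  by case: k {kn low lowG} => //= k; rewrite add2n.
- by case: k kn {low lowG} => //= k; rewrite !ltnS => kn; exact: ltnW.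
exists q.+1, chi; split=> // u.
by rewrite GE chiE mulrA -toCM -exprD mulnS.
Qed.

End radial.

(** * Averages over directions *)

Section averages.
Context {R : realType} {d : nat}.
Local Notation L := (lebesgue_Rn R d).
Local Notation mu := (@lebesgue_measure R).

(** Tents are transforms of integrable kernels, so that integrals of tents
    are means of the given transforms. *)
Lemma unique_of_fourier (disp : measure_display) (T : measurableType disp)
    (m : {sigma_finite_measure set T -> \bar R}) (a : T -> R[i]) (X : T -> Rn R d) E r :
  Cintegrable m a -> measurable_fun setT X ->
  (forall u, Cint m (fun w => a w * expi (dotp u (X w))) = 0) -> measurable E ->
  Cint m (fun w => a w * (\1_(E `&` cube r) (X w))%:C) = 0.
Proof.
move=> ia mX a0 mE.
have la : locally_Cintegrable m a X.
  split=> [|r']; first exact: ia.1.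
  have mI : cmeas (fun w => (\1_(cube r') (X w) : R)%:C).
    by apply: cmeas_toC; apply/measurable_EFinP; apply: measurable_indic_comp => //; exact: measurable_cube.
  have := CintegrableM_bounded mI ia (c := 1); rewrite (_ : (fun x => _) = (fun w => a w * (\1_(cube r') (X w))%:C)).
    by apply=> w; rewrite cnorm_toC indicE; case: (_ \in _); rewrite ?normr1 ?normr0.
  by apply/funext => w; exact: mulrC.
have l0 : locally_Cintegrable m (fun=> 0) X.
  split=> [|r']; first exact: cmeas_cst.
  by rewrite (_ : (fun w => _) = fun=> 0); [exact: Cintegrable0|apply/funext => w; rewrite mul0r].
rewrite (unique_of_tents mX mX la l0) => // [|del v del0].
  by rewrite -[RHS](Cint0 m); apply: eq_Cint => w; rewrite mul0r.
transitivity (Cint m (fun=> 0) : R[i]); last by apply: eq_Cint => w; rewrite mul0r.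
rewrite Cint0; transitivity (Cint m (fun w => a w * Cint L (fun x => tents_ker del v x * expi (- dotp (X w) x)))).
  by apply: eq_Cint => w; rewrite tents_kerE.
have mh : measurable_fun setT (fun z : T * Rn R d => - dotp (X z.1) z.2).
  apply: measurableT_comp => //; apply: measurable_dotp; last exact: measurable_snd.
  exact: (measurableT_comp mX measurable_fst).
rewrite (Cint_exchange ia (Cintegrable_tents_ker v del0) mh) -[RHS](Cint0 L).
apply: eq_Cint => x; rewrite [X in _ * X](_ : _ = 0) ?mulr0// -[RHS](a0 (vopp x)).
by apply: eq_Cint => w; rewrite dotpN (dotpC x).
Qed.

Definition hat (y : Rn R d) := vscale (enorm y)^-1 y.

Lemma enorm_hat y : enorm y != 0 -> enorm (hat y) = 1.
Proof. by move=> y0; rewrite enormZ ger0_norm ?invr_ge0 ?enorm_ge0// mulVf. Qed.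

Lemma enorm_hat_le1 y : enorm (hat y) <= 1.
Proof.
have [y0|/enorm_hat -> //] := eqVneq (enorm y) 0.
by rewrite enormZ y0 invr0 normr0 mul0r ler01.
Qed.

Lemma measurable_hat {disp} {T : measurableType disp} (f : T -> Rn R d) :
  measurable_fun setT f -> measurable_fun setT (fun t => hat (f t)).
Proof.
move=> mf; apply: measurable_vscale => //; apply: (measurableT_comp measurable_invr).
exact: measurable_enorm.
Qed.

(** The punctured unit ball, on which the direction is uniformly distributed. *)
Definition pball : set (Rn R d) := [set y | 0 < enorm y < 1].

Lemma measurable_pball : measurable pball.
Proof.
rewrite (_ : pball = [set y | 0 < enorm y] `&` [set y | enorm y < 1]).
  by apply: measurableI; apply: measurable_lt_set => //; exact: measurable_enorm.
by apply/seteqP; split=> y; rewrite /pball /=; [move=> /andP[]|move=> [-> ->]].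
Qed.

Definition pballC (y : Rn R d) : R[i] := (\1_pball y)%:C.

Lemma pballC_meas : cmeas pballC.
Proof. by apply: cmeas_toC; apply: measurable_indic; exact: measurable_pball. Qed.

Lemma pballC_le y : cnorm (pballC y) <= 1 * \1_(cube 1) y.
Proof.
rewrite mul1r /pballC cnorm_toC !indicE; case: (boolP (y \in pball)) => [/set_mem /= yp|_].
  by rewrite mem_set ?normr1//; apply: cube_enorm; move: yp => /andP[_ /ltW].
by rewrite normr0.
Qed.

Lemma pballC_int : Cintegrable L pballC.
Proof.
apply: (Cintegrable_le pballC_meas _ pballC_le); exact: integrable_cst_cube.
Qed.

Lemma Cint_householder (a : Rn R d) f : dotp a a != 0 -> cmeas f ->
  Cintegrable L (f \o householder a) -> Cint L f = Cint L (f \o householder a).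
Proof.
move=> a0 mf fi.
have LH (A : set (Rn R d)) : measurable A -> L A = L (householder a @^-1` A).
  move=> mA; have mI : measurable_fun setT (fun x : Rn R d => (\1_A x : R)%:E).
    by apply/measurable_EFinP; exact: measurable_indic.
  have iE (B : set (Rn R d)) : measurable B -> L B = (\int[L]_x (\1_B x)%:E)%E.
    by move=> mB; rewrite integral_indic// setIT.
  have mHA : measurable (householder a @^-1` A).
    by rewrite -[X in measurable X]setTI; apply: (measurable_householder a).
  rewrite (iE _ mA) (iE _ mHA) -(ge0_integral_householder a0 mI)//.
exact: (@Cint_image _ _ _ _ _ L L _ (measurable_householder a) LH f mf fi).2.
Qed.

Let sphere_int z : Cintegrable L (fun y => pballC y * expi (dotp z (hat y))).
Proof.
have mz : measurable_fun setT (fun y : Rn R d => dotp z (hat y)).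
  by apply: measurable_dotp; [exact: measurable_cst|apply: measurable_hat; exact: measurable_id].
by have := Cintegrable_expiM mz pballC_int; congr Cintegrable; apply/funext => y; exact: mulrC.
Qed.

Let sphere z := Cint L (fun y => pballC y * expi (dotp z (hat y))).

(** Reflections exchange any two vectors of the same norm and preserve the
    ball. *)
Lemma sphere_radial : radial sphere.
Proof.
move=> v w vw; have [->//|nvw] := eqVneq v w.
have [a0 vwE] := householder_exchange vw nvw; set a := vsub v w in a0 vwE.
have hh y : hat (householder a y) = householder a (hat y).
  rewrite /hat enorm_householder//; apply: eq_from_tnth => i.
  by rewrite /householder !tnthE dotpZr; ring.
have E : (fun y => pballC y * expi (dotp v (hat y))) \o householder a = fun y => pballC y * expi (dotp w (hat y)).
  apply/funext => y /=; rewrite hh -dotp_householder vwE; congr (_ * _).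
  rewrite /pballC !indicE; congr ((_ : bool)%:R)%:C; by apply/idP/idP; rewrite !inE /pball /= enorm_householder.
rewrite /sphere (Cint_householder a0 (sphere_int v).1) E//; exact: sphere_int.
Qed.

Section average.
Context (disp : measure_display) (T : measurableType disp).
Variables (m : {sigma_finite_measure set T -> \bar R}) (b : T -> R[i]) (X : T -> Rn R d).
Variables (rho : R) (chi : Rn R d -> R[i]).
Hypotheses (ib : Cintegrable m b) (mX : measurable_fun setT X).
Hypothesis bX : forall w, b w != 0 -> enorm (X w) <= rho.
Hypothesis chiE : forall u, chi u = Cint m (fun w => b w * expi (dotp u (X w))).
Variable a : Rn R d.

(** The spectrum, translated by [a] and then made rotation invariant. *)
Definition average u := Cint m (fun w => b w * Cint L (fun y =>
  pballC y * expi (dotp u (vscale (enorm (vadd (X w) a)) (hat y))))).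

Let mXa : measurable_fun setT (fun w => enorm (vadd (X w) a)).
Proof. by apply: measurable_enorm; apply: measurable_vadd => //; exact: measurable_cst. Qed.

Lemma average_brep : brep (cball (rho + enorm a)) average.
Proof.
apply: (@brep_product _ _ _ _ _ _ m L _ _ (fun z => vscale (enorm (vadd (X z.1) a)) (hat z.2))) => //.
- exact: pballC_int.
- apply: measurable_vscale; first exact: (measurableT_comp mXa measurable_fst).
  by apply: measurable_hat; exact: measurable_snd.
move=> w y /bX bw _; rewrite /cball /= enormZ ger0_norm ?enorm_ge0//.
apply: le_trans (_ : enorm (vadd (X w) a) <= _).
  by rewrite ler_piMr ?enorm_ge0 ?enorm_hat_le1.
by apply: le_trans (enormD _ _) _; rewrite lerD2r.
Qed.

Let averageE u : average u = Cint m (fun w => b w * sphere (vscale (enorm (vadd (X w) a)) u)).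
Proof.
apply: eq_Cint => w; congr (_ * _); apply: eq_Cint => y; congr (_ * expi _).
by rewrite dotpZr dotpZl.
Qed.

Lemma average_radial : radial average.
Proof.
move=> u v uv; rewrite !averageE; apply: eq_Cint => w; congr (_ * _).
by apply: sphere_radial; rewrite !enormZ uv.
Qed.

(** Since [sphere] is radial, the lengths of [u] and [X w + a] can be
    exchanged between its argument and the direction, and the integral
    over [w] is then [chi] at the point of length [|u|] in the direction
    of [y]. *)
Lemma average_directions u : average u = Cint L (fun y =>
  pballC y * (chi (vscale (enorm u) (hat y)) * expi (dotp a (vscale (enorm u) (hat y))))).
Proof.
rewrite averageE.
transitivity (Cint m (fun w => b w * Cint L (fun y =>
    pballC y * expi (enorm u * dotp (vadd (X w) a) (hat y))))).
  apply: eq_Cint => w; congr (_ * _).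
  rewrite (sphere_radial (v := vscale (enorm u) (vadd (X w) a))); last first.
    by rewrite !enormZ !ger0_norm ?enorm_ge0// mulrC.
  by apply: eq_Cint => y; rewrite dotpZl.
have mh : measurable_fun setT (fun z : T * Rn R d => enorm u * dotp (vadd (X z.1) a) (hat z.2)).
  apply: measurable_funM; first exact: measurable_cst.
  apply: measurable_dotp; last by apply: measurable_hat; exact: measurable_snd.
  by apply: measurable_vadd; [exact: (measurableT_comp mX measurable_fst)|exact: measurable_cst].
rewrite (Cint_exchange ib pballC_int mh); apply: eq_Cint => y; congr (_ * _).
rewrite chiE -CintZr; last exact: Cintegrable_rep.
apply: eq_Cint => w; rewrite -mulrA -expiD; congr (_ * expi _).
by rewrite /= dotpDl [dotp (vscale _ _) (X w)]dotpZl dotpZr (dotpC (hat y)); ring.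
Qed.

End average.

Local Notation dir u y := (vscale (enorm u) (hat y)).

Definition polar_const : \bar R := (\int[L]_u (\1_[set w | 1 < enorm w] u * enorm u ^- (2 * d))%:E)%E.

Let mtail : measurable_fun setT (fun u : Rn R d => \1_[set w | 1 < enorm w] u * enorm u ^- (2 * d)).
Proof.
apply: measurable_funM.
  by apply: measurable_indic; apply: measurable_lt_set => //; exact: measurable_enorm.
apply: (measurableT_comp measurable_invr); apply: measurable_funX.
by apply: measurable_enorm; exact: measurable_id.
Qed.

Lemma polar_const_lty : (polar_const < +oo)%E.
Proof.
have t0 (u : Rn R d) : 0 <= enorm u ^- (2 * d) by rewrite invr_ge0 exprn_ge0 ?enorm_ge0.
have fin : (\int[L]_u ((1 + enorm u) ^- (2 * d))%:E < +oo)%E := integral_enorm_pow_lty (leqnn _).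
have m1 : measurable_fun setT (fun u : Rn R d => ((1 + enorm u) ^- (2 * d))%:E).
  apply/measurable_EFinP; apply: (measurableT_comp measurable_invr); apply: measurable_funX.
  by apply: measurable_funD; [exact: measurable_cst|apply: measurable_enorm; exact: measurable_id].
apply: (@le_lt_trans _ _ (\int[L]_u ((2 ^+ (2 * d))%:E * ((1 + enorm u) ^- (2 * d))%:E))%E).
  apply: ge0_le_integral => //.
  - by move=> u _; rewrite lee_fin mulr_ge0.
  - exact/measurable_EFinP.
  - by apply: emeasurable_funM => //; exact: measurable_cst.
  move=> u _; rewrite -EFinM lee_fin indicE; case: (boolP (u \in _)) => [/set_mem /= u1|_]; last first.
    by rewrite mul0r mulr_ge0 ?exprn_ge0 ?invr_ge0 ?exprn_ge0 ?addr_ge0 ?enorm_ge0.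
  have e0 : 0 < enorm u by exact: lt_trans u1.
  rewrite mul1r -!exprVn -exprMn lerXn2r ?nnegrE ?mulr_ge0 ?invr_ge0 ?addr_ge0 ?(ltW e0)//.
  by rewrite -[leLHS]mul1r ler_pdivlMr ?ltr_wpDl ?(ltW e0)// mulrAC ler_pdivrMr//; move: u1; lra.
have nn u : (0 <= ((1 + enorm u) ^- (2 * d))%:E)%E.
  by rewrite lee_fin invr_ge0 exprn_ge0 ?addr_ge0 ?enorm_ge0.
rewrite ge0_integralZl ?lee_fin ?exprn_ge0//.
by rewrite lte_mul_pinfty// lee_fin exprn_ge0.
Qed.

(** Polar coordinates without the surface measure: a dilation of [u] for
    [y] fixed, then one of [y] for [u] fixed, bring in the point [|u| y],
    and a last dilation integrates [u] out. *)
Lemma polar (f : Rn R d -> \bar R) : measurable_fun setT f -> (forall v, 0 <= f v)%E ->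
  f vzero = 0%E ->
  (\int[L]_u \int[L]_y ((\1_pball y)%:E * f (dir u y)) = polar_const * \int[L]_v f v)%E.
Proof.
move=> mf f0 fz.
have mpI : measurable_fun setT (fun y : Rn R d => (\1_pball y : R)%:E).
  by apply/measurable_EFinP; apply: measurable_indic; exact: measurable_pball.
have mfst : measurable_fun setT (fun z : Rn R d * Rn R d => enorm z.1).
  by apply: measurable_enorm; exact: measurable_fst.
have msnd : measurable_fun setT (fun z : Rn R d * Rn R d => enorm z.2).
  by apply: measurable_enorm; exact: measurable_snd.
pose G1 (z : Rn R d * Rn R d) := ((\1_pball z.2)%:E * f (dir z.1 z.2))%E.
have mG1 : measurable_fun setT G1.
  apply: emeasurable_funM; first exact: (measurableT_comp mpI measurable_snd).
  apply: (measurableT_comp mf); apply: measurable_vscale => //.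
  by apply: measurable_hat; exact: measurable_snd.
have G10 z : (0 <= G1 z)%E by rewrite mule_ge0// lee_fin.
pose G2 (z : Rn R d * Rn R d) := ((\1_pball z.2 * enorm z.2 ^+ d)%:E * f (vscale (enorm z.1) z.2))%E.
have mG2 : measurable_fun setT G2.
  apply: emeasurable_funM.
    apply/measurable_EFinP; apply: measurable_funM; last exact: measurable_funX.
    apply/measurable_EFinP; exact: (measurableT_comp mpI measurable_snd).
  by apply: (measurableT_comp mf); apply: measurable_vscale => //; exact: measurable_snd.
have G20 z : (0 <= G2 z)%E by rewrite mule_ge0// lee_fin mulr_ge0 ?exprn_ge0 ?enorm_ge0.
pose k (u v : Rn R d) : R := \1_[set w | 0 < enorm w < enorm u] v *
  (enorm u ^- d * (enorm v / enorm u) ^+ d).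
have k0 u v : 0 <= k u v.
  by rewrite !mulr_ge0 ?exprn_ge0 ?invr_ge0 ?exprn_ge0 ?mulr_ge0 ?invr_ge0 ?enorm_ge0.
pose G3 (z : Rn R d * Rn R d) := ((k z.1 z.2)%:E * f z.2)%E.
have mG3 : measurable_fun setT G3.
  apply: emeasurable_funM; last exact: (measurableT_comp mf measurable_snd).
  apply/measurable_EFinP; apply: measurable_funM.
    rewrite (_ : (fun z => _) = \1_([set z : Rn R d * Rn R d | 0 < enorm z.2] `&` [set z | enorm z.2 < enorm z.1])).
      apply: measurable_indic; apply: measurableI; apply: measurable_lt_set => //.
    apply/funext => z; rewrite !indicE; congr ((_ : bool)%:R); apply/idP/idP; rewrite !inE /=.
      by move=> /andP.
    by move=> [-> ->].
  apply: measurable_funM; first by apply: (measurableT_comp measurable_invr); exact: measurable_funX.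
  by apply: measurable_funX; apply: measurable_funM => //; exact: (measurableT_comp measurable_invr).
have G30 z : (0 <= G3 z)%E by rewrite mule_ge0// lee_fin.
have S1 y : (\int[L]_u G1 (u, y) = \int[L]_u G2 (u, y))%E.
  rewrite /G1 /G2 /=; have [yp|yp] := pselect (pball y); last first.
    by apply: eq_integral => u _; rewrite indicE memNset// mul0r !mul0e.
  have /andP[y0 _] := yp; rewrite indicE mem_set// mul1r.
  have mg : measurable_fun setT (fun u : Rn R d => f (vscale (enorm u) y)).
    apply: (measurableT_comp mf); apply: measurable_vscale; last exact: measurable_cst.
    by apply: measurable_enorm; exact: measurable_id.
  rewrite [RHS]ge0_integralZl ?lee_fin ?exprn_ge0 ?(ltW y0)//.
  rewrite -(ge0_integral_dilation y0 mg)//.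
  apply: eq_integral => u _; rewrite mul1e; congr f; apply: eq_from_tnth => i.
  by rewrite enormZ ger0_norm ?invr_ge0 ?(ltW y0)// !tnthE; ring.
have S2 u : (\int[L]_y G2 (u, y) = \int[L]_v G3 (u, v))%E.
  rewrite /G2 /G3 /=; have [u0|u0] := eqVneq (enorm u) 0.
    rewrite u0; apply: eq_integral => y _; have -> : vscale 0 y = vzero.
      by apply: eq_from_tnth => i; rewrite !tnthE mul0r.
    rewrite fz mule0 /k u0 indicE memNset ?mul0r ?mul0e//= => /andP[h1 h2].
    by have := lt_trans h1 h2; rewrite ltxx.
  have {}u0 : 0 < enorm u by rewrite lt_neqAle eq_sym u0 enorm_ge0.
  pose h v := ((\1_[set w | 0 < enorm w < enorm u] v * (enorm v / enorm u) ^+ d)%:E * f v)%E.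
  have h0 v : (0 <= h v)%E.
    by rewrite mule_ge0// lee_fin mulr_ge0 ?exprn_ge0 ?divr_ge0 ?enorm_ge0.
  have eh v : ((k u v)%:E * f v = (enorm u ^- d)%:E * h v)%E.
    by rewrite /h muleA -EFinM /k; congr (_%:E * _)%E; ring.
  have mh : measurable_fun setT h.
    have := measurableT_comp mG3 (measurable_pair1 u) => mk.
    have -> : h = fun v => ((enorm u ^+ d)%:E * (G3 \o pair u) v)%E.
      apply/funext => v; rewrite /G3 /= eh muleA -EFinM mulfV ?mul1e// expf_neq0// gt_eqF//.
    by apply: emeasurable_funM => //; exact: measurable_cst.
  have ui : 0 < (enorm u)^-1 by rewrite invr_gt0.
  under [RHS]eq_integral do rewrite eh.
  rewrite ge0_integralZl ?lee_fin ?invr_ge0 ?exprn_ge0 ?(ltW u0)//.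
  rewrite -exprVn -(ge0_integral_dilation ui mh h0) invrK.
  apply: eq_integral => y _; rewrite /h enormZ (gtr0_norm u0) mulrAC mulfV ?gt_eqF// mul1r.
  congr ((_ * _)%:E * _)%E; rewrite !indicE; congr ((_ : bool)%:R).
  apply/idP/idP; rewrite !inE /pball /= enormZ (gtr0_norm u0) => /andP[h1 h2]; apply/andP.
    by rewrite mulr_gt0// gtr_pMr.
  by move: h1 h2; rewrite pmulr_rgt0// gtr_pMr.
have S3 v : (\int[L]_u G3 (u, v) = polar_const * f v)%E.
  rewrite /G3 /=; have [v0|v0] := eqVneq (enorm v) 0.
    have -> : v = vzero by exact: enorm_eq0.
    by rewrite fz mule0; under eq_integral do rewrite mule0; rewrite integral0.
  have {}v0 : 0 < enorm v by rewrite lt_neqAle eq_sym v0 enorm_ge0.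
  pose q (u : Rn R d) := (\1_[set w | 1 < enorm w] u * enorm u ^- (2 * d))%:E.
  have q0 u : (0 <= q u)%E by rewrite lee_fin mulr_ge0 ?invr_ge0 ?exprn_ge0 ?enorm_ge0.
  have mq : measurable_fun setT q by exact/measurable_EFinP.
  have eq1 u : (k u v)%:E = ((enorm v ^- d)%:E * q (vscale (enorm v)^-1 u))%E.
    rewrite /q /k -EFinM enormZ gtr0_norm ?invr_gt0//; congr EFin.
    rewrite !indicE mulrCA; have -> : (v \in [set w | 0 < enorm w < enorm u]) =
        (vscale (enorm v)^-1 u \in [set w | 1 < enorm w]).
      apply/idP/idP; rewrite !inE /= enormZ gtr0_norm ?invr_gt0// ltr_pdivlMl// mulr1.
        by move=> /andP[].
      by rewrite v0.
    case: (boolP (_ \in _)) => [|_]; last by rewrite !(mul0r, mulr0).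
    rewrite inE /= enormZ gtr0_norm ?invr_gt0// ltr_pdivlMl// mulr1 => uv.
    have u0 : 0 < enorm u by exact: lt_trans uv.
    rewrite !mul1r mul2n -addnn exprD !exprMn !exprVn; field.
    by rewrite !expf_neq0 ?gt_eqF.
  have mqv : measurable_fun setT (fun u : Rn R d => q (vscale (enorm v)^-1 u)).
    by apply: (measurableT_comp mq); apply: measurable_vscale => //; exact: measurable_cst.
  have mk : measurable_fun setT (fun u : Rn R d => (k u v)%:E).
    by under eq_fun do rewrite eq1; apply: emeasurable_funM => //; exact: measurable_cst.
  have kv0 u : (0 <= (k u v)%:E)%E by rewrite lee_fin.
  rewrite ge0_integralZr//; congr (_ * _)%E; rewrite /polar_const.
  under eq_integral do rewrite eq1.
  rewrite ge0_integralZl ?lee_fin ?invr_ge0 ?exprn_ge0 ?(ltW v0)//.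
  rewrite (ge0_integral_dilation v0 mq q0) muleA -EFinM mulVf ?mul1e// expf_neq0// gt_eqF//.
rewrite (fubini_tonelli (m1 := L) (m2 := L) G1 mG1 G10).
under eq_integral do rewrite S1.
rewrite -(fubini_tonelli (m1 := L) (m2 := L) G2 mG2 G20).
under eq_integral do rewrite S2.
rewrite (fubini_tonelli (m1 := L) (m2 := L) G3 mG3 G30).
under eq_integral do rewrite S3.
rewrite ge0_integralZl//.
by apply: integral_ge0 => u _; rewrite lee_fin mulr_ge0 ?invr_ge0 ?exprn_ge0 ?enorm_ge0.
Qed.

End averages.

Section average_bounds.
Context {R : realType} {d : nat}.
Local Notation L := (lebesgue_Rn R d).
Local Notation dir u y := (vscale (enorm u) (hat y)).

(** Cauchy-Schwarz on the ball; the volume is increased by one only in order to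
    be positive. *)
Lemma Cint_pball_sqr : exists2 C : R, 0 <= C & forall (g : Rn R d -> R[i]) c, cmeas g ->
  (forall y, cnorm (g y) <= c) ->
  ((cnorm (Cint L (fun y => pballC y * g y)) ^+ 2)%:E <=
   C%:E * \int[L]_y ((\1_pball y)%:E * (cnorm (g y) ^+ 2)%:E))%E.
Proof.
have sqpb (y : Rn R d) : cnorm (pballC y : R[i]) ^+ 2 = \1_pball y.
  by rewrite /pballC cnorm_toC indicE; case: (_ \in _); rewrite ?normr1 ?normr0 ?expr1n ?expr0n.
have p2 : inL2 L (pballC : Rn R d -> R[i]).
  apply: (inL2_le (B := fun y => 1 * \1_(cube 1) y)).
  - exact: pballC_meas.
  - exact: integrable_cst_cube.
  move=> y; rewrite sqpb mul1r !indicE; case: (boolP (y \in pball)) => [/set_mem yp|_] //.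
  by rewrite mem_set//; apply: cube_enorm; move: yp => /andP[_ /ltW].
pose V := sqn L (pballC : Rn R d -> R[i]) + 1.
have V0 : 0 < V by rewrite ltr_wpDl// Rintegral_ge0// => y _; rewrite sqr_ge0.
exists (4 * V); first by rewrite mulr_ge0// ltW.
move=> g c mg gc.
have g2 : inL2 L (fun y => pballC y * g y).
  apply: (inL2_le (B := fun y => c ^+ 2 * \1_(cube 1) y)).
  - by apply: cmeasM => //; exact: pballC_meas.
  - exact: integrable_cst_cube.
  move=> y; rewrite cnormM exprMn sqpb mulrC !indicE.
  case: (boolP (y \in pball)) => [/set_mem yp|_]; last by rewrite mulr0 mulr_ge0 ?sqr_ge0.
  rewrite mem_set ?mulr1; last by apply: cube_enorm; move: yp => /andP[_ /ltW].
  by rewrite lerXn2r ?nnegrE ?cnorm_ge0// (le_trans (cnorm_ge0 _) (gc y)).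
have E : (\int[L]_y ((\1_pball y)%:E * (cnorm (g y) ^+ 2)%:E) = (sqn L (fun y => pballC y * g y))%:E)%E.
  rewrite /sqn /Rintegral fineK; last exact: (integrable_fin_num measurableT g2.2).
  by apply: eq_integral => y _; rewrite -EFinM cnormM exprMn sqpb.
rewrite E -EFinM lee_fin.
have [_ pair] := inL2_pairing p2 g2.
have pp (y : Rn R d) : pballC y * (pballC y * g y) = pballC y * g y.
  by rewrite mulrA /pballC -toCM indicE; case: (_ \in _); rewrite ?mulr1 ?mulr0.
rewrite (eq_Cint L pp) in pair.
move: pair; set I := sqn L (fun y => pballC y * g y); set Z := cnorm _ => pair.
have I0 : 0 <= I by apply: Rintegral_ge0 => y _; exact: sqr_ge0.
have : 0 <= Z by exact: cnorm_ge0.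
rewrite le_eqVlt => /predU1P[<-|Z0]; first by rewrite expr0n mulr_ge0// mulr_ge0// ltW.
have t0 : 0 < Z / (2 * V) by rewrite divr_gt0// mulr_gt0.
have := pair _ t0; rewrite invf_div.
have h1 : Z / (2 * V) * sqn L (pballC : Rn R d -> R[i]) <= Z / 2.
  rewrite invfM mulrA -mulrA ler_piMr ?divr_ge0 ?(ltW Z0)// ler_pdivrMl// mulr1 /V.
  by rewrite lerDl.
have -> : 2 * V / Z * I = 2 * V * I / Z by rewrite mulrAC.
move=> h2; have {h1 h2} : Z / 2 <= 2 * V * I / Z.
  by move: h1 h2; move: (_ / Z) (sqn L pballC) => p q; lra.
rewrite ler_pdivlMr// expr2 mulrAC (_ : 4 * V * I = 2 * (2 * V * I)); last by ring.
by move: (Z * Z) (2 * V * I) => z p; lra.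
Qed.

Lemma lebesgue_vzero : (0 < d)%N -> L [set vzero] = 0%E.
Proof.
move=> d0; have -> : [set vzero] = [set x : Rn R d | forall i, [set (0 : measurableTypeR R)] (tnth x i)].
  apply/seteqP; split=> [x -> i|x h]; first by rewrite /= tnthE.
  by apply: eq_from_tnth => i; rewrite (h i) tnthE.
rewrite (@lebesgue_Rn_box R d (fun=> [set 0])); last by move=> i; exact: measurable_set1.
rewrite (bigD1 (Ordinal d0))//= [X in (X * _)%E](_ : _ = 0%E) ?mul0e//.
exact: lebesgue_measure_set1.
Qed.

Section average.
Context (disp : measure_display) (T : measurableType disp).
Variables (m : {sigma_finite_measure set T -> \bar R}) (b : T -> R[i]) (X : T -> Rn R d).
Variables (rho : R) (chi : Rn R d -> R[i]).
Hypotheses (ib : Cintegrable m b) (mX : measurable_fun setT X).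
Hypothesis bX : forall w, b w != 0 -> enorm (X w) <= rho.
Hypothesis chiE : forall u, chi u = Cint m (fun w => b w * expi (dotp u (X w))).

Let bchi : brep (cball rho) chi.
Proof. by exists disp, T, m, b, X; split=> // w /bX. Qed.

Let mdir (u : Rn R d) : measurable_fun setT (fun y : Rn R d => dir u y).
Proof.
by apply: measurable_vscale; [exact: measurable_cst|apply: measurable_hat; exact: measurable_id].
Qed.

(** In polar coordinates the average over directions is controlled by
    Cauchy-Schwarz on each sphere, where an isotropic weight is constant. *)
Lemma average_L2 (a : Rn R d) (w : Rn R d -> \bar R) : (0 < d)%N ->
  measurable_fun setT w -> (forall u, 0 <= w u)%E ->
  (forall u v, enorm u = enorm v -> w u = w v) ->
  (\int[L]_u ((cnorm (chi u) ^+ 2)%:E * w u) < +oo)%E ->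
  (\int[L]_u ((cnorm (average m b X a u) ^+ 2)%:E * w u) < +oo)%E.
Proof.
move=> d0 mw w0 wrad fin.
have [C C0 CS] := Cint_pball_sqr; have [c cb] := brep_bounded bchi.
pose nz : set (Rn R d) := [set v | 0 < enorm v].
have mnz : measurable nz.
  by apply: measurable_lt_set => //; apply: measurable_enorm; exact: measurable_id.
pose F v := ((\1_nz v)%:E * ((cnorm (chi v) ^+ 2)%:E * w v))%E.
have mchi2 : measurable_fun setT (fun v : Rn R d => (cnorm (chi v) ^+ 2)%:E).
  by apply/measurable_EFinP; apply: measurable_funX; exact: measurable_cnorm (brep_cmeas bchi).
have mF0 : measurable_fun setT (fun v => ((cnorm (chi v) ^+ 2)%:E * w v)%E).
  exact: emeasurable_funM.
have mF : measurable_fun setT F.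
  by apply: emeasurable_funM => //; apply/measurable_EFinP; exact: measurable_indic.
have F0 v : (0 <= F v)%E by rewrite !mule_ge0 ?lee_fin ?sqr_ge0.
have Fz : F vzero = 0%E.
  by rewrite /F indicE memNset ?mul0e// /nz /= enorm0 ltxx.
pose G (z : Rn R d * Rn R d) := ((\1_pball z.2)%:E * F (dir z.1 z.2))%E.
have mG : measurable_fun setT G.
  apply: emeasurable_funM.
    apply/measurable_EFinP; apply: (measurableT_comp _ measurable_snd).
    by apply: measurable_indic; exact: measurable_pball.
  apply: (measurableT_comp mF); apply: measurable_vscale.
    by apply: measurable_enorm; exact: measurable_fst.
  by apply: measurable_hat; exact: measurable_snd.
have G0 z : (0 <= G z)%E by rewrite mule_ge0 ?lee_fin.
have mGu : measurable_fun setT (fun u => \int[L]_y G (u, y))%E.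
  exact: (@measurable_fun_fubini_tonelli_F _ _ _ _ _ L G mG G0).
have Gu0 u : (0 <= \int[L]_y G (u, y))%E by apply: integral_ge0 => y _; exact: G0.
have bound u : nz u -> ((cnorm (average m b X a u) ^+ 2)%:E * w u <= C%:E * \int[L]_y G (u, y))%E.
  move=> nu; rewrite (average_directions ib mX chiE).
  pose g y := chi (dir u y) * expi (dotp a (dir u y)).
  have mg : cmeas g.
    apply: cmeasM; first exact: (cmeas_comp (brep_cmeas bchi) (mdir u)).
    by apply: cmeas_expi; apply: measurable_dotp => //; exact: measurable_cst.
  have gn y : cnorm (g y) = cnorm (chi (dir u y)) by rewrite cnormM cnorm_expi mulr1.
  have gc y : cnorm (g y) <= c by rewrite gn.
  apply: le_trans (lee_wpmul2r (w0 u) (CS g c mg gc)) _.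
  rewrite -muleA; apply: lee_wpmul2l; first by rewrite lee_fin.
  have mg2 : measurable_fun setT (fun y => (\1_pball y)%:E * (cnorm (g y) ^+ 2)%:E)%E.
    apply: emeasurable_funM; apply/measurable_EFinP.
      by apply: measurable_indic; exact: measurable_pball.
    by apply: measurable_funX; exact: measurable_cnorm.
  have g20 y : (0 <= (\1_pball y)%:E * (cnorm (g y) ^+ 2)%:E)%E.
    by rewrite mule_ge0 ?lee_fin ?sqr_ge0.
  rewrite -ge0_integralZr// le_eqVlt; apply/orP; left; apply/eqP; apply: eq_integral => y _.
  rewrite /G /F /= gn; have [yp|yp] := pselect (pball y); last first.
    by rewrite [\1_pball y]indicE memNset// !mul0e.
  have nd : enorm (dir u y) = enorm u.
    have /andP[y0 _] := yp.
    by rewrite enormZ enorm_hat ?gt_eqF// mulr1 ger0_norm ?enorm_ge0.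
  rewrite [\1_nz _]indicE mem_set ?mul1e; last by rewrite /nz /= nd.
  by rewrite (wrad _ u nd) muleA.
apply: (@le_lt_trans _ _ (\int[L]_u (C%:E * \int[L]_y G (u, y)))%E).
  have bav := average_brep ib mX bX a.
  apply: ae_ge0_le_integral => //.
  - by move=> u _; rewrite mule_ge0 ?lee_fin ?sqr_ge0.
  - apply: emeasurable_funM => //; apply/measurable_EFinP; apply: measurable_funX.
    exact: measurable_cnorm (brep_cmeas bav).
  - by move=> u _; rewrite mule_ge0 ?lee_fin.
  - by apply: emeasurable_funM => //; exact: measurable_cst.
  exists [set vzero]; split; first by rewrite -(setCK [set vzero]); apply: measurableC;
    rewrite (_ : ~` [set vzero] = nz)//; apply/seteqP; split=> u; rewrite /nz /=;
    [move=> u0; rewrite lt_neqAle eq_sym enorm_ge0 andbT; apply/eqP => /enorm_eq0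
    |move=> u0 uz; move: u0; rewrite uz enorm0 ltxx].
  - exact: lebesgue_vzero.
  move=> u /=; apply: contra_notP => uz _; apply: bound.
  rewrite /nz /= lt_neqAle eq_sym enorm_ge0 andbT; apply/eqP => /enorm_eq0; exact: uz.
rewrite ge0_integralZl ?lee_fin//.
rewrite lte_mul_pinfty ?lee_fin// (polar mF F0 Fz) lte_mul_pinfty//.
- by apply: integral_ge0 => u _; rewrite lee_fin mulr_ge0 ?invr_ge0 ?exprn_ge0 ?enorm_ge0.
- rewrite ge0_fin_numE ?polar_const_lty//.
  by apply: integral_ge0 => u _; rewrite lee_fin mulr_ge0 ?invr_ge0 ?exprn_ge0 ?enorm_ge0.
apply: le_lt_trans fin; apply: ge0_le_integral => // u _.
rewrite /F indicE; case: (_ \in _); rewrite ?mul1e// mul0e mule_ge0 ?lee_fin ?sqr_ge0//.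
Qed.

(** Directions move at controlled speed away from the origin. *)
Lemma hat_lipschitz (y0 y : Rn R d) : 0 < enorm y0 -> 0 < enorm y ->
  enorm (vsub (hat y) (hat y0)) <= 2 * enorm (vsub y y0) / enorm y0.
Proof.
move=> n0 n1.
have -> : vsub (hat y) (hat y0) = vadd (vscale (enorm y0)^-1 (vsub y y0))
    (vscale ((enorm y)^-1 - (enorm y0)^-1) y).
  by apply: eq_from_tnth => i; rewrite /hat !tnthE; ring.
apply: le_trans (enormD _ _) _; rewrite !enormZ gtr0_norm ?invr_gt0//.
have -> : (enorm y)^-1 - (enorm y0)^-1 = (enorm y0 - enorm y) / (enorm y0 * enorm y).
  by field; rewrite !gt_eqF.
rewrite normrM normfV (gtr0_norm (mulr_gt0 n0 n1)).
have -> : `|enorm y0 - enorm y| / (enorm y0 * enorm y) * enorm y = `|enorm y0 - enorm y| / enorm y0.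
  by field; rewrite !gt_eqF.
rewrite (mulrC _^-1) -mulrDl ler_pM2r ?invr_gt0// mulrDl !mul1r lerD2l.
have t1 : enorm y <= enorm (vsub y y0) + enorm y0.
  apply: le_trans (enormD _ _); rewrite (_ : vadd _ _ = y)//.
  by apply: eq_from_tnth => i; rewrite !tnthE subrK.
have t2 : enorm y0 <= enorm (vsub y y0) + enorm y.
  rewrite -(enormN (vsub y y0)); apply: le_trans (enormD _ _); rewrite (_ : vadd _ _ = y0)//.
  by apply: eq_from_tnth => i; rewrite !tnthE; ring.
by rewrite ler_norml; apply/andP; split; move: t1 t2; lra.
Qed.

(** If all small translations gave a zero average, the mean of [chi] against
    every exponential, hence by uniqueness against every set of directions,
    would vanish on a sphere where [chi] is not zero. *)
Lemma average_neq0 eps (i0 : 'I_d) : 0 <= rho -> 0 < eps -> (exists u, chi u != 0) ->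
  exists2 a, enorm a <= eps & exists u, average m b X a u != 0.
Proof.
move=> rho0 eps0 [u1 cu1].
have [u0 [t0 c0]] : exists u0, 0 < enorm u0 /\ chi u0 != 0.
  have [u1z|u1n] := eqVneq (enorm u1) 0; last first.
    by exists u1; rewrite lt_neqAle eq_sym u1n enorm_ge0.
  have [del del0 near] := brep_neq0_near bchi (@cball_cube _ _ rho) cu1.
  exists (upd vzero i0 del); have u1E := enorm_eq0 u1z; split.
    apply: lt_le_trans (ler_norm_tnth (upd (vzero : Rn R d) i0 del) i0).
    by rewrite /upd tnth_mktuple eqxx normr_gt0 gt_eqF.
  apply: near => j; rewrite u1E vsubv0 /upd tnth_mktuple; case: (j == i0); first by move: del0; lra.
  by rewrite tnthE; move: del0; lra.
apply: contrapT => none.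
have avg0 a u : enorm a <= eps -> average m b X a u = 0.
  move=> ae; apply/eqP; apply: contrapT => /negP n; apply: none; exists a => //; by exists u.
pose t := enorm u0; pose Xt (y : Rn R d) := vscale t (hat y).
have mXt : measurable_fun setT Xt by exact: mdir.
have Xtn y : enorm (Xt y) <= t.
  by rewrite enormZ ger0_norm ?enorm_ge0// ler_piMr ?enorm_ge0// enorm_hat_le1.
have [c cb] := brep_bounded bchi.
have mchiX : cmeas (fun y => chi (Xt y)) by exact: (cmeas_comp (brep_cmeas bchi) mXt).
pose g y := pballC y * chi (Xt y).
have ig : Cintegrable L g.
  have := CintegrableM_bounded mchiX (@pballC_int _ d) (c := c) (fun y => cb (Xt y)).
  by congr Cintegrable; apply/funext => y; rewrite mulrC.
have Zs a : enorm a <= eps -> Cint L (fun y => g y * expi (dotp a (Xt y))) = 0.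
  move=> ae; rewrite -[RHS](avg0 a u0 ae) (average_directions ib mX chiE).
  by apply: eq_Cint => y; rewrite /g mulrA.
(* Along every line of translations [a], this is a band-limited function
   that vanishes near the origin. *)
have Z0 a : Cint L (fun y => g y * expi (dotp a (Xt y))) = 0.
  pose f (l : R) := Cint L (fun y => g y * expi (l * dotp a (Xt y))).
  have fr : rep1 (enorm a * t + 1) (\int[L]_y cnorm (g y))%R f.
    exists _, _, L, g, (fun y => dotp a (Xt y)); split=> //.
      by apply: measurable_dotp => //; exact: measurable_cst.
    move=> y _; rewrite ler_norml; apply/andP; split.
      rewrite lerNl -dotpN (le_trans (ler_dotp _ _))// enormN ler_wpDr//.
      by apply: ler_wpM2l; [exact: enorm_ge0|exact: Xtn].
    rewrite (le_trans (ler_dotp _ _))// ler_wpDr//.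
    by apply: ler_wpM2l; [exact: enorm_ge0|exact: Xtn].
  have r0 : 0 < enorm a * t + 1 by rewrite ltr_wpDl// mulr_ge0 ?enorm_ge0.
  have e0 : 0 < eps / (enorm a + 1) by rewrite divr_gt0// ltr_wpDl// enorm_ge0.
  have := rep1_eq0 r0 fr e0; move=> /(_ _ 1) <-.
    by apply: eq_Cint => y; rewrite mul1r.
  move=> l le; rewrite -[RHS](Zs (vscale l a)); first by apply: eq_Cint => y; rewrite dotpZl.
  rewrite enormZ; move: le; rewrite ltr_pdivlMr ?ltr_wpDl ?enorm_ge0//.
  by have := normr_ge0 l; move: (`|l|) => q; nra.
(* Integrating over the directions where [chi] has a positive component
   along [chi u0] gives a positive number, since [chi] hardly changes around
   the direction of [u0]. *)
pose cc := (chi u0)^*%C.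
pose E : set (Rn R d) := [set v | 0 < cRe (chi v * cc)].
have mq : cmeas (fun v => chi v * cc).
  by apply: cmeasM; [exact: brep_cmeas bchi|exact: cmeas_cst].
have mE : measurable E by apply: measurable_lt_set => //; exact: mq.1.
have := unique_of_fourier (E := E) t ig mXt Z0 mE.
pose h y := g y * (\1_(E `&` cube t) (Xt y))%:C.
rewrite -/(Cint _ h) => h0.
have ih : Cintegrable L h.
  have mI : cmeas (fun y => (\1_(E `&` cube t) (Xt y) : R)%:C).
    apply: cmeas_toC; apply/measurable_EFinP; apply: measurable_indic_comp => //.
    by apply: measurableI => //; exact: measurable_cube.
  have := CintegrableM_bounded mI ig (c := 1); rewrite (_ : (fun x => _ * g x) = h).
    by apply=> y; rewrite cnorm_toC indicE; case: (_ \in _); rewrite ?normr1 ?normr0.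
  by apply/funext => y; rewrite mulrC.
have : Cint L (fun y => h y * cc) = 0 by rewrite CintZr// h0 mul0r.
have ihc : Cintegrable L (fun y => h y * cc).
  have := CintegrableZ cc ih; congr Cintegrable; apply/funext => y; exact: mulrC.
move=> /(congr1 cRe) /=; set q := fun y => cRe (h y * cc).
have qE y : q y = \1_pball y * (\1_E (Xt y) * cRe (chi (Xt y) * cc)).
  rewrite /q /h /g /pballC; have -> : \1_(E `&` cube t) (Xt y) = \1_E (Xt y) :> R.
    by rewrite !indicE in_setI [X in _ && X]mem_set ?andbT//; apply: cube_enorm; exact: Xtn.
  have Re_toC (p : R) z : cRe (p%:C * z) = p * cRe z by rewrite cReM /= mul0r subr0.
  have -> (z1 z2 z3 z4 : R[i]) : z1 * z2 * z3 * z4 = z1 * (z3 * (z2 * z4)) by ring.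
  by rewrite !Re_toC.
have q0 y : 0 <= q y.
  rewrite qE mulr_ge0// indicE; case: (boolP (_ \in _)) => [/set_mem yE|_]; rewrite ?mul0r// mul1r.
  exact: ltW.
have /CintegrableP[iq _] := ihc.
have mqE : measurable_fun setT (fun y => (q y)%:E).
  by apply/measurable_EFinP; exact: ihc.1.1.
move=> qz; have : (\int[L]_y (q y)%:E = 0)%E.
  rewrite -[LHS]fineK; last exact: (integrable_fin_num measurableT iq).
  by congr EFin; exact: qz.
have [K K0 lip] := brep_lipschitz bchi (@cball_cube _ _ rho).
pose c1 := cnorm (chi u0); have c10 : 0 < c1 by exact: cnorm_gt0.
pose zeta := c1 / (c1 + 4 * K * t) / (4 * (d%:R + 1)).
have d1 : 0 < d%:R + 1 :> R by rewrite ltr_wpDl.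
have D0 : 0 < c1 + 4 * K * t by rewrite ltr_wpDr// !mulr_ge0// enorm_ge0.
have z0 : 0 < zeta by rewrite /zeta !divr_gt0// mulr_gt0.
have dz : d%:R * zeta <= c1 / (c1 + 4 * K * t) / 4.
  have F0 : 0 <= c1 / (c1 + 4 * K * t) by rewrite divr_ge0 ?ltW.
  have -> : d%:R * zeta = c1 / (c1 + 4 * K * t) / 4 * (d%:R / (d%:R + 1)).
    by rewrite /zeta; move: (c1 / _) => F; field; rewrite gt_eqF.
  by rewrite ler_piMr ?(divr_ge0 F0)// ler_pdivrMr// mul1r lerDl.
have fr1 : c1 / (c1 + 4 * K * t) <= 1.
  by rewrite ler_pdivrMr// mul1r lerDl !mulr_ge0// enorm_ge0.
pose y0 := vscale (2 * t)^-1 u0.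
have ny0 : enorm y0 = 2^-1.
  rewrite enormZ gtr0_norm ?invr_gt0 ?mulr_gt0// invfM -mulrA mulVf ?mulr1// gt_eqF//.
have hy0 : vscale t (hat y0) = u0.
  by apply: eq_from_tnth => i; rewrite /hat ny0 /y0 !tnthE invrK; field; rewrite gt_eqF.
rewrite -(ge0_integral_shift y0 mqE) => [|y]; last by rewrite lee_fin.
apply/eqP; rewrite gt_eqF//.
apply: (@lt_le_trans _ _ (\int[L]_(z in cube zeta) (c1 ^+ 2 / 2)%:E)%E).
  rewrite integral_cst; last exact: measurable_cube.
  rewrite [X in (_ < _ * X)%E](_ : _ = ((2 * zeta) ^+ d)%:E); last first.
    by apply: lebesgue_cube; exact: ltW.
  rewrite -EFinM lte_fin; apply: mulr_gt0; first by rewrite divr_gt0 ?exprn_gt0.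
  by rewrite exprn_gt0// mulr_gt0.
apply: (@le_trans _ _ (\int[L]_(z in cube zeta) (q (vadd z y0))%:E)%E); last first.
  apply: ge0_subset_integral => //; first exact: measurable_cube.
  - by apply: (measurableT_comp mqE); apply: measurable_vadd; [exact: measurable_id|exact: measurable_cst].
  - by move=> z _; rewrite lee_fin.
apply: ge0_le_integral => //; first exact: measurable_cube.
- by move=> z _; rewrite lee_fin divr_ge0 ?sqr_ge0.
- apply: measurable_funTS; apply: (measurableT_comp mqE).
  by apply: measurable_vadd; [exact: measurable_id|exact: measurable_cst].
move=> z /enorm_cube zn; rewrite lee_fin qE.
pose y := vadd z y0.
have zn1 : enorm z <= c1 / (c1 + 4 * K * t) / 4 by exact: le_trans dz.
have zn2 : enorm z <= 4^-1 by apply: le_trans zn1 _; move: fr1; lra.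
have yz : vsub y y0 = z by apply: eq_from_tnth => i; rewrite !tnthE addrK.
have n1 : enorm y <= enorm z + 2^-1 by rewrite -ny0; exact: enormD.
have n2 : 2^-1 <= enorm z + enorm y.
  rewrite -ny0 -(enormN z); apply: le_trans (enormD _ _); rewrite (_ : vadd _ _ = y0)//.
  by apply: eq_from_tnth => i; rewrite !tnthE; ring.
have yp : 0 < enorm y < 1 by apply/andP; split; move: n1 n2 zn2; lra.
have cd : cnorm (chi (Xt y) - chi u0) <= c1 / 4.
  apply: le_trans (lip _ _) _.
  have -> : vsub (Xt y) u0 = vscale t (vsub (hat y) (hat y0)).
    by rewrite -{1}hy0; apply: eq_from_tnth => i; rewrite !tnthE; ring.
  rewrite enormZ (gtr0_norm t0).
  have yp0 : 0 < enorm y by case/andP: yp.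
  have y00 : 0 < enorm y0 by rewrite ny0.
  apply: le_trans (_ : K * (t * (4 * enorm z)) <= _).
    do 2 (apply: ler_wpM2l; rewrite ?(ltW t0)//).
    apply: le_trans (hat_lipschitz y00 yp0) _; rewrite yz ny0 invrK.
    by rewrite le_eqVlt; apply/orP; left; apply/eqP; ring.
  apply: le_trans (_ : (4 * K * t) * (c1 / (c1 + 4 * K * t) / 4) <= _).
    have -> : K * (t * (4 * enorm z)) = (4 * K * t) * enorm z by ring.
    by apply: ler_wpM2l => //; rewrite !mulr_ge0// ltW.
  have -> : 4 * K * t * (c1 / (c1 + 4 * K * t) / 4) = (c1 / 4) * ((4 * K * t) / (c1 + 4 * K * t)).
    by field; rewrite gt_eqF.
  by rewrite ler_piMr ?divr_ge0 ?(ltW c10)// ler_pdivrMr// mul1r lerDr ltW.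
have re : c1 ^+ 2 / 2 <= cRe (chi (Xt y) * cc).
  have -> : chi (Xt y) * cc = chi u0 * cc + (chi (Xt y) - chi u0) * cc by ring.
  rewrite cReD.
  have -> : cRe (chi u0 * cc) = c1 ^+ 2.
    by rewrite cnorm2E /cc; case: (chi u0) => p r /=; ring.
  have := ler_Re_cnorm ((chi (Xt y) - chi u0) * cc).
  rewrite cnormM cnorm_conj -/c1 ler_norml => /andP[h1 _].
  have : cnorm (chi (Xt y) - chi u0) * c1 <= c1 / 4 * c1 by rewrite ler_pM2r.
  by move: h1; move: (cnorm _ * c1) (cRe _) => p r h1 h2; have := sqr_ge0 c1; rewrite !expr2; move: h1 h2; nra.
have yE : E (Xt y).
  by rewrite /E /=; apply: lt_le_trans re; rewrite divr_gt0// exprn_gt0.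
by rewrite [\1_pball _]indicE mem_set// mul1r indicE mem_set// mul1r.
Qed.

End average.

End average_bounds.

(** * Isotropic densities *)

Section isotropic.
Context {disp : measure_display} {T : measurableType disp} {R : realType}.
Context {P : probability T R} {d : nat}.
Variables (M : wss_measure P d) (s : Rn R d -> R).
Hypothesis hs : is_spectral_density M s.
Local Notation L := (lebesgue_Rn R d).

(** The zero of the average at the origin is a power of the norm and is
    divided out. Away from the origin this does not spoil the
    integrability, and the factors [sinc] absorb the monomial; near the
    origin the quotient is bounded and the hypothesis on [k] applies. *)
Lemma isotropic_kernel (i0 : 'I_d) (k : multi_index d) r eps0 : 0 <= r -> 0 < eps0 ->
  isotropic s -> ~ linearly_maximally_rigid M (eball vzero r) ->
  ~ (forall eps : R, 0 < eps ->
      (\int[L]_(u in eball vzero eps) ((monomial k u ^+ 2)%:E * sinv s u) = +oo)%E) ->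
  exists chi, [/\ brep (cball (r + eps0)) chi, chi vzero != 0 &
    forall k0, mpoly.lem k k0 -> exists N, forall n del, (N <= n)%N -> 0 < del ->
    (\int[L]_u ((cnorm (chi u * peval (mpoly.mpolyX _ k0) u *
       (\prod_(i < d) sinc (del * tnth u i) ^+ n)%:C) ^+ 2)%:E * sinv s u) < +oo)%E].
Proof.
move=> r0 e0 iso nmax knear.
have ballr : eball vzero r `<=` (cube r : set (Rn R d)).
  by move=> x; rewrite eball0E => /ltW/cube_enorm.
have d1 : 0 < d%:R + 1 :> R by rewrite ltr_wpDl.
pose e1 : R := eps0 / 2 / (d%:R + 1).
have e10 : 0 < e1 by rewrite !divr_gt0.
have [e [chi0 [/andP[ep ele] bchi0 neq0 fin0]]] := dual_kernel hs ballr nmax e10.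
pose rho := r + eps0 / 2.
have rho0 : 0 <= rho by rewrite addr_ge0// ltW// divr_gt0.
have sub : blur (eball vzero r) e `<=` (cball rho : set (Rn R d)).
  move=> x [t]; rewrite eball0E => tr /enorm_cube tx.
  have -> : x = vadd t (vopp (vsub t x)).
    by apply: eq_from_tnth => i; rewrite !tnthE; ring.
  rewrite /cball /=; apply: le_trans (enormD _ _) _; rewrite enormN lerD ?(ltW tr)//.
  apply: le_trans tx _; apply: le_trans (_ : (d%:R + 1) * e1 <= _).
    by rewrite ler_pM ?(ltW ep)// lerDl.
  by rewrite /e1 mulrC divfK// gt_eqF.
have [disp' [T' [m [b [X [ib mX bX chiE]]]]]] := bchi0.
have bX' w : b w != 0 -> enorm (X w) <= rho by move=> /bX /sub.
have eh0 : 0 < eps0 / 2 by rewrite divr_gt0.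
have [a ae neqa] := average_neq0 ib mX bX' chiE i0 rho0 eh0 neq0.
have sinv_rad (u v : Rn R d) : enorm u = enorm v -> sinv s u = sinv s v.
  by move=> /iso uv; rewrite /sinv uv.
have d0 : (0 < d)%N := leq_ltn_trans (leq0n _) (ltn_ord i0).
have fin := average_L2 ib mX bX' chiE a d0 (measurable_sinv hs) (sinv_ge0 hs) sinv_rad fin0.
have bpsi := average_brep ib mX bX' a; have rpsi := average_radial m b X a.
have re0 : 0 <= rho + enorm a by rewrite addr_ge0 ?enorm_ge0.
have [q [chi [bchi chi0' psiE]]] := radial_factor i0 re0 bpsi rpsi neqa.
set psi := average m b X a in fin bpsi rpsi neqa psiE.
have [eps eps_gt0 epsfin] : exists2 eps, 0 < eps &
    (\int[L]_(u in eball vzero eps) ((monomial k u ^+ 2)%:E * sinv s u) < +oo)%E.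
  apply: contrapT => nex; apply: knear => eps eps0'; apply/eqP; rewrite -leye_eq leNgt.
  by apply/negP => h; apply: nex; exists eps.
exists chi; split=> //.
  apply: sub_brep bchi => x; rewrite /cball /= => /le_trans; apply.
  by move: ae; rewrite /rho; lra.
move=> k0 kk0; exists (\sum_(i < d) k0 i)%N => n del Nn del_gt0.
have [c cb] := brep_bounded bchi.
have c0 : 0 <= c by apply: le_trans (cb vzero); exact: cnorm_ge0.
pose S (u : Rn R d) : R := \prod_(i < d) sinc (del * tnth u i) ^+ n.
pose C1 : R := (c * \prod_(i < d) eps ^+ (k0 i - k i)) ^+ 2.
pose C2 : R := (eps ^- (2 * q) * \prod_(i < d) del ^- k0 i) ^+ 2.
pose B1 u : \bar R := ((\1_(eball vzero eps) u)%:E * ((monomial k u ^+ 2)%:E * sinv s u))%E.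
pose B2 u : \bar R := ((cnorm (psi u) ^+ 2)%:E * sinv s u)%E.
have C10 : 0 <= C1 by exact: sqr_ge0.
have C20 : 0 <= C2 by exact: sqr_ge0.
have B10 u : (0 <= B1 u)%E by rewrite !mule_ge0 ?(sinv_ge0 hs)// lee_fin ?sqr_ge0.
have B20 u : (0 <= B2 u)%E by rewrite mule_ge0 ?(sinv_ge0 hs)// lee_fin sqr_ge0.
have mmono (l : multi_index d) : measurable_fun setT (fun u : Rn R d => monomial l u).
  by apply: measurable_prod => j _; apply: measurable_funX; exact: measurable_tnthR.
have mB1 : measurable_fun setT B1.
  apply: emeasurable_funM.
    by apply/measurable_EFinP; apply: measurable_indic; exact: measurable_eball.
  apply: emeasurable_funM (measurable_sinv hs).
  by apply/measurable_EFinP; exact: measurable_funX.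
have mB2 : measurable_fun setT B2.
  apply: emeasurable_funM (measurable_sinv hs); apply/measurable_EFinP; apply: measurable_funX.
  exact: measurable_cnorm (brep_cmeas bpsi).
have s1 u : `|S u| <= 1.
  by rewrite /S normr_prod; apply: prodr_ile1 => i _; rewrite normr_ge0 normrX exprn_ile1 ?ler_sinc1.
pose H u : \bar R := ((cnorm (chi u * peval (mpoly.mpolyX _ k0) u * (S u)%:C) ^+ 2)%:E * sinv s u)%E.
have H0 u : (0 <= H u)%E by rewrite mule_ge0 ?(sinv_ge0 hs)// lee_fin sqr_ge0.
have mH : measurable_fun setT H.
  apply: emeasurable_funM (measurable_sinv hs); apply/measurable_EFinP; apply: measurable_funX.
  apply: measurable_cnorm; apply: cmeasM.
    by apply: cmeasM; [exact: brep_cmeas bchi|exact: cmeas_peval].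
  apply: cmeas_toC; apply: measurable_prod => j _; apply: measurable_funX.
  apply: (measurableT_comp measurable_sinc); apply: measurable_funM => //.
  exact: measurable_tnthR.
have le u : (H u <= C1%:E * B1 u + C2%:E * B2 u)%E.
  rewrite /H /B1 /B2 !muleA -!EFinM -ge0_muleDl; last 2 first.
  - by rewrite lee_fin; apply: mulr_ge0; [exact: mulr_ge0|exact: sqr_ge0].
  - by rewrite lee_fin mulr_ge0 ?sqr_ge0.
  apply: lee_wpmul2r; first exact: sinv_ge0 hs u.
  rewrite -EFinD lee_fin pevalX1 !cnormM !cnorm_toC.
  have [ue|ue] := ltP (enorm u) eps.
    rewrite -[leLHS]addr0; apply: lerD; last by rewrite mulr_ge0 ?sqr_ge0.
    rewrite indicE mem_set ?eball0E// mulr1 -(real_normK (num_real (monomial k u))) -exprMn.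
    have pe : 0 <= \prod_(i < d) eps ^+ (k0 i - k i).
      by apply: prodr_ge0 => i _; rewrite exprn_ge0// ltW.
    rewrite lerXn2r ?nnegrE ?(mulr_ge0, cnorm_ge0, normr_ge0)//.
    rewrite -[leRHS]mulr1 ler_pM ?mulr_ge0 ?cnorm_ge0// -mulrA ler_pM ?cnorm_ge0//.
    rewrite /monomial !normr_prod -big_split /=; apply: ler_prod => i _.
    rewrite normr_ge0 !normrX /=.
    have -> : k0 i = (k0 i - k i + k i)%N by rewrite subnK//; have /mpoly.mnm_lepP := kk0; apply.
    rewrite addnK exprD ler_wpM2r ?exprn_ge0// lerXn2r ?nnegrE ?(ltW eps_gt0)//.
    exact: le_trans (ler_norm_tnth u i) (ltW ue).
  rewrite -[leLHS]add0r; apply: lerD; first by apply: mulr_ge0; [exact: mulr_ge0|exact: sqr_ge0].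
  have u0 : 0 < enorm u by exact: lt_le_trans ue.
  have pd : 0 <= \prod_(i < d) del ^- k0 i.
    by apply: prodr_ge0 => i _; rewrite invr_ge0 exprn_ge0// ltW.
  have ep' : 0 <= eps ^- (2 * q) by rewrite invr_ge0 exprn_ge0// ltW.
  rewrite /C2 -exprMn lerXn2r ?nnegrE ?(mulr_ge0, cnorm_ge0, normr_ge0)//.
  have key1 : `|monomial k0 u| * `|S u| <= \prod_(i < d) del ^- k0 i.
    rewrite /monomial /S !normr_prod -big_split /=; apply: ler_prod => i _.
    rewrite mulr_ge0//= !normrX; apply: ler_pow_sinc => //.
    by apply: leq_trans Nn; rewrite (bigD1 i)//= leq_addr.
  have key2 : cnorm (chi u) <= eps ^- (2 * q) * cnorm (psi u).
    rewrite psiE cnormM cnorm_toC ger0_norm ?exprn_ge0 ?enorm_ge0// mulrA ler_peMl ?cnorm_ge0//.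
    by rewrite -exprVn -exprMn exprn_ege1// ler_pdivlMl// mulr1.
  rewrite -mulrA mulrAC; apply: ler_pM => //; exact: cnorm_ge0.
have mC1 : measurable_fun setT (fun u => C1%:E * B1 u)%E.
  by apply: emeasurable_funM => //; exact: measurable_cst.
have mC2 : measurable_fun setT (fun u => C2%:E * B2 u)%E.
  by apply: emeasurable_funM => //; exact: measurable_cst.
apply: (@le_lt_trans _ _ (\int[L]_u (C1%:E * B1 u + C2%:E * B2 u))%E).
  apply: ge0_le_integral => //.
  - by move=> u _; exact: H0.
  - exact: emeasurable_funD.
  - by move=> u _; exact: le.
rewrite ge0_integralD//; [|by move=> u _; rewrite mule_ge0 ?lee_fin..].
rewrite !ge0_integralZl ?lee_fin//.
rewrite lte_add_pinfty// lte_mul_pinfty ?lee_fin ?integral_ge0//.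
apply: le_lt_trans epsfin; rewrite [leRHS]integral_mkcond le_eqVlt; apply/orP; left; apply/eqP.
apply: eq_integral => u _; rewrite /B1 patchE indicE.
by case: (u \in eball vzero eps); rewrite ?mul1e ?mul0e.
Qed.

End isotropic.

(** * Enlargements of balls and cubes *)

Section enlargements.
Context {disp : measure_display} {T : measurableType disp} {R : realType}.
Context {P : probability T R} {d : nat}.
Variables (M : wss_measure P d) (s : Rn R d -> R).
Hypothesis hs : is_spectral_density M s.
Local Notation L := (lebesgue_Rn R d).

Lemma measurable_clamp (r : R) : measurable_fun setT (fun x : R => Num.max (- r) (Num.min r x)).
Proof. by apply: measurable_maxr => //; apply: measurable_minr. Qed.

(** The point of the cube nearest to [x] is found coordinate by coordinate. *)
Lemma enlarge_cubeE r eta : 0 <= r -> enlarge (cube r : set (Rn R d)) eta =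
  [set x | enorm (vsub x [tuple Num.max (- r) (Num.min r (tnth x i)) | i < d]) < eta].
Proof.
move=> r0; apply/seteqP; split=> x /= [].
  move=> t tr; rewrite /eball /=; apply: le_lt_trans.
  rewrite !enormE ler_wsqrtr// /dotp; apply: ler_sum => i _; rewrite !tnthE tnth_mktuple -!expr2.
  have := tr i; move: (tnth t i) (tnth x i) => p z /andP[h1 h2].
  rewrite -[leLHS]real_normK ?num_real// -[leRHS]real_normK ?num_real//.
  rewrite lerXn2r ?nnegrE//.
  have [zr|zr] := leP r z.
    rewrite max_r; last by lra.
    by rewrite !ger0_norm; lra.
  have [zr'|zr'] := leP (- r) z; first by rewrite subrr normr0.
  by rewrite !ler0_norm; lra.
move=> xe; exists [tuple Num.max (- r) (Num.min r (tnth x i)) | i < d] => //.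
move=> i; rewrite tnth_mktuple le_max lexx /= ge_max; apply/andP; split; first by lra.
by rewrite ge_min lexx.
Qed.

Lemma measurable_enlarge_cube r eta : 0 <= r -> measurable (enlarge (cube r : set (Rn R d)) eta).
Proof.
move=> r0; rewrite enlarge_cubeE//; apply: measurable_lt_set => //.
apply: measurable_enorm; apply: measurable_vsub => //.
apply: measurable_tuple_fun => i; under eq_fun do rewrite tnth_mktuple.
exact: (measurableT_comp (measurable_clamp r) (measurable_tnthR i)).
Qed.

Lemma enlarge_eball r eta : 0 < r -> 0 < eta ->
  enlarge (eball vzero r : set (Rn R d)) eta = eball vzero (r + eta).
Proof.
move=> r0 eta0; apply/seteqP; split=> x.
  move=> [t]; rewrite !eball0E /eball /= => tr xt.
  have -> : x = vadd t (vsub x t) by apply: eq_from_tnth => i; rewrite !tnthE; ring.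
  by apply: le_lt_trans (enormD _ _) _; exact: ltrD.
rewrite eball0E => xe; pose l := r / (r + eta).
have re : 0 < r + eta by exact: addr_gt0.
have l0 : 0 <= l by rewrite divr_ge0 ?ltW.
have l1 : 0 <= 1 - l by rewrite subr_ge0 ler_pdivrMr// mul1r lerDl ltW.
exists (vscale l x).
  by rewrite eball0E enormZ ger0_norm// /l mulrAC ltr_pdivrMr// ltr_pM2l.
rewrite /eball /=; have -> : vsub x (vscale l x) = vscale (1 - l) x.
  by apply: eq_from_tnth => i; rewrite !tnthE; ring.
rewrite enormZ ger0_norm//; have -> : 1 - l = eta / (r + eta).
  by rewrite /l; field; rewrite gt_eqF.
by rewrite mulrAC ltr_pdivrMr// ltr_pM2l.
Qed.

(** The weight is the top monomial of [Q]. The set [A] has to leave room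
    around the spectrum [B] of [chi] for the kernels of the factors
    [sinc]. *)
Lemma kernel_not_rigid (A B : set (Rn R d)) rA rB rho chi (k : multi_index d) (Q : cpoly R d) :
  measurable A -> A `<=` cube rA -> B `<=` cube rB -> 0 < rho ->
  (forall x t, B t -> cube rho (vsub x t) -> A x) -> brep B chi -> chi vzero != 0 ->
  (forall k0, mpoly.lem k k0 -> exists N, forall n del, (N <= n)%N -> 0 < del ->
    (\int[L]_u ((cnorm (chi u * peval (mpoly.mpolyX _ k0) u *
       (\prod_(i < d) sinc (del * tnth u i) ^+ n)%:C) ^+ 2)%:E * sinv s u) < +oo)%E) ->
  is_kpoly k Q -> ~ linearly_poly_rigid M A Q.
Proof.
move=> mA Ar Br rho0 BA bchi chi0 hN [k0 [kk0 Qk0 Qle]].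
apply: (brep_not_rigid hs mA Ar Br bchi chi0 rho0 BA Qk0 Qle (W := mpoly.mpolyX _ k0)).
- by rewrite mpoly.mcoeffX eqxx oner_eq0.
- by move=> j; rewrite mpoly.mcoeffX; case: (eqVneq k0 j) => [->//|_]; rewrite eqxx.
- exact: hN.
Qed.

End enlargements.

Theorem proposition4 (R : realType) (disp : measure_display)
    (T : measurableType disp) (P : probability T R) (d : nat) (hd : (0 < d)%N)
    (k : multi_index d) (M : wss_measure P d) (s : Rn R d -> R)
    (hs : is_spectral_density M s) (hk : ~ pole_of_order s k) :
  (forall (r : R) (A : set (Rn R d)), 0 < r ->
     (isotropic s /\ A = eball vzero r) \/ (separable s /\ A = cube r) ->
     ~ linearly_maximally_rigid M A ->
     ~ (forall eps : R, 0 < eps ->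
          (\int[lebesgue_Rn R d]_(u in eball vzero eps)
             ((monomial k u ^+ 2)%:E * sinv s u) = +oo)%E) ->
     forall eta : R, 0 < eta -> forall Q : cpoly R d, is_kpoly k Q ->
       ~ linearly_poly_rigid M (enlarge A eta) Q)
  /\
  (simple_density s ->
     forall eta : R, 0 < eta -> forall Q : cpoly R d, is_kpoly k Q ->
       ~ linearly_poly_rigid M (eball vzero eta) Q).
Proof.
split; last exact: simple_not_rigid.
move=> r A r0 shape nmax knear eta eta0 Q kQ.
have d1 : 0 < d%:R + 1 :> R by rewrite ltr_wpDl.
(* The spectrum of [chi] is allowed to leave the set by a quarter of [eta]
   or less, which leaves room for the factors [sinc]. *)
pose rho : R := eta / 4 / (d%:R + 1).
have rho0 : 0 < rho by rewrite !divr_gt0.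
have drho : d%:R * rho <= eta / 4.
  have -> : d%:R * rho = eta / 4 * (d%:R / (d%:R + 1)) by rewrite /rho; field; rewrite gt_eqF.
  by rewrite ler_piMr ?divr_ge0 ?(ltW eta0)// ler_pdivrMr// mul1r lerDl.
case: shape nmax => [[iso ->]|[[s_ [s_ge0 _ sE]] ->]] nmax.
  have e0 : 0 < eta / 4 by rewrite divr_gt0.
  have [chi [bchi chi0 hN]] := isotropic_kernel hs (Ordinal hd) (ltW r0) e0 iso nmax knear.
  rewrite enlarge_eball//.
  apply: (kernel_not_rigid hs (measurable_eball _ _) _ (@cball_cube _ _ _) rho0 _ bchi chi0 hN kQ
    (rA := r + eta)).
    by move=> x; rewrite eball0E => /ltW/cube_enorm.
  move=> x t; rewrite /cball /= eball0E => tr /enorm_cube xt.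
  have -> : x = vadd t (vsub x t) by apply: eq_from_tnth => i; rewrite !tnthE; ring.
  by apply: le_lt_trans (enormD _ _) _; move: tr xt drho eta0; lra.
have [chi [bchi chi0 hN]] := separable_kernel hs s_ge0 sE (ltW r0) rho0 nmax knear.
apply: (kernel_not_rigid hs (measurable_enlarge_cube _ (ltW r0)) _ (fun _ h => h) rho0 _ bchi chi0 hN kQ
  (rA := r + eta) (rB := r + rho)).
  move=> x [t tr]; rewrite /eball /= => /ltW/cube_enorm xt i.
  have /andP[h1 h2] := tr i; have /andP[h3 h4] := xt i; rewrite tnth_vsub in h3 h4.
  by apply/andP; split; lra.
move=> x t tB xt; rewrite enlarge_cubeE ?(ltW r0)//=.
set y := vsub _ _; apply: (@le_lt_trans _ _ (d%:R * (2 * rho))); last by move: drho eta0; lra.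
apply: enorm_cube => i; rewrite /y !tnthE tnth_mktuple.
have /andP[h1 h2] := tB i; have /andP[h3 h4] := xt i; rewrite tnth_vsub in h3 h4.
move: (tnth x i) (tnth t i) h1 h2 h3 h4 => p z h1 h2 h3 h4.
have [pr|pr] := leP r p.
  by rewrite max_r; [apply/andP; split; lra|lra].
have [pr'|pr'] := leP (- r) p; first by rewrite subrr; apply/andP; split; lra.
by apply/andP; split; lra.
Qed.
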